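(* Let $(B,\mathsf c_B,D^B)$ be an arbitrary $3$-dimensional Einstein-Weyl structure with Faraday curvature $F^B$ and scalar curvature $\mathrm{scal}^B$. Then $$g=\bigl(1-\tfrac16\mu_t^2\,\mathrm{scal}^B\bigr)\mu_t^{-2}\pi^*\mathsf c_B+\bigl(1-\tfrac16\mu_t^2\,\mathrm{scal}^B\bigr)^{-1}\bigl(\mu_t^{-1}D^B\mu_t-\tfrac12\mu_t\,{*_BF^B}\bigr)^2$$ is a selfdual Einstein metric of nonzero scalar curvature, with a Legendrian selfdual conformal submersion over $B$. Here $\mu_t$ is a section of $L$ increasing along the fibres of the conformal submersion $\pi\colon M\to B$, and the conformal structure $\mathsf c_B$ is the conformal infinity at $\mu_t=0$. Any selfdual Einstein metric of nonzero scalar curvature with a Legendrian selfdual conformal submersion arises in this way (locally, up to a constant multiple).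
   Context: Everything is smooth and local. On an $n$-manifold, $L^w$ denotes the oriented real line bundle of densities of weight $w$, associated to the frame bundle by $A\mapsto|\det A|^{w/n}$; $L=L^1$. A conformal structure $\mathsf c$ is an $L^2$-valued (unit determinant) inner product $\langle\cdot,\cdot\rangle$ on the tangent bundle; it identifies vectors with $1$-forms of the same weight. A Weyl derivative $D$ is a covariant derivative on $L$ (hence on every $L^w$); its curvature is a $2$-form $F^D$ (Faraday curvature); on a conformal manifold it determines a unique torsion-free connection $D$ on $TM$ with $D\mathsf c=0$. $D$ is Einstein-Weyl if the symmetric tracefree part of its Ricci tensor vanishes; its scalar curvature, the trace of the Ricci tensor with respect to $\mathsf c$, is a section of $L^{-2}$. The Hodge star on weighted forms is normalized by $\iota_X{*\alpha}=*(\langle X,\cdot\rangle\wedge\alpha)$ with $*1$ the orientation (so $*_B^2=-1$ on the $3$-manifold $B$ and $*^2=1$ on $2$-forms in dimension four). In the formula, $\mu_t$ is a section of $\pi^*L_B$: in terms of a length scale (positive section) $\mu_B$ of $L_B$ with $D^B\mu_B=\omega_B\mu_B$, $M$ is locally an open subset of $B\times\mathbb R$ with fibre coordinate $t$, $\mu_t=t\mu_B$ and $D^B\mu_t=(dt+t\omega_B)\mu_B$. The formula is considered where $\mu_t\ne0$ and $1-\frac16\mu_t^2\mathrm{scal}^B\neq0$. The metric $g$ is positive definite where $\mu_t^2\mathrm{scal}^B<6$ and negative definite where $\mu_t^2\mathrm{scal}^B>6$; in the latter region $-g$ is used. $M$ is oriented so that $*1=*_B1\wedge\xi$, where $\xi$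 is the weightless unit $1$-form positively proportional to the vertical $1$-form $D^B\mu_t-\frac12\mu_t^2{*_BF^B}$ whose kernel is the horizontal distribution. $g$ is selfdual if the antiselfdual part of its Weyl curvature vanishes. A conformal submersion with oriented one dimensional fibres is a surjective submersion $\pi\colon M\to B$ of conformal manifolds with $d\pi_x$ restricted to $(\ker d\pi_x)^\perp$ a nonzero conformal map; it is given by the weightless unit vertical vector field $\xi\in C^\infty(M,L^{-1}TM)$. Its minimal Weyl derivative $D^0$ is the unique Weyl derivative with $D^0_\xi\xi=0$ and $\mathrm{tr}\,D^0\xi=0$. In dimension four $\xi$ is selfdual if the Faraday curvature of $D^0$ is selfdual. If $D^g$ is the Levi-Civita derivative of an Einstein metric with nonzero scalar curvature, $\xi$ is Legendrian if the skew part of $(D^0\otimes D^g)\xi$ (the covariant derivative of $\xi\in L^{-1}\otimes TM$ using $D^0$ on $L^{-1}$ and $D^g$ on $TM$) is selfdual.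
   Formalization: Where μ_t² scal^B > 6, M is given the opposite orientation (with the stated one g is antiselfdual); in the converse 1/μ_t is a smooth section that may vanish, and the formula is claimed off its zero set (e.g. the equator of S^4, where μ_t is infinite). *)

(* Defs.v *)
From HB Require Import structures.
From mathcomp Require Import all_boot all_order all_algebra.
From mathcomp Require Import ring.
From mathcomp Require Import all_classical all_reals all_analysis.

Set Implicit Arguments.
Unset Strict Implicit.
Unset Printing Implicit Defensive.

Import Order.TTheory GRing.Theory Num.Theory.
Import numFieldNormedType.Exports.

Local Open Scope classical_set_scope.
Local Open Scope ring_scope.

(** Manifolds are open subsets of R^n, i.e. coordinate charts, and tensors are
    given by their components.  A coordinate system trivialises every density
    bundle L^w, so a section of L^w is a real function, a Weyl derivative is
    [d + w th] on L^w for a 1-form [th], and an L^2-valued inner product of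
    unit determinant is a positive definite matrix of determinant 1.
    1-forms and vectors are row vectors; a linear map acts on vectors on the
    right, hence on 1-forms (by pull-back) through its transpose. *)

Section calculus.
Variables (R : realType) (n : nat).
Implicit Types (f : 'rV[R]_n -> R) (x : 'rV[R]_n) (U : set 'rV[R]_n).

Definition partial (k : 'I_n) f x : R := 'D_(delta_mx 0 k) f x.

Definition differential f x : 'rV[R]_n := \row_k partial k f x.

Definition smooth_on U f :=
  forall (s : seq 'I_n) x, U x -> differentiable (foldr partial f s) x.

Definition smooth_mx_on U p q (A : 'rV[R]_n -> 'M[R]_(p, q)) :=
  forall i j, smooth_on U (fun x => A x i j).

End calculus.

Section weyl_geometry.
Variables (R : realType) (n : nat).
Implicit Types (x : 'rV[R]_n) (U : set 'rV[R]_n).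
Implicit Types (g h c : 'rV[R]_n -> 'M[R]_n) (th : 'rV[R]_n -> 'rV[R]_n).

Definition posdef (A : 'M[R]_n) :=
  forall v : 'rV[R]_n, v != 0 -> 0 < (v *m A *m v^T) 0 0.

Definition riemannian U g :=
  smooth_mx_on U g /\ forall x, U x -> (g x)^T = g x /\ posdef (g x).

Definition conformal_structure U c :=
  riemannian U c /\ forall x, U x -> \det (c x) = 1.

(** The conformal structure (of unit determinant) of a metric. *)
Definition conformal_class g x : 'M[R]_n :=
  (\det (g x) `^ (- n%:R^-1)) *: g x.

Definition weyl_deriv (w : R) th (k : 'I_n) (f : 'rV[R]_n -> R) x : R :=
  partial k f x + w * th x 0 k * f x.

(** Faraday curvature: the curvature of [d + th] on L. *)
Definition faraday th x : 'M[R]_n :=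
  \matrix_(i, j) (partial i (fun y => th y 0 j) x
                  - partial j (fun y => th y 0 i) x).

(** Components of connections on TM: [G l i j] is the [l]-th component of
    the derivative of the [j]-th coordinate field along the [i]-th one.
    [weyl_conn h th] is the torsion-free connection for which [h], regarded as
    having weight 2, is parallel (lemma [weyl_connP]); for [th = 0] it is the
    Levi-Civita connection of [h]. *)
Definition connection := 'I_n -> 'I_n -> 'I_n -> 'rV[R]_n -> R.

Definition weyl_conn h th : connection := fun l i j x =>
  2^-1 * \sum_(m < n) invmx (h x) l m *
    (weyl_deriv 2 th i (fun y => h y m j) x
     + weyl_deriv 2 th j (fun y => h y i m) x
     - weyl_deriv 2 th m (fun y => h y i j) x).

Definition levi_civita g : connection := weyl_conn g (fun=> 0).

Definition riemann (G : connection) (l i j k : 'I_n) x : R :=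
  partial i (G l j k) x - partial j (G l i k) x
  + \sum_(m < n) (G l i m x * G m j k x - G l j m x * G m i k x).

Definition ricci (G : connection) (j k : 'I_n) x : R :=
  \sum_(l < n) riemann G l l j k x.

Definition scalar_curvature h th x : R :=
  \sum_(i < n) \sum_(j < n) invmx (h x) i j * ricci (weyl_conn h th) i j x.

Definition einstein_weyl U c th :=
  [/\ open U, conformal_structure U c, smooth_mx_on U th &
    forall x, U x -> forall i j,
      2^-1 * (ricci (weyl_conn c th) i j x + ricci (weyl_conn c th) j i x)
      = n%:R^-1 * scalar_curvature c th x * c x i j].

Definition scal g x : R := scalar_curvature g (fun=> 0) x.

Definition einstein U g := forall x, U x -> forall i j,
  ricci (levi_civita g) i j x = n%:R^-1 * scal g x * g x i j.

Definition schouten g x (i j : 'I_n) : R :=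
  (n%:R - 2)^-1 * (ricci (levi_civita g) i j x
                   - scal g x / (2 * (n%:R - 1)) * g x i j).

(** The value at [x] of the Weyl curvature, all indices lowered;
    [i], [j] are the indices of the curvature 2-form. *)
Definition weyl_tensor g x (i j k l : 'I_n) : R :=
  \sum_(m < n) riemann (levi_civita g) m i j k x * g x m l
  - (schouten g x i l * g x j k + schouten g x j k * g x i l
     - schouten g x i k * g x j l - schouten g x j l * g x i k).

(** Derivative of a section [X] of L^w * TM; the row index is the direction
    of differentiation. *)
Definition cov_deriv (w : R) th (G : connection) (X : 'rV[R]_n -> 'rV[R]_n) x
    : 'M[R]_n :=
  \matrix_(k, i) (weyl_deriv w th k (fun y => X y 0 i) x
                  + \sum_(l < n) G i k l x * X x 0 l).

Definition levi_symbol (t : n.-tuple 'I_n) : R :=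
  \det (\matrix_(i, j) (tnth t i == j)%:R).

End weyl_geometry.

Lemma weyl_deriv_sym (R : realType) (n : nat) (U : set 'rV[R]_n)
    (h : 'rV[R]_n -> 'M[R]_n) (th : 'rV[R]_n -> 'rV[R]_n) (k i j : 'I_n) x :
  open U -> (forall y, U y -> (h y)^T = h y) -> U x ->
  weyl_deriv 2 th k (fun y => h y i j) x
  = weyl_deriv 2 th k (fun y => h y j i) x.
Proof.
move=> oU hsym Ux; have hE y : U y -> h y i j = h y j i.
  by move=> Uy; rewrite -{1}(hsym y Uy) mxE.
rewrite /weyl_deriv hE//; congr (_ + _); rewrite /partial.
have [-> | k0] := eqVneq (delta_mx 0 k : 'rV[R]_n) 0; first by rewrite !derive0.
apply: near_eq_derive => //; near=> y; apply: hE; near: y.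
exact: open_nbhs_nbhs.
Unshelve. all: by end_near. Qed.

Lemma weyl_connP (R : realType) (n : nat) (U : set 'rV[R]_n)
    (h : 'rV[R]_n -> 'M[R]_n) (th : 'rV[R]_n -> 'rV[R]_n)
    (G : connection R n) :
  open U -> (forall x, U x -> (h x)^T = h x /\ h x \in unitmx) ->
  (forall x, U x ->
     (forall l i j, G l i j x = G l j i x) /\
     forall k i j, weyl_deriv 2 th k (fun y => h y i j) x
       = \sum_(l < n) (G l k i x * h x l j + G l k j x * h x i l))
  <-> (forall x, U x -> forall l i j, G l i j x = weyl_conn h th l i j x).
Proof.
move=> oU hU; have dsym k i j x Ux :=
  @weyl_deriv_sym R n U h th k i j x oU (fun y Uy => (hU y Uy).1) Ux.
have hE x i j : U x -> h x i j = h x j i.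
  by move=> Ux; rewrite -{1}(hU x Ux).1 mxE.
split=> H x Ux; have [_ hu] := hU x Ux; last first.
  have low p i j : \sum_(l < n) h x p l * G l i j x = 2^-1 *
      (weyl_deriv 2 th i (fun y => h y p j) x
       + weyl_deriv 2 th j (fun y => h y i p) x
       - weyl_deriv 2 th p (fun y => h y i j) x).
    under eq_bigr => l _ do rewrite H// /weyl_conn mulrCA mulr_sumr.
    rewrite -mulr_sumr exchange_big /=; congr (_ * _).
    under eq_bigr => m _.
      under eq_bigr => l _ do rewrite mulrA.
      rewrite -mulr_suml.
      have -> : \sum_(l < n) h x p l * invmx (h x) l m = (p == m)%:R.
        by have /matrixP/(_ p m) := mulmxV hu; rewrite !mxE.
      over.
    rewrite (bigD1 p)//= eqxx mul1r big1 ?addr0// => m.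
    by rewrite eq_sym => /negPf ->; rewrite mul0r.
  split=> [l i j|k i j].
    rewrite !H// /weyl_conn; congr (_ * _); apply: eq_bigr => m _.
    congr (_ * _); rewrite (dsym i m j)// (dsym j i m)// (dsym m i j)//.
    by rewrite [X in X - _ = _]addrC.
  rewrite big_split /=.
  under eq_bigr => l _ do rewrite mulrC (hE x l j)//.
  under [X in _ = _ + X]eq_bigr => l _ do rewrite mulrC.
  by rewrite !low (dsym k j i)//; field.
have [sG dh] := H x Ux => l i j; rewrite /weyl_conn.
under eq_bigr => m _.
  rewrite !dh -big_split -sumrB /=.
  rewrite (eq_bigr (fun q => 2 * (h x m q * G q i j x))); last first.
    move=> q _; rewrite (sG q j i) (sG q j m) (sG q m i) (hE x q j)// (hE x q m)// (hE x i q)//.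
    ring.
  rewrite -mulr_sumr mulrCA mulr_sumr.
  over.
rewrite -[X in _ * X]mulr_sumr mulKf ?pnatr_eq0// exchange_big /=.
under eq_bigr => q _.
  under eq_bigr => m _ do rewrite mulrA.
  rewrite -mulr_suml.
  have -> : \sum_(m < n) invmx (h x) l m * h x m q = (l == q)%:R.
    by have /matrixP/(_ l q) := mulVmx hu; rewrite !mxE.
  over.
rewrite (bigD1 l)//= eqxx mul1r big1 ?addr0// => m.
by rewrite eq_sym => /negPf ->; rewrite mul0r.
Qed.

Section hodge.
Variable R : realType.

(** Hodge star on 2-forms [1/2 sum F_kl dx^k /\ dx^l], for a matrix [c] of
    determinant 1, with the normalisation
    [i_X *a = * (<X, .> /\ a)] and [*1] the orientation.  Iterating, [*a] has
    components [(star a)(X_1, .., X_m) = * (<X_m, .> /\ .. /\ <X_1, .> /\ a)],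
    and the star of [*1] is [(-1)^(n(n-1)/2)], i.e. [-1] for
    [n = 3] and [1] for [n = 4].  (Thus on 2-forms in dimension four this is
    minus the more common convention.)
    The orientation is [o dx^1 /\ dx^2 /\ dx^3] with [o] a sign in dimension
    three, and [dx^1 /\ dx^2 /\ dx^3 /\ dx^4] in dimension four. *)
Definition star3 (o : R) (c F : 'M[R]_3) : 'rV[R]_3 :=
  \row_i (- o * 2^-1 * \sum_(j < 3) \sum_(k < 3) \sum_(l < 3)
            levi_symbol R [tuple j; k; l] * c i j * F k l).

Definition star4 (c F : 'M[R]_4) : 'M[R]_4 :=
  \matrix_(i, j) (2^-1 *
    \sum_(a < 4) \sum_(b < 4) \sum_(k < 4) \sum_(l < 4)
      levi_symbol R [tuple a; b; k; l] * c j a * c i b * F k l).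

Definition selfdual_form (c F : 'M[R]_4) := star4 c F = F.

(** Vanishing of the antiselfdual part [1/2 (W - *W)] of the Weyl curvature. *)
Definition selfdual (M : set 'rV[R]_4) (g : 'rV[R]_4 -> 'M[R]_4) :=
  forall x, M x -> forall k l,
    selfdual_form (conformal_class g x)
                  (\matrix_(i, j) weyl_tensor g x i j k l).

End hodge.

Section submersions.
Variable R : realType.
Implicit Types (M : set 'rV[R]_4) (B : set 'rV[R]_3).
Implicit Types (g c : 'rV[R]_4 -> 'M[R]_4) (cB : 'rV[R]_3 -> 'M[R]_3).
Implicit Types (pi : 'rV[R]_4 -> 'rV[R]_3) (xi th : 'rV[R]_4 -> 'rV[R]_4).

(** [xi] is the weightless unit vertical field orienting the fibres. *)
Definition conformal_submersion M c B cB pi xi :=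
  [/\ [/\ open M, conformal_structure M c, open B & conformal_structure B cB],
      [/\ smooth_mx_on M pi, pi @` M = B &
          forall x, M x -> \rank ('J pi x) = 3%N],
      (forall x, M x -> exists2 lam : R, 0 < lam &
         forall X Y : 'rV[R]_4,
           (forall V : 'rV[R]_4, V *m 'J pi x = 0 -> X *m c x *m V^T = 0) ->
           (forall V : 'rV[R]_4, V *m 'J pi x = 0 -> Y *m c x *m V^T = 0) ->
           X *m 'J pi x *m cB (pi x) *m (Y *m 'J pi x)^T
           = lam *: (X *m c x *m Y^T)) &
      smooth_mx_on M xi /\
      forall x, M x -> xi x *m 'J pi x = 0 /\ xi x *m c x *m (xi x)^T = 1%:M].

Definition minimal_weyl M c xi th :=
  smooth_mx_on M th /\ forall x, M x ->
    xi x *m cov_deriv (-1) th (weyl_conn c th) xi x = 0 /\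
    \tr (cov_deriv (-1) th (weyl_conn c th) xi x) = 0.

Definition selfdual_weyl M c th :=
  forall x, M x -> selfdual_form (c x) (faraday th x).

(** [th] is the minimal Weyl derivative; the vector index of
    [(D^0 \otimes D^g) xi] is lowered with the conformal structure. *)
Definition legendrian M g xi th :=
  forall x, M x ->
    let A := cov_deriv (-1) th (levi_civita g) xi x
             *m conformal_class g x in
    selfdual_form (conformal_class g x) (2^-1 *: (A - A^T)).

Definition legendrian_selfdual_submersion M g B cB pi xi :=
  conformal_submersion M (conformal_class g) B cB pi xi /\
  exists th, [/\ minimal_weyl M (conformal_class g) xi th,
                 selfdual_weyl M (conformal_class g) th &
                 legendrian M g xi th].

End submersions.

Section ansatz.
Variable R : realType.
Variables (o : R) (c : 'rV[R]_3 -> 'M[R]_3) (th : 'rV[R]_3 -> 'rV[R]_3).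
Variables (pi : 'rV[R]_4 -> 'rV[R]_3) (mu : 'rV[R]_4 -> R).

(** [1 - mu^2 scal^B / 6]; [mu] is a section of the pull-back of L_B. *)
Definition ansatz_factor (x : 'rV[R]_4) : R :=
  1 - 6^-1 * mu x ^+ 2 * scalar_curvature c th (pi x).

Definition ansatz_form (x : 'rV[R]_4) : 'rV[R]_4 :=
  (mu x)^-1 *: (differential mu x + mu x *: (th (pi x) *m ('J pi x)^T))
  - (2^-1 * mu x) *:
      (star3 o (c (pi x)) (faraday th (pi x)) *m ('J pi x)^T).

Definition ansatz_metric (x : 'rV[R]_4) : 'M[R]_4 :=
  (ansatz_factor x * mu x ^- 2) *: ('J pi x *m c (pi x) *m ('J pi x)^T)
  + (ansatz_factor x)^-1 *: ((ansatz_form x)^T *m ansatz_form x).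

(** [eps] is the sign of [1 - mu^2 scal^B / 6], so that [eps *: g] is positive
    definite, and [o] gives the orientation of [B].  Let [xi] be the vertical
    field along which [mu] increases.  The determinant below is that of
    [dpi^1 /\ dpi^2 /\ dpi^3 /\ dmu], so the last condition says that the
    orientation [dx^1 /\ dx^2 /\ dx^3 /\ dx^4] of [M] is [eps *_B 1 /\ xi].
    The factor [eps] is forced: the conformal structure of [g] is
    [c + eta^2] with [eta = (D nu + 1/2 *F) / (nu^2 - scal^B / 6)],
    [nu = mu^-1], and its antiselfdual Weyl curvature for [- *_B 1 /\ eta]
    is a rational expression in the data, so this is the orientation for which
    it vanishes whatever the sign of the denominator. *)
Definition ansatz_data (eps : R) (B : set 'rV[R]_3) (M : set 'rV[R]_4) :=
  [/\ open M, smooth_mx_on M pi, smooth_on M mu, pi @` M = B &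
    forall x, M x ->
      0 < eps * ansatz_factor x /\
      0 < eps * o * \det (row_mx ('J pi x) (differential mu x)^T)].

End ansatz.

(* Main.v *)
From HB Require Import structures.
From mathcomp Require Import all_boot all_order all_algebra.
From mathcomp Require Import perm ring lra.
From mathcomp Require Import all_classical all_reals all_analysis.
Require Import Defs.

Set Implicit Arguments.
Unset Strict Implicit.
Unset Printing Implicit Defensive.

Import Order.TTheory GRing.Theory Num.Theory.
Import numFieldNormedType.Exports.

Local Open Scope classical_set_scope.
Local Open Scope ring_scope.

(** Let [e_1, e_2, e_3] be an orthonormal coframe of the base, with connection
    forms [A_k] as in [structure_eq], let [th] be the 1-form of [D^B], [s] its
    scalar curvature and [f] the 1-form [*F^B], and put [nu = mu^-1],
    [q = nu^2 - s / 6] and [q eta = d nu - nu th + f / 2].  In these terms the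
    metric of the ansatz is [q (e_1^2 + e_2^2 + e_3^2 + eta^2)], and everything
    follows from three facts.

    A metric in dimension four is Einstein and selfdual if and only if the
    connection it induces on the bundle of antiselfdual 2-forms has as curvature
    a multiple [m] of the tautological form, i.e. the components
    [m (e_i /\ e_j + e_k /\ eta)], [(i, j, k)] cyclic; then [m] is [- 1/12]
    times the scalar curvature in the scale of the coframe
    ([einstein_selfdualP], [einstein_selfdual_asd]).

    The base is Einstein-Weyl if and only if the curvature
    [d A_k + A_i /\ A_j] is [- (s / 6) e_i /\ e_j - 1/2 f /\ e_k]
    ([ew_rotation], [rotation_ew]).  For the ansatz the connection on the
    antiselfdual forms is [A_k - nu e_k], so that its curvature is
    [q (e_i /\ e_j + e_k /\ eta)] by the definition of [eta]
    ([monopole_curvature]).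

    The second Bianchi identity of the base says
    [d f = th /\ f - 1/3 sum s_k e_i /\ e_j], where
    [d s - 2 s th = sum s_k e_k] ([base_bianchi2]).  It determines [d q] and
    [d eta] ([differential_q], [faraday_eta]): with [w_k] the components of
    [d eta] on [e_i /\ e_j] and [w = sum w_k e_k], one finds
    [d q / q = 2 th + 2 nu eta + w] and
    [d eta = - (th + w) /\ eta + sum w_k e_i /\ e_j].  Hence, relative to the
    coframe, the Levi-Civita derivative is [th + nu eta + w / 2] and the minimal
    Weyl derivative is [th + w]; the skew forms in the definitions of a selfdual
    and of a Legendrian submersion are combinations of the selfdual forms
    [e_i /\ e_j - e_k /\ eta].

    Conversely, given a Legendrian submersion, scale the metric so that the
    submersion becomes Riemannian, and let [psi = sum psi_k e_k + nu eta] be the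
    Levi-Civita derivative in this scale.  The Legendrian condition relates the
    components of [d eta] to [psi] in such a way that the connection on the
    antiselfdual forms is [A_k + t_i e_j - t_j e_i - nu e_k], where
    [t_k = psi_k - w_k / 2]: its forms are horizontal.  Therefore the components
    of the curvature equation involving [eta] say that the [t_k] are constant
    along the fibres and that [nu] has vertical derivative [m]
    ([vertical_derivatives]).  So [sum t_k e_k] is locally the pull-back of a
    1-form of the base, and the horizontal part of the equation is the
    Einstein-Weyl equation for it, together with [d nu - nu th + f / 2 = m eta]
    and [m = nu^2 - s / 6] ([base_einstein_weyl], [base_monopole]).  Since the
    formula for [d q] now identifies [d q / 2 q] with [psi], the scalar curvature
    is constant and [g] is a constant multiple of the ansatz. *)

(** * Partial derivatives *)

Section germs.
Variables (R : realType) (V W : normedModType R).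

Lemma near_eq_differentiable (f g : V -> W) (x : V) :
  (\forall y \near x, f y = g y) -> differentiable f x -> differentiable g x.
Proof.
move=> fg df; have fgx : f x = g x by exact: nbhs_singleton fg.
have cdf := diff_continuous df.
have E : g \o shift x = cst (g x) + 'd f x +o_ 0 id.
  have := diff_locally df => /eqaddoP fE; apply/eqaddoP => eps e0.
  have fg0 : \forall h \near 0, f (h + x) = g (h + x).
    have := fg; rewrite (near_shift 0 x); apply: filterS => h /=.
    by rewrite subr0.
  apply: filterS2 (fE _ e0) fg0 => h.
  by rewrite -[(g \o _ - _) h]/(g (h + x) - (g x + 'd f x h))
    -[(f \o _ - _) h]/(f (h + x) - (f x + 'd f x h)) fgx => + <-.
have dg := diff_unique cdf E.
by apply/diff_locallyP; rewrite dg; split.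
Qed.

End germs.

Section partials.
Variables (R : realType) (n : nat).
Implicit Types (f g : 'rV[R]_n -> R) (U : set 'rV[R]_n) (x v : 'rV[R]_n).

Lemma near_open U x (P : 'rV[R]_n -> Prop) :
  open U -> U x -> (forall y, U y -> P y) -> \forall y \near x, P y.
Proof.
move=> oU Ux UP; apply: filterS UP _; exact: open_nbhs_nbhs.
Qed.

Lemma eq_on_partial U f g k x : open U -> U x -> (forall y, U y -> f y = g y) ->
  partial k f x = partial k g x.
Proof. by move=> oU Ux fg; apply: near_eq_derive; exact: near_open fg. Qed.

Lemma eq_on_differentiable U f g x :
  open U -> U x -> (forall y, U y -> f y = g y) ->
  differentiable f x -> differentiable g x.
Proof.
by move=> oU Ux fg; apply: near_eq_differentiable; exact: near_open fg.
Qed.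

Lemma partial_cst (c : R) k x : partial k (cst c) x = 0.
Proof. exact: derive_cst. Qed.

Lemma partialD f g k x : differentiable f x -> differentiable g x ->
  partial k (fun y => f y + g y) x = partial k f x + partial k g x.
Proof. by move=> df dg; apply: deriveD; exact: diff_derivable. Qed.

Lemma partialN f k x : differentiable f x ->
  partial k (fun y => - f y) x = - partial k f x.
Proof. by move=> df; apply: deriveN; exact: diff_derivable. Qed.

Lemma partialB f g k x : differentiable f x -> differentiable g x ->
  partial k (fun y => f y - g y) x = partial k f x - partial k g x.
Proof. by move=> df dg; apply: deriveB; exact: diff_derivable. Qed.

Lemma partialM f g k x : differentiable f x -> differentiable g x ->
  partial k (fun y => f y * g y) x = partial k f x * g x + f x * partial k g x.
Proof.
move=> df dg; rewrite /partial deriveM; [|exact: diff_derivable..].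
by rewrite addrC [g x *: _]mulrC.
Qed.

Lemma partialV f k x : f x != 0 -> differentiable f x ->
  partial k (fun y => (f y)^-1) x = - (f x) ^- 2 * partial k f x.
Proof.
by move=> f0 df; rewrite /partial (deriveV f0)//; exact: diff_derivable.
Qed.

Lemma partial_sum (I : finType) (F : I -> 'rV[R]_n -> R) k x :
  (forall i, differentiable (F i) x) ->
  partial k (fun y => \sum_i F i y) x = \sum_i partial k (F i) x.
Proof.
move=> dF; have : forall r : seq I,
    differentiable (fun y => \sum_(i <- r) F i y) x /\
    partial k (fun y => \sum_(i <- r) F i y) x = \sum_(i <- r) partial k (F i) x.
  elim=> [|i r [dr Er]].
    rewrite big_nil (_ : (fun _ => _) = cst 0); last first.
      by apply/funext => y; rewrite big_nil.
    by rewrite partial_cst; split=> //; exact: differentiable_cst.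
  rewrite big_cons (_ : (fun _ => _) = F i \+ (fun y => \sum_(i <- r) F i y)).
    by rewrite partialD// Er; split=> //; exact: differentiableD.
  by apply/funext => y; rewrite big_cons.
by move=> /(_ (index_enum I))[].
Qed.

Lemma differentiable_sumf (I : finType) (F : I -> 'rV[R]_n -> R) x :
  (forall i, differentiable (F i) x) ->
  differentiable (fun y => \sum_i F i y) x.
Proof.
move=> dF; elim: (index_enum I) => [|i r dr].
  rewrite (_ : (fun _ => _) = cst 0); first exact: differentiable_cst.
  by apply/funext => y; rewrite big_nil.
rewrite (_ : (fun _ => _) = F i \+ (fun y => \sum_(i <- r) F i y)).
  exact: differentiableD.
by apply/funext => y; rewrite big_cons.
Qed.

Lemma differentiable_powR f (a : R) x : 0 < f x -> differentiable f x ->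
  differentiable (fun y => f y `^ a) x.
Proof.
move=> f0 df; apply: (@differentiable_comp _ _ _ _ f (@powR R ^~ a)) => //.
by apply/derivable1_diffP; apply: derivable_powR; rewrite in_itv/= f0.
Qed.

Lemma partial_powR f (a : R) k x : 0 < f x -> differentiable f x ->
  partial k (fun y => f y `^ a) x = a * (f x `^ a * (f x)^-1) * partial k f x.
Proof.
move=> f0 df.
have dp : differentiable (@powR R ^~ a) (f x).
  by apply/derivable1_diffP; apply: derivable_powR; rewrite in_itv/= f0.
rewrite /partial -[fun y => _]/((@powR R ^~ a) \o f) deriveE; last first.
  exact: differentiable_comp.
rewrite diff_comp//= -(deriveE _ df) -[RHS]mulrC.
have -> : 'd (@powR R ^~ a) (f x)
    = (fun h => h *: (derive1 (@powR R ^~ a) (f x))) :> (R -> R).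
  by apply: deriv1E; exact/derivable1_diffP.
rewrite powR_derive1 ?in_itv/= ?f0//; congr (_ * (_ * _)).
by rewrite powRB ?powRr1 ?ltW// (gt_eqF f0) implybT.
Qed.

Lemma derive_partial f v x : differentiable f x ->
  'D_v f x = \sum_k v 0 k * partial k f x.
Proof.
move=> df; rewrite deriveE// {1}[v]row_sum_delta linear_sum.
by apply: eq_bigr => k _; rewrite linearZ /partial deriveE.
Qed.

End partials.

(** * Smooth functions *)

Section chain_rule.
Variables (R : realType) (n m : nat).
Implicit Types (F : 'rV[R]_n -> 'rV[R]_m) (f : 'rV[R]_m -> R).

Lemma differentiable_row F x :
  (forall k, differentiable (fun y => F y 0 k) x) -> differentiable F x.
Proof.
move=> dF; rewrite (_ : F = \sum_k (fun y => F y 0 k *: delta_mx 0 k)).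
  by apply: differentiable_sum => k; exact: differentiableZl.
by apply/funext => y; rewrite fct_sumE {1}[F y]row_sum_delta.
Qed.

Lemma derive_row F v x : differentiable F x ->
  'D_v F x = \row_k 'D_v (fun y => F y 0 k) x.
Proof.
move=> dF; rewrite derive_mx; last exact: diff_derivable.
by apply/rowP => k; rewrite !mxE.
Qed.

Lemma jacobianE F x i k : differentiable F x ->
  ('J F x) i k = partial i (fun y => F y 0 k) x.
Proof.
by move=> dF; rewrite /jacobian mxE -deriveE// derive_row// mxE.
Qed.

Lemma differentiable_compr F f x :
  (forall k, differentiable (fun y => F y 0 k) x) -> differentiable f (F x) ->
  differentiable (fun y => f (F y)) x.
Proof.
move=> dF df; apply: (@differentiable_comp _ _ _ _ F f) => //.
exact: differentiable_row.
Qed.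

Lemma derive_compr F f v x :
  (forall k, differentiable (fun y => F y 0 k) x) -> differentiable f (F x) ->
  'D_v (fun y => f (F y)) x
  = \sum_k 'D_v (fun y => F y 0 k) x * partial k f (F x).
Proof.
move=> /differentiable_row dF df.
rewrite (deriveE _ (_ : differentiable (f \o F) x)); last exact: differentiable_comp.
rewrite diff_comp//= -(deriveE _ dF) -(deriveE _ df) derive_partial//.
by apply: eq_bigr => k _; rewrite derive_row// mxE.
Qed.

Lemma partial_compr F f i x :
  (forall k, differentiable (fun y => F y 0 k) x) -> differentiable f (F x) ->
  partial i (fun y => f (F y)) x
  = \sum_k partial i (fun y => F y 0 k) x * partial k f (F x).
Proof. exact: derive_compr. Qed.

End chain_rule.

(** Smoothness up to order [k], in the inductive form which suits the proofs:
    every closure property below follows by induction from the formula for the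
    first partial derivatives. *)
Fixpoint smooth_upto (R : realType) (n k : nat) (U : set 'rV[R]_n)
    (f : 'rV[R]_n -> R) : Prop :=
  (forall x, U x -> differentiable f x) /\
  (if k is k'.+1 then forall j, smooth_upto k' U (partial j f) else True).

Section smoothness.
Variables (R : realType) (n : nat).
Implicit Types (f g : 'rV[R]_n -> R) (U : set 'rV[R]_n) (x : 'rV[R]_n).

Lemma smooth_uptoP U f : smooth_on U f <-> forall k, smooth_upto k U f.
Proof.
split=> [sf k|H s].
  elim: k f sf => [|k IH] f sf /=; (split; first by move=> x Ux; exact: (sf [::])).
    by [].
  by move=> j; apply: IH => s x Ux; have := sf (rcons s j) x Ux; rewrite foldr_rcons.
elim/last_ind: s f H => [|s j IH] f H x Ux; first by have [d _] := H 0%N; exact: d.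
by rewrite foldr_rcons; apply: IH => // k; have [_] := H k.+1; exact.
Qed.

Lemma smooth_uptoS k U f : smooth_upto k.+1 U f -> smooth_upto k U f.
Proof.
elim: k f => [|k IH] f [d H]; split=> // j; exact: IH.
Qed.

Lemma smooth_on_diff U f x : smooth_on U f -> U x -> differentiable f x.
Proof. by move=> sf Ux; exact: (sf [::]). Qed.

Lemma smooth_on_partial U f j : smooth_on U f -> smooth_on U (partial j f).
Proof.
by move=> sf s x Ux; have := sf (rcons s j) x Ux; rewrite foldr_rcons.
Qed.

Lemma eq_smooth_upto k U f g : open U -> (forall x, U x -> f x = g x) ->
  smooth_upto k U f -> smooth_upto k U g.
Proof.
move=> oU; elim: k f g => [|k IH] f g fg [d H] /=.
  by split=> // x Ux; exact: (eq_on_differentiable oU Ux fg (d x Ux)).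
split=> [x Ux|j]; first exact: (eq_on_differentiable oU Ux fg (d x Ux)).
by apply: IH (H j) => x Ux; exact: (eq_on_partial _ oU Ux fg).
Qed.

Lemma eq_smooth_on U f g : open U -> (forall x, U x -> f x = g x) ->
  smooth_on U f -> smooth_on U g.
Proof.
by move=> oU fg /smooth_uptoP sf; apply/smooth_uptoP => k; exact: eq_smooth_upto (sf k).
Qed.

Lemma smooth_on_sub U V f : V `<=` U -> smooth_on U f -> smooth_on V f.
Proof. by move=> VU sf s x /VU; exact: sf. Qed.

Lemma smooth_upto_cst k U (c : R) : smooth_upto k U (fun=> c).
Proof.
elim: k c => [|k IH] c; (split=> [x _|]; first exact: differentiable_cst) => //.
by move=> j; rewrite (_ : partial j _ = fun=> 0) //; apply/funext => x; exact: partial_cst.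
Qed.

Lemma smooth_uptoD k U f g : open U -> smooth_upto k U f -> smooth_upto k U g ->
  smooth_upto k U (fun x => f x + g x).
Proof.
move=> oU; elim: k f g => [|k IH] f g [df Hf] [dg Hg].
  by split=> // x Ux; apply: differentiableD; [exact: df|exact: dg].
split=> [x Ux|j]; first by apply: differentiableD; [exact: df|exact: dg].
apply: eq_smooth_upto (IH _ _ (Hf j) (Hg j)) => // x Ux.
by rewrite partialD; [|exact: df|exact: dg].
Qed.

Lemma smooth_uptoM k U f g : open U -> smooth_upto k U f -> smooth_upto k U g ->
  smooth_upto k U (fun x => f x * g x).
Proof.
move=> oU; elim: k f g => [|k IH] f g sf sg.
  split=> // x Ux.
  by apply: (@differentiableM _ _ f g); [exact: sf.1|exact: sg.1].
have [df Hf] := sf; have [dg Hg] := sg; split=> [x Ux|j].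
  by apply: (@differentiableM _ _ f g); [exact: df|exact: dg].
apply: eq_smooth_upto (smooth_uptoD oU (IH _ _ (Hf j) (smooth_uptoS sg))
  (IH _ _ (smooth_uptoS sf) (Hg j))) => // x Ux.
by rewrite partialM; [|exact: df|exact: dg].
Qed.

Lemma smooth_upto_sum k U (I : finType) (F : I -> 'rV[R]_n -> R) : open U ->
  (forall i, smooth_upto k U (F i)) -> smooth_upto k U (fun x => \sum_i F i x).
Proof.
move=> oU sF; elim: (index_enum I) => [|i r IH].
  by rewrite (_ : (fun _ => _) = fun=> 0); [exact: smooth_upto_cst|
    apply/funext => x; rewrite big_nil].
rewrite (_ : (fun _ => _) = fun x => F i x + \sum_(i <- r) F i x).
  exact: smooth_uptoD.
by apply/funext => x; rewrite big_cons.
Qed.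

Lemma smooth_upto_powR k U f (a : R) : open U -> (forall x, U x -> 0 < f x) ->
  smooth_upto k U f -> smooth_upto k U (fun x => f x `^ a).
Proof.
move=> oU f0; elim: k a f f0 => [|k IH] a f f0 sf.
  by split=> // x Ux; exact: differentiable_powR (f0 x Ux) (sf.1 x Ux).
have [df Hf] := sf; split=> [x Ux|j].
  exact: differentiable_powR (f0 x Ux) (df x Ux).
have sf' := smooth_uptoS sf.
apply: eq_smooth_upto (smooth_uptoM oU (smooth_uptoM oU (smooth_upto_cst k U a)
   (IH (a - 1) f f0 sf')) (Hf j)) => // x Ux.
rewrite (partial_powR a j (f0 x Ux) (df x Ux)); congr (_ * _ * _).
by rewrite powRB ?powRr1 ?ltW ?f0// (gt_eqF (f0 x Ux)) implybT.
Qed.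

Lemma smooth_uptoV k U f : open U -> (forall x, U x -> f x != 0) ->
  smooth_upto k U f -> smooth_upto k U (fun x => (f x)^-1).
Proof.
move=> oU f0; elim: k => [|k IH] sf.
  by split=> // x Ux; apply: (@differentiableV _ _ f); [exact: sf.1|exact: f0].
have [df Hf] := sf; split=> [x Ux|j].
  by apply: (@differentiableV _ _ f); [exact: df|exact: f0].
have sV := IH (smooth_uptoS sf).
apply: eq_smooth_upto (smooth_uptoM oU (smooth_uptoM oU (smooth_upto_cst k U (-1))
   (smooth_uptoM oU sV sV)) (Hf j)) => // x Ux.
by rewrite partialV ?f0//; [rewrite mulN1r -expr2 exprVn|exact: df].
Qed.

Lemma smooth_upto_comp m k (U : set 'rV[R]_n) (V : set 'rV[R]_m)
    (F : 'rV[R]_n -> 'rV[R]_m) (f : 'rV[R]_m -> R) :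
  open U -> (forall x, U x -> V (F x)) ->
  (forall j, smooth_upto k U (fun x => F x 0 j)) -> smooth_upto k V f ->
  smooth_upto k U (fun x => f (F x)).
Proof.
move=> oU UV; elim: k f => [|k IH] f sF sf.
  split=> // x Ux; apply: differentiable_compr => [j|]; first exact: (sF j).1.
  exact/sf.1/UV.
split=> [x Ux|i].
  apply: differentiable_compr => [j|]; first exact: (sF j).1.
  exact/sf.1/UV.
have H : smooth_upto k U
    (fun x => \sum_j partial i (fun y => F y 0 j) x * partial j f (F x)).
  apply: smooth_upto_sum => // j; apply: smooth_uptoM => //; first exact: (sF j).2.
  by apply: IH => [l|]; [exact: smooth_uptoS|exact: sf.2].
apply: eq_smooth_upto H => // x Ux; rewrite partial_compr// => [j|].
  exact: (sF j).1.
exact/sf.1/UV.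
Qed.

Lemma smooth_on_cst U (c : R) : smooth_on U (fun=> c).
Proof. by apply/smooth_uptoP => k; exact: smooth_upto_cst. Qed.

Lemma smooth_onD U f g : open U -> smooth_on U f -> smooth_on U g ->
  smooth_on U (fun x => f x + g x).
Proof.
by move=> oU /smooth_uptoP sf /smooth_uptoP sg; apply/smooth_uptoP => k; exact: smooth_uptoD.
Qed.

Lemma smooth_onM U f g : open U -> smooth_on U f -> smooth_on U g ->
  smooth_on U (fun x => f x * g x).
Proof.
by move=> oU /smooth_uptoP sf /smooth_uptoP sg; apply/smooth_uptoP => k; exact: smooth_uptoM.
Qed.

Lemma smooth_onN U f : open U -> smooth_on U f -> smooth_on U (fun x => - f x).
Proof.
move=> oU sf; have := smooth_onM oU (@smooth_on_cst U (-1)) sf.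
by apply: eq_smooth_on => // x _; rewrite mulN1r.
Qed.

Lemma smooth_onB U f g : open U -> smooth_on U f -> smooth_on U g ->
  smooth_on U (fun x => f x - g x).
Proof. by move=> oU sf sg; exact: smooth_onD (smooth_onN oU sg). Qed.

Lemma smooth_on_sum U (I : finType) (F : I -> 'rV[R]_n -> R) : open U ->
  (forall i, smooth_on U (F i)) -> smooth_on U (fun x => \sum_i F i x).
Proof.
move=> oU sF; apply/smooth_uptoP => k; apply: smooth_upto_sum => // i.
by have /smooth_uptoP := sF i; apply.
Qed.

Lemma smooth_on_prod U (I : finType) (F : I -> 'rV[R]_n -> R) : open U ->
  (forall i, smooth_on U (F i)) -> smooth_on U (fun x => \prod_i F i x).
Proof.
move=> oU sF; elim: (index_enum I) => [|i r IH].
  by rewrite (_ : (fun _ => _) = fun=> 1); [exact: smooth_on_cst|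
    apply/funext => x; rewrite big_nil].
rewrite (_ : (fun _ => _) = fun x => F i x * \prod_(i <- r) F i x).
  exact: smooth_onM.
by apply/funext => x; rewrite big_cons.
Qed.

Lemma smooth_on_powR U f (a : R) : open U -> (forall x, U x -> 0 < f x) ->
  smooth_on U f -> smooth_on U (fun x => f x `^ a).
Proof.
by move=> oU f0 /smooth_uptoP sf; apply/smooth_uptoP => k; exact: smooth_upto_powR.
Qed.

Lemma smooth_onV U f : open U -> (forall x, U x -> f x != 0) ->
  smooth_on U f -> smooth_on U (fun x => (f x)^-1).
Proof.
by move=> oU f0 /smooth_uptoP sf; apply/smooth_uptoP => k; exact: smooth_uptoV.
Qed.

Lemma smooth_on_coord U i j : smooth_on U (fun x : 'rV[R]_n => x i j).
Proof.
apply/smooth_uptoP => -[|k]; (split=> [x _|]; first exact: differentiable_coord) => //.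
move=> l; rewrite (_ : partial l _ = fun=> (delta_mx 0 l : 'rV[R]_n) i j).
  exact: smooth_upto_cst.
apply/funext => x; rewrite /partial ord1.
have did : differentiable (fun y : 'rV[R]_n => y) x.
  by apply: differentiable_row => k0; exact: differentiable_coord.
have := derive_row (delta_mx 0 l) did.
by rewrite derive_id => /rowP/(_ j); rewrite [RHS]mxE => ->.
Qed.

End smoothness.

Lemma smooth_on_comp (R : realType) (n m : nat) (U : set 'rV[R]_n) (V : set 'rV[R]_m)
    (F : 'rV[R]_n -> 'rV[R]_m) (f : 'rV[R]_m -> R) :
  open U -> (forall x, U x -> V (F x)) -> smooth_mx_on U F -> smooth_on V f ->
  smooth_on U (fun x => f (F x)).
Proof.
move=> oU UV sF /smooth_uptoP sf; apply/smooth_uptoP => k.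
by apply: smooth_upto_comp (sf k) => // j; have /smooth_uptoP := sF 0 j; apply.
Qed.

Section smooth_matrices.
Variables (R : realType) (n : nat) (U : set 'rV[R]_n).
Hypothesis oU : open U.

Lemma smooth_mx_mul p q r (A : 'rV[R]_n -> 'M[R]_(p, q)) (B : 'rV[R]_n -> 'M[R]_(q, r)) :
  smooth_mx_on U A -> smooth_mx_on U B -> smooth_mx_on U (fun x => A x *m B x).
Proof.
move=> sA sB i j.
apply: (@eq_smooth_on _ _ U (fun x => \sum_k A x i k * B x k j)) => //.
  by move=> x _; rewrite mxE.
by apply: smooth_on_sum => // k; exact: smooth_onM.
Qed.

Lemma smooth_mx_tr p q (A : 'rV[R]_n -> 'M[R]_(p, q)) :
  smooth_mx_on U A -> smooth_mx_on U (fun x => (A x)^T).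
Proof.
by move=> sA i j; apply: eq_smooth_on (sA j i) => // x _; rewrite mxE.
Qed.

Lemma smooth_mxD p q (A B : 'rV[R]_n -> 'M[R]_(p, q)) :
  smooth_mx_on U A -> smooth_mx_on U B -> smooth_mx_on U (fun x => A x + B x).
Proof.
by move=> sA sB i j; apply: eq_smooth_on (smooth_onD oU (sA i j) (sB i j)) => // x _; rewrite mxE.
Qed.

Lemma smooth_mxZ p q f (A : 'rV[R]_n -> 'M[R]_(p, q)) :
  smooth_on U f -> smooth_mx_on U A -> smooth_mx_on U (fun x => f x *: A x).
Proof.
by move=> sf sA i j; apply: eq_smooth_on (smooth_onM oU sf (sA i j)) => // x _; rewrite mxE.
Qed.

Lemma smooth_det p (A : 'rV[R]_n -> 'M[R]_p) :
  smooth_mx_on U A -> smooth_on U (fun x => \det (A x)).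
Proof.
move=> sA; rewrite /determinant; apply: smooth_on_sum => // s.
by apply: smooth_onM => //; [exact: smooth_on_cst|apply: smooth_on_prod].
Qed.

Lemma smooth_invmx p (A : 'rV[R]_n -> 'M[R]_p) :
  smooth_mx_on U A -> (forall x, U x -> A x \in unitmx) ->
  smooth_mx_on U (fun x => invmx (A x)).
Proof.
move=> sA uA i j.
have : smooth_on U (fun x => (\det (A x))^-1 *
    ((-1) ^+ (j + i) * \det (row' j (col' i (A x))))).
  apply: smooth_onM => //; first by apply: smooth_onV => //;
    [move=> x Ux; rewrite -unitfE -unitmxE; exact: uA|exact: smooth_det].
  apply: smooth_onM => //; first exact: smooth_on_cst.
  apply: smooth_det => k l.
  by apply: eq_smooth_on (sA (lift j k) (lift i l)) => // x _; rewrite !mxE.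
by apply: eq_smooth_on => // x Ux; rewrite /invmx uA// !mxE.
Qed.

Lemma smooth_differential f : smooth_on U f -> smooth_mx_on U (differential f).
Proof.
move=> sf i j; apply: eq_smooth_on (smooth_on_partial j sf) => // x _.
by rewrite mxE.
Qed.

Lemma smooth_jacobian m (F : 'rV[R]_n -> 'rV[R]_m) :
  smooth_mx_on U F -> smooth_mx_on U (fun x => 'J F x).
Proof.
move=> sF i j; apply: eq_smooth_on (smooth_on_partial i (sF 0 j)) => // x Ux.
rewrite jacobianE//; apply: differentiable_row => k; exact: smooth_on_diff Ux.
Qed.

End smooth_matrices.

(** * Mean values and the symmetry of second derivatives *)

Section line_derivatives.
Variables (R : realType) (n : nat).
Implicit Types (f g : 'rV[R]_n -> R) (U : set 'rV[R]_n) (x u v : 'rV[R]_n).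

Lemma derive_along_line f x u (t : R) : differentiable f (x + t *: u) ->
  is_derive t 1 (fun s : R => f (x + s *: u)) ('D_u f (x + t *: u)).
Proof.
move=> df.
have dl : is_diff t (fun s : R => x + s *: u) ( *:%R^~ u).
  have dc : is_diff t (cst x : R -> 'rV[R]_n) 0 by exact: is_diff_cst.
  have := is_diffD dc (is_diff_scalel t u).
  by rewrite add0r.
have dfx := differentiableP df.
have dc := is_diff_comp dl dfx.
have dd : differentiable (f \o (fun s : R => x + s *: u)) t by exact: ex_diff.
apply: DeriveDef; first exact: diff_derivable.
by rewrite (deriveE _ dd) diff_val /= scale1r deriveE.
Qed.

Lemma line_MVT f x u :
  (forall t : R, 0 <= t <= 1 -> differentiable f (x + t *: u)) ->
  exists2 t : R, 0 < t < 1 & f (x + u) - f x = 'D_u f (x + t *: u).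
Proof.
move=> df; pose h (s : R) := f (x + s *: u).
have dh (s : R) : 0 <= s <= 1 -> is_derive s 1 h ('D_u f (x + s *: u)).
  by move=> s01; apply: derive_along_line; exact: df.
have [||c + hE] := @MVT R h (fun s => 'D_u f (x + s *: u)) 0 1 ltr01.
- by move=> s; rewrite in_itv/= => /andP[s0 s1]; apply: dh; rewrite !ltW.
- apply: derivable_within_continuous => s; rewrite in_itv/= => s01.
  by have [] := dh s s01.
rewrite in_itv/= => c01; exists c => //.
by move: hE; rewrite /h subr0 mulr1 scale1r scale0r addr0.
Qed.

Lemma derive_scale_dir f (a : R) u x : differentiable f x ->
  'D_(a *: u) f x = a * 'D_u f x.
Proof. by move=> df; rewrite !deriveE// linearZ. Qed.

End line_derivatives.

Section norms.
Variables (R : realType) (n : nat).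
Implicit Types (x u v : 'rV[R]_n).

Lemma coord_le_norm x j : `|x 0 j| <= `|x|.
Proof.
rewrite [leRHS]/Num.Def.normr/= mx_normrE.
exact: (le_bigmax _ (fun ij => `|x ij.1 ij.2|) (0, j)).
Qed.

Lemma norm_le_coord x (c : R) : 0 <= c -> (forall j, `|x 0 j| <= c) -> `|x| <= c.
Proof.
move=> c0 H; rewrite [leLHS]/Num.Def.normr/= mx_normrE.
by apply: bigmax_le => //= -[i j] _; rewrite /= ord1.
Qed.

Lemma norm_delta (j : 'I_n) : `|(delta_mx 0 j : 'rV[R]_n)| <= 1.
Proof.
by apply: norm_le_coord => // i; rewrite mxE eqxx; case: eqP; rewrite ?normr1 ?normr0.
Qed.

Lemma norm_mulmx_le p (B : 'M[R]_(n, p)) :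
  exists2 C : R, 0 < C & forall v, `|v *m B| <= C * `|v|.
Proof.
exists (1 + \sum_i \sum_j `|B i j|).
  by rewrite ltr_pwDl// sumr_ge0// => i _; rewrite sumr_ge0.
move=> v; rewrite [leLHS]/Num.Def.normr/= mx_normrE.
apply: bigmax_le => [|[i j] _].
  by rewrite mulr_ge0// addr_ge0// sumr_ge0// => i _; rewrite sumr_ge0.
rewrite /= ord1 mxE (le_trans (ler_norm_sum _ _ _))// mulrDl mul1r mulr_suml.
rewrite ler_wpDl// ler_sum// => k _; rewrite normrM mulrC.
rewrite ler_pM// ?coord_le_norm// (bigD1 j)//= lerDl sumr_ge0//.
Qed.

End norms.

Section schwarz.
Variables (R : realType) (n : nat) (U : set 'rV[R]_n) (f : 'rV[R]_n -> R).
Variable x : 'rV[R]_n.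
Hypotheses (oU : open U) (sf : smooth_on U f) (Ux : U x).

Let S (i j : 'I_n) (h : R) : R :=
  f (x + h *: delta_mx 0 i + h *: delta_mx 0 j) - f (x + h *: delta_mx 0 i)
  - f (x + h *: delta_mx 0 j) + f x.

(** The second difference divided by [h ^+ 2] tends to the iterated derivative:
    apply the mean value theorem in the first direction, then the
    differentiability of the first partial derivative. *)
Lemma second_difference (i j : 'I_n) (e : R) : 0 < e ->
  \forall h \near 0^'+, `|S i j h - h ^+ 2 * partial j (partial i f) x| <= e * h ^+ 2.
Proof.
move=> e0; pose g := partial i f.
have sg : smooth_on U g by exact: smooth_on_partial.
have dg : differentiable g x by exact: smooth_on_diff sg Ux.
have e3 : 0 < e / 3 by rewrite divr_gt0.
have /= := diff_locally dg => /eqaddoP/(_ _ e3)/nbhs_ballP[d /= d0 Hd].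
have /nbhs_ballP[r /= r0 Hr] : nbhs x U by exact: open_nbhs_nbhs.
near=> h.
have h0 : 0 < h by near: h; exact: nbhs_right_gt.
have hd : h < d / 3 by near: h; apply: nbhs_right_lt; rewrite divr_gt0.
have hr : h < r / 3 by near: h; apply: nbhs_right_lt; rewrite divr_gt0.
set u : 'rV[R]_n := delta_mx 0 i; set v : 'rV[R]_n := delta_mx 0 j.
have small (t s : R) : 0 <= t <= 1 -> 0 <= s <= 1 -> `|(t * h) *: u + (s * h) *: v| <= 2 * h.
  move=> /andP[t0 t1] /andP[s0 s1]; rewrite (le_trans (ler_normD _ _))// !normrZ.
  rewrite mulr_natl mulr2n ?normrM (ger0_norm t0) (ger0_norm s0) (gtr0_norm h0).
  by apply: lerD; rewrite -[leRHS]mulr1 ler_pM ?norm_delta ?mulr_ge0 ?(ltW h0)// -[leRHS]mul1r ler_pM// ltW.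
have inU (t s : R) : 0 <= t <= 1 -> 0 <= s <= 1 -> U (x + ((t * h) *: u + (s * h) *: v)).
  move=> t1 s1; apply: Hr; rewrite -ball_normE /= opprD addrA subrr sub0r normrN.
  rewrite (le_lt_trans (small _ _ t1 s1))//.
  by move: hr; rewrite ltr_pdivlMr//; move: h0; lra.
pose phi y := f (y + h *: v) - f y.
have dphi y : differentiable f y -> differentiable f (y + h *: v) ->
    differentiable phi y /\ forall w, 'D_w phi y = 'D_w f (y + h *: v) - 'D_w f y.
  move=> d1 d2.
  have d3 : is_diff y (fun z : 'rV[R]_n => z + h *: v) id.
    have := is_diffD (is_diff_id y) (is_diff_cst (h *: v) y).
    by rewrite addr0.
  have d4 : is_diff y (f \o (fun z : 'rV[R]_n => z + h *: v)) ('d f (y + h *: v) \o id).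
    exact: (is_diff_comp d3 (differentiableP d2)).
  have d5 : differentiable (f \o (fun z : 'rV[R]_n => z + h *: v)) y by exact: ex_diff.
  split; first exact: differentiableB d5 d1.
  move=> w; rewrite (deriveB (diff_derivable d5) (diff_derivable d1)).
  by rewrite (deriveE _ d5) diff_val /= -deriveE.
have U1 (t : R) : 0 <= t <= 1 -> U (x + t *: (h *: u)).
  move=> t1; have := inU t 0 t1; rewrite mul0r scale0r addr0 scalerA; apply.
  by rewrite lexx ler01.
have U2 (t : R) : 0 <= t <= 1 -> U (x + t *: (h *: u) + h *: v).
  move=> t1; have := inU t 1 t1; rewrite mul1r scalerA addrA; apply.
  by rewrite lexx ler01.
have df y : U y -> differentiable f y by exact: smooth_on_diff.
have [t t01 phiE] : exists2 t : R, 0 < t < 1 &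
    phi (x + h *: u) - phi x = 'D_(h *: u) phi (x + t *: (h *: u)).
  apply: line_MVT => t t1; apply: (dphi _ _ _).1; apply: df; [exact: U1|exact: U2].
have t01' : 0 <= t <= 1 by case/andP: t01 => ? ?; rewrite !ltW.
have dphit := dphi _ (df _ (U1 t t01')) (df _ (U2 t t01')).
have SE : S i j h = h * (g (x + t *: (h *: u) + h *: v) - g (x + t *: (h *: u))).
  rewrite (_ : S i j h = phi (x + h *: u) - phi x); last first.
    by rewrite /S /phi -/u -/v opprB addrA addrAC.
  by rewrite phiE derive_scale_dir ?dphit.2//; exact: dphit.1.
pose k1 := t *: (h *: u) + h *: v; pose k2 := t *: (h *: u).
have k1s : `|k1| <= 2 * h.
  by have := small t 1 t01'; rewrite mul1r /k1 scalerA; apply; rewrite lexx ler01.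
have k2s : `|k2| <= h.
  rewrite /k2 scalerA !normrZ ?normrM (ger0_norm (andP t01').1) (gtr0_norm h0).
  have [t0 t1] := andP t01'; have th0 : 0 <= t * h by rewrite mulr_ge0// ltW.
  by rewrite (le_trans (ler_piMr th0 (norm_delta R i)))// ler_piMl// ltW.
have Hk k : `|k| <= 2 * h -> `|g (x + k) - (g x + 'd g x k)| <= e / 3 * `|k|.
  move=> kh; have kd : `|k| < d.
    by rewrite (le_lt_trans kh)//; move: hd; rewrite ltr_pdivlMr//; move: h0; lra.
  have := Hd k; rewrite -ball_normE /= sub0r normrN => /(_ kd).
  by rewrite -[(_ \o _ - _) k]/(g (k + x) - (g x + 'd g x k)) [x + k]addrC.
have H1 := Hk _ k1s; have H2 : `|g (x + k2) - (g x + 'd g x k2)| <= e / 3 * `|k2|.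
  by apply: Hk; rewrite (le_trans k2s)//; move: h0; lra.
have dk : 'd g x k1 = 'd g x k2 + h * partial j g x.
  rewrite /k1 (linearD ('d g x)) /partial (deriveE _ dg); congr (_ + _).
  exact: linearZ.
rewrite SE -[x + _ + _]addrA -/k1 -/k2 expr2 -mulrA -mulrBr normrM (gtr0_norm h0).
rewrite mulrCA ler_pM2l//; move: H1 H2; rewrite dk.
move: (g (x + k1)) (g (x + k2)) ('d g x k2) (h * partial j g x) => a b c p.
move: (g x) => gx H1 H2; have -> : a - b - p = (a - (gx + (c + p))) - (b - (gx + c)) by ring.
rewrite (le_trans (ler_normB _ _))// (le_trans (lerD H1 H2))//.
have -> : e * h = e / 3 * (2 * h) + e / 3 * h by field.
by rewrite lerD// ler_pM2l.
Unshelve. all: by end_near. Qed.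

(** The second difference is symmetric in the two directions, and both iterated
    derivatives are its limit. *)
Lemma partialC (i j : 'I_n) : partial i (partial j f) x = partial j (partial i f) x.
Proof.
apply/eqP; rewrite -subr_eq0 -normr_le0; apply/ler_addgt0Pr => e e0; rewrite add0r.
have e2 : 0 < e / 2 by rewrite divr_gt0.
have [h [[h0 H1] H2]] := filter_ex (filterI (filterI
  (nbhs_right_gt (0 : R)) (second_difference j i e2)) (second_difference i j e2)).
have Sij : S j i h = S i j h.
  rewrite /S [x + _ + _]addrAC; congr (_ + _); exact: addrAC.
have h2 : 0 < h ^+ 2 by rewrite exprn_gt0.
rewrite -(ler_pM2r h2) -{1}(gtr0_norm h2) -normrM.
have -> : (partial i (partial j f) x - partial j (partial i f) x) * h ^+ 2
  = (S i j h - h ^+ 2 * partial j (partial i f) x)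
    - (S j i h - h ^+ 2 * partial i (partial j f) x).
  rewrite Sij; move: (S i j h) (partial i _ x) (partial j _ x) => a b c.
  by ring.
rewrite (le_trans (ler_normB _ _))// (le_trans (lerD H2 H1))//.
by rewrite -mulrDl -splitr.
Qed.

End schwarz.

(** * The inverse function theorem *)

Lemma continuous_mulmxr (R : realType) (n p : nat) (B : 'M[R]_(n, p)) :
  continuous (mulmxr B : 'rV[R]_n -> 'rV[R]_p).
Proof.
move=> x; apply: differentiable_continuous; apply: differentiable_row => k.
rewrite (_ : (fun y : 'rV[R]_n => _) = fun y : 'rV[R]_n => \sum_l y 0 l * B l k).
  apply: differentiable_sumf => l.
  by apply: (@differentiableM _ _ (fun y : 'rV[R]_n => y 0 l) (cst (B l k)));
    [exact: differentiable_coord|exact: differentiable_cst].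
by apply/funext => y; rewrite /= mxE.
Qed.

Section inverse_function.
Variables (R : realType) (n : nat) (F : 'rV[R]_n -> 'rV[R]_n).
Variables (M : set 'rV[R]_n) (p : 'rV[R]_n).
Hypotheses (oM : open M) (sF : smooth_mx_on M F) (Mp : M p).
Hypothesis uJ : 'J F p \in unitmx.

Let B := invmx ('J F p).
Let K (x : 'rV[R]_n) : 'rV[R]_n := x - F x *m B.

Let dF x : M x -> differentiable F x.
Proof. by move=> Mx; apply: differentiable_row => k; exact: smooth_on_diff Mx. Qed.

Let sK j : smooth_on M (fun x => K x 0 j).
Proof.
apply: (@eq_smooth_on _ _ M (fun x : 'rV[R]_n => x 0 j - \sum_k F x 0 k * B k j)) => //.
  by move=> x _; rewrite !mxE.
apply: smooth_onB => //; first exact: smooth_on_coord.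
by apply: smooth_on_sum => // k; apply: smooth_onM => //; exact: smooth_on_cst.
Qed.

Let partialK i j : partial i (fun x => K x 0 j) p = 0.
Proof.
rewrite (_ : (fun x => _) = fun x : 'rV[R]_n => x 0 j - \sum_k F x 0 k * B k j); last first.
  by apply/funext => x; rewrite !mxE.
have dFk k : differentiable (fun x => F x 0 k) p by exact: smooth_on_diff Mp.
have dFB k : differentiable (fun x => F x 0 k * B k j) p.
  by apply: (@differentiableM _ _ (fun x => F x 0 k) (cst (B k j))).
rewrite partialB; [|exact: differentiable_coord|exact: differentiable_sumf].
rewrite partial_sum//.
have -> : partial i (fun x : 'rV[R]_n => x 0 j) p = (i == j)%:R.
  have did : differentiable (fun y : 'rV[R]_n => y) p.
    by apply: differentiable_row => k; exact: differentiable_coord.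
  have := derive_row (delta_mx 0 i) did.
  by rewrite derive_id /partial => /rowP/(_ j); rewrite [RHS]mxE => <-; rewrite mxE eqxx eq_sym.
have -> : \sum_k partial i (fun x => F x 0 k * B k j) p = ('J F p *m B) i j.
  rewrite mxE; apply: eq_bigr => k _; rewrite jacobianE; last exact: dF.
  rewrite (@partialM _ _ (fun x => F x 0 k) (fun=> B k j))//.
  by rewrite (partial_cst (B k j) i p) mulr0 addr0.
by rewrite /B mulmxV// mxE subrr.
Qed.

(** A radius on which [K] contracts by a factor [1 / 2]: the entries of its
    derivative are small because the derivative vanishes at [p]. *)
Let good (d : R) := 0 < d /\ forall x, `|x - p| <= d ->
  [/\ M x, 'J F x \in unitmx &
   forall i j, `|partial i (fun y => K y 0 j) x| <= (2 * n.+1%:R)^-1].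

Let good_radius : exists d, good d.
Proof.
have cdet : {for p, continuous (fun x => \det ('J F x))}.
  apply: differentiable_continuous.
  by apply: (@smooth_on_diff _ _ M) => //; apply: smooth_det => //; exact: smooth_jacobian.
have det0 : \det ('J F p) != 0 by rewrite -unitfE -unitmxE.
have n1 : (\forall x \near p, M x) by exact: open_nbhs_nbhs.
have n2 : \forall x \near p, 'J F x \in unitmx.
  have /cvgr_neq0/(_ det0) := cdet.
  by apply: filterS => x; rewrite -unitfE -unitmxE.
have n3 : \forall x \near p, forall ij : 'I_n * 'I_n,
    `|partial ij.1 (fun y => K y 0 ij.2) x| <= (2 * n.+1%:R)^-1.
  apply: (@filter_forall _ _ (fun (ij : 'I_n * 'I_n) x =>
    `|partial ij.1 (fun y => K y 0 ij.2) x| <= (2 * n.+1%:R)^-1) (nbhs p)) => -[i j] /=.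
  have c : {for p, continuous (partial i (fun y => K y 0 j))}.
    apply: differentiable_continuous; apply: (@smooth_on_diff _ _ M) => //.
    exact/smooth_on_partial/sK.
  have e0 : 0 < (2 * n.+1%:R)^-1 :> R by rewrite invr_gt0 mulr_gt0.
  have /cvgrPdist_le/(_ _ e0) := c; apply: filterS => x.
  by rewrite partialK sub0r normrN.
have : \forall x \near p, (M x /\ 'J F x \in unitmx) /\ forall ij : 'I_n * 'I_n,
    `|partial ij.1 (fun y => K y 0 ij.2) x| <= (2 * n.+1%:R)^-1.
  exact: filterI (filterI n1 n2) n3.
move=> /nbhs_ballP[d /= d0 Hd].
exists (d / 2); split; first by rewrite divr_gt0.
move=> x xp; have [|[Mx ux] kx] := Hd x.
  rewrite -ball_normE /= -normrN opprB (le_lt_trans xp)//.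
  by rewrite gtr_pMr// invf_lt1// ltr1n.
by split=> // i j; exact: (kx (i, j)).
Qed.

Section with_radius.
Variables (d : R) (gd : good d).
Let d0 : 0 < d := gd.1.

Lemma segment_in (x x' : 'rV[R]_n) (t : R) : `|x - p| <= d -> `|x' - p| <= d ->
  0 <= t <= 1 -> `|x' + t *: (x - x') - p| <= d.
Proof.
move=> xp xp' /andP[t0 t1].
have -> : x' + t *: (x - x') - p = (1 - t) *: (x' - p) + t *: (x - p).
  by apply/rowP => j; rewrite !mxE; ring.
rewrite (le_trans (ler_normD _ _))// !normrZ ger0_norm ?subr_ge0// (ger0_norm t0).
rewrite (_ : d = (1 - t) * d + t * d); last by rewrite mulrBl mul1r subrK.
by rewrite lerD// ler_wpM2l// subr_ge0.
Qed.

Lemma contract x x' : `|x - p| <= d -> `|x' - p| <= d ->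
  `|K x - K x'| <= 2^-1 * `|x - x'|.
Proof.
move=> xp xp'; apply: norm_le_coord; first by rewrite mulr_ge0.
move=> j; have -> : (K x - K x') 0 j = K x 0 j - K x' 0 j.
  by move: (K x) (K x') => a b; rewrite !mxE.
have seg t : 0 <= t <= 1 -> `|x' + t *: (x - x') - p| <= d by exact: segment_in.
have dK t : 0 <= t <= 1 -> differentiable (fun y => K y 0 j) (x' + t *: (x - x')).
  by move=> t01; apply: (smooth_on_diff (sK j)); have [] := gd.2 _ (seg _ t01).
have [t t01 /=] := line_MVT dK; rewrite (addrC x' (x - x')) subrK.
have t01' : 0 <= t <= 1 by case/andP: t01 => ? ?; rewrite !ltW.
have [_ _ kE] := gd.2 _ (seg _ t01').
move=> ->; rewrite derive_partial; last exact: dK.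
rewrite (le_trans (ler_norm_sum _ _ _))//.
apply: (@le_trans _ _ (\sum_(k < n) (2 * n.+1%:R)^-1 * `|x - x'|)).
  apply: ler_sum => k _; rewrite normrM [leLHS]mulrC ler_pM//; exact: coord_le_norm.
rewrite sumr_const card_ord -[_ *+ n]mulr_natr.
have N0 : (n.+1%:R : R) != 0 by rewrite pnatr_eq0.
rewrite (_ : _ * n%:R = 2^-1 * `|x - x'| * (n%:R / n.+1%:R)).
  by rewrite ler_piMr ?mulr_ge0// ler_pdivrMr// mul1r ler_nat.
by move: `|x - x'| => z; field.
Qed.

Lemma apart x x' : `|x - p| <= d -> `|x' - p| <= d ->
  `|x - x'| <= 2 * `|(F x - F x') *m B|.
Proof.
move=> xp xp'; have := contract xp xp'.
have -> : x - x' = (K x - K x') + (F x - F x') *m B.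
  rewrite /K mulmxBl; move: (F x *m B) (F x' *m B) => a b.
  by apply/rowP => j; rewrite !mxE; ring.
move: (K x - K x') ((F x - F x') *m B) => a b H.
have := ler_normD a b; move: H; move: `|a + b| `|a| `|b| => ab na nb.
lra.
Qed.

Lemma fixed y : `|(y - F p) *m B| < d / 2 ->
  exists2 x, `|x - p| < d & F x = y.
Proof.
move=> yB; pose T x := K x + y *m B.
have Tp : T p - p = (y - F p) *m B.
  rewrite /T /K mulmxBl; move: (F p *m B) (y *m B) => a b.
  by apply/rowP => j; rewrite !mxE; ring.
have TE x : T x - x = (y - F x) *m B.
  rewrite /T /K mulmxBl; move: (F x *m B) (y *m B) => a b.
  by apply/rowP => j; rewrite !mxE; ring.
have inT x : `|x - p| <= d -> `|T x - p| < d.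
  move=> xp; have -> : T x - p = (K x - K p) + (T p - p).
    rewrite /T; move: (K x) (K p) (y *m B) => a b c.
    by apply/rowP => j; rewrite !mxE; ring.
  rewrite (le_lt_trans (ler_normD _ _))// Tp (splitr d) ler_ltD//.
  have pd : `|p - p| <= d by rewrite subrr normr0 ltW.
  by rewrite (le_trans (contract xp pd))// mulrC ler_pM2r.
have TT x x' : `|x - p| <= d -> `|x' - p| <= d -> `|T x - T x'| <= 2^-1 * `|x - x'|.
  by move=> xp xp'; rewrite /T opprD addrACA subrr addr0; exact: contract.
pose A := closed_ball p d.
have AE x : A x <-> `|x - p| <= d.
  by rewrite /A closed_ballE// /closed_ball_ /= distrC.
pose psi x := `|(y - F x) *m B|.
have [||//|x0] := @EVT_min_rV R n psi A.
- by exists p; apply/AE; rewrite subrr normr0 ltW.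
- apply: bounded_closed_compact; last exact: closed_ball_closed.
  exists (`|p| + d); split; first exact: num_real.
  move=> c hc x /AE xp /=; rewrite (le_trans _ (ltW hc))//.
  by rewrite -[x](subrK p) addrC (le_trans (ler_normD _ _))// lerD2l.
- apply: continuous_in_subspaceT => x; rewrite inE => /AE xp.
  have [Mx _ _] := gd.2 _ xp.
  apply: continuous_comp; last exact: norm_continuous.
  apply: (@continuous_comp _ _ _ (fun z => y - F z) (mulmxr B)).
    apply: differentiable_continuous.
    by apply: differentiableB => //; exact: dF.
  exact: continuous_mulmxr.
rewrite inE => /AE x0p x0min.
have psi0 : psi x0 = 0.
  apply/eqP; rewrite eq_le normr_ge0 andbT leNgt; apply/negP => psi_gt0.
  have Tx0 := inT _ x0p; have Tx0' := ltW Tx0.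
  have /x0min : T x0 \in A by rewrite inE; apply/AE.
  rewrite leNgt => /negP; apply; rewrite /psi -TE.
  rewrite (le_lt_trans (TT _ _ Tx0' x0p))// TE -/(psi x0).
  by rewrite gtr_pMl// invf_lt1// ltr1n.
exists x0.
  have -> : x0 = T x0; last exact: inT.
  by apply/esym/eqP; rewrite -subr_eq0 TE -normr_eq0; apply/eqP.
apply/esym/eqP; rewrite -subr_eq0; apply/eqP.
have : (y - F x0) *m B = 0 by apply/eqP; rewrite -normr_eq0; apply/eqP.
by move=> /(congr1 (mulmx^~ ('J F p))); rewrite /B mulmxKV// mul0mx.
Qed.

End with_radius.

(** The map [x - (F x - y) *m B] is a contraction of a closed ball; its fixed
    point is found as a point of the ball where the displacement is minimal.
    The formula for the derivative of the inverse then gives smoothness by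
    induction on the order. *)
Lemma local_inverse : exists (r : R) (G : 'rV[R]_n -> 'rV[R]_n),
  [/\ 0 < r, smooth_mx_on (ball (F p) r) G, open (G @` ball (F p) r),
      G (F p) = p & forall y, ball (F p) r y -> M (G y) /\ F (G y) = y].
Proof.
have [d gd] := good_radius; have d0 := gd.1.
have [C C0 HC] := norm_mulmx_le B.
pose r := d / (2 * C); have r0 : 0 < r by rewrite divr_gt0// mulr_gt0.
pose W := ball (F p) r.
have /choice[G HG] : forall y, exists x, W y -> `|x - p| < d /\ F x = y.
  move=> y; have [Wy|nWy] := pselect (W y); last by exists p.
  have [|x xp xy] := fixed gd (y := y); last by exists x.
  rewrite (le_lt_trans (HC _))//; move: Wy; rewrite /W -ball_normE /= distrC.
  by rewrite /r invfM mulrA ltr_pdivlMr// mulrC.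
have inj x x' : `|x - p| <= d -> `|x' - p| <= d -> F x = F x' -> x = x'.
  move=> xp xp' FE; have := apart gd xp xp'; rewrite FE subrr mul0mx normr0 mulr0.
  by rewrite normr_le0 subr_eq0 => /eqP.
have Wp : W (F p) by exact: ballxx.
have GM y : W y -> M (G y) by move=> /HG[/ltW/gd.2[]].
have oW : open W by exact: ball_open.
have dG y0 : W y0 -> differentiable G y0 /\
    forall v, 'd G y0 v = v *m invmx ('J F (G y0)).
  move=> Wy0; have [xp Fx] := HG _ Wy0; set x0 := G y0 in xp Fx *.
  have [Mx0 ux0 _] := gd.2 _ (ltW xp).
  set D := invmx _; have cD : continuous (mulmxr D : 'rV[R]_n -> 'rV[R]_n).
    exact: continuous_mulmxr.
  have E : G \o shift y0 = cst (G y0) + mulmxr D +o_ 0 id.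
    apply/eqaddoP => e e0; have [C' C'0 HC'] := norm_mulmx_le D.
    pose e' := e / (C' * (2 * C)).
    have e'0 : 0 < e' by rewrite divr_gt0// !mulr_gt0.
    have /= := diff_locally (dF Mx0) => /eqaddoP/(_ _ e'0)/nbhs_ballP[s /= s0 Hs].
    have nW : \forall h \near (0 : 'rV[R]_n), W (h + y0).
      have : \forall y \near y0, W y by exact: open_nbhs_nbhs.
      by rewrite (near_shift 0 y0); apply: filterS => h /=; rewrite subr0.
    have ns : \forall h \near (0 : 'rV[R]_n), `|h| < s / (2 * C).
      apply/nbhs_ballP; exists (s / (2 * C)); first by rewrite /= divr_gt0// mulr_gt0.
      by move=> h; rewrite -ball_normE /= sub0r normrN.
    apply: filterS2 nW ns => h Wh hs.
    rewrite -[(G \o _ - _) h]/(G (h + y0) - (G y0 + h *m D)) -/x0.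
    have [xh Fh] := HG _ Wh.
    pose k := G (h + y0) - x0.
    have kh : `|k| <= 2 * (C * `|h|).
      apply: le_trans (apart gd (ltW xh) (ltW xp)) _.
      by rewrite (ler_pM2l (ltr0n _ 2)) Fh Fx addrK; exact: HC.
    have ks : `|k| < s.
      rewrite (le_lt_trans kh)//; move: hs; rewrite ltr_pdivlMr ?mulr_gt0//.
      by rewrite mulrC mulrA.
    have := Hs k; rewrite -ball_normE /= sub0r normrN => /(_ ks).
    rewrite -[(F \o _ - _) k]/(F (k + x0) - (F x0 + 'd F x0 k)).
    rewrite {1}/k subrK Fh Fx.
    have -> : 'd F x0 k = k *m 'J F x0 by rewrite /jacobian mul_rV_lin1.
    move=> Hk; have -> : G (h + y0) - (x0 + h *m D)
        = - ((h + y0 - (y0 + k *m 'J F x0)) *m D).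
      rewrite opprD addrA -/k opprD addrA addrK mulmxBl mulmxK// opprB.
      by [].
    rewrite normrN (le_trans (HC' _))//.
    apply: (@le_trans _ _ (C' * (e' * (2 * (C * `|h|))))).
      by rewrite ler_pM2l// (le_trans Hk)// ler_pM2l.
    rewrite le_eqVlt; apply/orP; left; apply/eqP.
    rewrite /e'; move: `|h| => t /=.
    by field; rewrite !gt_eqF.
  have dE := diff_unique cD E; split; last first.
    by move=> v; exact: (congr1 (fun f : 'rV[R]_n -> 'rV[R]_n => f v) dE).
  by apply/diff_locallyP; rewrite dE; split.
have pG y i j : W y -> partial i (fun z => G z 0 j) y = (invmx ('J F (G y))) i j.
  move=> Wy; have [dy dE] := dG _ Wy.
  have -> : partial i (fun z => G z 0 j) y = ('J G y) i j.
    by rewrite (jacobianE i j dy).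
  rewrite /jacobian /lin1_mx [LHS]mxE.
  apply: (etrans (congr1 (fun m : 'rV[R]_n => m 0 j) (dE (delta_mx 0 i)))).
  by rewrite -rowE [LHS]mxE.
have dGj y j : W y -> differentiable (fun z => G z 0 j) y.
  move=> Wy; have [dy _] := dG _ Wy.
  by apply: (@differentiable_comp _ _ _ _ G (fun z => z 0 j)) => //; exact: differentiable_coord.
exists r, G; split=> //.
- move=> i j; rewrite ord1; apply/smooth_uptoP => k.
  elim: k j => [|k IH] j; (split=> [y Wy|]; first exact: dGj) => //.
  move=> i'; pose V := ball p d.
  have oV : open V by exact: ball_open.
  have VE x : V x -> `|x - p| <= d by rewrite /V -ball_normE /= distrC => /ltW.
  have sJ : smooth_mx_on V (fun x => 'J F x).
    apply: (smooth_jacobian oV) => i1 j1.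
    by apply: smooth_on_sub (sF i1 j1) => x /VE/gd.2[].
  have uV x : V x -> 'J F x \in unitmx by move=> /VE/gd.2[].
  have sV := smooth_invmx oV sJ uV i' j.
  have : smooth_upto k W (fun y => (invmx ('J F (G y))) i' j).
    apply: (@smooth_upto_comp _ _ _ k W V G (fun x => (invmx ('J F x)) i' j)) => //.
      by move=> y /HG[]; rewrite /V -ball_normE /= distrC.
    by move/smooth_uptoP: sV; apply.
  by apply: eq_smooth_upto => // y Wy; rewrite pG.
- have -> : G @` W = [set x | ball p d x /\ W (F x)].
    apply/seteqP; split=> [x [y Wy <-]|x [xp Wx]] /=.
      by have [xp ->] := HG _ Wy; split=> //; rewrite -ball_normE /= distrC.
    exists (F x) => //; have [xp' FE] := HG _ Wx; apply: inj => //.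
      exact: ltW.
    by move: xp; rewrite -ball_normE /= distrC => /ltW.
  rewrite openE => x [xp Wx].
  have n1 : \forall z \near x, ball p d z by apply: open_nbhs_nbhs; split=> //; exact: ball_open.
  have Mx : M x.
    by have [] := gd.2 x _ => //; move: xp; rewrite -ball_normE /= distrC => /ltW.
  have n2 : \forall z \near x, W (F z).
    have cF := differentiable_continuous (dF Mx).
    by apply: cF; exact: open_nbhs_nbhs.
  exact: filterI n1 n2.
- have [Gp FG] := HG _ Wp; apply: inj => //; first exact: ltW.
  by rewrite subrr normr0 ltW.
- by move=> y Wy; split; [exact: GM|have [] := HG _ Wy].
Qed.

End inverse_function.

(** * Moving frames *)

Section matrix_derivatives.
Variables (R : realType) (n : nat) (U : set 'rV[R]_n).

Definition mpartial p q (i : 'I_n) (A : 'rV[R]_n -> 'M[R]_(p, q)) x : 'M[R]_(p, q) :=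
  \matrix_(k, l) partial i (fun y => A y k l) x.

Lemma smooth_mx_diff p q (A : 'rV[R]_n -> 'M[R]_(p, q)) k l x :
  smooth_mx_on U A -> U x -> differentiable (fun y => A y k l) x.
Proof. by move=> sA; exact: smooth_on_diff (sA k l). Qed.

Lemma smooth_mpartial p q i (A : 'rV[R]_n -> 'M[R]_(p, q)) :
  open U -> smooth_mx_on U A -> smooth_mx_on U (mpartial i A).
Proof.
move=> oU sA k l; apply: eq_smooth_on (smooth_on_partial i (sA k l)) => // x _.
by rewrite mxE.
Qed.

Lemma eq_on_mpartial p q i (A A' : 'rV[R]_n -> 'M[R]_(p, q)) x :
  open U -> (forall y, U y -> A y = A' y) -> U x -> mpartial i A x = mpartial i A' x.
Proof.
move=> oU AA Ux; apply/matrixP => k l; rewrite !mxE.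
by apply: (eq_on_partial _ oU Ux) => y Uy; rewrite AA.
Qed.

Lemma mpartialD p q i (A A' : 'rV[R]_n -> 'M[R]_(p, q)) x :
  smooth_mx_on U A -> smooth_mx_on U A' -> U x ->
  mpartial i (fun y => A y + A' y) x = mpartial i A x + mpartial i A' x.
Proof.
move=> sA sA' Ux; apply/matrixP => k l; rewrite !mxE.
rewrite (_ : (fun y => _) = (fun y => A y k l + A' y k l)).
  by apply: partialD; exact: smooth_mx_diff Ux.
by apply/funext => y; rewrite mxE.
Qed.

Lemma mpartialM p q r i (A : 'rV[R]_n -> 'M[R]_(p, q)) (A' : 'rV[R]_n -> 'M[R]_(q, r)) x :
  smooth_mx_on U A -> smooth_mx_on U A' -> U x ->
  mpartial i (fun y => A y *m A' y) x = mpartial i A x *m A' x + A x *m mpartial i A' x.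
Proof.
move=> sA sA' Ux; apply/matrixP => k l; rewrite !mxE -big_split /=.
rewrite (_ : (fun y => _) = (fun y => \sum_j A y k j * A' y j l)); last first.
  by apply/funext => y; rewrite mxE.
have dA j : differentiable (fun y => A y k j) x by exact: smooth_mx_diff Ux.
have dA' j : differentiable (fun y => A' y j l) x by exact: smooth_mx_diff Ux.
rewrite partial_sum => [|j].
  by apply: eq_bigr => j _; rewrite !mxE partialM.
by apply: (@differentiableM _ _ (fun y => A y k j) (fun y => A' y j l)).
Qed.

Lemma mpartial_tr p q i (A : 'rV[R]_n -> 'M[R]_(p, q)) x :
  mpartial i (fun y => (A y)^T) x = (mpartial i A x)^T.
Proof.
apply/matrixP => k l; rewrite !mxE; congr (partial i _ x).
by apply/funext => y; rewrite mxE.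
Qed.

Lemma mpartialC p q i j (A : 'rV[R]_n -> 'M[R]_(p, q)) x :
  open U -> smooth_mx_on U A -> U x ->
  mpartial i (mpartial j A) x = mpartial j (mpartial i A) x.
Proof.
move=> oU sA Ux; apply/matrixP => k l.
have E j' : (fun y => mpartial j' A y k l) = partial j' (fun y => A y k l).
  by apply/funext => y; rewrite mxE.
by rewrite [LHS]mxE [RHS]mxE (E i) (E j); exact: (partialC oU (sA k l) Ux i j).
Qed.

End matrix_derivatives.

Section frames.
Variables (R : realType) (n : nat) (U : set 'rV[R]_n).
Hypothesis oU : open U.
Implicit Types (Q : 'rV[R]_n -> 'M[R]_n) (G : connection R n) (th : 'rV[R]_n -> 'rV[R]_n).
Implicit Types (om : 'I_n -> 'rV[R]_n -> 'M[R]_n).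

Definition conn_mx G (i : 'I_n) x : 'M[R]_n := \matrix_(k, l) G l i k x.

Definition curv_mx G (i j : 'I_n) x : 'M[R]_n := \matrix_(k, l) riemann G l i j k x.

Definition gram Q x : 'M[R]_n := Q x *m (Q x)^T.

Lemma gram_sym Q x : (gram Q x)^T = gram Q x.
Proof. by rewrite /gram trmx_mul trmxK. Qed.

Lemma gram_unit Q x : Q x \in unitmx -> gram Q x \in unitmx.
Proof. by move=> uQ; rewrite unitmx_mul unitmx_tr uQ. Qed.

Lemma smooth_gram Q : smooth_mx_on U Q -> smooth_mx_on U (gram Q).
Proof. by move=> sQ; apply: smooth_mx_mul => //; exact: smooth_mx_tr. Qed.

(** Compatibility of the connection forms [om] with the inner product for which
    the coframe is orthonormal; the trace part comes from the weight 2. *)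
Definition skew_upto th om := forall x, U x -> forall i,
  om i x + (om i x)^T = (2 * th x 0 i)%:M.

Definition torsion_free Q om := forall x, U x -> forall i k a,
  mpartial i Q x k a + (Q x *m om i x) k a = mpartial k Q x i a + (Q x *m om k x) i a.

(** Both conditions on [om] are the frame versions of those which characterise
    [weyl_conn] in lemma [weyl_connP]. *)
Lemma weyl_conn_frame Q th om : smooth_mx_on U Q ->
  (forall x, U x -> Q x \in unitmx) -> skew_upto th om -> torsion_free Q om ->
  forall x, U x -> forall i,
    conn_mx (weyl_conn (gram Q) th) i x *m Q x = mpartial i Q x + Q x *m om i x.
Proof.
move=> sQ uQ skO tfO.
pose G : connection R n := fun l i k x =>
  ((mpartial i Q x + Q x *m om i x) *m invmx (Q x)) k l.
have hU x : U x -> (gram Q x)^T = gram Q x /\ gram Q x \in unitmx.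
  by move=> Ux; split; [exact: gram_sym|apply: gram_unit; exact: uQ].
have GQ i x : U x -> conn_mx G i x *m Q x = mpartial i Q x + Q x *m om i x.
  move=> Ux; rewrite (_ : conn_mx G i x = (mpartial i Q x + Q x *m om i x) *m invmx (Q x)).
    by rewrite mulmxKV// uQ.
  by apply/matrixP => k l; rewrite mxE.
have /(weyl_connP th G oU hU) GE : forall x, U x ->
     (forall l i j, G l i j x = G l j i x) /\
     forall k i j, weyl_deriv 2 th k (fun y => gram Q y i j) x
       = \sum_(l < n) (G l k i x * gram Q x l j + G l k j x * gram Q x i l).
  move=> x Ux; split=> [l i j|k i j].
    rewrite /G [LHS]mxE [RHS]mxE; apply: eq_bigr => a _; congr (_ * _).
    by rewrite [LHS]mxE [RHS]mxE tfO.
  have -> : \sum_(l < n) (G l k i x * gram Q x l j + G l k j x * gram Q x i l)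
      = (conn_mx G k x *m gram Q x + (conn_mx G k x *m gram Q x)^T) i j.
    rewrite [RHS]mxE [X in _ = _ + X]mxE ![(_ *m gram _ _) _ _]mxE -big_split /=.
    apply: eq_bigr => l _; rewrite ![conn_mx _ _ _ _ _]mxE; congr (_ + _ * _).
    by rewrite -[in LHS](gram_sym Q) mxE.
  have -> : conn_mx G k x *m gram Q x + (conn_mx G k x *m gram Q x)^T
      = mpartial k (gram Q) x + (2 * th x 0 k) *: gram Q x.
    rewrite /gram mulmxA GQ// (mpartialM k sQ (smooth_mx_tr oU sQ) Ux).
    rewrite mpartial_tr.
    rewrite mulmxDl linearD /= !trmx_mul trmxK addrACA mulmxA.
    by rewrite -mulmxDl -mulmxDr skO// mul_mx_scalar scalemxAl.
  by rewrite /weyl_deriv !mxE.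
move=> x Ux i; rewrite -GQ//; congr (_ *m _); apply/matrixP => k l.
by rewrite !mxE GE.
Qed.

(** The connection form in the frame [Q], obtained by solving
    [conn_mx Q = d Q + Q om]. *)
Definition frame_coef Q G i x : 'M[R]_n :=
  invmx (Q x) *m (conn_mx G i x *m Q x - mpartial i Q x).

Lemma frame_coefE Q G i x : Q x \in unitmx ->
  conn_mx G i x *m Q x = mpartial i Q x + Q x *m frame_coef Q G i x.
Proof. by move=> uQ; rewrite mulKVmx// addrC subrK. Qed.

Lemma weyl_frame_coef Q th : smooth_mx_on U Q ->
  (forall x, U x -> Q x \in unitmx) ->
  let om := frame_coef Q (weyl_conn (gram Q) th) in
  skew_upto th om /\ torsion_free Q om.
Proof.
move=> sQ uQ om.
have hU x : U x -> (gram Q x)^T = gram Q x /\ gram Q x \in unitmx.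
  by move=> Ux; split; [exact: gram_sym|apply: gram_unit; exact: uQ].
pose G := weyl_conn (gram Q) th.
have GE : forall x, U x -> forall l i j, G l i j x = weyl_conn (gram Q) th l i j x by [].
have H := (weyl_connP th G oU hU).2 GE.
have omE x i : U x -> conn_mx G i x *m Q x = mpartial i Q x + Q x *m om i x.
  by move=> Ux; exact: frame_coefE (uQ _ Ux).
split=> x Ux.
  move=> k; have [_ dh] := H x Ux.
  have E : mpartial k (gram Q) x + (2 * th x 0 k) *: gram Q x
      = conn_mx G k x *m gram Q x + (conn_mx G k x *m gram Q x)^T.
    apply/matrixP => i j; rewrite [LHS]mxE [mpartial _ _ _ _ _]mxE [X in _ + X]mxE.
    have := dh k i j; rewrite /weyl_deriv => ->.
    rewrite [RHS]mxE [X in _ = _ + X]mxE ![(_ *m gram _ _) _ _]mxE -big_split /=.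
    apply: eq_bigr => l _; rewrite ![conn_mx _ _ _ _ _]mxE; congr (_ + _ * _).
    by rewrite -[in LHS](gram_sym Q) mxE.
  have {}E : Q x *m (om k x + (om k x)^T) *m (Q x)^T = Q x *m (2 * th x 0 k)%:M *m (Q x)^T.
    move: E; rewrite /gram mulmxA omE// (mpartialM k sQ (smooth_mx_tr oU sQ) Ux).
    rewrite mpartial_tr.
    rewrite mulmxDl linearD /= !trmx_mul trmxK addrACA mulmxA.
    by rewrite -mulmxDl -mulmxDr mul_mx_scalar -scalemxAl => /addrI.
  move: E => /(congr1 (fun A => invmx (Q x) *m A *m invmx (Q x)^T)).
  by rewrite !mulmxA mulVmx ?uQ// !mul1mx !mulmxK// unitmx_tr uQ.
move=> i k a; have [sG _] := H x Ux.
have := omE x i Ux => /matrixP/(_ k a); rewrite [RHS]mxE => <-.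
have := omE x k Ux => /matrixP/(_ i a); rewrite [RHS]mxE => <-.
by rewrite !mxE; apply: eq_bigr => b _; rewrite !mxE sG.
Qed.

(** Differentiate [d Q = conn_mx Q - Q om] once more: second derivatives of [Q]
    are symmetric, and the curvature becomes [d om + om /\ om], with signs due
    to matrices acting on the right. *)
Lemma curvature_frame Q G om : smooth_mx_on U Q -> (forall i, smooth_mx_on U (om i)) ->
  (forall x, U x -> Q x \in unitmx) ->
  (forall x, U x -> forall i, conn_mx G i x *m Q x = mpartial i Q x + Q x *m om i x) ->
  forall x, U x -> forall i j,
    curv_mx G i j x *m Q x
    = Q x *m (mpartial i (om j) x - mpartial j (om i) x
              + om j x *m om i x - om i x *m om j x).
Proof.
move=> sQ sO uQ GQ.
have sG i : smooth_mx_on U (conn_mx G i).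
  have s1 : smooth_mx_on U (fun x => (mpartial i Q x + Q x *m om i x) *m invmx (Q x)).
    apply: smooth_mx_mul => //; last exact: smooth_invmx.
    by apply: smooth_mxD => //; [exact: smooth_mpartial|exact: smooth_mx_mul].
  move=> k l; apply: eq_smooth_on (s1 k l) => // x Ux.
  by rewrite -GQ// mulmxK ?uQ.
move=> x Ux.
have D i j : mpartial i (conn_mx G j) x *m Q x + conn_mx G j x *m mpartial i Q x
    = mpartial i (mpartial j Q) x + (mpartial i Q x *m om j x + Q x *m mpartial i (om j) x).
  rewrite -(mpartialM i (sG j) sQ Ux) -(mpartialM i sQ (sO j) Ux).
  rewrite -(mpartialD i (smooth_mpartial j oU sQ) (smooth_mx_mul oU sQ (sO j)) Ux).
  by apply: (eq_on_mpartial i oU _ Ux) => y Uy; exact: GQ.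
have dQ i : mpartial i Q x = conn_mx G i x *m Q x - Q x *m om i x by rewrite GQ// addrK.
move=> i j.
have -> : curv_mx G i j x = mpartial i (conn_mx G j) x - mpartial j (conn_mx G i) x
    + conn_mx G j x *m conn_mx G i x - conn_mx G i x *m conn_mx G j x.
  apply/matrixP => k l; rewrite /riemann !mxE /riemann.
  have E i' j' : partial i' (fun y => conn_mx G j' y k l) x = partial i' (G l j' k) x.
    by congr (partial i' _ x); apply/funext => y; rewrite mxE.
  rewrite !E -addrA; congr (_ + _); rewrite -sumrB; apply: eq_bigr => m _.
  by rewrite !mxE; congr (_ - _); exact: mulrC.
have := D j i; have := D i j; rewrite (mpartialC i j oU sQ Ux).
rewrite (dQ i) (dQ j); move: (mpartial i (conn_mx G j) x) (mpartial j (conn_mx G i) x).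
move: (mpartial j (mpartial i Q) x) (mpartial i (om j) x) (mpartial j (om i) x).
move: (conn_mx G i x) (conn_mx G j x) (om i x) (om j x) (Q x) => Gi Gj oi oj q dd doj doi dGj dGi.
rewrite !(mulmxBr, mulmxBl, mulmxDl, mulmxDr, mulNmx, mulmxN) !mulmxA.
move: (dGj *m q) (dGi *m q) (Gj *m Gi *m q) (Gi *m Gj *m q) (Gj *m q *m oi) (Gi *m q *m oj).
move: (q *m oi *m oj) (q *m oj *m oi) (q *m doj) (q *m doi).
move=> A1 A2 A3 A4 A5 A6 A7 A8 A9 A10 /matrixP E1 /matrixP E2; apply/matrixP => a b.
have := E1 a b; have := E2 a b; rewrite !mxE.
move: (A1 a b) (A2 a b) (A3 a b) (A4 a b) (A5 a b) (A6 a b) (A7 a b) (A8 a b) (A9 a b) (A10 a b) (dd a b).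
by move=> {}A1 {}A2 {}A3 {}A4 {}A5 {}A6 {}A7 {}A8 {}A9 {}A10 {}dd {}E1 {}E2; lra.
Qed.

End frames.

(** * Differential forms, pull-backs and changes of scale *)

(** The sealed definition keeps rewriting from looking inside products of
    1-forms. *)
Definition wedge (R : realType) (n : nat) (a b : 'rV[R]_n) : 'M[R]_n :=
  locked (a^T *m b - b^T *m a).

Section forms.
Variables (R : realType) (n : nat).
Implicit Types (f : 'rV[R]_n -> R) (a b : 'rV[R]_n -> 'rV[R]_n).
Implicit Types (U : set 'rV[R]_n).

Lemma wedgeE (a b : 'rV[R]_n) i j : wedge a b i j = a 0 i * b 0 j - a 0 j * b 0 i.
Proof.
by rewrite /wedge -lock !mxE !big_ord1 !mxE [b 0 i * _]mulrC.
Qed.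

Lemma faradayE a x i j : faraday a x i j
  = partial i (fun y => a y 0 j) x - partial j (fun y => a y 0 i) x.
Proof. by rewrite mxE. Qed.

Lemma faraday_anti a x i j : faraday a x j i = - faraday a x i j.
Proof. by rewrite !faradayE opprB. Qed.

Lemma faraday_tr a x : (faraday a x)^T = - faraday a x.
Proof. by apply/matrixP => i j; rewrite !mxE opprB. Qed.

Lemma eq_on_faraday U a b x : open U -> (forall y, U y -> a y = b y) -> U x ->
  faraday a x = faraday b x.
Proof.
move=> oU ab Ux; apply/matrixP => i j; rewrite !faradayE; congr (_ - _);
  by apply: (eq_on_partial _ oU Ux) => y Uy; rewrite ab.
Qed.

Lemma eq_on_differential U f g x : open U -> (forall y, U y -> f y = g y) -> U x ->
  differential f x = differential g x.
Proof.
move=> oU fg Ux; apply/rowP => i; rewrite !mxE.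
by apply: (eq_on_partial _ oU Ux) => y Uy; rewrite fg.
Qed.

Lemma faraday_differential U f x : open U -> smooth_on U f -> U x ->
  faraday (differential f) x = 0.
Proof.
move=> oU sf Ux; apply/matrixP => i j; rewrite faradayE mxE.
have E k : (fun y => differential f y 0 k) = partial k f.
  by apply/funext => y; rewrite mxE.
by rewrite !E (partialC oU sf Ux i j) subrr.
Qed.

Lemma faradayD U a b x : smooth_mx_on U a -> smooth_mx_on U b -> U x ->
  faraday (fun y => a y + b y) x = faraday a x + faraday b x.
Proof.
move=> sa sb Ux; apply/matrixP => i j; rewrite [RHS]mxE !faradayE.
have E k l : partial k (fun y => (a y + b y) 0 l) x
    = partial k (fun y => a y 0 l) x + partial k (fun y => b y 0 l) x.
  rewrite -partialD; [|exact: smooth_mx_diff sa Ux|exact: smooth_mx_diff sb Ux].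
  by congr (partial k _ x); apply/funext => y; rewrite mxE.
by rewrite !E opprD addrACA.
Qed.

Lemma faradayZ U f a x : smooth_on U f -> smooth_mx_on U a -> U x ->
  faraday (fun y => f y *: a y) x = wedge (differential f x) (a x) + f x *: faraday a x.
Proof.
move=> sf sa Ux; apply/matrixP => i j; rewrite [RHS]mxE wedgeE [X in _ + X]mxE !faradayE.
rewrite ![differential _ _ _ _]mxE.
have E k l : partial k (fun y => (f y *: a y) 0 l) x
    = partial k f x * a x 0 l + f x * partial k (fun y => a y 0 l) x.
  rewrite -(@partialM _ _ f (fun y => a y 0 l)); [|exact: smooth_on_diff sf Ux|exact: smooth_mx_diff sa Ux].
  by congr (partial k _ x); apply/funext => y; rewrite mxE.
rewrite !E; move: (partial _ _ _) (partial _ _ _) (f x) (a x 0 i) (a x 0 j).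
move: (partial _ _ _) (partial _ _ _) => p1 p2 p3 p4 fx ai aj.
by ring.
Qed.

Lemma faradayN U a x : smooth_mx_on U a -> U x ->
  faraday (fun y => - a y) x = - faraday a x.
Proof.
move=> sa Ux; apply/matrixP => i j; rewrite [RHS]mxE !faradayE.
have E k l : partial k (fun y => (- a y) 0 l) x = - partial k (fun y => a y 0 l) x.
  rewrite -partialN; last exact: smooth_mx_diff sa Ux.
  by congr (partial k _ x); apply/funext => y; rewrite mxE.
by rewrite !E opprB opprK addrC.
Qed.

Lemma faradayB U a b x : open U -> smooth_mx_on U a -> smooth_mx_on U b -> U x ->
  faraday (fun y => a y - b y) x = faraday a x - faraday b x.
Proof.
move=> oU sa sb Ux; rewrite (faradayD sa _ Ux) ?(faradayN sb)//.
by move=> i j; apply: eq_smooth_on (smooth_onN oU (sb i j)) => // y _; rewrite mxE.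
Qed.

Lemma differentialM U f g x : smooth_on U f -> smooth_on U g -> U x ->
  differential (fun y => f y * g y) x = g x *: differential f x + f x *: differential g x.
Proof.
move=> sf sg Ux; apply/rowP => i; rewrite !mxE.
rewrite (@partialM _ _ f g); [|exact: smooth_on_diff sf Ux|exact: smooth_on_diff sg Ux].
by rewrite mulrC.
Qed.

Lemma differentialD U f g x : smooth_on U f -> smooth_on U g -> U x ->
  differential (fun y => f y + g y) x = differential f x + differential g x.
Proof.
move=> sf sg Ux; apply/rowP => i; rewrite !mxE.
by rewrite (@partialD _ _ f g); [|exact: smooth_on_diff sf Ux|exact: smooth_on_diff sg Ux].
Qed.

Lemma differentialV U f x : smooth_on U f -> f x != 0 -> U x ->
  differential (fun y => (f y)^-1) x = - (f x) ^- 2 *: differential f x.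
Proof.
move=> sf f0 Ux; apply/rowP => i; rewrite !mxE partialV//.
exact: smooth_on_diff sf Ux.
Qed.

Lemma derive_differential U f v x : smooth_on U f -> U x ->
  'D_v f x = (v *m (differential f x)^T) 0 0.
Proof.
move=> sf Ux; rewrite derive_partial; last exact: smooth_on_diff sf Ux.
by rewrite mxE; apply: eq_bigr => i _; rewrite !mxE.
Qed.

End forms.

Section pull_back.
Variables (R : realType) (n m : nat) (F : 'rV[R]_n -> 'rV[R]_m).
Variables (U : set 'rV[R]_n) (V : set 'rV[R]_m).
Implicit Types (a b : 'rV[R]_m -> 'rV[R]_m).

Definition pull a (x : 'rV[R]_n) : 'rV[R]_n := a (F x) *m ('J F x)^T.

Hypotheses (oU : open U) (sF : smooth_mx_on U F) (UV : forall x, U x -> V (F x)).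

Lemma smooth_row_diff x : U x -> differentiable F x.
Proof. by move=> Ux; apply: differentiable_row => k; exact: smooth_on_diff Ux. Qed.

Lemma differential_pull f x : smooth_on V f -> U x ->
  differential (fun y => f (F y)) x = differential f (F x) *m ('J F x)^T.
Proof.
move=> sf Ux; apply/rowP => i; rewrite !mxE partial_compr => [|k|]; first last.
- exact: smooth_on_diff sf (UV Ux).
- exact: smooth_mx_diff sF Ux.
apply: eq_bigr => k _; rewrite !mxE mulrC; congr (_ * _).
by rewrite -jacobianE ?mxE//; exact: smooth_row_diff.
Qed.

Lemma smooth_pull a : smooth_mx_on V a -> smooth_mx_on U (pull a).
Proof.
move=> sa; apply: smooth_mx_mul => // [i j|].
  by apply: (@smooth_on_comp _ _ _ U V F (fun y => a y i j)).
by apply: smooth_mx_tr => //; exact: smooth_jacobian.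
Qed.

(** The chain rule gives a term in the second derivatives of [F], which is
    symmetric and drops out. *)
Lemma faraday_pull a x : smooth_mx_on V a -> U x ->
  faraday (pull a) x = 'J F x *m faraday a (F x) *m ('J F x)^T.
Proof.
move=> sa Ux; have VFx := UV Ux.
have dF k y : U y -> differentiable (fun z => F z 0 k) y.
  by move=> Uy; exact: smooth_mx_diff sF Uy.
have da k l : differentiable (fun y => partial l (fun z => F z 0 k) y) x.
  exact: smooth_on_diff (smooth_on_partial l (sF 0 k)) Ux.
have dc k : differentiable (fun y => a (F y) 0 k) x.
  apply: (@differentiable_compr _ _ _ F (fun z => a z 0 k)) => [l|]; first exact: dF.
  exact: smooth_mx_diff sa VFx.
have D i j : partial i (fun y => pull a y 0 j) x
    = \sum_k (partial i (fun y => a (F y) 0 k) x * partial j (fun z => F z 0 k) x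
              + a (F x) 0 k * partial i (partial j (fun z => F z 0 k)) x).
  rewrite (@eq_on_partial _ _ U _
      (fun y => \sum_k a (F y) 0 k * partial j (fun z => F z 0 k) y))//; last first.
    move=> y Uy; rewrite mxE; apply: eq_bigr => k _; rewrite mxE jacobianE//.
    exact: smooth_row_diff.
  rewrite partial_sum => [|k]; last first.
    by apply: (@differentiableM _ _ (fun y => a (F y) 0 k)).
  apply: eq_bigr => k _.
  by rewrite (@partialM _ _ (fun y => a (F y) 0 k) (partial j (fun z => F z 0 k))).
have C i k : partial i (fun y => a (F y) 0 k) x
    = \sum_l partial i (fun z => F z 0 l) x * partial l (fun y => a y 0 k) (F x).
  rewrite (@partial_compr _ _ _ F (fun z => a z 0 k))// => [l|]; first exact: dF.
  exact: smooth_mx_diff sa VFx.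
have J i k : 'J F x i k = partial i (fun z => F z 0 k) x.
  by rewrite jacobianE//; exact: smooth_row_diff.
apply/matrixP => i j; rewrite faradayE !D -sumrB.
transitivity (\sum_k \sum_l 'J F x i l * partial l (fun y => a y 0 k) (F x) * 'J F x j k
  - \sum_k \sum_l 'J F x j l * partial l (fun y => a y 0 k) (F x) * 'J F x i k).
  rewrite -sumrB; apply: eq_bigr => k _.
  rewrite (partialC oU (sF 0 k) Ux i j) (C i k) (C j k) opprD addrACA subrr addr0 !mulr_suml.
  by congr (_ - _); apply: eq_bigr => l _; rewrite !J.
rewrite [X in _ - X]exchange_big -sumrB /= [RHS]mxE; apply: eq_bigr => k _.
rewrite -sumrB [X in _ = X * _]mxE mulr_suml; apply: eq_bigr => l _.
rewrite faradayE [('J F x)^T k j]mxE.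
move: ('J F x) (partial l _ _) (partial k _ _) => JF p1 p2; ring.
Qed.

End pull_back.

Section gauge.
Variables (R : realType) (n : nat) (U : set 'rV[R]_n).
Implicit Types (h : 'rV[R]_n -> 'M[R]_n) (th : 'rV[R]_n -> 'rV[R]_n) (G : connection R n).

Lemma eq_on_weyl_conn h h' th th' l i j x : open U ->
  (forall y, U y -> h y = h' y) -> (forall y, U y -> th y = th' y) -> U x ->
  weyl_conn h th l i j x = weyl_conn h' th' l i j x.
Proof.
move=> oU hh tt Ux; rewrite /weyl_conn; congr (_ * _); apply: eq_bigr => m _.
have E k p q : weyl_deriv 2 th k (fun y => h y p q) x
    = weyl_deriv 2 th' k (fun y => h' y p q) x.
  rewrite /weyl_deriv hh// tt//; congr (_ + _).
  by apply: (eq_on_partial _ oU Ux) => y Uy; rewrite hh.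
by rewrite hh// !E.
Qed.

Lemma eq_on_riemann G G' (l i j k : 'I_n) x : open U ->
  (forall y, U y -> forall l i j, G l i j y = G' l i j y) -> U x ->
  riemann G l i j k x = riemann G' l i j k x.
Proof.
move=> oU1 GG Ux; rewrite /riemann; congr (_ - _ + _).
- by apply: (eq_on_partial _ oU1 Ux) => y Uy; rewrite GG.
- by apply: (eq_on_partial _ oU1 Ux) => y Uy; rewrite GG.
- by apply: eq_bigr => m0 _; rewrite !GG.
Qed.

(** The weight 2 derivative of [r ^+ 2 *: h] is [r ^+ 2] times that of [h], since
    the derivative of the scale is compensated by the change of the 1-form. *)
Lemma weyl_conn_gauge (r : 'rV[R]_n -> R) h th l i j x :
  smooth_on U r -> smooth_mx_on U h -> U x -> r x != 0 -> h x \in unitmx ->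
  weyl_conn (fun y => r y ^+ 2 *: h y)
    (fun y => th y - (r y)^-1 *: differential r y) l i j x = weyl_conn h th l i j x.
Proof.
move=> sr sh Ux r0 uh; rewrite /weyl_conn; congr (_ * _); apply: eq_bigr => m0 _.
have E k p q : weyl_deriv 2 (fun y => th y - (r y)^-1 *: differential r y) k
    (fun y => (r y ^+ 2 *: h y) p q) x = r x ^+ 2 * weyl_deriv 2 th k (fun y => h y p q) x.
  have dr := smooth_on_diff sr Ux.
  have dh : differentiable (fun y => h y p q) x by exact: smooth_mx_diff sh Ux.
  rewrite /weyl_deriv.
  have -> : partial k (fun y => (r y ^+ 2 *: h y) p q) x
      = (partial k r x * r x + r x * partial k r x) * h x p q
        + r x ^+ 2 * partial k (fun y => h y p q) x.
    rewrite -(@partialM _ _ r r)//.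
    rewrite -(@partialM _ _ (fun y => r y * r y) (fun y => h y p q))//; last first.
      by apply: (@differentiableM _ _ r r).
    by congr (partial k _ x); apply/funext => y; rewrite mxE expr2.
  rewrite !mxE; move: r0; move: (partial k r x) (partial k _ x) (h x p q) (th x 0 k) (r x).
  by move=> dr' dh' hx tx rx r0; field.
have uI : invmx (r x ^+ 2 *: h x) = (r x ^+ 2)^-1 *: invmx (h x).
  by rewrite invmxZ ?unitmxZ// unitfE expf_neq0.
rewrite uI [((r x ^+ 2)^-1 *: invmx (h x)) l m0]mxE /= (E i m0 j) (E j i m0) (E m0 i j).
rewrite -mulrDr -mulrBr.
by rewrite mulrACA mulVf ?mul1r// expf_neq0.
Qed.

End gauge.

(** * Smooth orthonormal coframes *)

Section cholesky.
Variables (R : realType) (n : nat) (U : set 'rV[R]_n).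
Hypothesis oU : open U.

(** Evaluate the form on vectors that complete the square. *)
Lemma schur_complement p (a : R) (b : 'cV[R]_p) (d : 'M[R]_p) :
  posdef (block_mx a%:M b^T b d : 'M[R]_(1 + p)) ->
  0 < a /\ posdef (d - a^-1 *: (b *m b^T)).
Proof.
move=> pA; have a0 : 0 < a.
  have := pA (row_mx 1%:M 0); rewrite mul_row_block !mul1mx !mul0mx !addr0.
  rewrite tr_row_mx mul_row_col !trmx0 mulmx0 addr0 trmx1 mulmx1 mxE eqxx mulr1n; apply.
  apply/eqP => /matrixP/(_ 0 (lshift p 0)); rewrite row_mxEl !mxE eqxx /=.
  by move/eqP; rewrite oner_eq0.
split=> // v v0; pose t : 'M[R]_1 := - a^-1 *: (v *m b).
have := pA (row_mx t v); rewrite mul_row_block tr_row_mx mul_row_col.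
have -> : t *m a%:M + v *m b = 0.
  by rewrite mul_mx_scalar scalerA mulrN mulfV ?gt_eqF// scaleN1r addNr.
rewrite mul0mx add0r => H.
have -> : v *m (d - a^-1 *: (b *m b^T)) *m v^T = (t *m b^T + v *m d) *m v^T.
  rewrite mulmxBr -scalemxAr mulmxDl /t -!scalemxAl mulmxBl -!scalemxAl !mulmxA.
  by rewrite scaleNr addrC.
apply: H; apply/eqP => /(congr1 rsubmx); rewrite row_mxKr => v00.
by move: v0; rewrite v00 -[X in rsubmx X](@row_mx0 _ 1 1 p) row_mxKr eqxx.
Qed.

(** Induction on the size by Schur complements: all the square roots taken are
    those of positive functions. *)
Lemma smooth_cholesky p (A : 'rV[R]_n -> 'M[R]_p) : smooth_mx_on U A ->
  (forall x, U x -> (A x)^T = A x /\ posdef (A x)) ->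
  exists Q : 'rV[R]_n -> 'M[R]_p, smooth_mx_on U Q /\
    forall x, U x -> Q x *m (Q x)^T = A x /\ 0 < \det (Q x).
Proof.
elim: p A => [|p IH] A sA pA.
  exists (fun=> 1%:M); split=> [[]//|x Ux]; split; last by rewrite det1.
  by apply/matrixP => -[].
have sA' : smooth_mx_on U (fun x => A x : 'M[R]_(1 + p)) by exact: sA.
pose a x := A x (lshift p 0 : 'I_(1 + p)) (lshift p 0 : 'I_(1 + p)).
pose b x : 'cV[R]_p := dlsubmx (A x : 'M[R]_(1 + p)).
pose d x : 'M[R]_p := drsubmx (A x : 'M[R]_(1 + p)).
have AE x : U x -> A x = block_mx (a x)%:M (b x)^T (b x) (d x) :> 'M[R]_(1 + p).
  move=> Ux; have [As _] := pA x Ux.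
  rewrite -[LHS](@submxK _ 1 p 1 p); congr (block_mx _ _ _ _).
    by apply/matrixP => i j; rewrite !ord1 !mxE eqxx mulr1n.
  by apply/matrixP => i j; rewrite !mxE -[in LHS]As mxE.
have ap x : U x -> 0 < a x /\ posdef (d x - (a x)^-1 *: (b x *m (b x)^T)).
  by move=> Ux; apply: schur_complement; rewrite -AE//; exact: (pA x Ux).2.
have sa : smooth_on U a by exact: sA.
have sb : smooth_mx_on U b.
  by move=> i j; apply: eq_smooth_on (sA (rshift 1 i) (lshift p j)) => // x _; rewrite !mxE.
have sd : smooth_mx_on U d.
  by move=> i j; apply: eq_smooth_on (sA (rshift 1 i) (rshift 1 j)) => // x _; rewrite !mxE.
have a0 x : U x -> a x != 0 by move=> /ap[? _]; rewrite gt_eqF.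
have sia : smooth_on U (fun x => (a x)^-1) by exact: smooth_onV.
have [|x Ux|Q' [sQ' Q'E]] := IH (fun x => d x - (a x)^-1 *: (b x *m (b x)^T)).
- have s1 : smooth_mx_on U (fun x => (-1 * (a x)^-1) *: (b x *m (b x)^T)).
    apply: smooth_mxZ => //; first by apply: smooth_onM => //; exact: smooth_on_cst.
    by apply: smooth_mx_mul => //; exact: smooth_mx_tr.
  have := smooth_mxD oU sd s1; congr (smooth_mx_on U _).
  by apply/funext => x; rewrite mulN1r scaleNr.
- split; last exact: (ap x Ux).2.
  rewrite linearB linearZ /= trmx_mul trmxK; congr (_ - _).
  by apply/matrixP => i j; rewrite !mxE -[in LHS](pA x Ux).1 mxE.
pose r x := a x `^ 2^-1.
have r0 x : U x -> 0 < r x by move=> /ap[? _]; rewrite powR_gt0.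
have rr x : U x -> r x * r x = a x.
  move=> Ux; have [a0' _] := ap x Ux.
  by rewrite /r powR12_sqrt ?ltW// -expr2 sqr_sqrtr// ltW.
have sr : smooth_on U r by apply: smooth_on_powR => // x /ap[].
exists (fun x => block_mx (r x)%:M 0 ((r x)^-1 *: b x) (Q' x) : 'M[R]_(1 + p)).
split.
  move=> i j.
  have sz (f : 'rV[R]_n -> R) g : (forall x, f x = g x) -> smooth_on U g -> smooth_on U f.
    by move=> /funext ->.
  case: (@fintype.split_ordP 1 p i) => i' ->; case: (@fintype.split_ordP 1 p j) => j' ->.
  - by apply: sz (sr) => x; rewrite (@block_mxEul _ 1 p 1 p) !ord1 mxE eqxx mulr1n.
  - by apply: sz (@smooth_on_cst R n U 0) => x; rewrite (@block_mxEur _ 1 p 1 p) mxE.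
  - have s1 : smooth_on U (fun x => (r x)^-1 * b x i' j').
      by apply: smooth_onM => //; apply: smooth_onV => // x /r0; case: ltrgt0P.
    by apply: sz s1 => x; rewrite (@block_mxEdl _ 1 p 1 p) mxE.
  - by apply: sz (sQ' i' j') => x; rewrite (@block_mxEdr _ 1 p 1 p).
move=> x Ux; have rn : r x != 0 by rewrite gt_eqF// r0.
split; last first.
  rewrite (@det_lblock _ 1 p) det_scalar1 mulr_gt0 ?r0//; exact: (Q'E x Ux).2.
have e1 : (r x)%:M *m (r x)%:M = (a x)%:M :> 'M[R]_1 by rewrite -scalar_mxM rr.
have e2 : (r x)%:M *m ((r x)^-1 *: b x)^T = (b x)^T.
  by rewrite mul_scalar_mx linearZ /= scalerA mulfV// scale1r.
have e3 : ((r x)^-1 *: b x) *m (r x)%:M = b x.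
  by rewrite mul_mx_scalar scalerA mulfV// scale1r.
have e4 : ((r x)^-1 *: b x) *m ((r x)^-1 *: b x)^T + Q' x *m (Q' x)^T = d x.
  have [-> _] := Q'E x Ux.
  by rewrite linearZ /= -scalemxAl -scalemxAr scalerA -invfM rr// addrC subrK.
rewrite (@tr_block_mx _ 1 p 1 p) (@mulmx_block _ 1 p 1 p 1 p).
rewrite !trmx0 !mul0mx !mulmx0 !addr0 tr_scalar_mx e1 e2 e3 e4.
by rewrite [RHS]AE.
Qed.

End cholesky.

(** * Cyclic indices in dimension three *)

(** For [i : 'I_3], the triple [(i, s1 i, s2 i)] is a cyclic permutation of
    [(0, 1, 2)], so that one formula replaces the three cyclic instances. *)
Definition s1 (i : 'I_3) : 'I_3 := i + 1.
Definition s2 (i : 'I_3) : 'I_3 := i + 1 + 1.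

Lemma s1s1 i : s1 (s1 i) = s2 i. Proof. by []. Qed.
Lemma s1s2 i : s1 (s2 i) = i.
Proof. by case: i => -[|[|[|//]]] ?; exact/val_inj. Qed.
Lemma s2s1 i : s2 (s1 i) = i.
Proof. by case: i => -[|[|[|//]]] ?; exact/val_inj. Qed.
Lemma s2s2 i : s2 (s2 i) = s1 i.
Proof. by case: i => -[|[|[|//]]] ?; exact/val_inj. Qed.
Definition cycE := (s1s1, s1s2, s2s1, s2s2).

Lemma neq_s1 i : (i == s1 i) = false.
Proof. by case: i => -[|[|[|//]]] ?. Qed.
Lemma neq_s2 i : (i == s2 i) = false.
Proof. by case: i => -[|[|[|//]]] ?. Qed.
Lemma neq_s1s i : (s1 i == i) = false.
Proof. by case: i => -[|[|[|//]]] ?. Qed.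
Lemma neq_s2s i : (s2 i == i) = false.
Proof. by case: i => -[|[|[|//]]] ?. Qed.
Lemma neq_s12 i : (s1 i == s2 i) = false.
Proof. by case: i => -[|[|[|//]]] ?. Qed.
Lemma neq_s21 i : (s2 i == s1 i) = false.
Proof. by case: i => -[|[|[|//]]] ?. Qed.
Definition cyc_neq := (neq_s1, neq_s2, neq_s1s, neq_s2s, neq_s12, neq_s21).

Lemma sum_cyc (V : zmodType) (f : 'I_3 -> V) i :
  \sum_j f j = f i + f (s1 i) + f (s2 i).
Proof.
rewrite (bigD1 i)//= (bigD1 (s1 i)) ?neq_s1s//= (bigD1 (s2 i)) ?neq_s2s ?neq_s21//=.
rewrite big1 ?addr0 ?addrA// => j.
by case: i => -[|[|[|//]]] ?; case: j => -[|[|[|//]]].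
Qed.

Lemma cyc_ind (P : 'I_3 -> Prop) i : P i -> P (s1 i) -> P (s2 i) -> forall j, P j.
Proof.
move=> p0 p1 p2 j.
have [->//|] := eqVneq j i; have [->//|] := eqVneq j (s1 i); have [->//|] := eqVneq j (s2 i).
by case: i {p0 p1 p2} => -[|[|[|//]]] ?; case: j => -[|[|[|//]]].
Qed.

(** * The Hodge star in a frame *)

Section levi.
Variable R : realType.

Definition o4 (k : nat) : 'I_4 := inord k.

Lemma levi4E (a b c d : 'I_4) : levi_symbol R [tuple a; b; c; d] =
  \sum_(s : 'S_4) (-1) ^+ s * ((a == s (o4 0))%:R * ((b == s (o4 1))%:R
    * ((c == s (o4 2))%:R * (d == s (o4 3))%:R))).
Proof.
apply: eq_bigr => s _; congr (_ * _); rewrite !big_ord_recl big_ord0 mulr1 !mxE.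
congr ((_ == s _)%:R * ((_ == s _)%:R * ((_ == s _)%:R * (_ == s _)%:R)));
  by apply/val_inj; rewrite /= inordK.
Qed.

Lemma sum_delta (I : finType) (f : I -> R) i : \sum_j (j == i)%:R * f j = f i.
Proof.
rewrite (bigD1 i)//= eqxx mul1r big1 ?addr0// => j /negPf ->.
by rewrite mul0r.
Qed.

(** This is the Leibniz formula. *)
Lemma levi4_sum (u v w z : 'I_4 -> R) :
  \sum_a \sum_b \sum_k \sum_l levi_symbol R [tuple a; b; k; l] * (u a * v b * w k * z l)
  = \det (\matrix_(i, j) tnth [tuple u; v; w; z] i j).
Proof.
transitivity (\sum_(s : 'S_4) (-1) ^+ s * (u (s (o4 0)) * (v (s (o4 1)) *
    (w (s (o4 2)) * z (s (o4 3)))))); last first.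
  apply: eq_bigr => s _; congr (_ * _); rewrite !big_ord_recl big_ord0 mulr1 !mxE.
  congr (u (s _) * (v (s _) * (w (s _) * z (s _))));
    by apply/val_inj; rewrite /= inordK.
under eq_bigr => a _ do under eq_bigr => b _ do under eq_bigr => k _ do
  under eq_bigr => l _ do rewrite levi4E mulr_suml.
under eq_bigr => a _ do under eq_bigr => b _ do under eq_bigr => k _ do
  rewrite exchange_big /=.
under eq_bigr => a _ do under eq_bigr => b _ do rewrite exchange_big /=.
under eq_bigr => a _ do rewrite exchange_big /=.
rewrite exchange_big /=; apply: eq_bigr => s _.
transitivity (\sum_a \sum_b \sum_k \sum_l
  (-1) ^+ s * ((a == s (o4 0))%:R * u a * ((b == s (o4 1))%:R * v b * ((k == s (o4 2))%:R * w k
   * ((l == s (o4 3))%:R * z l))))).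
  apply: eq_bigr => a _; apply: eq_bigr => b _; apply: eq_bigr => k _; apply: eq_bigr => l _.
  move: (u a) (v b) (w k) (z l) ((a == _)%:R : R) ((b == _)%:R : R) ((k == _)%:R : R).
  move: ((l == _)%:R : R) ((-1) ^+ s : R) => p1 p2 p3 p4 p5 p6 p7 p8 p9; ring.
under eq_bigr => a _ do under eq_bigr => b _ do under eq_bigr => k _ do
  rewrite -!mulr_sumr sum_delta.
under eq_bigr => a _ do under eq_bigr => b _ do
  rewrite -!mulr_sumr -mulr_suml sum_delta.
under eq_bigr => a _ do rewrite -!mulr_sumr -mulr_suml sum_delta.
by rewrite -!mulr_sumr -mulr_suml sum_delta.
Qed.

Lemma star4_1E (f : 'M[R]_4) i j :
  star4 1%:M f i j = 2^-1 * \sum_k \sum_l levi_symbol R [tuple j; i; k; l] * f k l.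
Proof.
rewrite mxE; congr (_ * _).
transitivity (\sum_a (a == j)%:R * \sum_b (b == i)%:R *
   \sum_k \sum_l levi_symbol R [tuple a; b; k; l] * f k l).
  apply: eq_bigr => a _; rewrite mulr_sumr; apply: eq_bigr => b _.
  rewrite !mulr_sumr; apply: eq_bigr => k _; rewrite !mulr_sumr; apply: eq_bigr => l _.
  by rewrite !mxE (eq_sym j) (eq_sym i); ring.
by rewrite !sum_delta.
Qed.

Lemma star4_conj (c F : 'M[R]_4) : star4 c F = c *m star4 1%:M F *m c^T.
Proof.
apply/matrixP => i j; rewrite [LHS]mxE [RHS]mxE mulr_sumr.
apply: eq_bigr => a _; rewrite [(_ *m _) i a]mxE mulr_suml mulr_sumr.
apply: eq_bigr => b _; rewrite star4_1E [c^T a j]mxE.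
rewrite mulr_sumr [X in _ = _ * X * _]mulr_sumr mulr_sumr mulr_suml.
apply: eq_bigr => k _; rewrite !mulr_sumr mulr_suml; apply: eq_bigr => l _.
move: (levi_symbol _ _) (F k l) (c j a) (c i b) => p1 p2 p3 p4; ring.
Qed.

Lemma star4_1_frame (Q f : 'M[R]_4) :
  Q^T *m star4 1%:M (Q *m f *m Q^T) *m Q = \det Q *: star4 1%:M f.
Proof.
pose L (a b k l : 'I_4) : R := levi_symbol R [tuple a; b; k; l].
have nat4 (a' b' c' d' : 'I_4) : \sum_a \sum_b \sum_k \sum_l L a b k l *
    (Q a a' * Q b b' * Q k c' * Q l d') = \det Q * L a' b' c' d'.
  rewrite (levi4_sum (Q^~ a') (Q^~ b') (Q^~ c') (Q^~ d')) /L /levi_symbol.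
  rewrite -[\det Q]det_tr mulrC -det_mulmx; congr (\det _).
  apply/matrixP => i j; rewrite !mxE (bigD1 (tnth [tuple a'; b'; c'; d'] i))//=.
  rewrite big1 ?addr0 => [|m mi]; last by rewrite mxE eq_sym (negPf mi) mul0r.
  rewrite [X in _ = X * _](_ : _ = 1) ?mul1r; last by rewrite mxE eqxx.
  rewrite !mxE.
  by case: i => -[|[|[|[|//]]]] ? /=; rewrite !(tnth_nth (fun=> 0)) !(tnth_nth ord0).
apply/matrixP => i j; rewrite [RHS]mxE star4_1E [LHS]mxE.
transitivity (\sum_b \sum_a \sum_k \sum_l \sum_c' \sum_d'
   2^-1 * f c' d' * (L b a k l * (Q b j * Q a i * Q k c' * Q l d'))).
  apply: eq_bigr => b _; rewrite mxE mulr_suml; apply: eq_bigr => a _.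
  rewrite star4_1E [Q^T i a]mxE.
  rewrite [X in _ * X * _ = _]mulr_sumr [X in X * _ = _]mulr_sumr mulr_suml.
  apply: eq_bigr => k _.
  rewrite [X in _ * X * _ = _]mulr_sumr [X in X * _ = _]mulr_sumr mulr_suml.
  apply: eq_bigr => l _.
  have -> : (Q *m f *m Q^T) k l = \sum_c' \sum_d' Q k c' * f c' d' * Q l d'.
    rewrite mxE exchange_big /=; apply: eq_bigr => d' _; rewrite mxE mulr_suml.
    by apply: eq_bigr => c' _; rewrite mxE.
  rewrite !mulr_sumr mulr_suml; apply: eq_bigr => c' _.
  rewrite !mulr_sumr mulr_suml; apply: eq_bigr => d' _.
  rewrite -/(L b a k l).
  move: (L b a k l) (Q b j) (Q a i) (Q k c') (Q l d') (f c' d') => p1 p2 p3 p4 p5 p6.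
  by ring.
transitivity (\sum_c' \sum_d' 2^-1 * f c' d' * \sum_b \sum_a \sum_k \sum_l
   (L b a k l * (Q b j * Q a i * Q k c' * Q l d'))).
  under eq_bigr => b _ do under eq_bigr => a _ do under eq_bigr => k _ do
    rewrite exchange_big /=.
  under eq_bigr => b _ do under eq_bigr => a _ do rewrite exchange_big /=.
  under eq_bigr => b _ do rewrite exchange_big /=.
  rewrite exchange_big /=; apply: eq_bigr => c' _.
  under eq_bigr => b _ do under eq_bigr => a _ do under eq_bigr => k _ do
    rewrite exchange_big /=.
  under eq_bigr => b _ do under eq_bigr => a _ do rewrite exchange_big /=.
  under eq_bigr => b _ do rewrite exchange_big /=.
  rewrite exchange_big /=; apply: eq_bigr => d' _.
  by do 4 (rewrite mulr_sumr; apply: eq_bigr => ? _).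
rewrite mulrCA mulr_sumr mulr_sumr; apply: eq_bigr => c' _.
rewrite !mulr_sumr; apply: eq_bigr => d' _; rewrite nat4 -/(L j i c' d').
move: (L j i c' d') (f c' d') (\det Q) => p1 p2 p3; ring.
Qed.

(** Contracting all four indices of the Levi-Civita symbol with [Q] produces
    the factor [\det Q], which the normalisation of [r] removes: in an oriented
    coframe the star is given by that of the standard inner product. *)
Lemma star4_frame (r : R) (Q f : 'M[R]_4) : r ^+ 4 * \det Q = 1 ->
  star4 (r ^+ 2 *: (Q *m Q^T)) (Q *m f *m Q^T) = Q *m star4 1%:M f *m Q^T.
Proof.
move=> rQ; rewrite star4_conj linearZ /= trmx_mul trmxK -!scalemxAl -scalemxAr scalerA.
have -> : Q *m Q^T *m star4 1%:M (Q *m f *m Q^T) *m (Q *m Q^T)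
    = Q *m (Q^T *m star4 1%:M (Q *m f *m Q^T) *m Q) *m Q^T by rewrite !mulmxA.
rewrite star4_1_frame -scalemxAr -scalemxAl scalerA -exprD rQ.
by rewrite scale1r.
Qed.

End levi.

Section small_determinants.
Variable R : realType.

(** The expansion along the first row, over natural numbers so that a
    determinant with concrete entries can be evaluated. *)
Fixpoint laplace (n : nat) (f : nat -> nat -> R) : R :=
  if n is m.+1 then
    foldr (fun j acc => f 0%N j * ((-1) ^+ j * laplace m (fun i k => f i.+1 (bump j k))) + acc)
      0 (iota 0 n)
  else 1.

Lemma laplaceE n (f : nat -> nat -> R) :
  \det (\matrix_(i < n, j < n) f i j) = laplace n f.
Proof.
elim: n f => [|n IH] f; first by rewrite det_mx00.
rewrite (expand_det_row _ ord0).
transitivity (\sum_(j < n.+1) f 0%N j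
    * ((-1) ^+ j * laplace n (fun i k => f i.+1 (bump j k)))).
  apply: eq_bigr => j _; rewrite mxE /cofactor add0n -IH.
  by congr (_ * (_ * \det _)); apply/matrixP => i k; rewrite !mxE.
rewrite -(big_mkord xpredT (fun j => f 0%N j
    * ((-1) ^+ j * laplace n (fun i k => f i.+1 (bump j k))))).
by rewrite unlock /reducebig /index_iota subn0.
Qed.

Lemma levi3_nat (a b c : 'I_3) : levi_symbol R [tuple a; b; c] =
  laplace 3 (fun i j => ((nth 0%N [:: val a; val b; val c] i) == j)%:R).
Proof.
rewrite -laplaceE /levi_symbol; congr (\det _); apply/matrixP => i j; rewrite !mxE.
by case: i => -[|[|[|//]]] ?; rewrite (tnth_nth ord0).
Qed.

Lemma levi4_nat (a b c d : 'I_4) : levi_symbol R [tuple a; b; c; d] =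
  laplace 4 (fun i j => ((nth 0%N [:: val a; val b; val c; val d] i) == j)%:R).
Proof.
rewrite -laplaceE /levi_symbol; congr (\det _); apply/matrixP => i j; rewrite !mxE.
by case: i => -[|[|[|[|//]]]] ?; rewrite (tnth_nth ord0).
Qed.

(** The cyclic form of the determinant: the triple product of the columns. *)
Lemma det3_cyc (Q : 'M[R]_3) k : \det Q
  = \sum_j Q j k * (Q (s1 j) (s1 k) * Q (s2 j) (s2 k) - Q (s2 j) (s1 k) * Q (s1 j) (s2 k)).
Proof.
have QE : Q = \matrix_(i < 3, j < 3) Q (inord i) (inord j).
  by apply/matrixP => i j; rewrite mxE !inord_val.
have iE (i : 'I_3) : inord i = i by exact: inord_val.
rewrite [in LHS]QE (laplaceE 3 (fun i j => Q (inord i) (inord j))) (sum_cyc _ 0).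
have [e0 e1 e2] : [/\ inord 0 = 0 :> 'I_3, inord 1 = s1 0 :> 'I_3 & inord 2 = s2 0 :> 'I_3].
  by split; apply/val_inj; rewrite /= inordK.
rewrite /= /bump /= e0 e1 e2 ?cycE; move: (Q) => q.
by move: k; apply: (cyc_ind (i := 0)); rewrite ?cycE; ring.
Qed.

Lemma star3E (o : R) (c F : 'M[R]_3) i : F^T = - F ->
  star3 o c F 0 i = - o * \sum_j c i j * F (s1 j) (s2 j).
Proof.
move=> aF; have FE k l : F l k = - F k l by rewrite -[in LHS](trmxK F) aF !mxE.
rewrite mxE -mulrA; congr (_ * _).
have E j : \sum_k \sum_l levi_symbol R [tuple j; k; l] * c i j * F k l
   = c i j * (F (s1 j) (s2 j) - F (s2 j) (s1 j)).
  transitivity (c i j * \sum_k \sum_l levi_symbol R [tuple j; k; l] * F k l).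
    rewrite mulr_sumr; apply: eq_bigr => k _; rewrite mulr_sumr; apply: eq_bigr => l _.
    by rewrite mulrCA mulrA.
  congr (_ * _); rewrite (sum_cyc _ j) !(sum_cyc (fun l => _ * F _ l) j).
  case: j => -[|[|[|//]]] ?; rewrite !levi3_nat /= /bump /=; by ring.
under eq_bigr => j _ do rewrite E (FE (s1 j)).
by rewrite mulr_sumr; apply: eq_bigr => j _; field.
Qed.

End small_determinants.

(** * Frames in dimension four *)
(** The indices of the three horizontal vectors of a frame; the last index,
    [vv], is that of the vertical one. *)
Definition hh (k : 'I_3) : 'I_4 := lshift 1 k.
Definition vv : 'I_4 := rshift 3 ord0.

Section dimension_four.
Variable R : realType.

Lemma sum_hv (V : zmodType) (f : 'I_4 -> V) k :
  \sum_j f j = f (hh k) + f (hh (s1 k)) + f (hh (s2 k)) + f vv.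
Proof.
have -> : \sum_j f j = \sum_(j < 3) f (hh j) + f vv.
  by rewrite (@big_split_ord _ _ _ 3 1) /= big_ord1.
by rewrite (sum_cyc _ k).
Qed.

Lemma hv_ind (P : 'I_4 -> Prop) : (forall k, P (hh k)) -> P vv -> forall a, P a.
Proof. by move=> Ph Pv a; case: (@fintype.split_ordP 3 1 a) => i ->; rewrite ?ord1. Qed.

Lemma star4_hh (f : 'M[R]_4) k :
  star4 1%:M f (hh (s1 k)) (hh (s2 k)) = 2^-1 * (f vv (hh k) - f (hh k) vv).
Proof.
rewrite star4_1E; congr (_ * _); rewrite (sum_hv _ k) !(sum_hv (fun l => _ * f _ l) k).
case: k => -[|[|[|//]]] ?; rewrite !levi4_nat;
  rewrite /= /bump /=; by ring.
Qed.

Lemma star4_vh (f : 'M[R]_4) k :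
  star4 1%:M f vv (hh k) = 2^-1 * (f (hh (s1 k)) (hh (s2 k)) - f (hh (s2 k)) (hh (s1 k))).
Proof.
rewrite star4_1E; congr (_ * _); rewrite (sum_hv _ k) !(sum_hv (fun l => _ * f _ l) k).
case: k => -[|[|[|//]]] ?; rewrite !levi4_nat;
  rewrite /= /bump /=; by ring.
Qed.

Lemma star4_tr (f : 'M[R]_4) : (star4 1%:M f)^T = - star4 1%:M f.
Proof.
apply/matrixP => i j; rewrite [LHS]mxE [RHS]mxE !star4_1E -mulrN; congr (_ * _).
rewrite -sumrN; apply: eq_bigr => k _; rewrite -sumrN; apply: eq_bigr => l _.
rewrite -mulNr; congr (_ * _); rewrite /levi_symbol.
pose A := \matrix_(p < 4, q < 4) (tnth [tuple j; i; k; l] p == q)%:R : 'M[R]_4.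
have t01 : (inord 0 : 'I_4) != inord 1 by rewrite -val_eqE /= !inordK.
have sg : \det (perm_mx (tperm (inord 0 : 'I_4) (inord 1)) : 'M[R]_4) = -1.
  by rewrite det_perm odd_tperm t01 expr1.
rewrite -/A -mulN1r -sg -det_mulmx -row_permE; congr (\det _); apply/matrixP => p q; rewrite !mxE.
congr ((_ == q)%:R); case: p => -[|[|[|[|//]]]] hp; rewrite !(tnth_nth i) permE /= -!val_eqE /= !inordK//=;
  by rewrite !inordK.
Qed.

(** With the normalisation of the star used here, the selfdual forms are spanned
    by [e_i /\ e_j - e_k /\ eta] and the antiselfdual ones by
    [e_i /\ e_j + e_k /\ eta]. *)
Lemma selfdual_1P (f : 'M[R]_4) : f^T = - f ->
  (star4 1%:M f = f <-> forall k, f (hh (s1 k)) (hh (s2 k)) = f vv (hh k)).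
Proof.
move=> af; have fE a b : f b a = - f a b by rewrite -[in LHS](trmxK f) af !mxE.
have sE a b : star4 1%:M f b a = - star4 1%:M f a b.
  by have /matrixP/(_ a b) := star4_tr f; rewrite !mxE.
split=> [H k|H].
  by rewrite -{1}H star4_hh (fE vv); field.
have f0 a : f a a = 0 by have := fE a a; lra.
have s0 a : star4 1%:M f a a = 0 by have := sE a a; lra.
have hv k : star4 1%:M f vv (hh k) = f vv (hh k).
  by rewrite star4_vh (fE (hh (s1 k))) H; field.
have h12 k : star4 1%:M f (hh (s1 k)) (hh (s2 k)) = f (hh (s1 k)) (hh (s2 k)).
  by rewrite star4_hh (fE vv) H; field.
apply/matrixP; elim/hv_ind => [k|]; elim/hv_ind => [l|].
- move: l; apply: (cyc_ind (i := k)); first by rewrite s0 f0.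
    by have := h12 (s2 k); rewrite !cycE.
  by have := h12 (s1 k); rewrite !cycE => E; rewrite sE fE E.
- by rewrite sE fE hv.
- exact: hv.
- by rewrite s0 f0.
Qed.

End dimension_four.

(** * Curvature in a frame *)

Section frame_curvature.
Variables (R : realType) (n : nat).
Implicit Types (Q : 'rV[R]_n -> 'M[R]_n) (G : connection R n).

(** Components of the curvature in the frame: [a], [b] are the indices of the
    2-form, and the curvature maps the [c]-th frame vector to a vector with
    [d]-th component [frame_curv Q G x a b c d]. *)
Definition frame_curv Q G x (a b c d : 'I_n) : R :=
  (invmx (Q x) *m (\matrix_(i, j) (invmx (Q x) *m curv_mx G i j x *m Q x) c d)
   *m (invmx (Q x))^T) a b.

Lemma curv_mx_anti G i j x : curv_mx G j i x = - curv_mx G i j x.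
Proof.
apply/matrixP => k l; rewrite !mxE /riemann.
rewrite opprD opprB -sumrN; congr (_ + _); apply: eq_bigr => m _.
by rewrite opprB.
Qed.

Lemma frame_curv_anti Q G x a b c d :
  frame_curv Q G x b a c d = - frame_curv Q G x a b c d.
Proof.
rewrite /frame_curv; set X := \matrix_(i, j) _; set E := invmx _.
have aX : X^T = - X.
  apply/matrixP => i j; rewrite [LHS]mxE [LHS]mxE [RHS]mxE [X i j]mxE curv_mx_anti.
  by rewrite mulmxN mulNmx [LHS]mxE.
have : (E *m X *m E^T)^T = - (E *m X *m E^T).
  by rewrite !trmx_mul trmxK aX mulNmx mulmxN mulmxA.
by move=> /matrixP/(_ a b); rewrite [LHS]mxE [RHS]mxE.
Qed.

Lemma frame_curv_Omega Q G x (Om : 'I_n -> 'I_n -> 'M[R]_n) a b c d :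
  Q x \in unitmx -> (forall i j, curv_mx G i j x *m Q x = Q x *m Om i j) ->
  frame_curv Q G x a b c d
  = (invmx (Q x) *m (\matrix_(i, j) Om i j c d) *m (invmx (Q x))^T) a b.
Proof.
move=> uQ H; rewrite /frame_curv; congr ((_ *m _ *m _) a b).
by apply/matrixP => i j; rewrite [LHS]mxE [RHS]mxE -mulmxA H mulKmx.
Qed.

Section at_point.
Variables (Q : 'rV[R]_n -> 'M[R]_n) (G : connection R n) (x : 'rV[R]_n).
Hypothesis uQ : Q x \in unitmx.
Let E := invmx (Q x).
Let X c d : 'M[R]_n := \matrix_(i, j) (E *m curv_mx G i j x *m Q x) c d.
Let EQT : E^T *m (Q x)^T = 1%:M. Proof. by rewrite -trmx_mul mulmxV// trmx1. Qed.
Let QE : Q x *m E = 1%:M. Proof. exact: mulmxV. Qed.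

Lemma frame_lowered i j k l :
  \sum_m riemann G m i j k x * gram Q x m l
  = (Q x *m (\matrix_(a, b) \sum_c \sum_d Q x k c * Q x l d * frame_curv Q G x a b c d)
     *m (Q x)^T) i j.
Proof.
have -> : \matrix_(a, b) (\sum_c \sum_d Q x k c * Q x l d * frame_curv Q G x a b c d)
    = \sum_c \sum_d (Q x k c * Q x l d) *: (E *m X c d *m E^T).
  apply/matrixP => a b; rewrite mxE summxE; apply: eq_bigr => c _.
  by rewrite summxE; apply: eq_bigr => d _; rewrite [RHS]mxE.
transitivity (\sum_c \sum_d Q x k c * Q x l d * X c d i j).
  transitivity ((Q x *m (E *m curv_mx G i j x *m Q x) *m (Q x)^T) k l).
    rewrite !mulmxA QE mul1mx -mulmxA -/(gram Q x) mxE.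
    by apply: eq_bigr => m _; rewrite [curv_mx _ _ _ _ _ _]mxE.
  rewrite mxE.
  under eq_bigr => d _ do rewrite mxE mulr_suml.
  rewrite [LHS]exchange_big /=; apply: eq_bigr => c _; apply: eq_bigr => d _.
  by rewrite ?[(Q x)^T _ _]mxE mulrAC; congr (_ * _); rewrite [RHS]mxE.
rewrite mulmx_sumr mulmx_suml summxE; apply: eq_bigr => c _.
rewrite mulmx_sumr mulmx_suml summxE; apply: eq_bigr => d _.
rewrite -scalemxAr -scalemxAl [RHS]mxE; congr (_ * _).
by rewrite !mulmxA QE mul1mx -mulmxA EQT mulmx1.
Qed.

Lemma frame_ricci j k : ricci G j k x
  = (Q x *m (\matrix_(b, c) \sum_d frame_curv Q G x d b c d) *m (Q x)^T) j k.
Proof.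
transitivity (\sum_c Q x k c * \sum_d (E *m X c d) d j).
  transitivity (\sum_l (Q x *m (E *m curv_mx G l j x *m Q x) *m E) k l).
    apply: eq_bigr => l _.
    by rewrite !mulmxA QE mul1mx -mulmxA QE mulmx1 mxE.
  under eq_bigr => l _ do rewrite mxE.
  rewrite exchange_big /=.
  under eq_bigr => d _ do under eq_bigr => l _ do rewrite mxE mulr_suml.
  under eq_bigr => d _ do rewrite exchange_big /=.
  rewrite exchange_big /=; apply: eq_bigr => c _; rewrite mulr_sumr.
  apply: eq_bigr => d _; rewrite mxE mulr_sumr; apply: eq_bigr => l _.
  by rewrite [X c d l j]mxE -mulrA; congr (_ * _); exact: mulrC.
rewrite [RHS]mxE; apply: eq_bigr => c _; rewrite [(Q x)^T _ _]mxE mulrC; congr (_ * _).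
rewrite [RHS]mxE.
under [RHS]eq_bigr => b _ do rewrite [(\matrix_(_, _) _) b c]mxE mulr_sumr.
rewrite exchange_big /=; apply: eq_bigr => d _.
have -> : E *m X c d = E *m X c d *m E^T *m (Q x)^T by rewrite -mulmxA EQT mulmx1.
rewrite mxE; apply: eq_bigr => b _.
by rewrite [(Q x)^T _ _]mxE mulrC.
Qed.

Lemma frame_curv_sum a b c d : frame_curv Q G x a b c d
  = \sum_i \sum_j \sum_k E a i * E b j * E c k * (curv_mx G i j x *m Q x) k d.
Proof.
rewrite /frame_curv -/E mxE exchange_big /=; apply: eq_bigr => j _.
rewrite mxE mulr_suml; apply: eq_bigr => i _; rewrite [X in _ * X * _]mxE -mulmxA.
rewrite [(E *m (curv_mx _ _ _ _ *m _)) c d]mxE [E^T j b]mxE mulrAC mulr_sumr.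
by apply: eq_bigr => k _; rewrite !mulrA.
Qed.

(** The cyclic sum of the curvature vanishes in coordinates by the symmetry of
    the connection coefficients, and both sides are tensors. *)
Lemma frame_bianchi (U : set 'rV[R]_n) a b c d : open U -> U x ->
  (forall y, U y -> forall l i j, G l i j y = G l j i y) ->
  frame_curv Q G x a b c d + frame_curv Q G x b c a d + frame_curv Q G x c a b d = 0.
Proof.
move=> oU Ux sG.
have bia l i j k : riemann G l i j k x + riemann G l j k i x + riemann G l k i j x = 0.
  have pG p q r s : partial p (G s q r) x = partial p (G s r q) x.
    by apply: (eq_on_partial _ oU Ux) => y Uy; rewrite sG.
  rewrite /riemann (pG j k i) (pG i k j) (pG k j i).
  have -> : \sum_m (G l i m x * G m j k x - G l j m x * G m i k x)
     = \sum_m G l i m x * G m j k x - \sum_m G l j m x * G m i k x by rewrite sumrB.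
  have -> : \sum_m (G l j m x * G m k i x - G l k m x * G m j i x)
     = \sum_m G l j m x * G m i k x - \sum_m G l k m x * G m i j x.
    by rewrite sumrB; congr (_ - _); apply: eq_bigr => m _; rewrite (sG x Ux m).
  have -> : \sum_m (G l k m x * G m i j x - G l i m x * G m k j x)
     = \sum_m G l k m x * G m i j x - \sum_m G l i m x * G m j k x.
    rewrite sumrB; congr (_ - _); apply: eq_bigr => m _; by rewrite (sG x Ux m k).
  move: (\sum_m _) (\sum_m _) (\sum_m _) => S1 S2 S3.
  move: (partial _ _ _) (partial _ _ _) (partial _ _ _) => p1 p2 p3; ring.
pose C i j k := (curv_mx G i j x *m Q x) k d.
have bC i j k : C i j k + C j k i + C k i j = 0.
  rewrite /C !mxE -!big_split /= big1// => l _.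
  by rewrite ![curv_mx _ _ _ _ _ _]mxE -!mulrDl bia mul0r.
have Eb : frame_curv Q G x b c a d
    = \sum_i \sum_j \sum_k E a i * E b j * E c k * C j k i.
  rewrite frame_curv_sum exchange_big /=.
  under eq_bigr => j _ do rewrite exchange_big /=.
  rewrite exchange_big /=; apply: eq_bigr => i _.
  rewrite exchange_big /=; apply: eq_bigr => j _; apply: eq_bigr => k _.
  by rewrite -/(C j k i); move: (C j k i) => z; ring.
have Ec : frame_curv Q G x c a b d
    = \sum_i \sum_j \sum_k E a i * E b j * E c k * C k i j.
  rewrite frame_curv_sum exchange_big /=; apply: eq_bigr => i _.
  rewrite exchange_big /=; apply: eq_bigr => j _; apply: eq_bigr => k _.
  by rewrite -/(C k i j); move: (C k i j) => z; ring.
rewrite Eb Ec frame_curv_sum -!big_split /= big1// => i _.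
rewrite -!big_split /= big1// => j _; rewrite -!big_split /= big1// => k _.
by rewrite -/(C i j k) -!mulrDr bC mulr0.
Qed.

Lemma frame_scal th : G = weyl_conn (gram Q) th ->
  scalar_curvature (gram Q) th x = \sum_b \sum_d frame_curv Q G x d b b d.
Proof.
move=> GE; pose r : 'M[R]_n := \matrix_(b, c) \sum_d frame_curv Q G x d b c d.
transitivity (\tr (invmx (gram Q x) *m (Q x *m r *m (Q x)^T)^T)).
  apply: eq_bigr => i _; rewrite mxE; apply: eq_bigr => j _.
  by rewrite -GE frame_ricci [(_^T) j i]mxE.
have -> : invmx (gram Q x) = E^T *m E.
  rewrite /gram -[RHS]mul1mx -(mulVmx (gram_unit uQ)) /gram -!mulmxA.
  by rewrite (mulmxA _ E^T) -trmx_mul mulVmx// trmx1 mul1mx mulmxV// mulmx1.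
rewrite !trmx_mul trmxK -!mulmxA (mulmxA E) mulVmx// mul1mx.
rewrite mxtrace_mulC -mulmxA -trmx_mul.
by rewrite mulVmx// trmx1 mulmx1 mxtrace_tr; apply: eq_bigr => b _; rewrite mxE.
Qed.

End at_point.
End frame_curvature.

(** * Weyl structures in dimension three *)

Section entries.
Variables (R : pzRingType) (p q : nat) (A B : 'M[R]_(p, q)) (i : 'I_p) (j : 'I_q).
Lemma mxDE : (A + B) i j = A i j + B i j. Proof. by rewrite mxE. Qed.
Lemma mxNE : (- A) i j = - A i j. Proof. by rewrite mxE. Qed.
Lemma mxZE (a : R) : (a *: A) i j = a * A i j. Proof. by rewrite mxE. Qed.
Lemma mx0E : (0 : 'M[R]_(p, q)) i j = 0. Proof. by rewrite mxE. Qed.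
End entries.
Definition entryE := (mxDE, mxNE, mxZE, mx0E).

Section skew_matrices.
Variable R : realType.

(** The skew matrix of the vector [v], i.e. an element of [so(3)]. *)
Definition skew3 (v : 'I_3 -> R) : 'M[R]_3 := \matrix_(a, b)
  (if b == s1 a then v (s2 a) else if a == s1 b then - v (s2 b) else 0).

Lemma skew3E (v : 'I_3 -> R) a :
  [/\ skew3 v a a = 0, skew3 v a (s1 a) = v (s2 a), skew3 v (s1 a) a = - v (s2 a),
      skew3 v a (s2 a) = - v (s1 a) & skew3 v (s2 a) a = v (s1 a)].
Proof. by split; rewrite mxE ?cycE ?cyc_neq ?eqxx. Qed.

Lemma skew3E12 (v : 'I_3 -> R) a :
  skew3 v (s1 a) (s2 a) = v a /\ skew3 v (s2 a) (s1 a) = - v a.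
Proof. by have [_ + + _ _] := skew3E v (s1 a); rewrite !cycE. Qed.

Lemma skew3_tr v : (skew3 v)^T = - skew3 v.
Proof.
apply/matrixP => a; apply: (cyc_ind (i := a)); rewrite !mxE ?cycE ?cyc_neq ?eqxx ?oppr0 ?opprK//.
Qed.

End skew_matrices.

Section coframes.
Variables (R : realType) (n : nat).

Definition coframe (Q : 'rV[R]_n -> 'M[R]_n) k x : 'rV[R]_n := (col k (Q x))^T.

Lemma coframeE Q k x i : coframe Q k x 0 i = Q x i k.
Proof. by rewrite !mxE. Qed.

Lemma smooth_coframe U Q k : open U -> smooth_mx_on U Q -> smooth_mx_on U (coframe Q k).
Proof. by move=> oU sQ i j; apply: eq_smooth_on (sQ j k) => // x _; rewrite ord1 coframeE. Qed.

End coframes.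

Section smooth_connection.
Variables (R : realType) (n : nat) (U : set 'rV[R]_n).
Hypothesis oU : open U.

Lemma smooth_weyl_deriv w th k f : smooth_mx_on U th -> smooth_on U f ->
  smooth_on U (@weyl_deriv R n w th k f).
Proof.
move=> sth sf; apply: smooth_onD => //; first exact: smooth_on_partial.
apply: (smooth_onM oU _ sf); apply: (smooth_onM oU (@smooth_on_cst _ _ _ w)); exact: sth.
Qed.

Lemma smooth_weyl_conn (h : 'rV[R]_n -> 'M[R]_n) th l i j : smooth_mx_on U h ->
  (forall x, U x -> h x \in unitmx) -> smooth_mx_on U th ->
  smooth_on U (weyl_conn h th l i j).
Proof.
move=> sh uh sth; apply: smooth_onM => //; first exact: smooth_on_cst.
apply: smooth_on_sum => // m; apply: smooth_onM => //; first exact: smooth_invmx.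
by apply: smooth_onB => //; first apply: smooth_onD => //; apply: smooth_weyl_deriv.
Qed.

Lemma smooth_frame_coef (Q : 'rV[R]_n -> 'M[R]_n) th i : smooth_mx_on U Q ->
  (forall x, U x -> Q x \in unitmx) -> smooth_mx_on U th ->
  smooth_mx_on U (frame_coef Q (weyl_conn (gram Q) th) i).
Proof.
move=> sQ uQ sth; apply: smooth_mx_mul => //; first exact: smooth_invmx.
have sG : smooth_mx_on U (fun x => conn_mx (weyl_conn (gram Q) th) i x *m Q x).
  apply: smooth_mx_mul => // k l.
  have : smooth_on U (weyl_conn (gram Q) th l i k).
    apply: smooth_weyl_conn => //; first exact: smooth_gram.
    by move=> x Ux; apply: gram_unit; exact: uQ.
  by apply: eq_smooth_on => // x _; rewrite mxE.
move=> k l; have := smooth_onB oU (sG k l) (smooth_mpartial i oU sQ k l).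
by apply: eq_smooth_on => // x _; rewrite [RHS]mxE [X in _ = _ + X]mxE.
Qed.

End smooth_connection.

Section two_form_components.
Variables (R : realType) (n : nat).
Implicit Types (Q : 'M[R]_n) (X : 'M[R]_n) (u v : 'rV[R]_n).

(** Components of a bilinear form in the frame dual to the coframe [Q]. *)
Definition fcomp Q X (a b : 'I_n) : R := (invmx Q *m X *m (invmx Q)^T) a b.

(** Components of a 1-form in the frame dual to the coframe [Q]. *)
Definition fcomp1 Q u (a : 'I_n) : R := (u *m (invmx Q)^T) 0 a.

Lemma fcompD Q X Y a b : fcomp Q (X + Y) a b = fcomp Q X a b + fcomp Q Y a b.
Proof. by rewrite /fcomp mulmxDr mulmxDl mxE. Qed.

Lemma fcompN Q X a b : fcomp Q (- X) a b = - fcomp Q X a b.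
Proof. by rewrite /fcomp mulmxN mulNmx mxE. Qed.

Lemma fcompZ Q X (r : R) a b : fcomp Q (r *: X) a b = r * fcomp Q X a b.
Proof. by rewrite /fcomp -scalemxAr -scalemxAl mxE. Qed.

Lemma fcomp_wedge Q u v a b : fcomp Q (wedge u v) a b
  = fcomp1 Q u a * fcomp1 Q v b - fcomp1 Q u b * fcomp1 Q v a.
Proof.
rewrite /fcomp /wedge -lock mulmxBr mulmxBl.
have O (w z : 'rV[R]_n) : (invmx Q *m (w^T *m z) *m (invmx Q)^T) a b
    = fcomp1 Q w a * fcomp1 Q z b.
  rewrite !mulmxA -mulmxA mxE big_ord1; congr (_ * _).
  by rewrite /fcomp1 -[w in RHS]trmxK -trmx_mul [RHS]mxE.
by rewrite mxDE mxNE !O [in X in _ - X]mulrC.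
Qed.

Lemma fcomp_anti Q X a b : X^T = - X -> fcomp Q X b a = - fcomp Q X a b.
Proof.
move=> aX; have : (invmx Q *m X *m (invmx Q)^T)^T = - (invmx Q *m X *m (invmx Q)^T).
  by rewrite !trmx_mul trmxK aX mulNmx mulmxN mulmxA.
by move=> /matrixP/(_ a b); rewrite mxNE => <-; rewrite mxE.
Qed.

Lemma fcomp_inj Q X Y : Q \in unitmx -> (forall a b, fcomp Q X a b = fcomp Q Y a b) -> X = Y.
Proof.
move=> uQ H; have E : invmx Q *m X *m (invmx Q)^T = invmx Q *m Y *m (invmx Q)^T.
  by apply/matrixP.
have := congr1 (fun Z => Q *m Z *m Q^T) E; rewrite /= !mulmxA mulmxV// !mul1mx.
by rewrite -!mulmxA -!trmx_mul mulmxV// trmx1 !mulmx1.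
Qed.

Lemma fcomp1_inj Q u v : Q \in unitmx -> (forall a, fcomp1 Q u a = fcomp1 Q v a) -> u = v.
Proof.
move=> uQ H; have E : u *m (invmx Q)^T = v *m (invmx Q)^T by apply/rowP.
have := congr1 (fun Z => Z *m Q^T) E.
by rewrite /= -!mulmxA -!trmx_mul mulmxV// trmx1 !mulmx1.
Qed.

Lemma fcomp1_coframe (P : 'rV[R]_n -> 'M[R]_n) k x a : P x \in unitmx ->
  fcomp1 (P x) (coframe P k x) a = (k == a)%:R.
Proof.
by move=> uP; rewrite /fcomp1 /coframe -trmx_mul colE mulKmx// !mxE eqxx andbT eq_sym.
Qed.

Lemma fcomp1D Q u v a : fcomp1 Q (u + v) a = fcomp1 Q u a + fcomp1 Q v a.
Proof. by rewrite /fcomp1 mulmxDl mxE. Qed.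

Lemma fcomp1N Q u a : fcomp1 Q (- u) a = - fcomp1 Q u a.
Proof. by rewrite /fcomp1 mulNmx mxE. Qed.

Lemma fcomp1Z Q u (r : R) a : fcomp1 Q (r *: u) a = r * fcomp1 Q u a.
Proof. by rewrite /fcomp1 -scalemxAl mxE. Qed.

Lemma fcomp1_sum (I : finType) Q (u : I -> 'rV[R]_n) a :
  fcomp1 Q (\sum_i u i) a = \sum_i fcomp1 Q (u i) a.
Proof. by rewrite /fcomp1 mulmx_suml summxE. Qed.

Lemma wedge_tr u v : (wedge u v)^T = - wedge u v.
Proof. by apply/matrixP => i j; rewrite mxNE mxE !wedgeE opprB. Qed.

End two_form_components.
Definition fcompE := (fcompD, fcompN, fcompZ, fcomp_wedge).
Definition fcomp1E := (fcomp1D, fcomp1N, fcomp1Z).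

Lemma weyl_conn_sym (R : realType) n (h : 'rV[R]_n -> 'M[R]_n) th l i j x :
  (forall y, (h y)^T = h y) -> weyl_conn h th l i j x = weyl_conn h th l j i x.
Proof.
move=> sh; have hE p q : (fun y => h y p q) = (fun y => h y q p).
  by apply/funext => y; rewrite -[in LHS]sh mxE.
rewrite /weyl_conn; congr (_ * _); apply: eq_bigr => m _; congr (_ * _).
by rewrite (hE i j) (hE m j) (hE i m) [X in X - _ = _]addrC.
Qed.

Section base.
Variables (R : realType) (U : set 'rV[R]_3).
Variables (Q : 'rV[R]_3 -> 'M[R]_3) (th : 'rV[R]_3 -> 'rV[R]_3).
Variable A : 'I_3 -> 'rV[R]_3 -> 'rV[R]_3.
Notation e := (coframe Q).

(** The first structure equation of a Weyl connection in an orthonormal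
    coframe; [A k] is the component of the connection form rotating
    [e (s1 k)] into [e (s2 k)]. *)
Definition structure_eq := forall x, U x -> forall k,
  faraday (e k) x = wedge (A (s2 k) x) (e (s1 k) x) - wedge (A (s1 k) x) (e (s2 k) x)
                    - wedge (th x) (e k x).

(** The curvature of the [so(3)] part of the connection. *)
Definition rotation_curv k x : 'M[R]_3 :=
  faraday (A k) x + wedge (A (s1 k) x) (A (s2 k) x).

Definition conn3 (i : 'I_3) x : 'M[R]_3 :=
  (th x 0 i)%:M + skew3 (fun k => A k x 0 i).

Hypotheses (oU : open U) (sQ : smooth_mx_on U Q) (sth : smooth_mx_on U th).
Hypothesis uQ : forall x, U x -> Q x \in unitmx.
Hypothesis sA : forall k, smooth_mx_on U (A k).
Hypothesis tors : structure_eq.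

Let G := weyl_conn (gram Q) th.

Lemma smooth_conn3 i : smooth_mx_on U (conn3 i).
Proof.
apply: smooth_mxD => // a b.
  have := smooth_onM oU (sth 0 i) (@smooth_on_cst R 3 U (a == b)%:R).
  by apply: eq_smooth_on => // x _; rewrite mxE mulr_natr.
pose v y k := A k y 0 i.
have : smooth_on U (fun x => if b == s1 a then v x (s2 a) else if a == s1 b then - v x (s2 b) else 0).
  case: (b == s1 a); first exact: sA.
  by case: (a == s1 b); [apply: smooth_onN => //; exact: sA|exact: smooth_on_cst].
by apply: eq_smooth_on => // x _; rewrite mxE.
Qed.

Lemma conn3_frame x : U x -> forall i,
  conn_mx G i x *m Q x = mpartial i Q x + Q x *m conn3 i x.
Proof.
move=> Ux; apply: (weyl_conn_frame oU) (Ux) => // {x Ux} x Ux.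
  move=> i; rewrite /conn3 linearD /= tr_scalar_mx skew3_tr addrACA subrr addr0.
  by rewrite -raddfD /= mulr_natl mulr2n.
move=> i k a; have /matrixP/(_ i k) := tors Ux a.
rewrite faradayE.
have E p q : partial p (fun y => e a y 0 q) x = mpartial p Q x q a.
  by rewrite mxE; congr (partial p _ x); apply/funext => y; rewrite coframeE.
rewrite !E ![(_ *m _) _ a]mxE !(sum_cyc _ a) ![conn3 _ _ _ _]mxE ![(_%:M) _ _]mxE.
rewrite eqxx !cyc_neq !mulr0n !mulr1n.
have SK p := skew3E (fun k => A k x 0 p) a.
have [-> _ -> _ ->] := SK i; have [-> _ -> _ ->] := SK k.
rewrite !entryE !wedgeE !coframeE.
move: (mpartial i Q x k a) (mpartial k Q x i a) (Q x) => p1 p2 q H.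
by lra.
Qed.

Notation hs k x := (wedge (e (s1 k) x) (e (s2 k) x)).

Lemma conn3_curv x i j k : U x ->
  let Om := mpartial i (conn3 j) x - mpartial j (conn3 i) x
            + conn3 j x *m conn3 i x - conn3 i x *m conn3 j x in
  [/\ Om k k = faraday th x i j, Om (s1 k) (s2 k) = rotation_curv k x i j
    & Om (s2 k) (s1 k) = - rotation_curv k x i j].
Proof.
move=> Ux Om.
have cD p y : conn3 p y k k = th y 0 p.
  by have [z _ _ _ _] := skew3E (fun l => A l y 0 p) k; rewrite mxDE z addr0 mxE eqxx.
have c12 p y : conn3 p y (s1 k) (s2 k) = A k y 0 p.
  have [z _] := skew3E12 (fun l => A l y 0 p) k.
  by rewrite mxDE z mxE cyc_neq add0r.
have c21 p y : conn3 p y (s2 k) (s1 k) = - A k y 0 p.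
  have [_ z] := skew3E12 (fun l => A l y 0 p) k.
  by rewrite mxDE z mxE cyc_neq add0r.
have S p := skew3E (fun l => A l x 0 p) k.
have [_ i1 i1' i2 i2'] := S i; have [_ j1 j1' j2 j2'] := S j.
have [i3 i3'] := skew3E12 (fun l => A l x 0 i) k.
have [j3 j3'] := skew3E12 (fun l => A l x 0 j) k.
have D (y : 'I_3) (B : 'I_3 -> 'rV[R]_3 -> 'M[R]_3) a b p q :
  mpartial p (B q) x a b = partial p (fun y => B q y a b) x by rewrite mxE.
have dA p q : partial p (fun y => - A k y 0 q) x = - partial p (fun y => A k y 0 q) x.
  by rewrite partialN//; exact: smooth_mx_diff (sA k) Ux.
have E3 p a b : conn3 p x a b = (th x 0 p) *+ (a == b) + skew3 (fun l => A l x 0 p) a b.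
  by rewrite mxDE mxE.
have P p q a b : (conn3 p x *m conn3 q x) a b
    = conn3 p x a k * conn3 q x k b + conn3 p x a (s1 k) * conn3 q x (s1 k) b
      + conn3 p x a (s2 k) * conn3 q x (s2 k) b by rewrite mxE (sum_cyc _ k).
have fE (F : 'rV[R]_3 -> R) F' p : (forall y, F y = F' y) -> partial p F x = partial p F' x.
  by move=> /funext ->.
split; rewrite /Om !mxDE !mxNE !(D i) !P !E3 ?eqxx ?cyc_neq ?mulr0n ?mulr1n ?add0r;
  rewrite ?i1 ?i1' ?i2 ?i2' ?i3 ?i3' ?j1 ?j1' ?j2 ?j2' ?j3 ?j3'.
- rewrite (fE _ _ i (cD j)) (fE _ _ j (cD i)) faradayE.
  by have [-> _ _ _ _] := S i; have [-> _ _ _ _] := S j; ring.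
- rewrite (fE _ _ i (c12 j)) (fE _ _ j (c12 i)) /rotation_curv ?mxDE faradayE wedgeE.
  have [z1 _ _ _ _] := skew3E (fun l => A l x 0 i) (s1 k).
  have [z2 _ _ _ _] := skew3E (fun l => A l x 0 j) (s1 k).
  have [z3 _ _ _ _] := skew3E (fun l => A l x 0 i) (s2 k).
  have [z4 _ _ _ _] := skew3E (fun l => A l x 0 j) (s2 k).
  by rewrite z1 z2 z3 z4; ring.
- rewrite (fE _ _ i (c21 j)) (fE _ _ j (c21 i)) !dA /rotation_curv ?mxDE faradayE wedgeE.
  have [z1 _ _ _ _] := skew3E (fun l => A l x 0 i) (s1 k).
  have [z2 _ _ _ _] := skew3E (fun l => A l x 0 j) (s1 k).
  have [z3 _ _ _ _] := skew3E (fun l => A l x 0 i) (s2 k).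
  have [z4 _ _ _ _] := skew3E (fun l => A l x 0 j) (s2 k).
  by rewrite z1 z2 z3 z4; ring.
Qed.

Notation FC := (frame_curv Q G).

Lemma base_frame_curv x a b k : U x ->
  [/\ FC x a b k k = fcomp (Q x) (faraday th x) a b,
      FC x a b (s1 k) (s2 k) = fcomp (Q x) (rotation_curv k x) a b &
      FC x a b (s2 k) (s1 k) = - fcomp (Q x) (rotation_curv k x) a b].
Proof.
move=> Ux.
have H := @frame_curv_Omega R 3 Q G x _ a b _ _ (uQ Ux)
  (curvature_frame oU sQ smooth_conn3 uQ conn3_frame Ux).
have C i j := conn3_curv i j k Ux.
rewrite !H /fcomp -mxNE -mulNmx -mulmxN; split; congr ((_ *m _ *m _) a b);
  apply/matrixP => i j; rewrite [LHS]mxE; have [c1 c2 c3] := C i j.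
- exact: c1.
- exact: c2.
- by rewrite [RHS]mxE; exact: c3.
Qed.

Definition rot_comp k l x : R := fcomp (Q x) (rotation_curv k x) (s1 l) (s2 l).
Definition far_comp l x : R := fcomp (Q x) (faraday th x) (s1 l) (s2 l).

Lemma rotation_curv_tr k x : (rotation_curv k x)^T = - rotation_curv k x.
Proof. by rewrite /rotation_curv linearD /= faraday_tr wedge_tr opprD. Qed.

(** This is the first Bianchi identity, the trace part of the curvature being
    [far_comp]. *)
Lemma base_bianchi1 k x : U x ->
  far_comp k x = rot_comp (s2 k) (s1 k) x - rot_comp (s1 k) (s2 k) x.
Proof.
move=> Ux; have sG y : U y -> forall l i j, G l i j y = G l j i y.
  by move=> _ l i j; apply: weyl_conn_sym => z; exact: gram_sym.
have := frame_bianchi Q k (s1 k) (s2 k) k oU Ux sG.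
have [_ c2 _] := base_frame_curv k (s1 k) (s1 k) Ux; move: c2; rewrite !cycE => ->.
have [-> _ _] := base_frame_curv (s1 k) (s2 k) k Ux.
have [_ _ c3] := base_frame_curv (s2 k) k (s2 k) Ux; move: c3; rewrite !cycE => ->.
by rewrite /far_comp /rot_comp !cycE; lra.
Qed.

Definition ric3 x : 'M[R]_3 := \matrix_(b, c) \sum_d FC x d b c d.

Lemma ric3E k x : U x ->
  [/\ ric3 x k k = - rot_comp (s1 k) (s1 k) x - rot_comp (s2 k) (s2 k) x,
      ric3 x (s1 k) (s2 k) = rot_comp (s1 k) (s2 k) x - far_comp k x &
      ric3 x (s2 k) (s1 k) = rot_comp (s2 k) (s1 k) x + far_comp k x].
Proof.
move=> Ux; have N a c d : FC x a a c d = 0 by have := frame_curv_anti Q G x a a c d; lra.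
have aF := faraday_tr th x; have aR l := rotation_curv_tr l x.
rewrite /rot_comp /far_comp !cycE; split; rewrite mxE (sum_cyc _ k) ?N ?add0r ?addr0.
- have [_ c2 _] := base_frame_curv (s1 k) k (s2 k) Ux; move: c2; rewrite !cycE => ->.
  have [_ _ c3] := base_frame_curv (s2 k) k (s1 k) Ux; move: c3; rewrite !cycE => ->.
  by rewrite (fcomp_anti _ k (s1 k) (aR (s2 k))); lra.
- have [_ c2 _] := base_frame_curv k (s1 k) (s1 k) Ux; move: c2; rewrite !cycE => ->.
  have [-> _ _] := base_frame_curv (s2 k) (s1 k) (s2 k) Ux.
  by rewrite (fcomp_anti _ (s1 k) (s2 k) aF).
- have [_ _ c3] := base_frame_curv k (s2 k) (s2 k) Ux; move: c3; rewrite !cycE => ->.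
  have [-> _ _] := base_frame_curv (s1 k) (s2 k) (s1 k) Ux.
  by rewrite (fcomp_anti _ (s2 k) k (aR (s2 k))); lra.
Qed.

Lemma base_scal x : U x ->
  scalar_curvature (gram Q) th x = - 2 * \sum_k rot_comp k k x.
Proof.
move=> Ux; rewrite (frame_scal (uQ Ux) (erefl G)).
transitivity (\sum_b ric3 x b b); first by apply: eq_bigr => b _; rewrite mxE.
rewrite !(sum_cyc _ 0); have [-> _ _] := ric3E 0 Ux.
have [-> _ _] := ric3E (s1 0) Ux; have [-> _ _] := ric3E (s2 0) Ux.
by rewrite !cycE; lra.
Qed.

Definition ew_at x := forall i j,
  2^-1 * (ricci G i j x + ricci G j i x)
  = 3%:R^-1 * scalar_curvature (gram Q) th x * gram Q x i j.

(** The Ricci tensor has the symmetric part of [rot_comp] as its off-diagonal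
    part, while the diagonal entries of [ric3] are sums of two of the three
    [rot_comp k k]. *)
Lemma ew_atP x : U x -> ew_at x <->
  forall k, rot_comp k k x = - 6^-1 * scalar_curvature (gram Q) th x
    /\ rot_comp (s1 k) (s2 k) x + rot_comp (s2 k) (s1 k) x = 0.
Proof.
move=> Ux; set s := scalar_curvature _ _ _.
have sE : s = - 2 * \sum_k rot_comp k k x by exact: base_scal.
have ewE : ew_at x <-> ric3 x + (ric3 x)^T = (2 / 3 * s)%:M.
  have RE i j : ricci G i j x = (Q x *m ric3 x *m (Q x)^T) i j.
    by rewrite (frame_ricci G (uQ Ux)).
  have RE' i j : ricci G j i x = (Q x *m (ric3 x)^T *m (Q x)^T) i j.
    rewrite RE; have -> : Q x *m (ric3 x)^T *m (Q x)^T = (Q x *m ric3 x *m (Q x)^T)^T.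
      by rewrite !trmx_mul trmxK mulmxA.
    by rewrite [RHS]mxE.
  split=> [H|H i j].
    have E : Q x *m (ric3 x + (ric3 x)^T) *m (Q x)^T = Q x *m (2 / 3 * s)%:M *m (Q x)^T.
      apply/matrixP => i j; rewrite mulmxDr mulmxDl mxDE -RE -RE'.
      rewrite mul_mx_scalar -scalemxAl mxZE -/(gram Q x).
      by have := H i j; rewrite -/s; move: (gram Q x i j) => h; lra.
    move: E => /(congr1 (fun Z => invmx (Q x) *m Z *m (invmx (Q x))^T)).
    rewrite !mulmxA !mulVmx ?uQ// !mul1mx -!mulmxA -!trmx_mul.
    by rewrite mulVmx ?uQ// trmx1 !mulmx1.
  have /matrixP/(_ i j) : Q x *m (ric3 x + (ric3 x)^T) *m (Q x)^T = Q x *m (2 / 3 * s)%:M *m (Q x)^T.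
    by rewrite H.
  rewrite mulmxDr mulmxDl mxDE -RE -RE' mul_mx_scalar -scalemxAl mxZE -/(gram Q x) -/s.
  by move: (gram Q x i j) => h; lra.
apply: (iff_trans ewE); split=> [H k|H].
  have /matrixP H' := H.
  have Hd l : 2 * ric3 x l l = 2 / 3 * s.
    by have := H' l l; rewrite mxDE ![_^T _ _]mxE ![_%:M _ _]mxE eqxx mulr1n => <-; lra.
  have := Hd k; have := Hd (s1 k); have := Hd (s2 k).
  have [-> r12 r21] := ric3E k Ux; have [-> _ _] := ric3E (s1 k) Ux; have [-> _ _] := ric3E (s2 k) Ux.
  have := H' (s1 k) (s2 k); rewrite mxDE ![_^T _ _]mxE ![_%:M _ _]mxE cyc_neq mulr0n r12 r21.
  move: sE; rewrite (sum_cyc _ k) !cycE.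
  by move=> h1 h2 h3 h4 h5; split; lra.
have Hk k : (ric3 x + (ric3 x)^T) k k = (2 / 3 * s)%:M k k /\
    (ric3 x + (ric3 x)^T) (s1 k) (s2 k) = (2 / 3 * s)%:M (s1 k) (s2 k).
  rewrite !mxDE ![_^T _ _]mxE ![_%:M _ _]mxE cyc_neq eqxx mulr0n mulr1n.
  have [-> -> ->] := ric3E k Ux; have [_ h2] := H k.
  by have [-> _] := H (s1 k); have [-> _] := H (s2 k); split; lra.
have sy (a b : 'I_3) : (ric3 x + (ric3 x)^T) b a = (ric3 x + (ric3 x)^T) a b.
  by rewrite !mxDE ![_^T _ _]mxE addrC.
apply/matrixP => k; apply: (cyc_ind (i := k)); first exact: (Hk k).1.
  by have [_] := Hk (s2 k); rewrite !cycE.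
rewrite sy; have [_] := Hk (s1 k); rewrite !cycE => ->.
by rewrite ![_%:M _ _]mxE eq_sym.
Qed.

End base.

(** * The Einstein-Weyl equation and its Bianchi identity *)

(** Leaves to [ring] or [field] the verification that an identity is a multiple,
    with the given factor [c], of a hypothesis. *)
Lemma linear_consequence (R : pzRingType) (c x y z : R) :
  x = y -> z = c * (x - y) -> z = 0.
Proof. by move=> -> ->; rewrite subrr mulr0. Qed.

Section three_forms.
Variables (R : realType) (U : set 'rV[R]_3).
Hypothesis oU : open U.
Implicit Types (X Y : 'rV[R]_3 -> 'M[R]_3) (a b : 'rV[R]_3 -> 'rV[R]_3).

(** The exterior derivative of a 2-form, as a multiple of the coordinate volume
    form; [prod3] is likewise the product of a 2-form with a 1-form. *)
Definition d3 X x : R := \sum_i partial i (fun y => X y (s1 i) (s2 i)) x.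

Definition prod3 (X : 'M[R]_3) (b : 'rV[R]_3) : R := \sum_i X (s1 i) (s2 i) * b 0 i.

Lemma prod3_wedge (a b c : 'rV[R]_3) : prod3 (wedge a b) c =
  (a 0 (s1 0) * b 0 (s2 0) - a 0 (s2 0) * b 0 (s1 0)) * c 0 0
  + (a 0 (s2 0) * b 0 0 - a 0 0 * b 0 (s2 0)) * c 0 (s1 0)
  + (a 0 0 * b 0 (s1 0) - a 0 (s1 0) * b 0 0) * c 0 (s2 0).
Proof. by rewrite /prod3 (sum_cyc _ 0) !cycE !wedgeE. Qed.

Lemma prod3D (X Y : 'M[R]_3) c : prod3 (X + Y) c = prod3 X c + prod3 Y c.
Proof. by rewrite /prod3 -big_split; apply: eq_bigr => i _; rewrite mxDE mulrDl. Qed.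
Lemma prod3N (X : 'M[R]_3) c : prod3 (- X) c = - prod3 X c.
Proof. by rewrite /prod3 -sumrN; apply: eq_bigr => i _; rewrite mxNE mulNr. Qed.
Lemma prod3Z r (X : 'M[R]_3) c : prod3 (r *: X) c = r * prod3 X c.
Proof. by rewrite /prod3 mulr_sumr; apply: eq_bigr => i _; rewrite mxZE mulrA. Qed.

Lemma prod3r_lin (X : 'M[R]_3) (c d : 'rV[R]_3) (r : R) : prod3 X (c + r *: d) = prod3 X c + r * prod3 X d.
Proof.
rewrite /prod3 mulr_sumr -big_split; apply: eq_bigr => i _.
by rewrite mxDE mxZE mulrDr mulrCA.
Qed.

Lemma eq_on_d3 X Y x : (forall y, U y -> X y = Y y) -> U x -> d3 X x = d3 Y x.
Proof.
move=> XY Ux; apply: eq_bigr => i _.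
by apply: (eq_on_partial _ oU Ux) => y Uy; rewrite XY.
Qed.

Lemma d3D X Y x : smooth_mx_on U X -> smooth_mx_on U Y -> U x ->
  d3 (fun y => X y + Y y) x = d3 X x + d3 Y x.
Proof.
move=> sX sY Ux; rewrite /d3 -big_split; apply: eq_bigr => i _ /=.
rewrite -partialD; [|exact: smooth_mx_diff sX Ux|exact: smooth_mx_diff sY Ux].
by congr (partial i _ x); apply/funext => y; rewrite mxE.
Qed.

Lemma d3Z f X x : smooth_on U f -> smooth_mx_on U X -> U x ->
  d3 (fun y => f y *: X y) x = prod3 (X x) (differential f x) + f x * d3 X x.
Proof.
move=> sf sX Ux; rewrite /d3 mulr_sumr -big_split; apply: eq_bigr => i _ /=.
rewrite [differential _ _ _ _]mxE [X in _ = X + _]mulrC.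
rewrite -(@partialM _ _ f (fun y => X y (s1 i) (s2 i))); [|exact: smooth_on_diff sf Ux|exact: smooth_mx_diff sX Ux].
by congr (partial i _ x); apply/funext => y; rewrite mxE.
Qed.

Lemma d3_faraday a x : smooth_mx_on U a -> U x -> d3 (faraday a) x = 0.
Proof.
move=> sa Ux.
have D i j k : partial i (fun y => faraday a y j k) x
    = partial i (partial j (fun y => a y 0 k)) x - partial i (partial k (fun y => a y 0 j)) x.
  rewrite -partialB; first by congr (partial i _ x); apply/funext => y; rewrite faradayE.
    exact: smooth_on_diff (smooth_on_partial j (sa 0 k)) Ux.
  exact: smooth_on_diff (smooth_on_partial k (sa 0 j)) Ux.
rewrite /d3 (sum_cyc _ 0) !D !cycE.
rewrite (partialC oU (sa 0 (s2 0)) Ux 0 (s1 0)) (partialC oU (sa 0 (s1 0)) Ux 0 (s2 0)).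
rewrite (partialC oU (sa 0 0) Ux (s1 0) (s2 0)).
move: (partial _ _ _) (partial _ _ _) (partial _ _ _) => p1 p2 p3; ring.
Qed.

Lemma smooth_wedge n (V : set 'rV[R]_n) (a b : 'rV[R]_n -> 'rV[R]_n) : open V ->
  smooth_mx_on V a -> smooth_mx_on V b -> smooth_mx_on V (fun y => wedge (a y) (b y)).
Proof.
move=> oV sa sb i j.
have := smooth_onB oV (smooth_onM oV (sa 0 i) (sb 0 j)) (smooth_onM oV (sa 0 j) (sb 0 i)).
by apply: eq_smooth_on => // x _; rewrite wedgeE.
Qed.

Lemma smooth_faraday n (V : set 'rV[R]_n) (a : 'rV[R]_n -> 'rV[R]_n) : open V ->
  smooth_mx_on V a -> smooth_mx_on V (faraday a).
Proof.
move=> oV sa i j.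
have := smooth_onB oV (smooth_on_partial i (sa 0 j)) (smooth_on_partial j (sa 0 i)).
by apply: eq_smooth_on => // x _; rewrite faradayE.
Qed.

Lemma d3_wedge a b x : smooth_mx_on U a -> smooth_mx_on U b -> U x ->
  d3 (fun y => wedge (a y) (b y)) x = prod3 (faraday a x) (b x) - prod3 (faraday b x) (a x).
Proof.
move=> sa sb Ux.
have da k : differentiable (fun y => a y 0 k) x by exact: smooth_mx_diff sa Ux.
have db k : differentiable (fun y => b y 0 k) x by exact: smooth_mx_diff sb Ux.
have D i j k : partial i (fun y => wedge (a y) (b y) j k) x
    = partial i (fun y => a y 0 j) x * b x 0 k + a x 0 j * partial i (fun y => b y 0 k) x
      - (partial i (fun y => a y 0 k) x * b x 0 j + a x 0 k * partial i (fun y => b y 0 j) x).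
  rewrite -!(@partialM _ _ (fun y => a y 0 _) (fun y => b y 0 _))//.
  rewrite -(@partialB _ _ (fun y => a y 0 j * b y 0 k) (fun y => a y 0 k * b y 0 j)).
  - by congr (partial i _ x); apply/funext => y; rewrite wedgeE.
  - by apply: (@differentiableM _ _ (fun y => a y 0 j) (fun y => b y 0 k)).
  - by apply: (@differentiableM _ _ (fun y => a y 0 k) (fun y => b y 0 j)).
rewrite /d3 /prod3 !(sum_cyc _ 0) !D !faradayE !cycE.
have gen (P : 'I_3 -> 'I_3 -> R) (P' : 'I_3 -> 'I_3 -> R) : 
  forall (u v : 'I_3 -> R),
  P 0 (s1 0) * v (s2 0) + u (s1 0) * P' 0 (s2 0) - (P 0 (s2 0) * v (s1 0) + u (s2 0) * P' 0 (s1 0))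
  + (P (s1 0) (s2 0) * v 0 + u (s2 0) * P' (s1 0) 0 - (P (s1 0) 0 * v (s2 0) + u 0 * P' (s1 0) (s2 0)))
  + (P (s2 0) 0 * v (s1 0) + u 0 * P' (s2 0) (s1 0) - (P (s2 0) (s1 0) * v 0 + u (s1 0) * P' (s2 0) 0))
  = (P (s1 0) (s2 0) - P (s2 0) (s1 0)) * v 0 + (P (s2 0) 0 - P 0 (s2 0)) * v (s1 0)
    + (P 0 (s1 0) - P (s1 0) 0) * v (s2 0)
    - ((P' (s1 0) (s2 0) - P' (s2 0) (s1 0)) * u 0 + (P' (s2 0) 0 - P' 0 (s2 0)) * u (s1 0)
    + (P' 0 (s1 0) - P' (s1 0) 0) * u (s2 0)).
  by move=> u v; ring.
exact: (gen (fun i j => partial i (fun y => a y 0 j) x) (fun i j => partial i (fun y => b y 0 j) x)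
  (a x 0) (b x 0)).
Qed.

End three_forms.

Section base_einstein_weyl.
Variables (R : realType) (U : set 'rV[R]_3).
Variables (Q : 'rV[R]_3 -> 'M[R]_3) (th : 'rV[R]_3 -> 'rV[R]_3).
Variable A : 'I_3 -> 'rV[R]_3 -> 'rV[R]_3.
Notation e := (coframe Q).
Notation hs k x := (wedge (e (s1 k) x) (e (s2 k) x)).
Notation F := (rotation_curv A).
Notation f := (far_comp Q th).
Notation rc := (rot_comp Q A).
Hypotheses (oU : open U) (sQ : smooth_mx_on U Q) (sth : smooth_mx_on U th).
Hypothesis uQ : forall x, U x -> Q x \in unitmx.
Hypothesis sA : forall k, smooth_mx_on U (A k).
Hypothesis tors : structure_eq U Q th A.
Notation sc := (scalar_curvature (gram Q) th).

(** The 1-form [*F^B], by [star3_faraday]. *)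
Definition dual_faraday x : 'rV[R]_3 := \sum_l f l x *: e l x.

Lemma expand_form1 x u : Q x \in unitmx ->
  u = \sum_k fcomp1 (Q x) u k *: e k x.
Proof.
move=> ux; apply: (fcomp1_inj ux) => a; rewrite fcomp1_sum (bigD1 a)//=.
rewrite fcomp1Z fcomp1_coframe// eqxx mulr1 big1 ?addr0// => k ka.
by rewrite fcomp1Z fcomp1_coframe// (negPf ka) mulr0.
Qed.

Lemma expand_form2 x X : Q x \in unitmx -> X^T = - X ->
  X = \sum_l fcomp (Q x) X (s1 l) (s2 l) *: hs l x.
Proof.
move=> ux aX; apply: (fcomp_inj ux) => a b.
pose Y := fcomp (Q x) X; have aY c d : Y d c = - Y c d by exact: fcomp_anti.
rewrite (sum_cyc _ a) !fcompE !fcomp1_coframe// !cycE -/(Y a b).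
rewrite -/(Y (s1 a) (s2 a)) -/(Y (s2 a) a) -/(Y a (s1 a)).
move: (Y) aY => {}Y aY; have a0 : Y a a = 0 by have := aY a a; lra.
move: b; apply: (cyc_ind (i := a)); rewrite ?eqxx ?cyc_neq ?a0 ?(aY a (s2 a)) /=.
- ring.
- ring.
- ring.
Qed.

Lemma faraday_expand x : U x -> faraday th x = \sum_l f l x *: hs l x.
Proof. by move=> Ux; rewrite {1}(expand_form2 (uQ Ux) (faraday_tr _ _)). Qed.

(** On an Einstein-Weyl space [rot_comp] is the sum of a multiple of the identity
    and a skew matrix, which is given by the first Bianchi identity. *)
Lemma ew_rotation x : U x -> ew_at Q th x -> forall k,
  F k x = (- 6^-1 * sc x) *: hs k x - 2^-1 *: wedge (dual_faraday x) (e k x).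
Proof.
move=> Ux /(ew_atP oU sQ sth uQ sA tors Ux) H k; have ux := uQ Ux.
have B l := base_bianchi1 oU sQ sth uQ sA tors l Ux.
have dE c : fcomp1 (Q x) (dual_faraday x) c = f c x.
  rewrite fcomp1_sum (bigD1 c)//= fcomp1Z fcomp1_coframe// eqxx mulr1.
  by rewrite big1 ?addr0// => j jc; rewrite fcomp1Z fcomp1_coframe// (negPf jc) mulr0.
have r0 : fcomp (Q x) (F k x) (s1 k) (s2 k) = - 6^-1 * sc x by have [<- _] := H k.
have r1 : fcomp (Q x) (F k x) (s2 k) k = - 2^-1 * f (s2 k) x.
  have [_ h] := H (s2 k); have := B (s2 k); move: h; rewrite !cycE /rot_comp !cycE; lra.
have r2 : fcomp (Q x) (F k x) k (s1 k) = 2^-1 * f (s1 k) x.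
  have [_ h] := H (s1 k); have := B (s1 k); move: h; rewrite !cycE /rot_comp !cycE; lra.
rewrite [LHS](expand_form2 ux (rotation_curv_tr A k x)) (sum_cyc _ k) !cycE r0 r1 r2.
apply: (fcomp_inj ux) => a b; rewrite !fcompE !dE !fcomp1_coframe//.
move: (sc x) => s; pose g l := f l x; rewrite -!/(g _); move: (g) => {}g.
by move: a b; apply: (cyc_ind (i := k)); apply: (cyc_ind (i := k));
  rewrite ?eqxx ?cyc_neq /=; ring.
Qed.

(** The trace, the skew part and the symmetric tracefree part of [rot_comp] can
    be read off from such an expression. *)
Lemma rotation_ew x (a : R) X : U x ->
  (forall k, F k x = a *: hs k x + wedge X (e k x)) ->
  [/\ ew_at Q th x, sc x = - 6 * a & dual_faraday x = - 2 *: X].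
Proof.
move=> Ux H; have ux := uQ Ux; pose X' := fcomp1 (Q x) X.
have rE k l : rc k l x = a * (k == l)%:R + (X' (s1 l) * (k == s2 l)%:R - X' (s2 l) * (k == s1 l)%:R).
  rewrite /rot_comp H !fcompE !fcomp1_coframe// -/(X' _) -/(X' _); congr (a * _ + _).
  by move: k; apply: (cyc_ind (i := l)); rewrite ?cycE ?eqxx ?cyc_neq /=; ring.
have rkk k : rc k k x = a by rewrite rE eqxx !cyc_neq /=; ring.
have r12 k : rc (s1 k) (s2 k) x = X' k.
  by rewrite rE !cycE ?eqxx !cyc_neq /=; ring.
have r21 k : rc (s2 k) (s1 k) x = - X' k.
  by rewrite rE !cycE ?eqxx !cyc_neq /=; ring.
have sE : sc x = - 6 * a.
  by rewrite (base_scal oU sQ sth uQ sA tors Ux) (sum_cyc _ 0) !rkk; ring.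
split=> //.
  apply/(ew_atP oU sQ sth uQ sA tors Ux) => k; rewrite rkk r12 r21 sE subrr; split=> //.
  by field.
rewrite {1}[X](expand_form1 X ux) scaler_sumr; apply: eq_bigr => l _.
by rewrite scalerA (base_bianchi1 oU sQ sth uQ sA tors l Ux) r12 r21 /X'; congr (_ *: _); ring.
Qed.

(** The sign [- o] of the determinant is that for which [star3 o] maps
    [e (s1 k) /\ e (s2 k)] to [e k]: in the normalisation of the star its square
    is [- 1] on a 3-manifold. *)
Lemma star3_faraday (o : R) x : U x -> o * o = 1 -> \det (Q x) = - o ->
  star3 o (gram Q x) (faraday th x) = dual_faraday x.
Proof.
move=> Ux oo dQ; apply/rowP => i; rewrite star3E ?faraday_tr// summxE.
have FE j : faraday th x (s1 j) (s2 j) = \sum_l f l x *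
    (Q x (s1 j) (s1 l) * Q x (s2 j) (s2 l) - Q x (s2 j) (s1 l) * Q x (s1 j) (s2 l)).
  rewrite {1}(faraday_expand Ux) summxE; apply: eq_bigr => l _.
  by rewrite mxZE wedgeE !coframeE.
under eq_bigr => j _ do rewrite FE [gram _ _ _ _]mxE mulr_suml.
rewrite exchange_big /= mulr_sumr; apply: eq_bigr => m _.
rewrite mxZE coframeE.
have C l : \sum_j Q x j m * (Q x (s1 j) (s1 l) * Q x (s2 j) (s2 l)
    - Q x (s2 j) (s1 l) * Q x (s1 j) (s2 l)) = (m == l)%:R * \det (Q x).
  move: l; apply: (cyc_ind (i := m)).
  - by rewrite eqxx mul1r (det3_cyc (Q x) m).
  - rewrite neq_s1 mul0r (sum_cyc _ 0) !cycE; move: (Q x) => q; ring.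
  - rewrite neq_s2 mul0r (sum_cyc _ 0) !cycE; move: (Q x) => q; ring.
transitivity (- o * (Q x i m * \sum_l f l x * ((m == l)%:R * \det (Q x)))).
  congr (_ * _); rewrite mulr_sumr.
  under [RHS]eq_bigr => l _ do rewrite -C mulr_sumr mulr_sumr.
  rewrite exchange_big /=; apply: eq_bigr => j _; rewrite mulr_sumr.
  apply: eq_bigr => l _; rewrite [(Q x)^T _ _]mxE.
  move: (f l x) (Q x) => g q; ring.
rewrite (bigD1 m)//= eqxx mul1r big1 ?addr0 => [|l lm]; last first.
  by rewrite eq_sym (negPf lm) mul0r mulr0.
rewrite dQ; move: (f m x) (Q x i m) => g q.
by transitivity (g * q * (o * o)); [ring|rewrite oo mulr1].
Qed.

Hypothesis ew : forall x, U x -> ew_at Q th x.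

Lemma smooth_fcomp X a b : smooth_mx_on U X ->
  smooth_on U (fun x => fcomp (Q x) (X x) a b).
Proof.
move=> sX; have sE : smooth_mx_on U (fun x => invmx (Q x)) by exact: smooth_invmx.
have := smooth_mx_mul oU (smooth_mx_mul oU sE sX) (smooth_mx_tr oU sE).
by move=> /(_ a b).
Qed.

Lemma smooth_rotation k : smooth_mx_on U (F k).
Proof. by apply: smooth_mxD => //; [exact: smooth_faraday|exact: smooth_wedge]. Qed.

Lemma smooth_sc : smooth_on U sc.
Proof.
have s1 : smooth_on U (fun x => - 2 * \sum_k rc k k x).
  apply: smooth_onM => //; first exact: smooth_on_cst.
  by apply: smooth_on_sum => // k; apply: smooth_fcomp; exact: smooth_rotation.
by apply: eq_smooth_on s1 => // x Ux; rewrite (base_scal oU sQ sth uQ sA tors Ux).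
Qed.

Lemma smooth_dual_faraday : smooth_mx_on U dual_faraday.
Proof.
move=> i j.
have : smooth_on U (fun x => \sum_l f l x * e l x i j).
  apply: smooth_on_sum => // l; apply: smooth_onM => //; last exact: smooth_coframe.
  by apply: smooth_fcomp; exact: smooth_faraday.
by apply: eq_smooth_on => // x _; rewrite summxE; apply: eq_bigr => l _; rewrite mxZE.
Qed.

(** The derivative of the scalar curvature, which has weight [- 2]. *)
Definition dscal x : 'rV[R]_3 := differential sc x - (2 * sc x) *: th x.

(** Differentiating the curvature forms [F k] and inserting their values from
    [ew_rotation] gives three equations, one for each [k], between [dscal] and
    the derivative of [dual_faraday]. *)
Lemma base_bianchi2 x : U x ->
  faraday dual_faraday x - wedge (th x) (dual_faraday x)
  = - 3^-1 *: \sum_k fcomp1 (Q x) (dscal x) k *: hs k x.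
Proof.
move=> Ux; have ux := uQ Ux.
have se k : smooth_mx_on U (e k) by exact: smooth_coframe.
have sd := smooth_dual_faraday.
have L k : d3 (F k) x = prod3 (faraday (A (s1 k)) x) (A (s2 k) x)
                        - prod3 (faraday (A (s2 k)) x) (A (s1 k) x).
  rewrite (d3D _ _ Ux); [|exact: smooth_faraday|exact: smooth_wedge].
  by rewrite (d3_faraday oU (sA k) Ux) add0r (d3_wedge (sA _) (sA _) Ux).
have Rr k : d3 (F k) x = - 6^-1 * prod3 (hs k x) (differential sc x)
    - 6^-1 * sc x * (prod3 (faraday (e (s1 k)) x) (e (s2 k) x)
                     - prod3 (faraday (e (s2 k)) x) (e (s1 k) x))
    - 2^-1 * (prod3 (faraday dual_faraday x) (e k x)
              - prod3 (faraday (e k) x) (dual_faraday x)).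
  pose g1 (y : 'rV[R]_3) := - 6^-1 * sc y; pose g2 (y : 'rV[R]_3) : R := - 2^-1.
  have sg1 : smooth_on U g1.
    by apply: smooth_onM => //; [exact: smooth_on_cst|exact: smooth_sc].
  have sg2 : smooth_on U g2 by exact: smooth_on_cst.
  have sw1 : smooth_mx_on U (fun y => hs k y) by exact: smooth_wedge.
  have sw2 : smooth_mx_on U (fun y => wedge (dual_faraday y) (e k y)) by exact: smooth_wedge.
  rewrite (eq_on_d3 oU (Y := fun y => g1 y *: hs k y + g2 y *: wedge (dual_faraday y) (e k y)))//; last first.
    by move=> y Uy; rewrite (ew_rotation Uy (ew Uy)) /g2 scaleNr.
  rewrite (d3D _ _ Ux); [|exact: smooth_mxZ|exact: smooth_mxZ].
  rewrite (d3Z sg1 sw1 Ux) (d3Z sg2 sw2 Ux) (d3_wedge (se _) (se _) Ux) (d3_wedge sd (se _) Ux).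
  have -> : differential g1 x = - 6^-1 *: differential sc x.
    apply/rowP => i; rewrite mxZE !mxE.
    rewrite (@partialM _ _ (fun=> - 6^-1) sc)//; last exact: smooth_on_diff smooth_sc Ux.
    by rewrite (partial_cst (- 6^-1) i x) mul0r add0r.
  have -> : differential g2 x = 0.
    by apply/rowP => i; rewrite !mxE; exact: partial_cst.
  have z0 X : prod3 X 0 = 0 by rewrite /prod3 big1// => i _; rewrite mxE mulr0.
  have zZ X r c : prod3 X (r *: c) = r * prod3 X c.
    by have := prod3r_lin X 0 c r; rewrite z0 !add0r.
  by rewrite z0 zZ /g1 /g2; move: (prod3 _ _) (prod3 _ _) (prod3 _ _) (prod3 _ _) (prod3 _ _) (sc x) => *; ring.
pose sg k := fcomp1 (Q x) (dscal x) k.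
have dsE : differential sc x = (2 * sc x) *: th x + \sum_k sg k *: e k x.
  by rewrite -(expand_form1 _ ux) /dscal addrC subrK.
have FA l : faraday (A l) x = F l x - wedge (A (s1 l) x) (A (s2 l) x) by rewrite addrK.
have key k : prod3 (faraday dual_faraday x - wedge (th x) (dual_faraday x)
    + 3^-1 *: \sum_l sg l *: hs l x) (e k x) = 0.
  have H := L k; rewrite Rr !FA !(ew_rotation Ux (ew Ux)) !(tors Ux) in H.
  rewrite !cycE in H.
  have dsi i : differential sc x 0 i = 2 * sc x * th x 0 i
      + (sg k * e k x 0 i + sg (s1 k) * e (s1 k) x 0 i + sg (s2 k) * e (s2 k) x 0 i).
    by rewrite dsE mxDE mxZE (sum_cyc _ k) !mxDE !mxZE.
  rewrite (sum_cyc _ k) !cycE.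
  rewrite !(prod3D, prod3N, prod3Z) !prod3_wedge !dsi in H *.
  move: H; move: (prod3 (faraday dual_faraday x) (e k x)) (dual_faraday x) (th x).
  move: (e k x) (e (s1 k) x) (e (s2 k) x) (A k x) (A (s1 k) x) (A (s2 k) x).
  move: (sg k) (sg (s1 k)) (sg (s2 k)) (sc x) => g0 g1 g2 s e0 e1 e2 a0 a1 a2 p d t H.
  by apply: (linear_consequence (c := - 2) H); field.
set X := _ + _ in key; have aX : X^T = - X.
  apply/matrixP => i j; rewrite mxE mxNE /X !(mxDE, mxNE, mxZE) !summxE.
  have -> : \sum_l (sg l *: hs l x) j i = - \sum_l (sg l *: hs l x) i j.
    rewrite -sumrN; apply: eq_bigr => l _; rewrite !mxZE !wedgeE; ring.
  rewrite (faraday_anti _ x i j) !wedgeE; move: (\sum_l _) (faraday _ _ _ _) => S p; ring.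
suff X0 : X = 0.
  apply/eqP; rewrite -subr_eq0 scaleNr opprK; apply/eqP; exact: X0.
rewrite (expand_form2 ux aX).
have dQ : \det (Q x) != 0 by rewrite -unitfE -unitmxE; exact: ux.
have hsE k l : prod3 (hs l x) (e k x) = (k == l)%:R * \det (Q x).
  rewrite prod3_wedge !coframeE; move: k; apply: (cyc_ind (i := l)).
  - rewrite eqxx (det3_cyc (Q x) l) (sum_cyc _ 0) !cycE /= mul1r; move: (Q x) => q; ring.
  - rewrite cyc_neq /= mul0r; move: (Q x) => q; ring.
  - rewrite cyc_neq /= mul0r; move: (Q x) => q; ring.
apply: big1 => l _; suff -> : fcomp (Q x) X (s1 l) (s2 l) = 0 by rewrite scale0r.
have := key l; rewrite {1}(expand_form2 ux aX) (sum_cyc _ l) !(prod3D, prod3Z) !hsE.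
rewrite eqxx !cyc_neq !mul0r !mulr0 !addr0 mul1r => /eqP.
by rewrite mulf_eq0 (negPf dQ) orbF => /eqP.
Qed.

End base_einstein_weyl.

(** * Selfdual Einstein curvature in dimension four *)

Section curvature_algebra.
Variables (R : realType) (T : 'I_4 -> 'I_4 -> 'I_4 -> 'I_4 -> R).
Hypothesis antiL : forall a b c d, T b a c d = - T a b c d.
Hypothesis antiR : forall a b c d, T a b d c = - T a b c d.
Hypothesis bianchi : forall a b c d, T a b c d + T b c a d + T c a b d = 0.

(** The classical octahedron argument: a combination of instances of the cyclic
    identity. *)
Lemma pair_symmetry a b c d : T a b c d = T c d a b.
Proof.
have b1 := bianchi a b c d; have b2 := bianchi b c d a.
have b3 := bianchi c d a b; have b4 := bianchi d a b c.
have e1 := antiR b c a d; have e2 := antiR c d a b.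
have e3 := antiL b d c a; have e3' := antiR b d a c.
have e4 := antiL c a d b; have e4' := antiR c a b d.
have e5 := antiL a d c b; have e5' := antiR a d b c.
have e6 := antiL a d b c; have e7 := antiR a b c d.
lra.
Qed.

Definition ric4 b c : R := \sum_d T d b c d.

(** The antiselfdual 2-form [e_i /\ e_j + e_k /\ eta], evaluated on the frame
    vectors [a] and [b]. *)
Definition asd_form (k : 'I_3) (a b : 'I_4) : R :=
  (hh (s1 k) == a)%:R * (hh (s2 k) == b)%:R - (hh (s1 k) == b)%:R * (hh (s2 k) == a)%:R
  + ((hh k == a)%:R * (vv == b)%:R - (hh k == b)%:R * (vv == a)%:R).

(** The curvature of the bundle of antiselfdual 2-forms; see [asd_curvE]. *)
Definition asd_curv (k : 'I_3) (a b : 'I_4) : R :=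
  T a b (hh (s1 k)) (hh (s2 k)) + T a b (hh k) vv.

(** The curvature with the part of constant sectional curvature removed; for an
    Einstein metric and the right [m] this is the Weyl tensor. *)
Definition weyl4 (m : R) (a b c d : 'I_4) : R :=
  T a b c d + m * ((a == d)%:R * (b == c)%:R - (a == c)%:R * (b == d)%:R).

Lemma weyl4_asd m k a b :
  weyl4 m (hh (s1 k)) (hh (s2 k)) a b + weyl4 m (hh k) vv a b
  = asd_curv k a b - m * asd_form k a b.
Proof.
rewrite /weyl4 /asd_curv /asd_form !(pair_symmetry _ _ a b).
move: (T _ _ _ _) (T _ _ _ _) => t1 t2.
move: ((hh (s1 k) == a)%:R : R) ((hh (s2 k) == a)%:R : R) ((hh (s1 k) == b)%:R : R)
  ((hh (s2 k) == b)%:R : R) ((hh k == b)%:R : R) ((vv == a)%:R : R) ((hh k == a)%:R : R)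
  ((vv == b)%:R : R) => *.
by ring.
Qed.

Lemma hh_eq j k : (hh j == hh k) = (j == k).
Proof. by rewrite -!val_eqE. Qed.
Lemma hv_eq j : (hh j == vv) = false.
Proof. by rewrite -val_eqE /=; case: j => -[|[|[|//]]]. Qed.
Lemma vh_eq j : (vv == hh j) = false.
Proof. by rewrite eq_sym hv_eq. Qed.

(** By pair symmetry the curvature is a symmetric operator on 2-forms, in blocks
    with respect to the two types of forms: an antiselfdual block which is a
    multiple of the identity, and a vanishing mixed block, which is the
    tracefree Ricci tensor.  The Bianchi identity equates the traces of the two
    diagonal blocks. *)
Lemma ric4_asd m : (forall k a b, asd_curv k a b = m * asd_form k a b) ->
  forall b c, ric4 b c = - 3 * m * (b == c)%:R.
Proof.
move=> H.
have T0 a c d : T a a c d = 0 by have := antiL a a c d; lra.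
have T0' a b c : T a b c c = 0 by have := antiR a b c c; lra.
(* the blocks of the curvature operator *)
pose al j k := T (hh (s1 j)) (hh (s2 j)) (hh (s1 k)) (hh (s2 k)).
pose be j k := T (hh (s1 j)) (hh (s2 j)) (hh k) vv.
pose de j k := T (hh j) vv (hh k) vv.
have ab j k : al j k + be j k = m * (k == j)%:R.
  have := H k (hh (s1 j)) (hh (s2 j)); rewrite /asd_curv /asd_form -/(al j k) -/(be j k) => ->.
  rewrite !(hh_eq, hv_eq, vh_eq); congr (_ * _).
  by move: k; apply: (cyc_ind (i := j)); rewrite ?cycE ?eqxx ?cyc_neq /=; ring.
have bd j k : be k j + de j k = m * (k == j)%:R.
  have := H k (hh j) vv; rewrite /asd_curv /asd_form pair_symmetry -/(be k j) -/(de j k) => ->.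
  by rewrite !(hh_eq, hv_eq, vh_eq) eqxx /=; ring.
have trb : be 0 0 + be (s1 0) (s1 0) + be (s2 0) (s2 0) = 0.
  have := bianchi (hh 0) (hh (s1 0)) (hh (s2 0)) vv.
  by rewrite /be !cycE; lra.
have als j k : al j k = al k j by exact: pair_symmetry.
have des j k : de j k = de k j by exact: pair_symmetry.
have tr k : al k k + al (s1 k) (s1 k) + al (s2 k) (s2 k) = 3 * m.
  have E : \sum_j al j j = 3 * m.
    rewrite (sum_cyc _ 0); have := ab 0 0; have := ab (s1 0) (s1 0); have := ab (s2 0) (s2 0).
    by rewrite !eqxx mulr1; move: trb; lra.
  by rewrite -(sum_cyc (fun j => al j j)).
have dea j k : de j k = al j k.
  by have := ab j k; have := ab k j; have := bd j k; rewrite (als k j) (eq_sym j k); lra.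
have r1 k : ric4 (hh k) (hh k) = - 3 * m.
  rewrite /ric4 (sum_hv _ k) T0 add0r.
  have -> : T (hh (s1 k)) (hh k) (hh k) (hh (s1 k)) = - al (s2 k) (s2 k).
    by rewrite antiL /al !cycE.
  have -> : T (hh (s2 k)) (hh k) (hh k) (hh (s2 k)) = - al (s1 k) (s1 k).
    by rewrite antiR /al !cycE.
  have -> : T vv (hh k) (hh k) vv = - al k k by rewrite antiL -dea.
  by have := tr k; lra.
have r2 k : ric4 (hh (s1 k)) (hh (s2 k)) = 0 /\ ric4 (hh (s2 k)) (hh (s1 k)) = 0.
  rewrite /ric4 !(sum_hv _ k) !T0 !T0' !addr0.
  have -> : T (hh k) (hh (s1 k)) (hh (s2 k)) (hh k) = al (s2 k) (s1 k) by rewrite /al !cycE.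
  have -> : T (hh k) (hh (s2 k)) (hh (s1 k)) (hh k) = al (s1 k) (s2 k).
    by rewrite antiL antiR opprK /al !cycE.
  have -> : T vv (hh (s1 k)) (hh (s2 k)) vv = - al (s1 k) (s2 k) by rewrite antiL -dea.
  have -> : T vv (hh (s2 k)) (hh (s1 k)) vv = - al (s2 k) (s1 k) by rewrite antiL -dea.
  by rewrite (als (s2 k)) subrr.
have bes j k : be j k = be k j.
  by have := ab j k; have := ab k j; rewrite (als k j) (eq_sym j k); lra.
have r3 k : ric4 (hh k) vv = 0 /\ ric4 vv (hh k) = 0.
  rewrite /ric4 !(sum_hv _ k) !T0 !T0' !addr0 !add0r.
  have -> : T (hh (s1 k)) (hh k) vv (hh (s1 k)) = be (s2 k) (s1 k).
    by rewrite antiL antiR opprK /be !cycE.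
  have -> : T (hh (s2 k)) (hh k) vv (hh (s2 k)) = - be (s1 k) (s2 k).
    by rewrite antiR /be !cycE.
  have -> : T (hh (s1 k)) vv (hh k) (hh (s1 k)) = be (s2 k) (s1 k).
    by rewrite pair_symmetry /be !cycE.
  have -> : T (hh (s2 k)) vv (hh k) (hh (s2 k)) = - be (s1 k) (s2 k).
    by rewrite pair_symmetry antiL /be !cycE.
  by rewrite (bes (s2 k)); split; lra.
have r4 : ric4 vv vv = - 3 * m.
  rewrite /ric4 (sum_hv _ 0) T0 addr0.
  have E j : T (hh j) vv vv (hh j) = - al j j by rewrite antiR -dea.
  by rewrite !E; have := tr 0; lra.
apply: hv_ind => [k|]; apply: hv_ind => [l|].
- move: l; apply: (cyc_ind (i := k)); rewrite hh_eq ?eqxx ?cyc_neq ?mulr1 ?mulr0 //.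
    by have [] := r2 (s2 k); rewrite !cycE.
  by have [] := r2 (s1 k); rewrite !cycE.
- by rewrite hv_eq mulr0; have [] := r3 k.
- by rewrite vh_eq mulr0; have [] := r3 l.
- by rewrite eqxx mulr1.
Qed.

End curvature_algebra.

(** * Connections in dimension four and antiselfdual forms *)

Section connection_four.
Variables (R : realType) (U : set 'rV[R]_4).
Variables (P : 'rV[R]_4 -> 'M[R]_4) (psi : 'rV[R]_4 -> 'rV[R]_4).
Variables (X Y : 'I_3 -> 'rV[R]_4 -> 'rV[R]_4).
Notation e k := (coframe P (hh k)).
Notation eta := (coframe P vv).

(** The first structure equation for the connection with trace part [psi],
    whose [so(4)] part consists of the rotations [X] of the horizontal vectors
    and of the components [Y] mixing them with the vertical one. *)
Definition structure_eq4 := forall x, U x ->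
  (forall k, faraday (e k) x = wedge (X (s2 k) x) (e (s1 k) x)
     - wedge (X (s1 k) x) (e (s2 k) x) + wedge (Y k x) (eta x) - wedge (psi x) (e k x))
  /\ faraday eta x = - \sum_k wedge (Y k x) (e k x) - wedge (psi x) (eta x).

Definition skew4 (i : 'I_4) x : 'M[R]_4 :=
  block_mx (skew3 (fun k => X k x 0 i)) (\col_k Y k x 0 i) (- (\row_k Y k x 0 i)) (0 : 'M[R]_1).

Definition conn4 (i : 'I_4) x : 'M[R]_4 := (psi x 0 i)%:M + skew4 i x.

Hypotheses (oU : open U) (sP : smooth_mx_on U P) (spsi : smooth_mx_on U psi).
Hypothesis uP : forall x, U x -> P x \in unitmx.
Hypotheses (sX : forall k, smooth_mx_on U (X k)) (sY : forall k, smooth_mx_on U (Y k)).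
Hypothesis tors : structure_eq4.

Let G := weyl_conn (gram P) psi.

Lemma skew4_hh i x a b : skew4 i x (hh a) (hh b) = skew3 (fun k => X k x 0 i) a b.
Proof. exact: (etrans (@block_mxEul _ 3 1 3 1 _ _ _ _ a b)). Qed.

Lemma skew4_hv i x a : skew4 i x (hh a) vv = Y a x 0 i.
Proof. by rewrite /skew4 (@block_mxEur _ 3 1 3 1) mxE. Qed.

Lemma skew4_vh i x a : skew4 i x vv (hh a) = - Y a x 0 i.
Proof. by rewrite /skew4 (@block_mxEdl _ 3 1 3 1) !mxE. Qed.

Lemma skew4_vv i x : skew4 i x vv vv = 0.
Proof. by rewrite /skew4 (@block_mxEdr _ 3 1 3 1) !mxE. Qed.

Lemma skew4_tr i x : (skew4 i x)^T = - skew4 i x.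
Proof.
apply/matrixP; apply: hv_ind => [k|]; apply: hv_ind => [l|]; rewrite mxE mxNE.
- rewrite !skew4_hh; have /matrixP/(_ k l) := skew3_tr (fun m => X m x 0 i).
  by rewrite mxE mxNE.
- by rewrite skew4_vh skew4_hv.
- by rewrite skew4_vh skew4_hv opprK.
- by rewrite !skew4_vv oppr0.
Qed.

Lemma conn4E i x k :
  [/\ conn4 i x (hh k) (hh k) = psi x 0 i, conn4 i x (hh k) (hh (s1 k)) = X (s2 k) x 0 i,
      conn4 i x (hh (s1 k)) (hh k) = - X (s2 k) x 0 i,
      conn4 i x (hh k) (hh (s2 k)) = - X (s1 k) x 0 i
    & conn4 i x (hh (s2 k)) (hh k) = X (s1 k) x 0 i].
Proof.
have [z1 z2 z3 z4 z5] := skew3E (fun k => X k x 0 i) k.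
split; rewrite mxDE skew4_hh ?z1 ?z2 ?z3 ?z4 ?z5 mxE hh_eq ?eqxx ?cyc_neq ?mulr0n ?mulr1n;
  by rewrite ?add0r ?addr0.
Qed.

Lemma conn4E12 i x k : conn4 i x (hh (s1 k)) (hh (s2 k)) = X k x 0 i
  /\ conn4 i x (hh (s2 k)) (hh (s1 k)) = - X k x 0 i.
Proof. by have [_ + + _ _] := conn4E i x (s1 k); rewrite !cycE. Qed.

Lemma conn4Ev i x k : [/\ conn4 i x (hh k) vv = Y k x 0 i,
  conn4 i x vv (hh k) = - Y k x 0 i & conn4 i x vv vv = psi x 0 i].
Proof.
split; rewrite mxDE ?skew4_hv ?skew4_vh ?skew4_vv mxE ?hv_eq ?vh_eq ?eqxx ?mulr0n ?mulr1n;
  by rewrite ?add0r ?addr0.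
Qed.

Lemma smooth_conn4 i : smooth_mx_on U (conn4 i).
Proof.
have sv c : smooth_on U (fun x => psi x 0 i * c).
  exact: (smooth_onM oU (spsi 0 i) (@smooth_on_cst R 4 U c)).
have s0 := @smooth_on_cst R 4 U 0.
have E f g : (forall x, f x = g x) -> smooth_on U g -> smooth_on U f.
  by move=> /funext ->.
apply: smooth_mxD => // a b.
  by apply: E (sv (a == b)%:R) => x; rewrite mxE mulr_natr.
move: a b; apply: hv_ind => [k|]; apply: hv_ind => [l|].
- apply: (E _ (fun x => if l == s1 k then X (s2 k) x 0 i else
      if k == s1 l then - X (s2 l) x 0 i else 0)).
    by move=> x; rewrite skew4_hh mxE.
  case: (l == s1 k); first exact: sX.
  by case: (k == s1 l) => //; apply: smooth_onN => //; exact: sX.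
- by apply: E (sY k 0 i) => x; rewrite skew4_hv.
- by apply: E (smooth_onN oU (sY l 0 i)) => x; rewrite skew4_vh.
- by apply: E s0 => x; rewrite skew4_vv.
Qed.

Lemma conn4_frame x : U x -> forall i,
  conn_mx G i x *m P x = mpartial i P x + P x *m conn4 i x.
Proof.
move=> Ux; apply: (weyl_conn_frame oU) (Ux) => // {x Ux} x Ux.
  move=> i; rewrite /conn4 linearD /= tr_scalar_mx skew4_tr addrACA subrr addr0.
  by rewrite -raddfD /= mulr_natl mulr2n.
have E p q a : mpartial p P x q a = partial p (fun y => coframe P a y 0 q) x.
  by rewrite mxE; congr (partial p _ x); apply/funext => y; rewrite coframeE.
have [T1 T2] := tors Ux.
move=> i j; apply: hv_ind => [k|].
  have /matrixP/(_ i j) := T1 k.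
  rewrite faradayE !E ![(_ *m _) _ (hh k)]mxE !(sum_hv _ k).
  have [-> _ -> _ ->] := conn4E i x k; have [-> _ -> _ ->] := conn4E j x k.
  have [_ -> _] := conn4Ev i x k; have [_ -> _] := conn4Ev j x k.
  rewrite !entryE !wedgeE !coframeE.
  move: (partial _ _ x) (partial _ _ x) (P x) => p1 p2 q H; lra.
have /matrixP/(_ i j) := T2.
rewrite faradayE !E ![(_ *m _) _ vv]mxE !(sum_hv _ 0) (sum_cyc _ 0).
have V p k := conn4Ev p x k.
have [-> _ ->] := V i 0; have [-> _ _] := V i (s1 0); have [-> _ _] := V i (s2 0).
have [-> _ ->] := V j 0; have [-> _ _] := V j (s1 0); have [-> _ _] := V j (s2 0).
rewrite mxDE mxNE mxNE !mxDE !wedgeE !coframeE.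
move: (partial _ _ x) (partial _ _ x) (P x) => p1 p2 q H; lra.
Qed.

Notation FC := (frame_curv P G).
(** The component of the connection under the projection of [so(4)] to the
    factor [so(3)] that acts on antiselfdual forms. *)
Definition asd_conn k x : 'rV[R]_4 := X k x + Y k x.

Lemma frame_curv_conn4 x : U x -> forall a b c d, FC x a b c d
  = (invmx (P x) *m (\matrix_(i, j) (mpartial i (conn4 j) x - mpartial j (conn4 i) x
       + conn4 j x *m conn4 i x - conn4 i x *m conn4 j x) c d) *m (invmx (P x))^T) a b.
Proof.
move=> Ux a b c d.
exact: frame_curv_Omega (uP Ux) (curvature_frame oU sP smooth_conn4 uP conn4_frame Ux).
Qed.

(** The projection of [so(4)] onto one of its two factors is a homomorphism of
    Lie algebras. *)
Lemma asd_curvE x : U x -> forall k a b, asd_curv (FC x) k a b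
  = fcomp (P x) (faraday (asd_conn k) x + wedge (asd_conn (s1 k) x) (asd_conn (s2 k) x)) a b.
Proof.
move=> Ux k a b; rewrite /asd_curv !frame_curv_conn4// /fcomp -mxDE -mulmxDl -mulmxDr.
congr ((_ *m _ *m _) a b); apply/matrixP => i j.
have Om (C : 'I_4 -> 'rV[R]_4 -> 'M[R]_4) c d : (\matrix_(i, j) (mpartial i (C j) x - mpartial j (C i) x
       + C j x *m C i x - C i x *m C j x) c d) i j
    = partial i (fun y => C j y c d) x - partial j (fun y => C i y c d) x
      + (\sum_m C j x c m * C i x m d) - (\sum_m C i x c m * C j x m d).
  by rewrite !mxE.
rewrite [LHS]mxDE [X in X + _ = _](Om conn4) [X in _ + X = _](Om conn4).
rewrite [RHS]mxDE wedgeE (faradayD (sX k) (sY k) Ux) mxDE !faradayE.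
have c12 p y : conn4 p y (hh (s1 k)) (hh (s2 k)) = X k y 0 p by have [] := conn4E12 p y k.
have ckv p y : conn4 p y (hh k) vv = Y k y 0 p by have [] := conn4Ev p y k.
have fE (F : 'rV[R]_4 -> R) F' p : (forall y, F y = F' y) -> partial p F x = partial p F' x.
  by move=> /funext ->.
rewrite (fE _ _ i (c12 j)) (fE _ _ j (c12 i)) (fE _ _ i (ckv j)) (fE _ _ j (ckv i)).
rewrite !(sum_hv _ k) !c12 !ckv.
have [i0 i1 i1' i2 i2'] := conn4E i x k; have [j0 j1 j1' j2 j2'] := conn4E j x k.
have [k0 _ _ _ _] := conn4E i x (s1 k); have [k1 _ _ _ _] := conn4E i x (s2 k).
have [l0 _ _ _ _] := conn4E j x (s1 k); have [l1 _ _ _ _] := conn4E j x (s2 k).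
have [m0 _ mv] := conn4Ev i x (s1 k); have [n0 _ nv] := conn4Ev j x (s1 k).
have [m2 m1 _] := conn4Ev i x (s2 k); have [n2 n1 _] := conn4Ev j x (s2 k).
rewrite ?i0 ?i1 ?i1' ?i2 ?i2' ?j0 ?j1 ?j1' ?j2 ?j2' ?k0 ?k1 ?l0 ?l1.
rewrite ?m0 ?m1 ?m2 ?mv ?n0 ?n1 ?n2 ?nv.
move: (partial _ _ x) (partial _ _ x) (partial _ _ x) (partial _ _ x) => p1 p2 p3 p4.
by rewrite /asd_conn !mxDE; ring.
Qed.

(** Only the trace part of the connection fails to be skew. *)
Lemma frame_curv_trace x : U x -> forall a b c d,
  FC x a b c d + FC x a b d c = 2 * (c == d)%:R * fcomp (P x) (faraday psi x) a b.
Proof.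
move=> Ux a b c d; rewrite !frame_curv_conn4// /fcomp -mxDE -mulmxDl -mulmxDr -mxZE.
rewrite scalemxAl scalemxAr; congr ((_ *m _ *m _) a b); apply/matrixP => i j.
rewrite mxDE ![(\matrix_(_, _) _) i j]mxE mxZE faradayE.
have S p y c' d' : conn4 p y c' d' + conn4 p y d' c' = 2 * (c' == d')%:R * psi y 0 p.
  have /matrixP/(_ c' d') := skew4_tr p y; rewrite mxE mxNE => E.
  rewrite !mxDE E ![_%:M _ _]mxE (eq_sym d').
  by case: (c' == d'); rewrite ?mulr1n ?mulr0n /=; ring.
have D p q : mpartial p (conn4 q) x c d + mpartial p (conn4 q) x d c
    = 2 * (c == d)%:R * partial p (fun y => psi y 0 q) x.
  have dc c' d' : differentiable (fun y => conn4 q y c' d') x.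
    exact: smooth_mx_diff (smooth_conn4 q) Ux.
  rewrite ![mpartial _ _ _ _ _]mxE -(@partialD _ _ (fun y => conn4 q y c d) (fun y => conn4 q y d c))//.
  pose k0 := 2 * (c == d)%:R : R.
  have -> : (fun y => conn4 q y c d + conn4 q y d c) = (fun y => k0 * psi y 0 q).
    by apply/funext => y; rewrite S.
  rewrite (@partialM _ _ (fun=> k0) (fun y => psi y 0 q))//; last exact: smooth_mx_diff spsi Ux.
  by rewrite (partial_cst k0 p x) mul0r add0r.
have Q : (conn4 j x *m conn4 i x - conn4 i x *m conn4 j x) c d
       + (conn4 j x *m conn4 i x - conn4 i x *m conn4 j x) d c = 0.
  have E p : conn4 p x = (psi x 0 p)%:M + skew4 p x by [].
  rewrite !E !mulmxDl !mulmxDr !mul_scalar_mx !mul_mx_scalar.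
  have Ts (B C : 'M[R]_4) : B^T = - B -> C^T = - C ->
      (B *m C - C *m B) c d + (B *m C - C *m B) d c = 0.
    move=> tB tC; have : (B *m C - C *m B)^T = - (B *m C - C *m B).
      by rewrite linearB /= !trmx_mul tB tC !mulmxN !mulNmx !opprK opprB.
    by move=> /matrixP/(_ c d); rewrite mxE mxNE => ->; rewrite subrr.
  have := Ts _ _ (skew4_tr j x) (skew4_tr i x); rewrite !(mxDE, mxNE, mxZE) ![_%:M _ _]mxE.
  move: ((skew4 j x *m skew4 i x) c d) ((skew4 i x *m skew4 j x) c d)
    ((skew4 j x *m skew4 i x) d c) ((skew4 i x *m skew4 j x) d c) => q1 q2 q3 q4 H.
  move: (skew4 j x c d) (skew4 i x c d) (skew4 j x d c) (skew4 i x d c) => r1 r2 r3 r4.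
  rewrite (eq_sym d c).
  by case: (c == d); rewrite ?mulr1n ?mulr0n; move: H; lra.
have fin (a1 a2 b1 b2 q1 q2 q3 q4 f1 f2 z : R) : a1 + a2 = z * f1 -> b1 + b2 = z * f2 ->
    q1 - q3 + (q2 - q4) = 0 ->
    a1 - b1 + q1 - q3 + (a2 - b2 + q2 - q4) = z * (f1 - f2).
  by move=> E1 E2 E3; rewrite mulrBr -E1 -E2; lra.
move: Q; rewrite !(mxDE, mxNE) => q.
exact: fin (D i j) (D j i) q.
Qed.

End connection_four.

(** * Selfdual Einstein metrics in a conformal frame *)

Lemma wedge_conj (R : realType) n m (B : 'M[R]_(m, n)) (u v : 'rV[R]_n) :
  B *m wedge u v *m B^T = wedge (u *m B^T) (v *m B^T).
Proof. by rewrite /wedge -!lock !trmx_mul !trmxK mulmxBr mulmxBl !mulmxA. Qed.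

Section conformal_metric.
Variables (R : realType) (n : nat) (U : set 'rV[R]_n).
Variables (P g : 'rV[R]_n -> 'M[R]_n) (psi : 'rV[R]_n -> 'rV[R]_n) (rho : 'rV[R]_n -> R).
Hypotheses (oU : open U) (sP : smooth_mx_on U P) (srho : smooth_on U rho).
Hypothesis uP : forall x, U x -> P x \in unitmx.
Hypothesis rho0 : forall x, U x -> rho x != 0.
Hypothesis gE : forall x, U x -> g x = rho x ^+ 2 *: gram P x.
Hypothesis psiE : forall x, U x -> psi x = (rho x)^-1 *: differential rho x.
Let G := weyl_conn (gram P) psi.

(** The metric is parallel for the Weyl derivative which is trivial in its own
    scale; in the scale of the coframe this is the 1-form [d rho / rho]. *)
Lemma levi_civita_conformal x l i j : U x -> levi_civita g l i j x = G l i j x.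
Proof.
move=> Ux; rewrite /levi_civita /G.
rewrite -(weyl_conn_gauge psi l i j srho (smooth_gram oU sP) Ux (rho0 Ux) (gram_unit (uP Ux))).
apply: (eq_on_weyl_conn l i j oU gE _ Ux) => y Uy.
by rewrite psiE// subrr.
Qed.

Lemma riemann_conformal x l i j k : U x ->
  riemann (levi_civita g) l i j k x = riemann G l i j k x.
Proof.
move=> Ux; apply: (eq_on_riemann l i j k oU _ Ux) => y Uy a b c.
exact: levi_civita_conformal.
Qed.

Lemma ricci_conformal x i j : U x -> ricci (levi_civita g) i j x = ricci G i j x.
Proof. by move=> Ux; apply: eq_bigr => l _; rewrite riemann_conformal. Qed.

Lemma scal_conformal x : U x ->
  scal g x = (rho x) ^- 2 * \sum_b \sum_d frame_curv P G x d b b d.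
Proof.
move=> Ux; have ux := uP Ux.
rewrite -(frame_scal ux (erefl G)) /scal /scalar_curvature mulr_sumr.
apply: eq_bigr => i _; rewrite mulr_sumr; apply: eq_bigr => j _.
rewrite -/(levi_civita g) ricci_conformal// gE// mulrA; congr (_ * _).
rewrite invmxZ ?mxZE// unitmxZ ?gram_unit//.
by rewrite unitfE expf_neq0// rho0.
Qed.

End conformal_metric.

Section einstein_selfdual.
Variables (R : realType) (U : set 'rV[R]_4).
Variables (P g : 'rV[R]_4 -> 'M[R]_4) (psi : 'rV[R]_4 -> 'rV[R]_4) (rho rc : 'rV[R]_4 -> R).
Hypotheses (oU : open U) (sP : smooth_mx_on U P) (srho : smooth_on U rho).
Hypothesis uP : forall x, U x -> P x \in unitmx.
Hypothesis rho0 : forall x, U x -> rho x != 0.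
Hypothesis gE : forall x, U x -> g x = rho x ^+ 2 *: gram P x.
Hypothesis psiE : forall x, U x -> psi x = (rho x)^-1 *: differential rho x.
Let G := weyl_conn (gram P) psi.
Notation FC := (frame_curv P G).

Variable x : 'rV[R]_4.
Hypotheses (Ux : U x).
Hypothesis antiR : forall a b c d, FC x a b d c = - FC x a b c d.
Hypothesis cE : conformal_class g x = rc x ^+ 2 *: gram P x.
Hypothesis rc1 : rc x ^+ 4 * \det (P x) = 1.

Let ux : P x \in unitmx := uP Ux.

Let antiL a b c d : FC x b a c d = - FC x a b c d.
Proof. exact: frame_curv_anti. Qed.

Let bianchi a b c d : FC x a b c d + FC x b c a d + FC x c a b d = 0.
Proof.
apply: (frame_bianchi P a b c d oU Ux) => y _ l i j.
by apply: weyl_conn_sym => z; exact: gram_sym.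
Qed.

Definition einstein_at := forall i j,
  ricci (levi_civita g) i j x = 4%:R^-1 * scal g x * g x i j.

Definition selfdual_at := forall k l, selfdual_form (conformal_class g x)
  (\matrix_(i, j) weyl_tensor g x i j k l).

Let r4 := ric4 (FC x).

Let scalE : scal g x = (rho x) ^- 2 * \sum_b r4 b b.
Proof. by rewrite (scal_conformal oU sP srho uP rho0 gE psiE Ux). Qed.

Let ricE i j : ricci (levi_civita g) i j x
  = (P x *m (\matrix_(b, c) r4 b c) *m (P x)^T) i j.
Proof. by rewrite (ricci_conformal oU sP srho uP rho0 gE psiE)// (frame_ricci G ux). Qed.

Lemma einstein_atP : einstein_at <->
  forall b c, r4 b c = 4%:R^-1 * (\sum_b r4 b b) * (b == c)%:R.
Proof.
pose L : R := 4%:R^-1 * \sum_b r4 b b.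
have gL i j : 4%:R^-1 * scal g x * g x i j = (P x *m L%:M *m (P x)^T) i j.
  rewrite gE// mxZE scalE mul_mx_scalar -scalemxAl mxZE -/(gram P x) /L.
  move: (gram P x i j) (\sum_b _) (rho0 Ux) => h s; move: (rho x) => r r0.
  by field.
split=> [H b c|H i j].
  have E : P x *m (\matrix_(b, c) r4 b c) *m (P x)^T = P x *m L%:M *m (P x)^T.
    by apply/matrixP => i j; rewrite -ricE -gL; exact: H.
  move: E => /(congr1 (fun Z => invmx (P x) *m Z *m (invmx (P x))^T)).
  rewrite !mulmxA !mulVmx// !mul1mx -!mulmxA -!trmx_mul mulVmx// trmx1 !mulmx1.
  by move=> /matrixP/(_ b c); rewrite !mxE /L mulr_natr.
rewrite ricE gL; congr ((_ *m _ *m _) i j); apply/matrixP => b c.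
by rewrite !mxE H /L mulr_natr.
Qed.

Lemma weyl_tensor_frame (L : R) k l : (forall b c, r4 b c = L * (b == c)%:R) ->
  \matrix_(i, j) weyl_tensor g x i j k l = P x *m
    (rho x ^+ 2 *: \matrix_(a, b) \sum_c \sum_d P x k c * P x l d * weyl4 (FC x) (- 3^-1 * L) a b c d)
    *m (P x)^T.
Proof.
move=> rL.
have trL : \sum_b r4 b b = 4 * L.
  by rewrite (sum_hv _ 0) !rL !eqxx !mulr1; ring.
have ricL i j : ricci (levi_civita g) i j x = L * gram P x i j.
  rewrite ricE -mxZE /gram; have -> : \matrix_(b, c) r4 b c = L%:M.
    by apply/matrixP => b c; rewrite !mxE rL mulr_natr.
  by rewrite mul_mx_scalar -scalemxAl.
have schE i j : schouten g x i j = 6^-1 * L * gram P x i j.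
  rewrite /schouten ricL scalE trL gE// mxZE.
  move: (gram P x i j) (rho0 Ux) => h; move: (rho x) => r r0.
  by field.
have gsym i j : gram P x i j = gram P x j i by rewrite -[in LHS](gram_sym P) mxE.
apply/matrixP => i j; rewrite [LHS]mxE /weyl_tensor !schE.
have -> : \sum_m riemann (levi_civita g) m i j k x * g x m l
    = rho x ^+ 2 * \sum_m riemann G m i j k x * gram P x m l.
  rewrite mulr_sumr; apply: eq_bigr => m _.
  rewrite (riemann_conformal oU sP srho uP rho0 gE psiE)// gE// mxZE.
  by rewrite mulrCA.
rewrite (frame_lowered G ux) gE//.
pose M1 : 'M[R]_4 := \matrix_(a, b) \sum_c \sum_d P x k c * P x l d * FC x a b c d.
have -> : \matrix_(a, b) (\sum_c \sum_d P x k c * P x l d * weyl4 (FC x) (- 3^-1 * L) a b c d)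
    = M1 + (- 3^-1 * L) *: wedge (row l (P x)) (row k (P x)).
  apply/matrixP => a b; rewrite mxDE mxZE wedgeE ![_ a b]mxE ![row _ _ _ _]mxE.
  rewrite mulrBr.
  transitivity (\sum_c \sum_d (P x k c * P x l d * FC x a b c d
     + ((d == a)%:R * ((c == b)%:R * (- 3^-1 * L * (P x l d * P x k c)))
        - (d == b)%:R * ((c == a)%:R * (- 3^-1 * L * (P x l d * P x k c)))))).
    apply: eq_bigr => c _; apply: eq_bigr => d _; rewrite /weyl4.
    rewrite (eq_sym a d) (eq_sym b c) (eq_sym a c) (eq_sym b d).
    move: (FC x a b c d) (P x k c) (P x l d) ((d == a)%:R : R) ((c == b)%:R : R) => *.
    by ring.
  under eq_bigr => c _ do rewrite big_split /= sumrB.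
  rewrite big_split /= sumrB; congr (_ + (_ - _)).
  - by rewrite ?mxE.
  - by under eq_bigr => c _ do rewrite sum_delta; rewrite sum_delta.
  - by under eq_bigr => c _ do rewrite sum_delta; rewrite sum_delta.
rewrite -/M1 scalerDr mulmxDr mulmxDl mxDE scalerA -!scalemxAr -!scalemxAl !mxZE wedge_conj wedgeE.
have rg q p : (row q (P x) *m (P x)^T) 0 p = gram P x q p by rewrite -row_mul mxE.
rewrite !rg (gsym l i) (gsym k j) (gsym l j) (gsym k i).
move: ((P x *m M1 *m (P x)^T) i j) (gram P x) => t h.
by field.
Qed.

(** The hypothesis makes the mixed block of the curvature vanish, whence the
    metric is Einstein, and the antiselfdual block of its Weyl tensor is what
    remains of [asd_curv] after subtraction of [m * asd_form]. *)
Lemma einstein_selfdualP (m : R) :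
  (forall k a b, asd_curv (FC x) k a b = m * asd_form R k a b) ->
  [/\ einstein_at, selfdual_at & scal g x = - 12 * m / rho x ^+ 2].
Proof.
move=> H; have rm := ric4_asd antiL antiR bianchi H.
have tr : \sum_b r4 b b = - 12 * m.
  by rewrite (sum_hv _ 0) /r4 !rm !eqxx !mulr1; ring.
split.
- apply/einstein_atP => b c; rewrite tr [LHS]rm; congr (_ * _); by field.
- move=> k l; rewrite /selfdual_form (weyl_tensor_frame _ _ rm) cE star4_frame//.
  set f := _ *: _; suff -> : star4 1%:M f = f by [].
  have fE a b : f a b = rho x ^+ 2 * \sum_c \sum_d P x k c * P x l d * weyl4 (FC x) m a b c d.
    rewrite mxZE mxE; congr (_ * _); apply: eq_bigr => c _; apply: eq_bigr => d _.
    by congr (_ * weyl4 _ _ _ _ _ _); field.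
  have wa a b c d : weyl4 (FC x) m b a c d = - weyl4 (FC x) m a b c d.
    by rewrite /weyl4 antiL; move: (FC _ _ _ _ _) => t; ring.
  have af : f^T = - f.
    apply/matrixP => a b; rewrite mxE mxNE !fE -mulrN -sumrN; congr (_ * _).
    apply: eq_bigr => c _; rewrite -sumrN; apply: eq_bigr => d _.
    by rewrite wa mulrN.
  apply/(selfdual_1P af) => j; rewrite !fE; congr (_ * _).
  apply: eq_bigr => c _; apply: eq_bigr => d _; congr (_ * _).
  rewrite (wa (hh j) vv); apply/eqP; rewrite -subr_eq0 opprK.
  by rewrite weyl4_asd// H subrr.
- by rewrite scalE tr mulrC.
Qed.

(** For an Einstein metric [weyl4], with [m] a multiple of the scalar curvature,
    is the Weyl tensor in the frame, and [asd_curv - m * asd_form] is its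
    antiselfdual part. *)
Lemma einstein_selfdual_asd : einstein_at -> selfdual_at -> forall k a b,
  asd_curv (FC x) k a b = (- 12^-1 * scal g x * rho x ^+ 2) * asd_form R k a b.
Proof.
move=> /einstein_atP rL sd; set m := - 12^-1 * _ * _.
have mE : - 3^-1 * (4%:R^-1 * \sum_b r4 b b) = m.
  rewrite /m scalE; move: (\sum_b _) (rho0 Ux) => s; move: (rho x) => r r0.
  by field.
have uPT : (P x)^T \in unitmx by rewrite unitmx_tr.
have H k l j : \sum_c \sum_d P x k c * P x l d *
    (weyl4 (FC x) m (hh (s1 j)) (hh (s2 j)) c d + weyl4 (FC x) m (hh j) vv c d) = 0.
  have := sd k l; rewrite /selfdual_form (weyl_tensor_frame _ _ rL) cE star4_frame// mE.
  set f := _ *: _; move=> E.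
  have {E} sf : star4 1%:M f = f.
    have := congr1 (fun Z => invmx (P x) *m Z *m invmx (P x)^T) E.
    by rewrite /= !mulmxA !mulVmx// !mul1mx !mulmxK.
  have fE a b : f a b = rho x ^+ 2 * \sum_c \sum_d P x k c * P x l d * weyl4 (FC x) m a b c d.
    by rewrite mxZE mxE.
  have wa a b c d : weyl4 (FC x) m b a c d = - weyl4 (FC x) m a b c d.
    by rewrite /weyl4 antiL; move: (FC _ _ _ _ _) => t; ring.
  have af : f^T = - f.
    apply/matrixP => a b; rewrite mxE mxNE !fE -mulrN -sumrN; congr (_ * _).
    apply: eq_bigr => c _; rewrite -sumrN; apply: eq_bigr => d _.
    by rewrite wa mulrN.
  have r2 : rho x ^+ 2 != 0 by rewrite expf_neq0// rho0.
  have := (selfdual_1P af).1 sf j; rewrite !fE => /(mulfI r2) E.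
  transitivity (\sum_c \sum_d P x k c * P x l d * weyl4 (FC x) m (hh (s1 j)) (hh (s2 j)) c d
    - \sum_c \sum_d P x k c * P x l d * weyl4 (FC x) m vv (hh j) c d); last first.
    by rewrite E subrr.
  rewrite -sumrB; apply: eq_bigr => c _; rewrite -sumrB; apply: eq_bigr => d _.
  by rewrite (wa (hh j) vv) mulrN opprK mulrDr.
move=> k a b; apply/eqP; rewrite -subr_eq0; apply/eqP.
pose Z : 'M[R]_4 := \matrix_(c, d) (asd_curv (FC x) k c d - m * asd_form R k c d).
have ZE c d : Z c d = weyl4 (FC x) m (hh (s1 k)) (hh (s2 k)) c d + weyl4 (FC x) m (hh k) vv c d.
  by rewrite mxE weyl4_asd.
have PZ : P x *m Z *m (P x)^T = 0.
  apply/matrixP => i j; rewrite mx0E -[RHS](H i j k) mxE exchange_big /=.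
  apply: eq_bigr => d _; rewrite mxE mulr_suml; apply: eq_bigr => c _.
  by rewrite -ZE [(P x)^T _ _]mxE mulrAC.
have Z0 : Z = 0.
  have := congr1 (fun W => invmx (P x) *m W *m invmx (P x)^T) PZ.
  by rewrite /= !mulmxA !mulVmx// !mul1mx mulmxK// mulmx0 mul0mx.
by have /matrixP/(_ a b) := Z0; rewrite mx0E mxE.
Qed.

End einstein_selfdual.

(** * Weyl derivatives along a submersion *)

Lemma mx_fcomp (R : realType) n (Q X : 'M[R]_n) : Q \in unitmx ->
  X = Q *m (\matrix_(a, b) fcomp Q X a b) *m Q^T.
Proof.
move=> uQ; have -> : \matrix_(a, b) fcomp Q X a b = invmx Q *m X *m (invmx Q)^T.
  by apply/matrixP => a b; rewrite mxE.
by rewrite !mulmxA mulmxV// mul1mx -mulmxA -trmx_mul mulmxV// trmx1 mulmx1.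
Qed.

Lemma selfdual_fcomp (R : realType) (r : R) (Q X : 'M[R]_4) : r ^+ 4 * \det Q = 1 ->
  X^T = - X -> (selfdual_form (r ^+ 2 *: (Q *m Q^T)) X <->
    forall k, fcomp Q X (hh (s1 k)) (hh (s2 k)) = fcomp Q X vv (hh k)).
Proof.
move=> rQ aX; have uQ : Q \in unitmx.
  rewrite unitmxE unitfE; apply/eqP => d0; move: rQ; rewrite d0 mulr0 => /esym/eqP.
  by rewrite oner_eq0.
pose f : 'M[R]_4 := \matrix_(a, b) fcomp Q X a b.
have af : f^T = - f by apply/matrixP => a b; rewrite !mxE; exact: fcomp_anti.
have XE : X = Q *m f *m Q^T := mx_fcomp X uQ.
have fE a b : fcomp Q X a b = f a b by rewrite mxE.
have uQT : Q^T \in unitmx by rewrite unitmx_tr.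
have -> : selfdual_form (r ^+ 2 *: (Q *m Q^T)) X <-> star4 1%:M f = f.
  rewrite /selfdual_form {1 2}XE star4_frame//; split=> [E|-> //].
  have := congr1 (fun Z => invmx Q *m Z *m invmx Q^T) E.
  by rewrite /= !mulmxA !mulVmx// !mul1mx !mulmxK.
by split=> [/(selfdual_1P af) H k|H]; [rewrite !fE; exact: H|
  apply/(selfdual_1P af) => k; rewrite -!fE; exact: H].
Qed.

Lemma faraday_dlog (R : realType) n (U : set 'rV[R]_n) (r : 'rV[R]_n -> R) x :
  open U -> smooth_on U r -> (forall y, U y -> r y != 0) -> U x ->
  faraday (fun y => (r y)^-1 *: differential r y) x = 0.
Proof.
move=> oU sr r0 Ux.
rewrite (faradayZ (smooth_onV oU r0 sr) (smooth_differential oU sr) Ux).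
rewrite (faraday_differential oU sr Ux) scaler0 addr0 (differentialV sr (r0 x Ux) Ux).
apply/matrixP => i j; rewrite wedgeE !mxZE mx0E.
by ring.
Qed.

Section submersion_frame.
Variables (R : realType) (U : set 'rV[R]_4).
Variables (P : 'rV[R]_4 -> 'M[R]_4) (th : 'rV[R]_4 -> 'rV[R]_4).
Variables (A : 'I_3 -> 'rV[R]_4 -> 'rV[R]_4) (phi w : 'I_3 -> 'rV[R]_4 -> R).
Notation e k := (coframe P (hh k)).
Notation eta := (coframe P vv).
Hypothesis S1 : forall x, U x -> forall k, faraday (e k) x
  = wedge (A (s2 k) x) (e (s1 k) x) - wedge (A (s1 k) x) (e (s2 k) x) - wedge (th x) (e k x).
Hypothesis S2 : forall x, U x -> faraday eta x
  = \sum_k phi k x *: wedge (e k x) (eta x) + \sum_k w k x *: wedge (e (s1 k) x) (e (s2 k) x).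

Section weyl_form.
Variables (p y : 'I_3 -> 'rV[R]_4 -> R) (nu : 'rV[R]_4 -> R).

(** The 1-form of a Weyl derivative in the scale of the coframe; [rot_form] and
    [fibre_form] are the connection forms which solve the structure equations
    for it, given those of the coframe. *)
Definition frame_form x : 'rV[R]_4 := th x + \sum_k p k x *: e k x + nu x *: eta x.

Definition rot_form k x : 'rV[R]_4 := A k x + p (s1 k) x *: e (s2 k) x
  - p (s2 k) x *: e (s1 k) x + (2^-1 * w k x) *: eta x.

Definition fibre_form k x : 'rV[R]_4 := y k x *: eta x - nu x *: e k x
  - 2^-1 *: (w (s1 k) x *: e (s2 k) x - w (s2 k) x *: e (s1 k) x).

(** The torsion equation of [eta] fixes the components of the connection forms
    mixing [eta] with the [e k]; the function [y] measures how far the fibres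
    are from being geodesics. *)
Lemma submersion_structure :
  (forall x, U x -> \sum_k y k x *: e k x
     = th x + \sum_k p k x *: e k x + \sum_k phi k x *: e k x) ->
  structure_eq4 U P frame_form rot_form fibre_form.
Proof.
move=> yE x Ux; split=> [k|].
  rewrite S1//; apply/matrixP => i j.
  rewrite /frame_form /rot_form /fibre_form (sum_cyc _ k) !cycE.
  rewrite !(mxDE, mxNE, mxZE) !wedgeE !(mxDE, mxNE, mxZE).
  move: (A (s1 k) x) (A (s2 k) x) (th x) (e k x) (e (s1 k) x) (e (s2 k) x) (eta x).
  move: (p k x) (p (s1 k) x) (p (s2 k) x) (w (s1 k) x) (w (s2 k) x) (y k x) (nu x) => *.
  by field.
rewrite S2//; apply/matrixP => i j.
have yEi a : th x 0 a = y 0 x * e 0 x 0 a + y (s1 0) x * e (s1 0) x 0 a + y (s2 0) x * e (s2 0) x 0 a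
    - (p 0 x * e 0 x 0 a + p (s1 0) x * e (s1 0) x 0 a + p (s2 0) x * e (s2 0) x 0 a)
    - (phi 0 x * e 0 x 0 a + phi (s1 0) x * e (s1 0) x 0 a + phi (s2 0) x * e (s2 0) x 0 a).
  have := congr1 (fun v : 'rV[R]_4 => v 0 a) (yE x Ux); rewrite /= !(sum_cyc _ 0) !entryE => ->.
  by move: (th x 0 a) => b; rewrite -!addrA; ring.
have YE k a : fibre_form k x 0 a = y k x * eta x 0 a - nu x * e k x 0 a
    - 2^-1 * (w (s1 k) x * e (s2 k) x 0 a - w (s2 k) x * e (s1 k) x 0 a).
  rewrite /fibre_form; move: (e k x) (e (s1 k) x) (e (s2 k) x) (eta x) => *.
  by rewrite !entryE.
have FE a : frame_form x 0 a = th x 0 a + (p 0 x * e 0 x 0 a + p (s1 0) x * e (s1 0) x 0 a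
    + p (s2 0) x * e (s2 0) x 0 a) + nu x * eta x 0 a.
  rewrite /frame_form (sum_cyc _ 0); move: (e 0 x) (e (s1 0) x) (e (s2 0) x) (eta x) => *.
  by rewrite !entryE.
have RE (Y1 Y2 Y3 F e1 e2 e3 h : 'rV[R]_4) :
    (- (wedge Y1 e1 + wedge Y2 e2 + wedge Y3 e3) - wedge F h) i j
    = - ((Y1 0 i * e1 0 j - Y1 0 j * e1 0 i) + (Y2 0 i * e2 0 j - Y2 0 j * e2 0 i)
         + (Y3 0 i * e3 0 j - Y3 0 j * e3 0 i)) - (F 0 i * h 0 j - F 0 j * h 0 i).
  by rewrite !entryE !wedgeE.
have LE (e1 e2 e3 h : 'rV[R]_4) a1 a2 a3 b1 b2 b3 :
    (a1 *: wedge e1 h + a2 *: wedge e2 h + a3 *: wedge e3 h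
     + (b1 *: wedge e2 e3 + b2 *: wedge e3 e1 + b3 *: wedge e1 e2)) i j
    = a1 * (e1 0 i * h 0 j - e1 0 j * h 0 i) + a2 * (e2 0 i * h 0 j - e2 0 j * h 0 i)
      + a3 * (e3 0 i * h 0 j - e3 0 j * h 0 i)
      + (b1 * (e2 0 i * e3 0 j - e2 0 j * e3 0 i) + b2 * (e3 0 i * e1 0 j - e3 0 j * e1 0 i)
         + b3 * (e1 0 i * e2 0 j - e1 0 j * e2 0 i)).
  by rewrite !entryE !wedgeE.
rewrite !(sum_cyc _ 0) !cycE LE RE !YE !FE !cycE.
move: (yEi i) (yEi j); move: (e 0 x) (e (s1 0) x) (e (s2 0) x) (eta x) (th x) => e0 e1 e2 e3 b.
move: (p 0 x) (p (s1 0) x) (p (s2 0) x) (w 0 x) (w (s1 0) x) (w (s2 0) x) => p0 p1 p2 w0 w1 w2.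
move: (phi 0 x) (phi (s1 0) x) (phi (s2 0) x) (y 0 x) (y (s1 0) x) (y (s2 0) x) (nu x).
by move=> f0 f1 f2 y0 y1 y2 n -> ->; field.
Qed.

End weyl_form.
End submersion_frame.

Section derivative_of_fibre_field.
Variables (R : realType) (U : set 'rV[R]_4).
Variables (P : 'rV[R]_4 -> 'M[R]_4) (xi : 'rV[R]_4 -> 'rV[R]_4) (rc : 'rV[R]_4 -> R).
Hypotheses (oU : open U) (sP : smooth_mx_on U P).
Hypothesis uP : forall x, U x -> P x \in unitmx.
Hypotheses (src : smooth_on U rc) (rc0 : forall x, U x -> rc x != 0).
Hypothesis xiE : forall x, U x -> xi x = (rc x)^-1 *: row vv (invmx (P x)).

Lemma mpartial_invmx i x : U x ->
  mpartial i (fun y => invmx (P y)) x = - (invmx (P x) *m mpartial i P x *m invmx (P x)).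
Proof.
move=> Ux; have sE : smooth_mx_on U (fun y => invmx (P y)) by exact: smooth_invmx.
have : mpartial i (fun y => invmx (P y) *m P y) x = 0.
  rewrite (eq_on_mpartial i oU (A' := fun=> 1%:M) _ Ux); last first.
    by move=> y Uy; rewrite mulVmx// uP.
  by apply/matrixP => k l; rewrite !mxE; exact: partial_cst.
rewrite (mpartialM i sE sP Ux) => /eqP; rewrite addr_eq0 => /eqP E.
by rewrite -[LHS](mulmxK (uP Ux)) E mulNmx.
Qed.

(** In the scale of the coframe [xi] is the unit vertical vector; the derivative
    of the scale [rc] is absorbed by the change of the 1-form from [th0] to
    [tau]. *)
Lemma cov_deriv_frame (th0 tau : 'rV[R]_4 -> 'rV[R]_4) (G : connection R 4)
    (om : 'I_4 -> 'M[R]_4) x : U x ->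
  th0 x = tau x - (rc x)^-1 *: differential rc x ->
  (forall i, conn_mx G i x *m P x = mpartial i P x + P x *m om i) ->
  cov_deriv (-1) th0 G xi x *m P x
  = \matrix_(k, a) ((rc x)^-1 * (om k vv a - tau x 0 k * (a == vv)%:R)).
Proof.
move=> Ux tE GE; have ux := uP Ux; have r0 := rc0 Ux.
set E := invmx (P x).
have dE k j : partial k (fun y => invmx (P y) vv j) x
    = (- (E *m mpartial k P x *m E)) vv j by rewrite -mpartial_invmx// mxE.
have EG k : E *m conn_mx G k x = E *m mpartial k P x *m E + om k *m E.
  by rewrite -[LHS](mulmxK ux) -/E -!mulmxA (mulmxA (conn_mx _ _ _)) GE mulmxDl mulmxDr
    !mulmxA (mulVmx ux) mul1mx.
have sE : smooth_mx_on U (fun y => invmx (P y)) by exact: smooth_invmx.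
have sV : smooth_on U (fun y => (rc y)^-1) by exact: smooth_onV.
have C k j : cov_deriv (-1) th0 G xi x k j
    = (rc x)^-1 * ((om k *m E) vv j - tau x 0 k * E vv j).
  rewrite mxE /weyl_deriv xiE// tE.
  have -> : partial k (fun y => xi y 0 j) x
      = - (rc x) ^- 2 * partial k rc x * E vv j
        + (rc x)^-1 * (- (E *m mpartial k P x *m E)) vv j.
    rewrite -dE -(partialV k r0 (smooth_on_diff src Ux)).
    rewrite -(@partialM _ _ (fun y => (rc y)^-1) (fun y => invmx (P y) vv j)).
    - by apply: (eq_on_partial _ oU Ux) => y Uy; rewrite xiE// !mxE.
    - exact: smooth_on_diff sV Ux.
    - exact: smooth_mx_diff sE Ux.
  have -> : \sum_l G j k l x * ((rc x)^-1 *: row vv E) 0 l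
      = (rc x)^-1 * (E *m conn_mx G k x) vv j.
    rewrite mxE mulr_sumr; apply: eq_bigr => l _.
    by rewrite mxZE [row _ _ _ _]mxE [conn_mx _ _ _ _ _]mxE; ring.
  rewrite EG !(mxDE, mxNE, mxZE) [row _ _ _ _]mxE [differential _ _ _ _]mxE.
  move: ((E *m mpartial k P x *m E) vv j) ((om k *m E) vv j) (E vv j) (partial k rc x) (tau x 0 k).
  move: (rc x) r0 => r r0 p1 p2 p3 p4 p5.
  by field.
apply/matrixP => k a; rewrite [RHS]mxE [LHS]mxE.
under eq_bigr => j _ do rewrite C -mulrA mulrBl -mulrA.
rewrite -mulr_sumr sumrB -mulr_sumr; congr (_ * (_ - _ * _)).
- have <- : (om k *m E *m P x) vv a = om k vv a by rewrite -mulmxA mulVmx// mulmx1.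
  by rewrite mxE.
- have <- : (E *m P x) vv a = (a == vv)%:R by rewrite mulVmx// mxE eq_sym.
  by rewrite mxE.
Qed.

Variables (psi th0 : 'rV[R]_4 -> 'rV[R]_4) (X Y : 'I_3 -> 'rV[R]_4 -> 'rV[R]_4).
Variable c g : 'rV[R]_4 -> 'M[R]_4.
Hypotheses (spsi : smooth_mx_on U psi) (tors : structure_eq4 U P psi X Y).
Hypothesis cE : forall x, U x -> c x = rc x ^+ 2 *: gram P x.

(** In the frame the two conditions say that the vertical vector field has
    geodesic integral curves and no divergence. *)
Lemma minimal_frame x : U x ->
  (forall y, U y -> th0 y = psi y - (rc y)^-1 *: differential rc y) ->
  (xi x *m cov_deriv (-1) th0 (weyl_conn c th0) xi x = 0
   /\ \tr (cov_deriv (-1) th0 (weyl_conn c th0) xi x) = 0)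
  <-> (forall k, fcomp1 (P x) (Y k x) vv = 0) /\ \sum_k fcomp1 (P x) (Y k x) (hh k) = 0.
Proof.
move=> Ux tE; have ux := uP Ux; have r0 := rc0 Ux.
pose G := weyl_conn (gram P) psi.
have GE l i j y : U y -> weyl_conn c th0 l i j y = G l i j y.
  move=> Uy; rewrite /G.
  rewrite -(weyl_conn_gauge psi l i j src (smooth_gram oU sP) Uy (rc0 Uy) (gram_unit (uP Uy))).
  exact: (eq_on_weyl_conn l i j oU cE tE Uy).
have GP i : conn_mx (weyl_conn c th0) i x *m P x = mpartial i P x + P x *m conn4 psi X Y i x.
  rewrite -(conn4_frame oU sP uP tors Ux); congr (_ *m _); apply/matrixP => a b.
  by rewrite !mxE GE.
have C := cov_deriv_frame Ux (tE x Ux) GP.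
set D := cov_deriv _ _ _ _ _ in C *.
have DE : D *m P x = \matrix_(k, a) ((rc x)^-1 * (if fintype.split (a : 'I_(3 + 1)) is inl b
      then - Y b x 0 k else 0)).
  rewrite C; apply/matrixP => k; apply: hv_ind => [b|]; rewrite [LHS]mxE [RHS]mxE.
    have [_ -> _] := conn4Ev psi X Y k x b.
    have -> : fintype.split (hh b : 'I_(3 + 1)) = inl b by exact: (unsplitK (inl b)).
    by rewrite hv_eq mulr0 subr0.
  have [_ _ ->] := conn4Ev psi X Y k x 0.
  have -> : fintype.split (vv : 'I_(3 + 1)) = inr ord0 by exact: (unsplitK (inr ord0)).
  by rewrite eqxx mulr1 subrr.
have Dh k b : (D *m P x) k (hh b) = - (rc x)^-1 * Y b x 0 k.
  rewrite DE mxE (_ : fintype.split _ = inl b) ?mulrN ?mulNr//; exact: (unsplitK (inl b)).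
have Dv k : (D *m P x) k vv = 0.
  rewrite DE mxE (_ : fintype.split _ = inr ord0) ?mulr0//; exact: (unsplitK (inr ord0)).
have fE u a : fcomp1 (P x) u a = \sum_k u 0 k * invmx (P x) a k.
  by rewrite /fcomp1 mxE; apply: eq_bigr => k _; rewrite [_^T _ _]mxE.
have F1 : xi x *m D = 0 <-> forall k, fcomp1 (P x) (Y k x) vv = 0.
  have R1 b : (xi x *m (D *m P x)) 0 (hh b) = - (rc x) ^- 2 * fcomp1 (P x) (Y b x) vv.
    rewrite mxE fE mulr_sumr; apply: eq_bigr => k _; rewrite Dh xiE// mxZE [row _ _ _ _]mxE.
    by move: (invmx _ _ _) (Y _ _ _ _) r0 => t1 t2; move: (rc x) => r r0; field.
  have R2 : (xi x *m (D *m P x)) 0 vv = 0.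
    by rewrite mxE big1// => k _; rewrite Dv mulr0.
  split=> [H k|H].
    move: (R1 k); rewrite mulmxA H mul0mx mx0E => /esym/eqP.
    by rewrite mulf_eq0 oppr_eq0 invr_eq0 expf_eq0 /= (negPf r0) /= => /eqP.
  rewrite -[xi x *m D](mulmxK ux) -(mulmxA (xi x) D) -[RHS](mul0mx _ (invmx (P x))); congr (_ *m _).
  apply/rowP; apply: hv_ind => [b|]; rewrite mx0E ?R2//.
  by rewrite R1 H mulr0.
have F2 : \tr D = - (rc x)^-1 * \sum_k fcomp1 (P x) (Y k x) (hh k).
  rewrite -[D](mulmxK ux) mxtrace_mulC /mxtrace (@big_split_ord _ _ _ 3 1) /= big_ord1.
  rewrite [X in _ + X](_ : _ = 0) ?addr0; last first.
    by rewrite mxE big1// => k _; rewrite (Dv k) mulr0.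
  rewrite mulr_sumr; apply: eq_bigr => b _; rewrite mxE fE mulr_sumr.
  apply: eq_bigr => k _; rewrite -/(hh b) Dh.
  by move: (invmx _ _ _) (Y _ _ _ _) (rc x)^-1 => *; ring.
rewrite F1 F2; split=> -[h1 h2]; split=> //; last by rewrite h2 mulr0.
by move/eqP: h2; rewrite mulf_eq0 oppr_eq0 invr_eq0 (negPf r0) => /eqP.
Qed.

(** The antisymmetrised derivative of [xi] lowered to a 1-form is its exterior
    derivative, once the difference of the two connections involved is taken
    into account. *)
Lemma legendrian_frame (tau : 'rV[R]_4 -> 'rV[R]_4) x : U x ->
  th0 x = tau x - (rc x)^-1 *: differential rc x ->
  (forall l i j, levi_civita g l i j x = weyl_conn (gram P) psi l i j x) ->
  let A := cov_deriv (-1) th0 (levi_civita g) xi x *m c x in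
  2^-1 *: (A - A^T) = (2^-1 * rc x) *: (faraday (coframe P vv) x
      + wedge ((psi x + psi x) - tau x) (coframe P vv x)).
Proof.
move=> Ux tE GE A; have r0 := rc0 Ux.
have GP i : conn_mx (levi_civita g) i x *m P x = mpartial i P x + P x *m conn4 psi X Y i x.
  rewrite -(conn4_frame oU sP uP tors Ux); congr (_ *m _); apply/matrixP => a b.
  by rewrite !mxE GE.
have C := cov_deriv_frame Ux tE GP.
have AE i j : A i j = rc x * ((psi x 0 i - tau x 0 i) * P x j vv - \sum_k Y k x 0 i * P x j (hh k)).
  rewrite /A cE// -scalemxAr mxZE /gram mulmxA C mxE (@big_split_ord _ _ _ 3 1) /= big_ord1.
  rewrite -/vv ![(\matrix_(_, _) _) i _]mxE ![(P x)^T _ _]mxE eqxx mulr1.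
  have [_ _ ->] := conn4Ev psi X Y i x 0.
  rewrite (eq_bigr (fun k => - (rc x)^-1 * (Y k x 0 i * P x j (hh k)))); last first.
    move=> k _; rewrite -/(hh k) ![(\matrix_(_, _) _) i _]mxE ![(P x)^T _ _]mxE hv_eq.
    have [_ -> _] := conn4Ev psi X Y i x k.
    rewrite mulr0 subr0.
    by move: (rc x)^-1 (Y k x 0 i) (P x j (hh k)) => *; ring.
  rewrite -mulr_sumr.
  move: (\sum_k _) (psi x 0 i - tau x 0 i) (P x j vv) r0 => t1 t2 t3; move: (rc x) => r r0.
  by field.
have [_ T2] := tors Ux.
have -> : faraday (coframe P vv) x
    = - \sum_k wedge (Y k x) (coframe P (hh k) x) - wedge (psi x) (coframe P vv x) := T2.
apply/matrixP => i j; rewrite !(mxDE, mxNE, mxZE) [A^T _ _]mxE !AE !(sum_cyc _ 0) !(mxDE, mxNE).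
rewrite !wedgeE !(mxDE, mxNE) !coframeE.
move: (P x i vv) (P x j vv) (P x i (hh 0)) (P x j (hh 0)) (P x i (hh (s1 0)))
  (P x j (hh (s1 0))) (P x i (hh (s2 0))) (P x j (hh (s2 0))) (psi x) (tau x)
  (Y 0 x) (Y (s1 0) x) (Y (s2 0) x) (rc x) => *.
by field.
Qed.

End derivative_of_fibre_field.

(** * The monopole over an Einstein-Weyl space *)

Section pulled_back_base.
Variables (R : realType) (B : set 'rV[R]_3) (U : set 'rV[R]_4).
Variables (Q : 'rV[R]_3 -> 'M[R]_3) (th : 'rV[R]_3 -> 'rV[R]_3).
Variable A : 'I_3 -> 'rV[R]_3 -> 'rV[R]_3.
Variable pi : 'rV[R]_4 -> 'rV[R]_3.
Hypotheses (oB : open B) (sQ : smooth_mx_on B Q) (sth : smooth_mx_on B th).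
Hypothesis uQ : forall y, B y -> Q y \in unitmx.
Hypothesis sA : forall k, smooth_mx_on B (A k).
Hypothesis tors : structure_eq B Q th A.
Hypotheses (oU : open U) (spi : smooth_mx_on U pi) (UB : forall x, U x -> B (pi x)).

Notation e k := (pull pi (coframe Q k)).
Notation thM := (pull pi th).
Notation AM k := (pull pi (A k)).
Notation hs k x := (wedge (e (s1 k) x) (e (s2 k) x)).

Lemma pull_structure x k : U x -> faraday (e k) x
  = wedge (AM (s2 k) x) (e (s1 k) x) - wedge (AM (s1 k) x) (e (s2 k) x) - wedge (thM x) (e k x).
Proof.
move=> Ux; rewrite (faraday_pull oU spi UB (smooth_coframe k oB sQ) Ux) (tors (UB Ux) k).
by rewrite !mulmxBr !mulmxBl !wedge_conj.
Qed.

Lemma pull_rotation x k : U x ->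
  'J pi x *m rotation_curv A k (pi x) *m ('J pi x)^T
  = faraday (AM k) x + wedge (AM (s1 k) x) (AM (s2 k) x).
Proof.
by move=> Ux; rewrite (faraday_pull oU spi UB (sA k) Ux) mulmxDr mulmxDl wedge_conj.
Qed.

Lemma pull_expand x u : U x ->
  u *m ('J pi x)^T = \sum_k fcomp1 (Q (pi x)) u k *: e k x.
Proof.
move=> Ux; rewrite {1}(expand_form1 u (uQ (UB Ux))) mulmx_suml.
by apply: eq_bigr => k _; rewrite -scalemxAl.
Qed.

Lemma pull_faraday_th x : U x ->
  faraday thM x = \sum_k far_comp Q th k (pi x) *: hs k x.
Proof.
move=> Ux; rewrite (faraday_pull oU spi UB sth Ux).
rewrite (faraday_expand th uQ (UB Ux)) mulmx_sumr mulmx_suml.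
by apply: eq_bigr => k _; rewrite -scalemxAr -scalemxAl wedge_conj.
Qed.

Lemma pull_dual_faraday x :
  pull pi (dual_faraday Q th) x = \sum_k far_comp Q th k (pi x) *: e k x.
Proof. by rewrite /pull mulmx_suml; apply: eq_bigr => k _; rewrite -scalemxAl. Qed.

Notation sc := (scalar_curvature (gram Q) th).
Hypothesis ew : forall y, B y -> ew_at Q th y.
Notation fM := (pull pi (dual_faraday Q th)).
Notation sig k x := (fcomp1 (Q (pi x)) (dscal Q th (pi x)) k).

Lemma pull_differential_sc x : U x -> differential (fun y => sc (pi y)) x
  = (2 * sc (pi x)) *: thM x + \sum_k sig k x *: e k x.
Proof.
move=> Ux; rewrite (differential_pull spi UB (smooth_sc oB sQ sth uQ sA tors) Ux).
by rewrite -pull_expand// /dscal mulmxBl -scalemxAl addrC subrK.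
Qed.

Lemma pull_bianchi2 x : U x -> faraday fM x
  = wedge (thM x) (fM x) - 3^-1 *: \sum_k sig k x *: hs k x.
Proof.
move=> Ux; rewrite (faraday_pull oU spi UB (smooth_dual_faraday oB sQ sth uQ) Ux).
have := base_bianchi2 oB sQ sth uQ sA tors ew (UB Ux) => /eqP; rewrite subr_eq addrC => /eqP ->.
rewrite mulmxDr mulmxDl wedge_conj -scalemxAr -scalemxAl scaleNr; congr (_ - _ *: _).
rewrite mulmx_sumr mulmx_suml.
by apply: eq_bigr => k _; rewrite -scalemxAr -scalemxAl wedge_conj.
Qed.

Section monopole.
Variables (nu q : 'rV[R]_4 -> R) (eta : 'rV[R]_4 -> 'rV[R]_4).
Hypotheses (snu : smooth_on U nu) (seta : smooth_mx_on U eta).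
Hypothesis qE : forall x, U x -> q x = nu x ^+ 2 - 6^-1 * sc (pi x).
Hypothesis q0 : forall x, U x -> q x != 0.
Hypothesis etaE : forall x, U x ->
  differential nu x = nu x *: thM x - 2^-1 *: fM x + q x *: eta x.

(** The components of [d eta] on pairs of horizontal vectors, by
    [faraday_eta]. *)
Definition twist k x : R :=
  - (6^-1 * sig k x + nu x * far_comp Q th k (pi x)) / q x.

Lemma smooth_q : smooth_on U q.
Proof.
have scM : smooth_on U (fun x => sc (pi x)).
  exact: (smooth_on_comp oU UB spi (smooth_sc oB sQ sth uQ sA tors)).
apply: (eq_smooth_on oU (fun y Uy => esym (qE Uy))).
apply: smooth_onB => //; first by apply: smooth_onM.
by apply: smooth_onM => //; exact: smooth_on_cst.
Qed.

(** The derivative of the scalar curvature of the base and the monopole equation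
    combine to a multiple of [q]. *)
Lemma differential_q x : U x -> differential q x
  = q x *: (2 *: thM x + (2 * nu x) *: eta x + \sum_k twist k x *: e k x).
Proof.
move=> Ux.
have scM : smooth_on U (fun x => sc (pi x)).
  exact: (smooth_on_comp oU UB spi (smooth_sc oB sQ sth uQ sA tors)).
have sc6 : smooth_on U (fun y => - 6^-1 * sc (pi y)) by apply: smooth_onM => //; exact: smooth_on_cst.
rewrite (eq_on_differential (g := fun y => nu y * nu y + - 6^-1 * sc (pi y)) oU _ Ux); last first.
  by move=> y Uy; rewrite qE// expr2 mulNr.
rewrite (differentialD (smooth_onM oU snu snu) sc6 Ux) (differentialM snu snu Ux).
rewrite (differentialM (smooth_on_cst _) scM Ux).
have -> : differential (fun _ : 'rV[R]_4 => - 6^-1 : R) x = 0.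
  by apply/rowP => k; rewrite mxE mx0E partial_cst.
rewrite scaler0 add0r (pull_differential_sc Ux) (etaE Ux) pull_dual_faraday.
apply/rowP => i; rewrite !(sum_cyc _ 0) !(mxDE, mxNE, mxZE).
rewrite /twist (qE Ux).
have := q0 Ux; rewrite (qE Ux).
move: (sc (pi x)) (nu x) (sig 0 x) (sig (s1 0) x) (sig (s2 0) x) => a b c1 c2 c3.
move: (far_comp Q th 0 (pi x)) (far_comp Q th (s1 0) (pi x)) (far_comp Q th (s2 0) (pi x)) => d1 d2 d3.
move: (e 0 x 0 i) (e (s1 0) x 0 i) (e (s2 0) x 0 i) (eta x 0 i) (thM x 0 i) => g1 g2 g3 g4 g5 H.
field; apply: contraNneq H => H; apply/eqP.
by apply: (@linear_consequence _ 6^-1 _ _ _ H); field.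
Qed.

(** Differentiate the monopole equation: [d (d nu) = 0] and [base_bianchi2]
    determine [d (q *: eta)]. *)
Lemma faraday_eta x : U x -> faraday eta x
  = \sum_k (- (fcomp1 (Q (pi x)) (th (pi x)) k + twist k x)) *: wedge (e k x) (eta x)
    + \sum_k twist k x *: hs k x.
Proof.
move=> Ux.
have sthM := smooth_pull oU spi UB sth.
have sfM := smooth_pull oU spi UB (smooth_dual_faraday oB sQ sth uQ).
have sqe : smooth_mx_on U (fun y => q y *: eta y) by apply: smooth_mxZ => //; exact: smooth_q.
have sc1 : smooth_mx_on U (fun y => nu y *: thM y) by apply: smooth_mxZ.
have sc2 : smooth_mx_on U (fun y => 2^-1 *: fM y) by apply: smooth_mxZ => //; exact: smooth_on_cst.
have sc3 : smooth_mx_on U (fun y => - (2^-1 *: fM y)).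
  by move=> i j; apply: (eq_smooth_on oU _ (smooth_onN oU (sc2 i j))) => y Uy; rewrite mxNE.
have sc4 : smooth_mx_on U (fun y => nu y *: thM y - 2^-1 *: fM y) by apply: smooth_mxD.
have E0 := faraday_differential oU snu Ux.
rewrite (eq_on_faraday oU etaE Ux) (faradayD sc4 sqe Ux) (faradayB oU sc1 sc2 Ux) in E0.
rewrite (faradayZ snu sthM Ux) (faradayZ smooth_q seta Ux) (faradayZ (smooth_on_cst _) sfM Ux) in E0.
rewrite (differential_q Ux) (etaE Ux) (pull_faraday_th Ux) (pull_bianchi2 Ux) in E0.
have d0 : differential (fun _ : 'rV[R]_4 => 2^-1 : R) x = 0.
  by apply/rowP => k; rewrite mxE mx0E partial_cst.
rewrite d0 in E0.
have thE : thM x = \sum_k fcomp1 (Q (pi x)) (th (pi x)) k *: e k x by rewrite -pull_expand.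
move: E0; rewrite thE pull_dual_faraday => E0.
apply/matrixP => i j; move/matrixP/(_ i j): E0.
rewrite !(sum_cyc _ 0) !(mxDE, mxNE, mxZE, mx0E) !wedgeE !(mxDE, mxNE, mxZE, mx0E).
rewrite /twist.
have := q0 Ux.
move: (faraday eta x i j) (q x) (nu x) (sig 0 x) (sig (s1 0) x) (sig (s2 0) x) => a b c0 c1 c2 c3.
move: (far_comp Q th 0 (pi x)) (far_comp Q th (s1 0) (pi x)) (far_comp Q th (s2 0) (pi x)) => d1 d2 d3.
move: (fcomp1 (Q (pi x)) (th (pi x)) 0) (fcomp1 (Q (pi x)) (th (pi x)) (s1 0)) (fcomp1 (Q (pi x)) (th (pi x)) (s2 0)) => f1 f2 f3.
move: (e 0 x) (e (s1 0) x) (e (s2 0) x) (eta x).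
move=> v1 v2 v3 v4.
move: (v1 0 i) (v2 0 i) (v3 0 i) (v4 0 i) (v1 0 j) (v2 0 j) (v3 0 j) (v4 0 j) => u1 u2 u3 u4 w1 w2 w3 w4 b0.
move=> H; apply/eqP; rewrite -subr_eq0; apply/eqP.
by apply: (@linear_consequence _ (b^-1) _ _ _ H); field.
Qed.

(** The terms in [f] cancel between the curvature of the base and the derivative
    of [nu]: this is what the monopole equation [etaE] is for. *)
Lemma monopole_curvature x k : U x ->
  let u j y := AM j y - nu y *: e j y in
  faraday (u k) x + wedge (u (s1 k) x) (u (s2 k) x)
  = q x *: (hs k x + wedge (e k x) (eta x)).
Proof.
move=> Ux u; rewrite /u.
have sAM := smooth_pull oU spi UB (sA k).
have se := smooth_pull oU spi UB (smooth_coframe k oB sQ).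
rewrite (faradayB oU sAM (smooth_mxZ oU snu se) Ux) (faradayZ snu se Ux).
rewrite (pull_structure k Ux) (etaE Ux).
have := pull_rotation k Ux.
rewrite (ew_rotation oB sQ sth uQ sA tors (UB Ux) (ew (UB Ux)) k).
rewrite mulmxBr mulmxBl -!scalemxAr -!scalemxAl !wedge_conj.
rewrite -[coframe Q k (pi x) *m _]/(e k x) -[coframe Q (s1 k) (pi x) *m _]/(e (s1 k) x)
  -[coframe Q (s2 k) (pi x) *m _]/(e (s2 k) x) -[dual_faraday Q th (pi x) *m _]/(fM x).
move=> H; apply/matrixP => i j; move/matrixP/(_ i j): H.
rewrite !(mxDE, mxNE, mxZE) !wedgeE !(mxDE, mxNE, mxZE) (qE Ux).
move: (faraday _ x i j) (sc (pi x)) (nu x) (e k x) (e (s1 k) x) (e (s2 k) x) (eta x) (fM x) (thM x)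
  (AM (s1 k) x) (AM (s2 k) x) => p1 p2 p3 p4 p5 p6 p7 p8 p9 p10 p11 H.
apply/eqP; rewrite -subr_eq0; apply/eqP.
by apply: (@linear_consequence _ (-1) _ _ _ H); field.
Qed.

End monopole.
End pulled_back_base.

(** * Coframes adapted to a submersion *)

Section more_smooth.
Variables (R : realType) (n : nat) (U : set 'rV[R]_n).
Hypothesis oU : open U.

Lemma eq_smooth_mx p q (A A' : 'rV[R]_n -> 'M[R]_(p, q)) :
  (forall x, U x -> A x = A' x) -> smooth_mx_on U A -> smooth_mx_on U A'.
Proof. by move=> E sA i j; apply: (eq_smooth_on oU _ (sA i j)) => x Ux; rewrite E. Qed.

Lemma smooth_mxN p q (A : 'rV[R]_n -> 'M[R]_(p, q)) :
  smooth_mx_on U A -> smooth_mx_on U (fun x => - A x).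
Proof.
by move=> sA i j; apply: (eq_smooth_on oU _ (smooth_onN oU (sA i j))) => x Ux; rewrite mxNE.
Qed.

Lemma smooth_mxB p q (A A' : 'rV[R]_n -> 'M[R]_(p, q)) :
  smooth_mx_on U A -> smooth_mx_on U A' -> smooth_mx_on U (fun x => A x - A' x).
Proof. by move=> sA sA'; exact: smooth_mxD (sA) (smooth_mxN sA'). Qed.

Lemma smooth_mx_sum p q (I : finType) (A : I -> 'rV[R]_n -> 'M[R]_(p, q)) :
  (forall k, smooth_mx_on U (A k)) -> smooth_mx_on U (fun x => \sum_k A k x).
Proof.
move=> sA i j; have S := smooth_on_sum oU (fun k => sA k i j).
by apply: (eq_smooth_on oU _ S) => x Ux; rewrite summxE.
Qed.

Lemma smooth_row_mx p q q' (A : 'rV[R]_n -> 'M[R]_(p, q)) (A' : 'rV[R]_n -> 'M[R]_(p, q')) :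
  smooth_mx_on U A -> smooth_mx_on U A' -> smooth_mx_on U (fun x => row_mx (A x) (A' x)).
Proof.
move=> sA sA' i j; case: (@fintype.split_ordP _ _ j) => k ->.
  by apply: (eq_smooth_on oU _ (sA i k)) => x Ux; rewrite row_mxEl.
by apply: (eq_smooth_on oU _ (sA' i k)) => x Ux; rewrite row_mxEr.
Qed.

Lemma smooth_mx_comp m p q (V : set 'rV[R]_m) (F : 'rV[R]_n -> 'rV[R]_m)
    (A : 'rV[R]_m -> 'M[R]_(p, q)) : smooth_mx_on U F -> (forall x, U x -> V (F x)) ->
  smooth_mx_on V A -> smooth_mx_on U (fun x => A (F x)).
Proof. by move=> sF UV sA i j; exact: (smooth_on_comp oU UV sF (sA i j)). Qed.

End more_smooth.

Lemma gram_posdef (R : realType) n (Q : 'M[R]_n) : Q \in unitmx -> posdef (Q *m Q^T).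
Proof.
move=> uQ v v0; rewrite mulmxA -mulmxA -trmx_mul; set w := v *m Q.
have w0 : w != 0 by apply: contraNneq v0 => w0; rewrite -(mulmxK uQ v) -/w w0 mul0mx.
rewrite mxE (eq_bigr (fun j => w 0 j ^+ 2)); last by move=> j _; rewrite [w^T _ _]mxE expr2.
rewrite lt_def sumr_ge0 ?andbT; last by move=> j _; exact: sqr_ge0.
apply: contraNneq w0 => /eqP; rewrite psumr_eq0; last by move=> j _; exact: sqr_ge0.
move=> /allP H; apply/eqP/rowP => j; rewrite mx0E; apply/eqP.
by have := H j (mem_index_enum _); rewrite sqrf_eq0.
Qed.

Lemma posdefZ (R : realType) n (a : R) (A : 'M[R]_n) : 0 < a -> posdef A -> posdef (a *: A).
Proof. by move=> a0 pA v /pA H; rewrite -scalemxAr -scalemxAl mxZE mulr_gt0. Qed.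

(** The determinant of [g] is the fourth power of [rho ^+ 2 / rc ^+ 2]. *)
Lemma conformal_class_frame (R : realType) (P g : 'rV[R]_4 -> 'M[R]_4) (rho rc : R) x :
  rho != 0 -> rc ^+ 4 * \det (P x) = 1 -> g x = rho ^+ 2 *: gram P x ->
  conformal_class g x = rc ^+ 2 *: gram P x.
Proof.
move=> rho0 rcP gE.
have rc0 : rc != 0.
  by apply: contraTneq (oner_neq0 R) => rc0; rewrite -rcP rc0 expr0n /= mul0r eqxx.
have r2 : 0 < rho ^+ 2 by rewrite exprn_even_gt0.
have c2 : 0 < rc ^+ 2 by rewrite exprn_even_gt0.
have dE : \det (g x) = (rc ^+ 2 / rho ^+ 2) ^- 4.
  have dP : \det (P x) = rc ^- 4.
    by apply: (mulfI (expf_neq0 4 rc0)); rewrite rcP mulfV// expf_neq0.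
  rewrite gE detZ /gram det_mulmx det_tr dP; move: rc0 rho0 => {rcP gE dP r2 c2} h1 h2.
  by field; rewrite h2 h1.
have q0 : 0 < rc ^+ 2 / rho ^+ 2 by rewrite divr_gt0.
rewrite /conformal_class dE powRN -powR_invn; last exact: ltW.
rewrite -powRrM mulNr mulfV ?pnatr_eq0// powR_inv1 ?invrK; last exact: ltW.
by rewrite gE scalerA divfK// gt_eqF.
Qed.

Section fibred_frame.
Variables (R : realType) (Q : 'rV[R]_3 -> 'M[R]_3) (pi : 'rV[R]_4 -> 'rV[R]_3).
Variable eta : 'rV[R]_4 -> 'rV[R]_4.

(** The coframe formed by the pull-back of a coframe of the base and a 1-form
    [eta], written as a matrix whose columns are the four forms. *)
Definition fibre_frame x : 'M[R]_4 :=
  (row_mx ('J pi x *m Q (pi x)) (eta x)^T : 'M[R]_(4, 3 + 1)).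

Notation P := fibre_frame.

Lemma fibre_frame_h k : coframe P (hh k) = pull pi (coframe Q k).
Proof.
apply/funext => x; apply/rowP => i; rewrite coframeE (@row_mxEl _ 4 3 1) /pull.
rewrite [LHS]mxE [RHS]mxE; apply: eq_bigr => j _.
by rewrite coframeE [('J pi x)^T _ _]mxE mulrC.
Qed.

Lemma fibre_frame_v : coframe P vv = eta.
Proof.
by apply/funext => x; apply/rowP => i; rewrite coframeE (@row_mxEr _ 4 3 1) mxE.
Qed.

Lemma gram_fibre_frame x : gram P x
  = 'J pi x *m gram Q (pi x) *m ('J pi x)^T + (eta x)^T *m eta x.
Proof.
rewrite /gram /P (@tr_row_mx _ 4 3 1) (@mul_row_col _ 4 3 1 4) trmxK trmx_mul.
by rewrite !mulmxA.
Qed.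

Lemma smooth_fibre_frame (U : set 'rV[R]_4) (B : set 'rV[R]_3) : open U ->
  smooth_mx_on U pi -> (forall x, U x -> B (pi x)) -> smooth_mx_on B Q ->
  smooth_mx_on U eta -> smooth_mx_on U P.
Proof.
move=> oU spi UB sQ seta; apply: (@smooth_row_mx R 4 U oU 4 3 1).
  exact: (smooth_mx_mul oU (smooth_jacobian oU spi) (smooth_mx_comp oU spi UB sQ)).
exact: smooth_mx_tr.
Qed.

Lemma det_fibre_frame (d : 'rV[R]_4) (v : 'rV[R]_3) (a : R) x :
  eta x = a *: d + v *m ('J pi x)^T ->
  \det (P x) = a * \det (Q (pi x)) * \det (row_mx ('J pi x) d^T : 'M[R]_(3 + 1)).
Proof.
move=> etaE; rewrite /P.
have -> : row_mx ('J pi x *m Q (pi x)) (eta x)^T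
    = (row_mx ('J pi x) d^T : 'M[R]_(3 + 1)) *m block_mx (Q (pi x)) v^T 0 (a%:M : 'M[R]_1).
  rewrite (@mul_row_block _ 4 3 1 3 1) mulmx0 addr0 etaE linearD /= linearZ /= trmx_mul trmxK.
  by rewrite mul_mx_scalar addrC.
by rewrite det_mulmx (@det_ublock _ 3 1) det_scalar1 [LHS]mulrC; congr (_ * _); rewrite mulrC.
Qed.

Variables (B : set 'rV[R]_3) (x : 'rV[R]_4).
Hypotheses (uP : P x \in unitmx) (uQ : Q (pi x) \in unitmx).

Lemma fibre_dual_h : row vv (invmx (P x)) *m 'J pi x = 0.
Proof.
have E : row vv (invmx (P x)) *m ('J pi x *m Q (pi x)) = 0.
  apply/rowP => k; rewrite mx0E.
  have := congr1 (fun Z : 'M[R]_4 => Z vv (hh k)) (mulVmx uP); rewrite [RHS]mxE vh_eq /= => E.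
  rewrite -[RHS]E [LHS]mxE [RHS]mxE; apply: eq_bigr => j _; rewrite [row _ _ _ _]mxE; congr (_ * _).
  by rewrite (@row_mxEl _ 4 3 1).
by rewrite -[LHS](mulmxK uQ) -(mulmxA (row _ _)) E mul0mx.
Qed.

Lemma fibre_dual_v : row vv (invmx (P x)) *m (eta x)^T = 1%:M.
Proof.
apply/rowP => k; rewrite (ord1 k).
have := congr1 (fun Z : 'M[R]_4 => Z vv vv) (mulVmx uP); rewrite !mxE eqxx => E.
rewrite -[RHS]E; apply: eq_bigr => j _.
by rewrite [row _ _ _ _]mxE; congr (_ * _); rewrite (@row_mxEr _ 4 3 1).
Qed.

Lemma fibre_frame_rank : \rank ('J pi x) = 3%N.
Proof.
apply/eqP; rewrite eqn_leq rank_leq_col /=.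
have : (\rank (P x) <= \rank ('J pi x) + 1)%N.
  have -> : P x = row_mx ('J pi x) 0 *m block_mx (Q (pi x)) 0 0 (0 : 'M[R]_1)
      + (row_mx 0 (eta x)^T : 'M[R]_(4, 3 + 1)).
    rewrite (@mul_row_block _ 4 3 1 3 1) !mulmx0 ?mul0mx !addr0 /P.
    by rewrite (@add_row_mx _ 4 3 1) addr0 add0r.
  apply: leq_trans (mxrank_add _ _) _; apply: leq_add.
    apply: leq_trans (mxrankM_maxl _ _) _.
    have -> : row_mx ('J pi x) 0 = 'J pi x *m (row_mx 1%:M 0 : 'M[R]_(3, 3 + 1)).
      by rewrite mul_mx_row mulmx1 mulmx0.
    exact: mxrankM_maxl.
  have -> : (row_mx 0 (eta x)^T : 'M[R]_(4, 3 + 1)) = (eta x)^T *m row_mx 0 1%:M.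
    by rewrite mul_mx_row mulmx1 mulmx0.
  exact: leq_trans (mxrankM_maxl _ _) (rank_leq_col _).
by rewrite mxrank_unit// addn1 ltnS.
Qed.

End fibred_frame.

(** The last vector of the frame dual to [fibre_frame] is vertical and the first
    three span the horizontal space, where the metric is pulled back from the
    base up to the factor [rc ^+ 2]. *)
Lemma fibre_frame_submersion (R : realType) (U : set 'rV[R]_4) (B : set 'rV[R]_3)
    (cB : 'rV[R]_3 -> 'M[R]_3) Q pi eta (c : 'rV[R]_4 -> 'M[R]_4) (xi : 'rV[R]_4 -> 'rV[R]_4)
    (rc : 'rV[R]_4 -> R) :
  let P := fibre_frame Q pi eta in
  open U -> open B -> conformal_structure B cB -> (forall y, B y -> cB y = gram Q y) ->
  (forall y, B y -> Q y \in unitmx) -> smooth_mx_on U pi -> pi @` U = B ->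
  smooth_mx_on U P -> (forall x, U x -> P x \in unitmx) ->
  smooth_on U rc -> (forall x, U x -> rc x ^+ 4 * \det (P x) = 1) ->
  (forall x, U x -> c x = rc x ^+ 2 *: gram P x) ->
  (forall x, U x -> xi x = (rc x)^-1 *: row vv (invmx (P x))) ->
  conformal_submersion U c B cB pi xi.
Proof.
move=> P oU oB csB cBE uQ spi pU sP uP src rcP cE xiE.
have UB x : U x -> B (pi x) by move=> Ux; rewrite -pU; exists x.
have rc0 x : U x -> rc x != 0.
  move=> Ux; apply: contraTneq (oner_neq0 R) => rc0.
  by rewrite -(rcP x Ux) rc0 expr0n /= mul0r eqxx.
split=> //.
- split=> //; split=> [|x Ux]; first split=> [|x Ux].
  + apply: (eq_smooth_mx oU (fun x Ux => esym (cE x Ux))).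
    apply: smooth_mxZ => //; last exact: smooth_gram.
    by apply: (eq_smooth_on oU (f := fun x => rc x * rc x)) => [x _|]; [rewrite expr2|exact: smooth_onM].
  + rewrite cE//; split; first by rewrite linearZ /= gram_sym.
    apply: posdefZ; first by rewrite exprn_even_gt0// rc0.
    exact/gram_posdef/uP.
  + rewrite cE// detZ /gram det_mulmx det_tr.
    rewrite -[RHS](mulr1 1) -{1}(rcP x Ux) -(rcP x Ux).
    by move: (rc x) (\det _) => *; ring.
- by split=> // x Ux; exact: fibre_frame_rank (uP x Ux).
- move=> x Ux; have r0 := rc0 x Ux.
  exists ((rc x) ^- 2); first by rewrite invr_gt0 exprn_even_gt0.
  have hor (X : 'rV[R]_4) : (forall V : 'rV[R]_4, V *m 'J pi x = 0 -> X *m c x *m V^T = 0) -> X *m (eta x)^T = 0.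
    move=> /(_ _ (fibre_dual_h (uP x Ux) (uQ _ (UB x Ux)))).
    rewrite cE// -scalemxAr -scalemxAl gram_fibre_frame mulmxDr mulmxDl.
    rewrite -!mulmxA -trmx_mul (fibre_dual_h (uP x Ux) (uQ _ (UB x Ux))) trmx0 !mulmx0 add0r.
    have -> : eta x *m (row vv (invmx (P x)))^T = 1%:M.
      by rewrite -[eta x]trmxK -trmx_mul (fibre_dual_v (uP x Ux)) trmx1.
    rewrite mulmx1 => /eqP; rewrite scaler_eq0 expf_eq0 /= (negPf r0) => /eqP.
    by [].
  move=> X Y /hor hX /hor hY.
  rewrite cE// -[in RHS]scalemxAr -scalemxAl scalerA mulVf ?expf_neq0// scale1r.
  rewrite gram_fibre_frame mulmxDr mulmxDl !mulmxA hX !mul0mx addr0.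
  by rewrite cBE ?trmx_mul ?mulmxA//; exact: UB.
- split.
    apply: (eq_smooth_mx oU (fun x Ux => esym (xiE x Ux))).
    apply: smooth_mxZ => //; first exact: smooth_onV.
    move=> i j; apply: (eq_smooth_on oU _ (smooth_invmx oU sP uP vv j)) => x Ux.
    by rewrite [RHS]mxE.
  move=> x Ux; have r0 := rc0 x Ux.
  rewrite xiE// -scalemxAl (fibre_dual_h (uP x Ux) (uQ _ (UB x Ux))) scaler0; split=> //.
  have E4 : row vv (invmx (P x)) *m P x = delta_mx 0 vv :> 'rV[R]_4.
    by rewrite -row_mul mulVmx ?uP// row1.
  have ZT (a : R) (E : 'rV[R]_4) : (a *: E)^T = a *: E^T by exact: linearZ.
  rewrite cE// ZT /gram -!scalemxAr -!scalemxAl !scalerA mulmxA E4.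
  rewrite -mulmxA -trmx_mul E4 trmx_delta mul_delta_mx.
  have -> : delta_mx 0 0 = 1%:M :> 'M[R]_1.
    by apply/matrixP => i j; rewrite (ord1 i) (ord1 j) !mxE eqxx.
  rewrite (_ : _ * _ = 1) ?scale1r//.
  by move: r0; move: (rc x) => r r0; field.
Qed.

(** * The geometry of a monopole *)

Lemma selfdual_sum (R : realType) (P : 'rV[R]_4 -> 'M[R]_4) (r : R) (a : 'I_3 -> R) x :
  P x \in unitmx -> r ^+ 4 * \det (P x) = 1 ->
  selfdual_form (r ^+ 2 *: gram P x)
    (\sum_k a k *: (wedge (coframe P (hh (s1 k)) x) (coframe P (hh (s2 k)) x)
                    - wedge (coframe P (hh k) x) (coframe P vv x))).
Proof.
move=> uP rP; apply/(selfdual_fcomp rP).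
  by apply/matrixP => i j; rewrite mxE mxNE !(sum_cyc _ 0) !entryE !wedgeE; ring.
move=> k; rewrite (sum_cyc _ k) !cycE !(fcompD, fcompN, fcompZ, fcomp_wedge) !fcomp1_coframe//.
rewrite !(hh_eq, hv_eq, vh_eq, cyc_neq, eqxx) /=.
by ring.
Qed.

Section monopole_geometry.
Variables (R : realType) (B : set 'rV[R]_3) (U : set 'rV[R]_4).
Variables (Q : 'rV[R]_3 -> 'M[R]_3) (th : 'rV[R]_3 -> 'rV[R]_3).
Variable A : 'I_3 -> 'rV[R]_3 -> 'rV[R]_3.
Variable pi : 'rV[R]_4 -> 'rV[R]_3.
Hypotheses (oB : open B) (sQ : smooth_mx_on B Q) (sth : smooth_mx_on B th).
Hypothesis uQ : forall y, B y -> Q y \in unitmx.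
Hypothesis sA : forall k, smooth_mx_on B (A k).
Hypothesis tors : structure_eq B Q th A.
Hypotheses (oU : open U) (spi : smooth_mx_on U pi) (UB : forall x, U x -> B (pi x)).
Notation sc := (scalar_curvature (gram Q) th).
Hypothesis ew : forall y, B y -> ew_at Q th y.
Variables (nu q : 'rV[R]_4 -> R) (eta : 'rV[R]_4 -> 'rV[R]_4).
Hypotheses (snu : smooth_on U nu) (seta : smooth_mx_on U eta).
Hypothesis qE : forall x, U x -> q x = nu x ^+ 2 - 6^-1 * sc (pi x).
Hypothesis q0 : forall x, U x -> q x != 0.
Notation thM := (pull pi th).
Notation fM := (pull pi (dual_faraday Q th)).
Hypothesis etaE : forall x, U x ->
  differential nu x = nu x *: thM x - 2^-1 *: fM x + q x *: eta x.
Let P := fibre_frame Q pi eta.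
Hypothesis uP : forall x, U x -> P x \in unitmx.
Notation e k := (pull pi (coframe Q k)).
Notation AM k := (pull pi (A k)).
Notation hs k x := (wedge (e (s1 k) x) (e (s2 k) x)).
Notation w := (twist Q th pi nu q).

Let phi k x := - (fcomp1 (Q (pi x)) (th (pi x)) k + w k x).

Let sP : smooth_mx_on U P := smooth_fibre_frame oU spi UB sQ seta.
Let se k : smooth_mx_on U (e k) := smooth_pull oU spi UB (smooth_coframe k oB sQ).
Let sth' : smooth_mx_on U thM := smooth_pull oU spi UB sth.
Let sq : smooth_on U q := smooth_q oB sQ sth uQ sA tors oU spi UB snu qE.

Lemma smooth_twist k : smooth_on U (w k).
Proof.
have sf : smooth_on U (fun x => far_comp Q th k (pi x)).
  apply: (smooth_on_comp oU UB spi); apply: smooth_fcomp => //; exact: smooth_faraday.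
have sd : smooth_mx_on B (dscal Q th).
  have ssc := smooth_sc oB sQ sth uQ sA tors.
  apply: smooth_mxB => //; first exact: smooth_differential.
  by apply: smooth_mxZ => //; apply: smooth_onM => //; exact: smooth_on_cst.
have ss : smooth_on U (fun x => fcomp1 (Q (pi x)) (dscal Q th (pi x)) k).
  apply: (smooth_on_comp (V := B) (f := fun y => fcomp1 (Q y) (dscal Q th y) k) oU UB spi).
  exact: (smooth_mx_mul oB sd (smooth_mx_tr oB (smooth_invmx oB sQ uQ)) 0 k).
apply: smooth_onM => //; last exact: smooth_onV.
apply: smooth_onN => //; apply: smooth_onD => //; last exact: smooth_onM.
by apply: smooth_onM => //; exact: smooth_on_cst.
Qed.

Lemma monopole_frame_h x k : U x -> faraday (coframe P (hh k)) x
  = wedge (AM (s2 k) x) (coframe P (hh (s1 k)) x)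
    - wedge (AM (s1 k) x) (coframe P (hh (s2 k)) x) - wedge (thM x) (coframe P (hh k) x).
Proof. by move=> Ux; rewrite !fibre_frame_h; exact: (pull_structure oB sQ tors oU spi UB k Ux). Qed.

Lemma monopole_frame_v x : U x -> faraday (coframe P vv) x
  = \sum_k phi k x *: wedge (coframe P (hh k) x) (coframe P vv x)
    + \sum_k w k x *: wedge (coframe P (hh (s1 k)) x) (coframe P (hh (s2 k)) x).
Proof.
move=> Ux; rewrite fibre_frame_v (faraday_eta oB sQ sth uQ sA tors oU spi UB ew snu seta qE q0 etaE Ux).
by congr (_ + _); apply: eq_bigr => k _; rewrite !fibre_frame_h.
Qed.

Let thE x : U x -> thM x = \sum_k fcomp1 (Q (pi x)) (th (pi x)) k *: coframe P (hh k) x.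
Proof.
move=> Ux; rewrite [LHS](pull_expand uQ UB (th (pi x)) Ux).
by apply: eq_bigr => k _; rewrite fibre_frame_h.
Qed.

Let p k x := 2^-1 * w k x.
Let y k x := - (2^-1 * w k x).
Let psi := frame_form P thM p nu.
Let X := rot_form P (fun k => AM k) w p.
Let Y := fibre_form P w y nu.

Let tors4 : structure_eq4 U P psi X Y.
Proof.
apply: (submersion_structure (phi := phi)) => [x Ux k|x Ux|x Ux].
- exact: monopole_frame_h.
- exact: monopole_frame_v.
rewrite thE// !(sum_cyc _ 0) /phi /y /p.
apply/rowP => i; rewrite !entryE.
move: (coframe P (hh 0) x) (coframe P (hh (s1 0)) x) (coframe P (hh (s2 0)) x) => a b c.
move: (w 0 x) (w (s1 0) x) (w (s2 0) x) => d1 d2 d3.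
move: (fcomp1 (Q (pi x)) (th (pi x)) 0) (fcomp1 (Q (pi x)) (th (pi x)) (s1 0))
  (fcomp1 (Q (pi x)) (th (pi x)) (s2 0)) => *.
by field.
Qed.

Let scf a : smooth_mx_on U (coframe P a) := smooth_coframe a oU sP.
Let sw k : smooth_on U (w k) := smooth_twist k.
Let sp k : smooth_on U (p k).
Proof. by apply: smooth_onM => //; exact: smooth_on_cst. Qed.
Let sy k : smooth_on U (y k).
Proof. by apply: smooth_onN => //; exact: sp. Qed.

Let spsi : smooth_mx_on U psi.
Proof.
apply: smooth_mxD => //; last exact: (smooth_mxZ oU snu (scf vv)).
apply: smooth_mxD => //; apply: smooth_mx_sum => // k; exact: (smooth_mxZ oU (sp k) (scf _)).
Qed.

Let sX k : smooth_mx_on U (X k).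
Proof.
apply: smooth_mxD => //; last exact: (smooth_mxZ oU (sp k) (scf vv)).
apply: smooth_mxB => //; last exact: (smooth_mxZ oU (sp _) (scf _)).
apply: smooth_mxD => //; last exact: (smooth_mxZ oU (sp _) (scf _)).
exact: (smooth_pull oU spi UB (sA k)).
Qed.

Let sY k : smooth_mx_on U (Y k).
Proof.
apply: smooth_mxB => //.
  exact: (smooth_mxB oU (smooth_mxZ oU (sy k) (scf vv)) (smooth_mxZ oU snu (scf _))).
apply: smooth_mxZ => //; first exact: smooth_on_cst.
exact: (smooth_mxB oU (smooth_mxZ oU (sw _) (scf _)) (smooth_mxZ oU (sw _) (scf _))).
Qed.

Let asdE k x : asd_conn X Y k x = AM k x - nu x *: e k x.
Proof.
rewrite -(fibre_frame_h Q pi eta) -/P /asd_conn /X /Y /rot_form /fibre_form /p /y.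
apply/rowP => i; rewrite !entryE.
move: (AM k x) (coframe P (hh k) x) (coframe P (hh (s1 k)) x) (coframe P (hh (s2 k)) x)
  (coframe P vv x) (w k x) (w (s1 k) x) (w (s2 k) x) (nu x) => *.
by field.
Qed.

Variables (eps : R) (rho : 'rV[R]_4 -> R) (g : 'rV[R]_4 -> 'M[R]_4).
Hypotheses (eps1 : eps * eps = 1) (srho : smooth_on U rho).
Hypothesis rho0 : forall x, U x -> rho x != 0.
Hypothesis qrho : forall x, U x -> q x = eps * rho x ^+ 2.
Hypothesis gE : forall x, U x -> g x = rho x ^+ 2 *: gram P x.

Let psiE x : U x -> psi x = (rho x)^-1 *: differential rho x.
Proof.
move=> Ux; have dq := differential_q oB sQ sth uQ sA tors oU spi UB snu qE q0 etaE Ux.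
have e0 : eps != 0 by apply: contra_eqN eps1 => /eqP ->; rewrite mul0r eq_sym oner_eq0.
have dq' : differential q x = (eps * (2 * rho x)) *: differential rho x.
  rewrite (eq_on_differential (g := fun y => eps * (rho y * rho y)) oU _ Ux); last first.
    by move=> z Uz; rewrite qrho// expr2.
  rewrite (differentialM (smooth_on_cst _) (smooth_onM oU srho srho) Ux) (differentialM srho srho Ux).
  have -> : differential (fun _ : 'rV[R]_4 => eps) x = 0.
    by apply/rowP => k; rewrite mxE mx0E partial_cst.
  by rewrite scaler0 add0r -scalerDl scalerA mulr_natl mulr2n.
have r0 := rho0 Ux.
move: dq; rewrite dq' qrho// => dq.
have -> : (rho x)^-1 *: differential rho x
    = (2^-1 / (eps * rho x ^+ 2)) *: ((eps * (2 * rho x)) *: differential rho x).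
  rewrite scalerA; congr (_ *: _); move: r0; move: (rho x) => r r0.
  by field; rewrite r0.
rewrite dq scalerA /psi /frame_form /p fibre_frame_v; apply/rowP => i.
rewrite !(sum_cyc _ 0) !entryE !fibre_frame_h.
move: (e 0 x) (e (s1 0) x) (e (s2 0) x) (eta x) (thM x) (w 0 x) (w (s1 0) x) (w (s2 0) x) (nu x) => *.
by move: r0; move: (rho x) => r r0; field; rewrite r0.
Qed.

Variable rc : 'rV[R]_4 -> R.
Hypotheses (src : smooth_on U rc) (rcP : forall x, U x -> rc x ^+ 4 * \det (P x) = 1).

Let rc0 x : U x -> rc x != 0.
Proof.
move=> Ux; apply: contraTneq (oner_neq0 R) => rc0.
by rewrite -(rcP Ux) rc0 expr0n /= mul0r eqxx.
Qed.

Let cE x : U x -> conformal_class g x = rc x ^+ 2 *: gram P x.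
Proof. by move=> Ux; exact: conformal_class_frame (rho0 Ux) (rcP Ux) (gE Ux). Qed.

(** The Levi-Civita form is [d q / 2 q = th + nu eta + w / 2]; with it the
    connection on antiselfdual forms becomes [A_k - nu e_k], and
    [monopole_curvature] applies. *)
Lemma monopole_einstein x : U x ->
  [/\ einstein_at g x, selfdual_at g x & scal g x = - 12 * eps].
Proof.
move=> Ux.
have antiR a b c d : frame_curv P (weyl_conn (gram P) psi) x a b d c
    = - frame_curv P (weyl_conn (gram P) psi) x a b c d.
  have := frame_curv_trace oU sP spsi uP sX sY tors4 Ux a b c d.
  rewrite (eq_on_faraday oU psiE Ux) (faraday_dlog oU srho rho0 Ux) /fcomp mulmx0 mul0mx mx0E mulr0.
  by rewrite addrC => /eqP; rewrite addr_eq0 => /eqP.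
have asd k a b : asd_curv (frame_curv P (weyl_conn (gram P) psi) x) k a b
    = q x * asd_form R k a b.
  rewrite (asd_curvE oU sP spsi uP sX sY tors4 Ux).
  rewrite (eq_on_faraday (b := fun x => AM k x - nu x *: e k x) oU _ Ux); last by move=> z Uz; exact: asdE.
  rewrite !asdE (monopole_curvature oB sQ sth uQ sA tors oU spi UB ew snu qE etaE k Ux).
  rewrite -!(fibre_frame_h Q pi eta) -/P -(fibre_frame_v Q pi eta) -/P !fcompE !fcomp1_coframe ?uP//.
have [E1 E2 E3] := einstein_selfdualP oU sP srho uP rho0 gE psiE Ux antiR (cE Ux) (rcP Ux) asd.
split=> //; rewrite E3 qrho//.
by have := rho0 Ux; move: (rho x) => r r0; field; rewrite r0.
Qed.

Let tau := frame_form P thM w (fun=> 0).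

Let tauE x : U x -> tau x = (q x)^-1 *: differential q x - thM x - (2 * nu x) *: eta x.
Proof.
move=> Ux; rewrite (differential_q oB sQ sth uQ sA tors oU spi UB snu qE q0 etaE Ux).
rewrite scalerA mulVf ?q0// scale1r /tau /frame_form scale0r addr0.
rewrite (eq_bigr (fun k => w k x *: e k x)); last by move=> k _; rewrite fibre_frame_h.
move: (\sum_k _) => S; apply/rowP => i; rewrite !entryE.
by move: (thM x) (eta x) (S 0 i) (nu x) => *; ring.
Qed.

Let stau : smooth_mx_on U tau.
Proof.
apply: smooth_mxD => //; last by apply: smooth_mxZ => //; exact: smooth_on_cst.
apply: smooth_mxD => //; apply: smooth_mx_sum => // k; exact: smooth_mxZ.
Qed.

Let sdE x (a : 'I_3 -> R) : \sum_k a k *: (hs k x - wedge (e k x) (eta x))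
  = \sum_k a k *: (wedge (coframe P (hh (s1 k)) x) (coframe P (hh (s2 k)) x)
                    - wedge (coframe P (hh k) x) (coframe P vv x)).
Proof. by apply: eq_bigr => k _; rewrite !fibre_frame_h fibre_frame_v. Qed.

Let dtau x : U x -> faraday tau x = \sum_k (- (far_comp Q th k (pi x) + 2 * nu x * w k x)) *:
  (hs k x - wedge (e k x) (eta x)).
Proof.
move=> Ux.
have sdq : smooth_mx_on U (fun x => (q x)^-1 *: differential q x).
  apply: smooth_mxZ => //; [exact: smooth_onV|exact: smooth_differential].
have s2n : smooth_on U (fun x => 2 * nu x) by apply: smooth_onM => //; exact: smooth_on_cst.
have sn2 : smooth_mx_on U (fun x => (2 * nu x) *: eta x) by exact: smooth_mxZ.
have s3 : smooth_mx_on U (fun x => (q x)^-1 *: differential q x - thM x) by exact: smooth_mxB.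
rewrite (eq_on_faraday oU tauE Ux) (faradayB oU s3 sn2 Ux) (faradayB oU sdq sth' Ux).
rewrite (faraday_dlog oU sq q0 Ux) (faradayZ s2n seta Ux).
rewrite (differentialM (smooth_on_cst _) snu Ux).
have -> : differential (fun _ : 'rV[R]_4 => 2 : R) x = 0.
  by apply/rowP => k; rewrite mxE mx0E partial_cst.
rewrite (pull_faraday_th sth uQ oU spi UB Ux) (etaE Ux).
rewrite (faraday_eta oB sQ sth uQ sA tors oU spi UB ew snu seta qE q0 etaE Ux).
rewrite (pull_expand uQ UB (th (pi x)) Ux : thM x = _) pull_dual_faraday.
apply/matrixP => i j.
rewrite !(sum_cyc _ 0) !entryE !wedgeE !entryE.
move: (far_comp Q th 0 (pi x)) (far_comp Q th (s1 0) (pi x)) (far_comp Q th (s2 0) (pi x)) => d1 d2 d3.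
move: (fcomp1 (Q (pi x)) (th (pi x)) 0) (fcomp1 (Q (pi x)) (th (pi x)) (s1 0)) (fcomp1 (Q (pi x)) (th (pi x)) (s2 0)) => f1 f2 f3.
move: (w 0 x) (w (s1 0) x) (w (s2 0) x) (q x) (nu x) => w1 w2 w3 a b.
move: (e 0 x) (e (s1 0) x) (e (s2 0) x) (eta x) => v1 v2 v3 v4.
move: (v1 0 i) (v2 0 i) (v3 0 i) (v4 0 i) (v1 0 j) (v2 0 j) (v3 0 j) (v4 0 j) => *.
by field.
Qed.

Variable xi : 'rV[R]_4 -> 'rV[R]_4.
Hypothesis xiE : forall x, U x -> xi x = (rc x)^-1 *: row vv (invmx (P x)).

(** The minimal Weyl form is [th + w], which by [differential_q] is
    [d q / q - th - 2 nu eta]; its exterior derivative, and the skew form of the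
    Legendrian condition, are combinations of selfdual forms. *)
Lemma monopole_legendrian : exists th0,
  [/\ minimal_weyl U (conformal_class g) xi th0, selfdual_weyl U (conformal_class g) th0
    & legendrian U g xi th0].
Proof.
pose th0 x := tau x - (rc x)^-1 *: differential rc x.
have sdrc : smooth_mx_on U (fun x => (rc x)^-1 *: differential rc x).
  apply: smooth_mxZ => //; [exact: smooth_onV|exact: smooth_differential].
have sth0 : smooth_mx_on U th0 := smooth_mxB oU stau sdrc.
have torst : structure_eq4 U P tau (rot_form P (fun k => AM k) w w) (fibre_form P w (fun _ _ => 0) (fun=> 0)).
  apply: (submersion_structure (phi := phi)) => [x Ux k|x Ux|x Ux].
  - exact: monopole_frame_h.
  - exact: monopole_frame_v.
  rewrite thE// !(sum_cyc _ 0) /phi.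
  apply/rowP => i; rewrite !entryE.
  move: (coframe P (hh 0) x) (coframe P (hh (s1 0)) x) (coframe P (hh (s2 0)) x) => a b c.
  move: (w 0 x) (w (s1 0) x) (w (s2 0) x) => d1 d2 d3.
  move: (fcomp1 (Q (pi x)) (th (pi x)) 0) (fcomp1 (Q (pi x)) (th (pi x)) (s1 0))
    (fcomp1 (Q (pi x)) (th (pi x)) (s2 0)) => *.
  by ring.
exists th0; split.
- split=> // x Ux; apply/(minimal_frame oU sP uP src rc0 xiE torst cE Ux) => //.
  by split=> [k|]; rewrite ?(sum_cyc _ 0) /fibre_form !fcomp1E !fcomp1_coframe ?uP//
    !(hh_eq, hv_eq, vh_eq, cyc_neq, eqxx) /=; ring.
- move=> x Ux; rewrite cE// /th0 (faradayB oU stau sdrc Ux) (faraday_dlog oU src rc0 Ux) subr0.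
  by rewrite dtau// sdE; apply: selfdual_sum; [exact: uP|exact: rcP].
move=> x Ux; cbv zeta.
have lc l i j : levi_civita g l i j x = weyl_conn (gram P) psi l i j x.
  exact: (levi_civita_conformal oU sP srho uP rho0 gE psiE l i j Ux).
rewrite (legendrian_frame oU sP uP src rc0 xiE tors4 cE (tau := tau) Ux erefl lc) cE//.
have -> : (2^-1 * rc x) *: (faraday (coframe P vv) x + wedge (psi x + psi x - tau x) (coframe P vv x))
    = \sum_k (2^-1 * rc x * w k x) *: (hs k x - wedge (e k x) (eta x)).
  rewrite monopole_frame_v// /psi /tau /frame_form thE// /phi /p.
  apply/matrixP => i j.
  rewrite !(sum_cyc _ 0) -!(fibre_frame_h Q pi eta) -/P -(fibre_frame_v Q pi eta) -/P !entryE !wedgeE !entryE.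
  move: (fcomp1 (Q (pi x)) (th (pi x)) 0) (fcomp1 (Q (pi x)) (th (pi x)) (s1 0)) (fcomp1 (Q (pi x)) (th (pi x)) (s2 0)) => f1 f2 f3.
  move: (w 0 x) (w (s1 0) x) (w (s2 0) x) (rc x) (nu x) => w1 w2 w3 a b.
  move: (coframe P (hh 0) x) (coframe P (hh (s1 0)) x) (coframe P (hh (s2 0)) x) (coframe P vv x) => v1 v2 v3 v4.
  move: (v1 0 i) (v2 0 i) (v3 0 i) (v4 0 i) (v1 0 j) (v2 0 j) (v3 0 j) (v4 0 j) => *.
  by field.
by rewrite sdE; apply: selfdual_sum; [exact: uP|exact: rcP].
Qed.

End monopole_geometry.

(** * The ansatz *)

Lemma eq_on_scalar_curvature (R : realType) n (U : set 'rV[R]_n) (h h' : 'rV[R]_n -> 'M[R]_n)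
    (th : 'rV[R]_n -> 'rV[R]_n) x :
  open U -> (forall y, U y -> h y = h' y) -> U x ->
  scalar_curvature h th x = scalar_curvature h' th x.
Proof.
move=> oU hE Ux; apply: eq_bigr => i _; apply: eq_bigr => j _; rewrite hE//; congr (_ * _).
apply: eq_bigr => l _; apply: (eq_on_riemann _ _ _ _ oU) Ux => y Uy l' i' j'.
exact: (eq_on_weyl_conn l' i' j' oU hE (fun _ _ => erefl) Uy).
Qed.

Lemma eq_on_ricci (R : realType) n (U : set 'rV[R]_n) (h h' : 'rV[R]_n -> 'M[R]_n)
    (th : 'rV[R]_n -> 'rV[R]_n) x i j :
  open U -> (forall y, U y -> h y = h' y) -> U x ->
  ricci (weyl_conn h th) i j x = ricci (weyl_conn h' th) i j x.
Proof.
move=> oU hE Ux.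
apply: eq_bigr => l _; apply: (eq_on_riemann _ _ _ _ oU) Ux => y Uy l' i' j'.
exact: (eq_on_weyl_conn l' i' j' oU hE (fun _ _ => erefl) Uy).
Qed.

(** A Cholesky coframe has determinant [1]; the sign [- o] adapts it to the
    orientation (see [star3_faraday]). *)
Lemma exists_coframe (R : realType) (B : set 'rV[R]_3) (c : 'rV[R]_3 -> 'M[R]_3) (o : R) :
  open B -> conformal_structure B c -> o = 1 \/ o = -1 ->
  exists Q : 'rV[R]_3 -> 'M[R]_3, smooth_mx_on B Q /\
    forall y, B y -> [/\ c y = gram Q y, \det (Q y) = - o & Q y \in unitmx].
Proof.
move=> oB [[sc csp] dc] o1; have [Q [sQ QE]] := smooth_cholesky oB sc csp.
have o2 : (- o) * (- o) = 1 by case: o1 => ->; rewrite ?opprK ?mulr1 ?mulrNN ?mulr1.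
have dQ y : B y -> \det (Q y) = 1.
  move=> By; have [E d0] := QE y By.
  have := dc y By; rewrite -E det_mulmx det_tr -expr2 => /eqP; rewrite sqrf_eq1 => /orP[/eqP//|/eqP H].
  by move: d0; rewrite H ltr0N1.
exists (fun y => (- o) *: Q y); split; first by apply: smooth_mxZ => //; exact: smooth_on_cst.
move=> y By; have [E d0] := QE y By; split.
- by rewrite /gram linearZ /= -scalemxAr -scalemxAl scalerA o2 scale1r E.
- by rewrite detZ dQ// mulr1 exprS expr2 o2 mulr1.
- rewrite unitmxE detZ dQ// mulr1 unitfE expf_eq0 /= oppr_eq0.
  by case: o1 => ->; rewrite ?oppr_eq0 oner_eq0.
Qed.

Lemma rotation_structure (R : realType) (B : set 'rV[R]_3) (Q : 'rV[R]_3 -> 'M[R]_3)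
    (th : 'rV[R]_3 -> 'rV[R]_3) (om : 'I_3 -> 'rV[R]_3 -> 'M[R]_3) :
  skew_upto B th om -> torsion_free B Q om ->
  structure_eq B Q th (fun k x => \row_i om i x (s1 k) (s2 k)).
Proof.
move=> sk tf x Bx k.
have skE i a b : om i x a b + om i x b a = 2 * th x 0 i * (a == b)%:R.
  have /matrixP/(_ a b) := sk x Bx i; rewrite mxDE [_^T _ _]mxE => ->.
  by rewrite mxE mulr_natr.
have d a : om a x k k = th x 0 a by have := skE a k k; rewrite eqxx /=; lra.
have n1 a : om a x (s1 k) k = - om a x k (s1 k).
  by have := skE a k (s1 k); rewrite cyc_neq /=; lra.
have ME (y : 'rV[R]_3) a b i : (Q y *m om i y) a b = Q y a k * om i y k b
    + Q y a (s1 k) * om i y (s1 k) b + Q y a (s2 k) * om i y (s2 k) b.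
  by rewrite mxE (sum_cyc _ k).
apply/matrixP => i j.
have T : partial i (fun y => coframe Q k y 0 j) x + (Q x *m om i x) j k
    = partial j (fun y => coframe Q k y 0 i) x + (Q x *m om j x) i k.
  have E a : (fun y => coframe Q k y 0 a) = (fun y => Q y a k) by apply/funext => y; rewrite coframeE.
  by rewrite !E; have := tf x Bx i j k; rewrite ![mpartial _ _ _ _ _]mxE.
rewrite faradayE !mxDE !mxNE !wedgeE.
have RE a b i' : (\row_i om i x a b) 0 i' = om i' x a b by rewrite mxE.
rewrite !RE !cycE !coframeE.
move: T; rewrite !ME (d i) (d j) (n1 i) (n1 j).
move: (partial _ _ x) (partial _ _ x) => f1 f2 H.
move: H; move: (om i x k (s1 k)) (om j x k (s1 k)) (om i x (s2 k) k) (om j x (s2 k) k).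
move: (Q x i k) (Q x i (s1 k)) (Q x i (s2 k)) (Q x j k) (Q x j (s1 k)) (Q x j (s2 k)) (th x 0 i) (th x 0 j) => *.
by lra.
Qed.

Lemma exists_rotation_forms (R : realType) (B : set 'rV[R]_3) (Q : 'rV[R]_3 -> 'M[R]_3)
    (th : 'rV[R]_3 -> 'rV[R]_3) : open B -> smooth_mx_on B Q ->
  (forall y, B y -> Q y \in unitmx) -> smooth_mx_on B th ->
  exists A : 'I_3 -> 'rV[R]_3 -> 'rV[R]_3,
    (forall k, smooth_mx_on B (A k)) /\ structure_eq B Q th A.
Proof.
move=> oB sQ uQ sth; have [sk tf] := weyl_frame_coef oB th sQ uQ.
exists (fun k x => \row_i frame_coef Q (weyl_conn (gram Q) th) i x (s1 k) (s2 k)).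
split=> [k i j|]; last exact: rotation_structure sk tf.
have := smooth_frame_coef oB j sQ uQ sth (s1 k) (s2 k).
by apply: eq_smooth_on => // x Bx; rewrite [RHS]mxE.
Qed.

Lemma ew_at_frame (R : realType) (B : set 'rV[R]_3) (c : 'rV[R]_3 -> 'M[R]_3)
    (Q : 'rV[R]_3 -> 'M[R]_3) (th : 'rV[R]_3 -> 'rV[R]_3) : open B ->
  (forall y, B y -> c y = gram Q y) ->
  (forall y, B y -> forall i j,
      2^-1 * (ricci (weyl_conn c th) i j y + ricci (weyl_conn c th) j i y)
      = 3%:R^-1 * scalar_curvature c th y * c y i j) <->
  (forall y, B y -> ew_at Q th y).
Proof.
move=> oB cE; split=> H y By i j; have := H y By i j;
  by rewrite !(eq_on_ricci _ _ _ oB cE By) (eq_on_scalar_curvature th oB cE By) (cE y By).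
Qed.

Lemma powR_half_sqr (R : realType) (a : R) : 0 < a -> (a `^ 2^-1) ^+ 2 = a.
Proof.
by move=> a0; rewrite -powR_mulrn ?powR_ge0// -powRrM mulVf ?pnatr_eq0// powRr1// ltW.
Qed.

Lemma outerZ (R : realType) n (a : R) (v : 'rV[R]_n) :
  (a *: v)^T *m (a *: v) = (a * a) *: (v^T *m v).
Proof.
have -> : (a *: v)^T = a *: v^T by exact: linearZ.
by rewrite -scalemxAr -scalemxAl scalerA.
Qed.

(** The form of the ansatz is [- mu q eta] and its factor is [mu ^+ 2 * q]. *)
Lemma ansatz_metric_frame (R : realType) (o : R) (c : 'rV[R]_3 -> 'M[R]_3) th pi mu
    (Q : 'rV[R]_3 -> 'M[R]_3) (eta : 'rV[R]_4 -> 'rV[R]_4) x (q : R) :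
  mu x != 0 -> q != 0 -> c (pi x) = gram Q (pi x) ->
  ansatz_factor c th pi mu x = mu x ^+ 2 * q ->
  eta x = (- (mu x ^+ 2 * q)^-1) *: differential mu x
    + (q^-1 *: (2^-1 *: star3 o (c (pi x)) (faraday th (pi x)) - (mu x)^-1 *: th (pi x)))
      *m ('J pi x)^T ->
  ansatz_metric o c th pi mu x = q *: gram (fibre_frame Q pi eta) x.
Proof.
move=> m0 r0 cE fE etaE; rewrite /ansatz_metric fE gram_fibre_frame scalerDr cE.
congr (_ *: _ + _).
  by move: m0 r0; move: (mu x) => m m0 r0; field.
have -> : ansatz_form o c th pi mu x = (- (mu x * q)) *: eta x.
  rewrite /ansatz_form etaE -scalemxAl mulmxBl -!scalemxAl.
  apply/rowP => i; rewrite !entryE.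
  move: (star3 _ _ _ *m _) (th (pi x) *m _) (differential mu x) => a b d.
  by move: m0 r0; move: (mu x) => m m0 r0; field; rewrite ?m0 ?r0.
rewrite outerZ !scalerA; congr (_ *: _).
by move: m0 r0; move: (mu x) => m m0 r0; field; rewrite ?m0 ?r0.
Qed.

Section ansatz_is_monopole.
Variables (R : realType) (B : set 'rV[R]_3) (c : 'rV[R]_3 -> 'M[R]_3).
Variables (th : 'rV[R]_3 -> 'rV[R]_3) (o eps : R).
Hypotheses (ewB : einstein_weyl B c th) (o1 : o = 1 \/ o = -1) (eps1 : eps = 1 \/ eps = -1).
Variables (M : set 'rV[R]_4) (pi : 'rV[R]_4 -> 'rV[R]_3) (mu : 'rV[R]_4 -> R).
Hypothesis data : ansatz_data o c th pi mu eps B M.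
Variables (Q : 'rV[R]_3 -> 'M[R]_3) (A : 'I_3 -> 'rV[R]_3 -> 'rV[R]_3).
Hypothesis sQ : smooth_mx_on B Q.
Hypothesis QE : forall y, B y -> [/\ c y = gram Q y, \det (Q y) = - o & Q y \in unitmx].
Hypotheses (sA : forall k, smooth_mx_on B (A k)) (tors : structure_eq B Q th A).
Notation sc := (scalar_curvature (gram Q) th).
Notation thM := (pull pi th).
Notation fM := (pull pi (dual_faraday Q th)).

Let oB : open B. Proof. by case: ewB. Qed.
Let sth : smooth_mx_on B th. Proof. by case: ewB. Qed.
Let csB : conformal_structure B c. Proof. by case: ewB. Qed.
Let oM : open M. Proof. by case: data. Qed.
Let spi : smooth_mx_on M pi. Proof. by case: data. Qed.
Let smu : smooth_on M mu. Proof. by case: data. Qed.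
Let piM : pi @` M = B. Proof. by case: data. Qed.
Let MB x : M x -> B (pi x). Proof. by move=> Mx; rewrite -piM; exists x. Qed.
Let uQ y : B y -> Q y \in unitmx. Proof. by case/QE. Qed.
Let cE y : B y -> c y = gram Q y. Proof. by case/QE. Qed.
Let ew y : B y -> ew_at Q th y.
Proof. by move: y; apply/(ew_at_frame th oB cE); case: ewB. Qed.

Let oo : o * o = 1.
Proof. by case: o1 => ->; rewrite ?mulr1 ?mulrNN ?mulr1. Qed.
Let ee : eps * eps = 1.
Proof. by case: eps1 => ->; rewrite ?mulr1 ?mulrNN ?mulr1. Qed.

Lemma star3_pull x : M x ->
  star3 o (c (pi x)) (faraday th (pi x)) *m ('J pi x)^T = fM x.
Proof.
move=> Mx; have [E dQ _] := QE (MB Mx).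
by rewrite E (star3_faraday th uQ (MB Mx) oo dQ).
Qed.

Lemma sc_pull x : M x -> scalar_curvature c th (pi x) = sc (pi x).
Proof. by move=> Mx; exact: eq_on_scalar_curvature oB cE (MB Mx). Qed.

Let smooth_scM : smooth_on M (fun x => sc (pi x)) :=
  smooth_on_comp oM MB spi (smooth_sc oB sQ sth uQ sA tors).

Section conformal_infinity.

Let F x := 1 - 6^-1 * mu x ^+ 2 * sc (pi x).
Let Phi x := differential mu x + mu x *: thM x - (2^-1 * mu x ^+ 2) *: fM x.

Let FE x : M x -> ansatz_factor c th pi mu x = F x.
Proof. by move=> Mx; rewrite /ansatz_factor sc_pull. Qed.

(** Multiplication of the metric by [mu ^+ 2] removes the poles of its
    coefficients: the form of the ansatz enters through [mu] times it, which is
    [d mu] at the conformal infinity. *)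
Lemma ansatz_conformal_infinity : eps = 1 -> exists G : 'rV[R]_4 -> 'M[R]_4,
  [/\ riemannian M G,
      (forall x, M x -> mu x != 0 -> G x = mu x ^+ 2 *: ansatz_metric o c th pi mu x) &
      forall x, M x -> mu x = 0 ->
        differential mu x != 0 /\
        forall X Y : 'rV[R]_4, 'D_X mu x = 0 -> 'D_Y mu x = 0 ->
          X *m G x *m Y^T = X *m 'J pi x *m c (pi x) *m (Y *m 'J pi x)^T].
Proof.
move=> e1; have F0 x : M x -> 0 < F x /\ \det (row_mx ('J pi x) (differential mu x)^T : 'M[R]_(3 + 1)) != 0.
  move=> Mx; case: data => _ _ _ _ /(_ x Mx); rewrite FE// e1 mul1r => -[? H]; split=> //.
  by apply: contraTneq H => ->; rewrite mulr0 ltxx.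
exists (fun x => F x *: ('J pi x *m c (pi x) *m ('J pi x)^T) + (F x)^-1 *: ((Phi x)^T *m Phi x)).
split.
- have smu2 : smooth_on M (fun x => mu x ^+ 2).
    apply: (eq_smooth_on oM (f := fun x => mu x * mu x)) => [x _|]; first by rewrite expr2.
    exact: smooth_onM.
  have sF : smooth_on M F.
    apply: smooth_onB => //; first exact: smooth_on_cst.
    by apply: smooth_onM => //; apply: smooth_onM => //; exact: smooth_on_cst.
  have sP : smooth_mx_on M Phi.
    apply: smooth_mxB => //.
      apply: smooth_mxD => //; first exact: smooth_differential.
      by apply: smooth_mxZ => //; exact: (smooth_pull oM spi MB sth).
    apply: smooth_mxZ => //; first by apply: smooth_onM => //; exact: smooth_on_cst.
    exact: (smooth_pull oM spi MB (smooth_dual_faraday oB sQ sth uQ)).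
  have sJ := smooth_jacobian oM spi.
  have scM : smooth_mx_on M (fun x => c (pi x)).
    by case: csB => -[sc _] _; exact: (smooth_mx_comp oM spi MB sc).
  split=> [|x Mx].
    apply: smooth_mxD => //; apply: smooth_mxZ => //.
    + exact: (smooth_mx_mul oM (smooth_mx_mul oM sJ scM) (smooth_mx_tr oM sJ)).
    + by apply: smooth_onV => // x /F0[+ _]; rewrite lt0r => /andP[].
    + exact: (smooth_mx_mul oM (smooth_mx_tr oM sP) sP).
  have [Fx dx] := F0 x Mx; case: csB => -[_ /(_ _ (MB Mx)) [csym cpos]] _.
  split; first by rewrite linearD /= !linearZ /= !trmx_mul !trmxK csym mulmxA.
  move=> v v0; rewrite mulmxDr mulmxDl -!scalemxAr -!scalemxAl mxDE !mxZE !mulmxA.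
  set u := v *m 'J pi x.
  have -> : u *m c (pi x) *m ('J pi x)^T *m v^T = u *m c (pi x) *m u^T.
    by rewrite /u trmx_mul !mulmxA.
  set t := v *m (Phi x)^T.
  have -> : t *m Phi x *m v^T = t *m t^T by rewrite /t trmx_mul trmxK !mulmxA.
  have tt : (t *m t^T) 0 0 = t 0 0 ^+ 2 by rewrite mxE big_ord1 [t^T _ _]mxE expr2.
  rewrite tt; have [u0|u0] := eqVneq u 0; last first.
    by apply: ltr_wpDr; [rewrite mulr_ge0 ?sqr_ge0// invr_ge0 ltW|rewrite mulr_gt0// cpos].
  rewrite u0 !mul0mx mx0E mulr0 add0r mulr_gt0 ?invr_gt0// exprn_even_gt0//=.
  apply: contraNneq v0 => t0.
  have tE : t = v *m (differential mu x)^T.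
    have PE : Phi x = differential mu x
        + (mu x *: th (pi x) - (2^-1 * mu x ^+ 2) *: dual_faraday Q th (pi x)) *m ('J pi x)^T.
      by rewrite mulmxBl -!scalemxAl addrA.
    by rewrite /t PE linearD /= trmx_mul trmxK mulmxDr mulmxA -/u u0 mul0mx addr0.
  have uD : (row_mx ('J pi x) (differential mu x)^T : 'M[R]_(3 + 1)) \in unitmx.
    by rewrite unitmxE unitfE.
  rewrite -(mulmxK uD v) mul_mx_row -/u -tE u0.
  have -> : t = 0 by apply/rowP => k; rewrite (ord1 k) mx0E.
  by rewrite row_mx0 mul0mx.
- move=> x Mx mu0; rewrite /ansatz_metric FE// scalerDr scalerA mulrCA divff ?expf_neq0// mulr1.
  congr (_ + _); have -> : ansatz_form o c th pi mu x = (mu x)^-1 *: Phi x.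
    rewrite /ansatz_form star3_pull// /Phi scalerBr scalerA.
    congr (_ - _ *: _); move: mu0; move: (mu x) => m m0; by field.
  rewrite outerZ !scalerA; congr (_ *: _).
  have [/lt0r_neq0 + _] := F0 x Mx; move: mu0; move: (mu x) (F x) => a b a0 b0.
  by field; rewrite a0.
move=> x Mx mu0; have [Fx dx] := F0 x Mx; split.
  apply: contraNneq dx => ->; rewrite trmx0.
  have -> : (row_mx ('J pi x) 0 : 'M[R]_(3 + 1)) = row_mx ('J pi x) 0 *m block_mx 1%:M 0 0 (0 : 'M[R]_1).
    by rewrite (@mul_row_block _ 4 3 1 3 1) mulmx1 !mulmx0 !addr0.
  by rewrite det_mulmx (@det_ublock _ 3 1) det_mx11 mxE !mulr0.
move=> X Y; rewrite !(derive_differential _ smu Mx) => hX hY.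
have -> : F x = 1 by rewrite /F mu0 expr0n /= mulr0 mul0r subr0.
have -> : Phi x = differential mu x by rewrite /Phi mu0 expr0n /= mulr0 !scale0r addr0 subr0.
rewrite invr1 !scale1r mulmxDr mulmxDl.
have -> : X *m ((differential mu x)^T *m differential mu x) *m Y^T = 0.
  rewrite mulmxA; have -> : X *m (differential mu x)^T = 0.
    by apply/rowP => k; rewrite (ord1 k) hX mx0E.
  by rewrite !mul0mx.
by rewrite addr0 !trmx_mul !mulmxA.
Qed.

End conformal_infinity.

Hypothesis mu0 : forall x, M x -> mu x != 0.

Let nu x := (mu x)^-1.
Let q x := nu x ^+ 2 - 6^-1 * sc (pi x).
Let eta x : 'rV[R]_4 := (q x)^-1 *: (differential nu x - nu x *: thM x + 2^-1 *: fM x).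
Let P := fibre_frame Q pi eta.
Let g x := eps *: ansatz_metric o c th pi mu x.

Let snu : smooth_on M nu. Proof. exact: smooth_onV. Qed.
Let sq : smooth_on M q.
Proof.
apply: smooth_onB => //; last by apply: smooth_onM => //; exact: smooth_on_cst.
by apply: (eq_smooth_on oM (f := fun x => nu x * nu x)) => [x _|]; [rewrite expr2|exact: smooth_onM].
Qed.

Let factorE x : M x -> ansatz_factor c th pi mu x = mu x ^+ 2 * q x.
Proof.
move=> Mx; rewrite /ansatz_factor sc_pull// /q /nu.
by have := mu0 Mx; move: (mu x) (sc _) => m s m0; field.
Qed.

Let eq0 x : M x -> 0 < eps * q x.
Proof.
move=> Mx; case: data => _ _ _ _ /(_ x Mx) [+ _]; rewrite factorE// mulrCA pmulr_rgt0//.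
by rewrite exprn_even_gt0//= mu0.
Qed.

Let q0 x : M x -> q x != 0.
Proof. by move=> /eq0; apply: contraTneq => ->; rewrite mulr0 ltxx. Qed.

Let etaE x : M x -> differential nu x = nu x *: thM x - 2^-1 *: fM x + q x *: eta x.
Proof.
move=> Mx; rewrite /eta scalerA divff ?q0// scale1r; apply/rowP => i; rewrite !entryE; ring.
Qed.

Let seta : smooth_mx_on M eta.
Proof.
apply: smooth_mxZ => //; first exact: (smooth_onV oM q0 sq).
apply: smooth_mxD => //; last first.
  apply: smooth_mxZ => //; first exact: smooth_on_cst.
  exact: (smooth_pull oM spi MB (smooth_dual_faraday oB sQ sth uQ)).
apply: smooth_mxB => //; first exact: smooth_differential.
by apply: smooth_mxZ => //; exact: (smooth_pull oM spi MB sth).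
Qed.

Let etaD x : M x -> eta x = (- (mu x ^+ 2 * q x)^-1) *: differential mu x
  + ((q x)^-1 *: (2^-1 *: dual_faraday Q th (pi x) - nu x *: th (pi x))) *m ('J pi x)^T.
Proof.
move=> Mx; rewrite /eta (differentialV smu (mu0 Mx) Mx) -scalemxAl mulmxBl -!scalemxAl.
rewrite -/(thM x) -/(fM x); apply/rowP => i; rewrite !entryE.
move: (thM x) (fM x) (differential mu x) (nu x) (mu0 Mx) (q0 Mx) => a b d n.
by move: (mu x) (q x) => m r m0 r0; field; rewrite ?m0 ?r0.
Qed.

Let detP x : M x -> 0 < \det (P x).
Proof.
move=> Mx; rewrite /P (det_fibre_frame Q (etaD Mx)); have [_ -> _] := QE (MB Mx).
case: data => _ _ _ _ /(_ x Mx) []; rewrite factorE//.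
move: (\det _) (mu x ^+ 2 * q x) => d a a0 d0.
have -> : - a^-1 * - o * d = (eps * a)^-1 * (eps * o * d).
  have a1 : a != 0 by apply: contraTneq a0 => ->; rewrite mulr0 ltxx.
  have e1 : eps != 0 by apply: contra_eqN ee => /eqP ->; rewrite mul0r eq_sym oner_eq0.
  by field; rewrite a1.
by rewrite mulr_gt0// invr_gt0.
Qed.

Let uP x : M x -> P x \in unitmx.
Proof. by move=> Mx; rewrite unitmxE unitfE gt_eqF// detP. Qed.

Let rho x := (eps * q x) `^ 2^-1.
(* The sign is the one for which [mu] increases along [xi]. *)
Let rc x := - eps * \det (P x) `^ (- 4%:R^-1).
Let xi x : 'rV[R]_4 := (rc x)^-1 *: row vv (invmx (P x)).

Let sP : smooth_mx_on M P := smooth_fibre_frame oM spi MB sQ seta.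

Let rho0 x : M x -> rho x != 0.
Proof. by move=> Mx; rewrite gt_eqF// powR_gt0// eq0. Qed.

Let srho : smooth_on M rho.
Proof.
by apply: (smooth_on_powR _ oM eq0); apply: smooth_onM => //; exact: smooth_on_cst.
Qed.

Let src : smooth_on M rc.
Proof.
apply: smooth_onM => //; first exact: smooth_on_cst.
by apply: smooth_on_powR => //; exact: smooth_det.
Qed.

Let rcP x : M x -> rc x ^+ 4 * \det (P x) = 1.
Proof.
move=> Mx; have d0 := detP Mx; rewrite /rc exprMn.
have -> : (\det (P x) `^ (- 4%:R^-1)) ^+ 4 = (\det (P x))^-1.
  by rewrite -powR_mulrn ?powR_ge0// -powRrM mulNr mulVf ?pnatr_eq0// powR_inv1// ltW.
rewrite mulfVK ?gt_eqF//.
have -> : (- eps) ^+ 4 = (eps * eps) ^+ 2 by ring.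
by rewrite ee expr1n.
Qed.

Let qrho x : M x -> q x = eps * rho x ^+ 2.
Proof. by move=> Mx; rewrite powR_half_sqr ?eq0// mulrA ee mul1r. Qed.

Let gE x : M x -> g x = rho x ^+ 2 *: gram P x.
Proof.
move=> Mx; rewrite powR_half_sqr ?eq0// /g -scalerA; congr (_ *: _).
apply: ansatz_metric_frame => //; [exact: mu0|exact: q0|exact/cE/MB|exact: factorE|].
have [E dQ _] := QE (MB Mx); rewrite etaD// E.
by rewrite (star3_faraday th uQ (MB Mx) oo dQ).
Qed.

(** In terms of [nu = mu^-1] the ansatz is the metric [eps q] times that of an
    adapted coframe, whose last form satisfies the monopole equation by
    definition. *)
Lemma ansatz_selfdual_einstein :
  [/\ riemannian M g, einstein M g, (forall x, M x -> scal g x != 0), selfdual M g &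
     exists xi : 'rV[R]_4 -> 'rV[R]_4, (forall x, M x -> 0 < 'D_(xi x) mu x) /\
       legendrian_selfdual_submersion M g B c pi xi].
Proof.
have qE x : M x -> q x = nu x ^+ 2 - 6^-1 * sc (pi x) by [].
have E x : M x -> _ := @monopole_einstein R B M Q th A pi oB sQ sth uQ sA tors oM spi MB ew
  nu q eta snu seta qE q0 etaE uP eps rho g ee srho rho0 qrho gE rc rcP x.
have e0 : eps != 0 by apply: contra_eqN ee => /eqP ->; rewrite mul0r eq_sym oner_eq0.
split.
- split.
    apply: (eq_smooth_mx oM (fun x Mx => esym (gE Mx))); apply: smooth_mxZ => //; last exact: smooth_gram.
    by apply: (eq_smooth_on oM (f := fun x => rho x * rho x)) => [x _|]; [rewrite expr2|exact: (smooth_onM oM srho srho)].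
  move=> x Mx; rewrite gE//; split; first by rewrite linearZ /= gram_sym.
  by apply: posdefZ; [rewrite exprn_even_gt0// rho0|exact/gram_posdef/uP].
- by move=> x /E[].
- by move=> x /E[_ _ ->]; rewrite mulf_neq0// oppr_eq0 pnatr_eq0.
- by move=> x /E[].
exists xi; split.
  move=> x Mx; rewrite (derive_differential _ smu Mx) /xi -scalemxAl mxZE.
  have := fibre_dual_v (uP Mx); rewrite etaD// linearD /= linearZ /= trmx_mul trmxK mulmxDr.
  rewrite mulmxA (fibre_dual_h (uP Mx) (uQ (MB Mx))) mul0mx addr0 -scalemxAr.
  move=> /(congr1 (fun Z : 'M[R]_1 => Z 0 0)); rewrite mxZE [RHS]mxE eqxx mulr1n => H.
  have a0 : mu x ^+ 2 * q x != 0 by rewrite mulf_neq0 ?expf_neq0 ?mu0 ?q0.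
  have -> : (row vv (invmx (P x)) *m (differential mu x)^T) 0 0 = - (mu x ^+ 2 * q x).
    by move: H a0; move: (_ * q x) ((_ *m _) 0 0) => a b H a0; apply: (mulfI a0);
      rewrite -[RHS]mulr1 -H; field.
  rewrite /rc; have d0 : 0 < \det (P x) `^ (- 4%:R^-1) by exact: powR_gt0 (detP Mx).
  have := eq0 Mx; have m2 : 0 < mu x ^+ 2 by rewrite exprn_even_gt0//= mu0.
  move: d0 m2; move: (_ `^ _) (mu x ^+ 2) (q x) => d m r d0 m0 r0.
  have -> : (- eps * d)^-1 * - (m * r) = m * (eps * r) / (eps * eps) / d.
    by field; rewrite e0 gt_eqF.
  by rewrite ee divr1 divr_gt0// mulr_gt0.
split.
  apply: (@fibre_frame_submersion R M B c Q pi eta (conformal_class g) xi rc) => //.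
  by move=> x Mx; exact: conformal_class_frame (rho0 Mx) (rcP Mx) (gE Mx).
exact: (@monopole_legendrian R B M Q th A pi oB sQ sth uQ sA tors oM spi MB ew
  nu q eta snu seta qE q0 etaE uP eps rho g ee srho rho0 qrho gE rc src rcP xi (fun _ _ => erefl)).
Qed.

End ansatz_is_monopole.

(** * An adapted coframe for a conformal submersion *)

Lemma full_rank_linv (R : realType) (J : 'M[R]_(4, 3)) : \rank J = 3%N ->
  exists K : 'M[R]_(3, 4), K *m J = 1%:M.
Proof.
by move=> rJ; have /row_fullP[K KE] : row_full J by [rewrite /row_full rJ]; exists K.
Qed.

Lemma kernel_line (R : realType) (J : 'M[R]_(4, 3)) (v w : 'rV[R]_4) : \rank J = 3%N ->
  v *m J = 0 -> v != 0 -> w *m J = 0 -> exists a, w = a *: v.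
Proof.
move=> rJ vJ v0 wJ.
have kr : \rank (kermx J) = 1%N by rewrite mxrank_ker rJ.
have vk : (v <= kermx J)%MS by apply/sub_kermxP.
have wk : (w <= kermx J)%MS by apply/sub_kermxP.
have kv : (kermx J <= v)%MS.
  by have := mxrank_leqif_sup vk; rewrite kr rank_rV v0 => -[_ <-].
by have /sub_rVP[a ->] := submx_trans wk kv; exists a.
Qed.

(** Project vectors to the orthogonal complement of [xi]; the right hand side is
    the square of this projection. *)
Lemma horizontal_metric (R : realType) (J : 'M[R]_(4, 3)) (c : 'M[R]_4) (h : 'M[R]_3)
    (xi : 'rV[R]_4) (lam : R) : \rank J = 3%N -> c^T = c ->
  xi *m J = 0 -> xi *m c *m xi^T = 1%:M ->
  (forall X Y : 'rV[R]_4,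
     (forall V : 'rV[R]_4, V *m J = 0 -> X *m c *m V^T = 0) ->
     (forall V : 'rV[R]_4, V *m J = 0 -> Y *m c *m V^T = 0) ->
     X *m J *m h *m (Y *m J)^T = lam *: (X *m c *m Y^T)) ->
  J *m h *m J^T = lam *: (c - (xi *m c)^T *m (xi *m c)).
Proof.
move=> rJ cT xJ xc H.
have xi0 : xi != 0.
  by apply: contra_eqN xc => /eqP ->; rewrite mul0mx mul0mx; apply/eqP => /matrixP/(_ 0 0);
     rewrite !mxE eqxx => /eqP; rewrite eq_sym oner_eq0.
set z := xi *m c.
have zx : z *m xi^T = 1%:M by [].
pose pr := 1%:M - z^T *m xi.
have hor (X : 'rV[R]_4) (V : 'rV[R]_4) : V *m J = 0 -> X *m pr *m c *m V^T = 0.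
  move=> /(kernel_line rJ xJ xi0)[a ->].
  have -> : (a *: xi)^T = a *: xi^T by exact: linearZ.
  rewrite -scalemxAr mulmxBr mulmx1 !mulmxBl !mulmxA -(mulmxA (X *m z^T)) -/z.
  have -> : X *m z^T *m z *m xi^T = X *m z^T by rewrite -mulmxA zx mulmx1.
  by rewrite /z trmx_mul cT mulmxA subrr scaler0.
have prJ : pr *m J = J by rewrite mulmxBl mul1mx -mulmxA xJ mulmx0 subr0.
have prc : pr *m c *m pr^T = c - z^T *m z.
  have prcE : pr *m c = c - z^T *m z by rewrite mulmxBl mul1mx -mulmxA.
  have -> : pr^T = 1%:M - xi^T *m z by rewrite /pr linearB /= trmx1 (trmx_mul z^T) trmxK.
  rewrite prcE mulmxBr mulmx1 mulmxBl.
  have -> : c *m (xi^T *m z) = z^T *m z by rewrite mulmxA /z trmx_mul cT.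
  have -> : z^T *m z *m (xi^T *m z) = z^T *m z.
    by rewrite mulmxA -(mulmxA z^T) zx mulmx1.
  by rewrite subrr subr0.
apply/matrixP => i j.
pose di : 'rV[R]_4 := delta_mx 0 i; pose dj : 'rV[R]_4 := delta_mx 0 j.
have E := H (di *m pr) (dj *m pr) (hor _) (hor _).
have L : di *m pr *m J *m h *m (dj *m pr *m J)^T
    = di *m (J *m h *m J^T) *m dj^T.
  by rewrite -!(mulmxA _ pr J) prJ (trmx_mul dj) !mulmxA.
have C : di *m pr *m c *m (dj *m pr)^T
    = di *m (pr *m c *m pr^T) *m dj^T.
  by rewrite (trmx_mul dj) !mulmxA.
have d1 (Z : 'M[R]_4) : (di *m Z *m dj^T) 0 0 = Z i j.
  by rewrite /di /dj -rowE trmx_delta -colE !mxE.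
by have := congr1 (fun Z : 'M[R]_1 => Z 0 0) E; rewrite L C mxZE !d1 prc => ->; rewrite mxZE.
Qed.

Section adapted_frame.
Variables (R : realType) (M : set 'rV[R]_4) (g : 'rV[R]_4 -> 'M[R]_4).
Variables (B : set 'rV[R]_3) (c : 'rV[R]_3 -> 'M[R]_3).
Variables (pi : 'rV[R]_4 -> 'rV[R]_3) (xi : 'rV[R]_4 -> 'rV[R]_4).
Hypotheses (rg : riemannian M g) (cs : conformal_submersion M (conformal_class g) B c pi xi).

Let cM := conformal_class g.
Let oM : open M. Proof. by case: cs => -[]. Qed.
Let csM : conformal_structure M cM. Proof. by case: cs => -[]. Qed.
Let oB : open B. Proof. by case: cs => -[]. Qed.
Let csB : conformal_structure B c. Proof. by case: cs => -[]. Qed.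
Let spi : smooth_mx_on M pi. Proof. by case: cs => _ []. Qed.
Let piM : pi @` M = B. Proof. by case: cs => _ []. Qed.
Let MB x : M x -> B (pi x). Proof. by move=> Mx; rewrite -piM; exists x. Qed.

Let sxi : smooth_mx_on M xi. Proof. by case: cs => _ _ _ []. Qed.

Let lam x := 3^-1 * \tr (invmx (cM x) *m ('J pi x *m c (pi x) *m ('J pi x)^T)).
Let zeta x := xi x *m cM x.

Let posdef_det n (A : 'M[R]_n) : A^T = A -> posdef A -> 0 < \det A.
Proof.
move=> AT pA.
have [Q [_ /(_ 0 I) [<- d0]]] := @smooth_cholesky R 1 setT (@openT _) n (fun=> A)
  (fun i j => smooth_on_cst _) (fun _ _ => conj AT pA).
by rewrite det_mulmx det_tr mulr_gt0.
Qed.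

Let cM_unit x : M x -> cM x \in unitmx.
Proof. by move=> Mx; rewrite unitmxE; case: csM => _ ->//; exact: unitr1. Qed.

(** The conformal factor of the submersion is a trace, hence a smooth function. *)
Lemma submersion_metric x : M x -> 0 < lam x /\
  'J pi x *m c (pi x) *m ('J pi x)^T = lam x *: (cM x - (zeta x)^T *m zeta x).
Proof.
move=> Mx; case: cs => _ [_ _ rJ] /(_ x Mx)[l l0 lE] [_ /(_ x Mx)[xJ xc]].
have cT : (cM x)^T = cM x by case: csM => -[_ /(_ x Mx)[]].
have E := horizontal_metric (rJ x Mx) cT xJ xc lE.
suff -> : lam x = l by split=> //; exact: E.
rewrite /lam E -scalemxAr mxtraceZ mulmxBr mulVmx ?cM_unit// [\tr (_ - _)]raddfB /= mxtrace1.
have -> : invmx (cM x) *m ((xi x *m cM x)^T *m (xi x *m cM x)) = (xi x)^T *m (xi x *m cM x).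
  by rewrite trmx_mul cT -!mulmxA mulKmx ?cM_unit.
rewrite mxtrace_mulC xc.
by rewrite mxtrace1; field.
Qed.

Let slam : smooth_on M lam.
Proof.
have sJ := smooth_jacobian oM spi.
have sc : smooth_mx_on B c by case: csB => -[].
have sc' := smooth_mx_comp oM spi MB sc.
have sT := smooth_mx_mul oM (smooth_mx_mul oM sJ sc') (smooth_mx_tr oM sJ).
have sI : smooth_mx_on M (fun x => invmx (cM x)).
  by case: csM => -[scM _] _; exact: (smooth_invmx oM scM cM_unit).
have sm := smooth_mx_mul oM sI sT.
apply: smooth_onM => //; first exact: smooth_on_cst.
exact: (smooth_on_sum oM (fun k => sm k k)).
Qed.

(** Rescale by the conformal factor [lam], so that the submersion becomes
    Riemannian: the form dual to [xi] completes the pull-back of an orthonormal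
    coframe of the base.  The sign of the form can be prescribed, since that of
    the coframe of the base remains free to adapt the orientation. *)
Lemma exists_adapted_frame (s : R) p : s = 1 \/ s = -1 -> M p ->
  exists (U : set 'rV[R]_4) (o : R) (Q : 'rV[R]_3 -> 'M[R]_3) (eta : 'rV[R]_4 -> 'rV[R]_4)
    (rho rc : 'rV[R]_4 -> R),
    let P := fibre_frame Q pi eta in
  [/\ [/\ open U, U p, U `<=` M & o = 1 \/ o = -1],
      smooth_mx_on B Q /\ (forall y, B y -> [/\ c y = gram Q y, \det (Q y) = - o & Q y \in unitmx]),
      [/\ smooth_mx_on U eta, smooth_on U rho & smooth_on U rc] &
      forall x, U x ->
        [/\ P x \in unitmx, rho x != 0 /\ g x = rho x ^+ 2 *: gram P x, rc x ^+ 4 * \det (P x) = 1,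
            xi x = (rc x)^-1 *: row vv (invmx (P x)) & 0 < s * rc x]].
Proof.
move=> s1 Mp; have ss : s * s = 1 by case: s1 => ->; rewrite ?mulr1 ?mulrNN ?mulr1.
pose rl x := lam x `^ 2^-1.
have rl0 x : M x -> 0 < rl x by move=> Mx; rewrite powR_gt0//; case: (submersion_metric Mx).
have rl2 x : M x -> rl x ^+ 2 = lam x.
  by move=> Mx; rewrite powR_half_sqr//; case: (submersion_metric Mx).
have srl : smooth_on M rl by apply: smooth_on_powR => // x Mx; case: (submersion_metric Mx).
pose eta x := (s * rl x) *: zeta x.
have szeta : smooth_mx_on M zeta by apply: smooth_mx_mul => //; case: csM => -[].
have seta : smooth_mx_on M eta.
  by apply: smooth_mxZ => //; apply: smooth_onM => //; exact: smooth_on_cst.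
pose D x := \det (row_mx ('J pi x) (eta x)^T : 'M[R]_(3 + 1)).
(* This makes the adapted coframe positively oriented at [p]. *)
pose o := - Num.sg (D p).
have grE Q x : M x -> c (pi x) = gram Q (pi x) ->
    gram (fibre_frame Q pi eta) x = lam x *: cM x.
  move=> Mx E; rewrite gram_fibre_frame -E; have [_ ->] := submersion_metric Mx.
  rewrite /eta outerZ.
  have -> : s * rl x * (s * rl x) = lam x by rewrite mulrACA ss mul1r -expr2 rl2.
  by rewrite scalerBr subrK.
have detE Q x : M x -> c (pi x) = gram Q (pi x) -> \det (fibre_frame Q pi eta x) ^+ 2 = lam x ^+ 4.
  move=> Mx E; have := congr1 determinant (grE Q x Mx E).
  by rewrite detZ /gram det_mulmx det_tr -expr2 => ->; case: csM => _ ->; rewrite ?mulr1.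
have dP Q x : \det (fibre_frame Q pi eta x) = \det (Q (pi x)) * D x.
  rewrite (@det_fibre_frame R Q pi eta (eta x) 0 1) ?mul1r//.
  by rewrite scale1r mul0mx addr0.
have lam0 x : M x -> lam x != 0 by move=> /submersion_metric[/lt0r_neq0].
have D0 : D p != 0.
  have [Q [_ QE]] := exists_coframe oB csB (or_introl erefl : 1 = 1 :> R \/ 1 = -1 :> R).
  have [E _ _] := QE _ (MB Mp); have := detE Q p Mp E.
  rewrite dP => H; apply: contra_neq (expf_neq0 4 (lam0 p Mp)) => d0.
  by rewrite -H d0 mulr0 expr0n.
have o1 : o = 1 \/ o = -1.
  by rewrite /o; case: sgrP D0 => // _ _; [right|left; rewrite opprK].
have [Q [sQ QE]] := exists_coframe oB csB o1.
pose P := fibre_frame Q pi eta.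
have dPp : 0 < \det (P p).
  rewrite /P dP; have [_ -> _] := QE _ (MB Mp).
  by rewrite opprK; case: sgrP D0 => // d1 _; rewrite ?mul1r// mulN1r oppr_gt0.
have sP : smooth_mx_on M P := smooth_fibre_frame oM spi MB sQ seta.
have [r r0 rE] : exists2 r : R, 0 < r & ball p r `<=` [set x | M x /\ 0 < \det (P x)].
  have N : nbhs p [set x | M x /\ 0 < \det (P x)].
    have /differentiable_continuous cd : differentiable (fun x => \det (P x)) p.
      exact: smooth_on_diff (smooth_det oM sP) Mp.
    apply: filterI; first exact: open_nbhs_nbhs.
    by apply: (cd [set y | 0 < y]); apply: open_nbhs_nbhs; split=> //; exact: open_gt.
  by have /nbhs_ballP[r r0 H] := N; exists r.
pose rho x := (\det (g x) `^ (4%:R^-1) / lam x) `^ 2^-1.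
have [sg gsp] := rg.
have dg x : M x -> 0 < \det (g x) by move=> /gsp[? ?]; exact: posdef_det.
pose rc x := s / rl x.
have uP x : ball p r x -> P x \in unitmx.
  by move=> /rE[_ d0]; rewrite unitmxE unitfE gt_eqF.
have sub : ball p r `<=` M by move=> x /rE[].
exists (ball p r), o, Q, eta, rho, rc; split.
- split=> //; [exact: ball_open|exact: ballxx].
- by [].
- have l4 : smooth_on M (fun x => \det (g x) `^ 4%:R^-1).
    by apply: smooth_on_powR => //; exact: smooth_det.
  have ph x : M x -> 0 < \det (g x) `^ 4%:R^-1 / lam x.
    by move=> Mx; rewrite divr_gt0 ?powR_gt0 ?dg//; case: (submersion_metric Mx).
  split; [|apply: (smooth_on_sub sub)|apply: (smooth_on_sub sub)].
  + by move=> i j; apply: (smooth_on_sub sub).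
  + by apply: smooth_on_powR => //; apply: smooth_onM => //; exact: smooth_onV.
  + apply: smooth_onM => //; first exact: smooth_on_cst.
    by apply: smooth_onV => // x /rl0/lt0r_neq0.
move=> x bx; have [Mx d0] := rE x bx.
have [l0 _] := submersion_metric Mx; have [cE _ uQ] := QE _ (MB Mx).
have ph : 0 < \det (g x) `^ 4%:R^-1 / lam x by rewrite divr_gt0// powR_gt0// dg.
have dPE : \det (P x) = lam x ^+ 2.
  apply/eqP; rewrite -(eqrXn2 (n := 2))//; [|exact: ltW|exact: sqr_ge0].
  by rewrite detE// -exprM.
split.
- exact: uP.
- split; first by rewrite gt_eqF// powR_gt0.
  rewrite powR_half_sqr// grE// scalerA mulfVK ?gt_eqF// /cM /conformal_class scalerA.
  by rewrite powRN divff ?scale1r// gt_eqF// powR_gt0// dg.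
- rewrite dPE -(rl2 x Mx) /rc; have := rl0 x Mx.
  have s4 : s ^+ 4 = (s * s) ^+ 2 by ring.
  rewrite expr_div_n s4 ss; move: (rl x) => t t0.
  by field; rewrite gt_eqF.
- have r0' : rl x != 0 by rewrite gt_eqF// rl0.
  have s0 : s != 0 by apply: contra_eqN ss => /eqP ->; rewrite mul0r eq_sym oner_eq0.
  case: cs => _ [_ _ rJ] _ [_ /(_ x Mx)[xJ xc]].
  have xi0 : xi x != 0.
    by apply: contra_eqN xc => /eqP ->; rewrite !mul0mx; apply/eqP => /matrixP/(_ 0 0);
      rewrite !mxE eqxx => /eqP; rewrite eq_sym oner_eq0.
  have [a aE] := kernel_line (rJ x Mx) xJ xi0 (fibre_dual_h (uP x bx) uQ).
  have := fibre_dual_v (uP x bx); rewrite -/P aE /eta -scalemxAl.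
  have -> : ((s * rl x) *: zeta x)^T = (s * rl x) *: (zeta x)^T by exact: linearZ.
  rewrite -scalemxAr /zeta trmx_mul; have cT : (cM x)^T = cM x by case: csM => -[_ /(_ x Mx)[]].
  rewrite cT mulmxA xc => /(congr1 (fun Z : 'M[R]_1 => Z 0 0)).
  rewrite !mxZE [_%:M _ _]mxE eqxx mulr1n mulr1 => H.
  rewrite scalerA /rc (_ : _ * a = 1) ?scale1r// -H invf_div.
  have -> : rl x / s = s * rl x; last by ring.
  by rewrite -[rl x in LHS]mul1r -ss; field.
- by rewrite /rc mulrA ss mul1r invr_gt0 rl0.
Qed.

End adapted_frame.

(** * The Legendrian condition *)

Section expansions.
Variables (R : realType) (P : 'rV[R]_4 -> 'M[R]_4) (x : 'rV[R]_4).
Hypothesis uP : P x \in unitmx.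
Notation e k := (coframe P (hh k) x).
Notation eta := (coframe P vv x).

Lemma frame_expand1 u :
  u = \sum_k fcomp1 (P x) u (hh k) *: e k + fcomp1 (P x) u vv *: eta.
Proof.
apply: (fcomp1_inj uP) => a; rewrite fcomp1D fcomp1_sum; move: a; apply: hv_ind => [k|].
  rewrite (sum_cyc _ k) !fcomp1Z !fcomp1_coframe// !(hh_eq, hv_eq, vh_eq, cyc_neq, eqxx) /=.
  by rewrite !(mulr0, mulr1, addr0).
rewrite big1 => [|k _]; rewrite !fcomp1Z !fcomp1_coframe// ?hv_eq ?mulr0//.
by rewrite eqxx mulr1 add0r.
Qed.

Lemma frame_expand2 X : X^T = - X ->
  X = \sum_k fcomp (P x) X (hh k) vv *: wedge (e k) eta
    + \sum_k fcomp (P x) X (hh (s1 k)) (hh (s2 k)) *: wedge (e (s1 k)) (e (s2 k)).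
Proof.
move=> aX; apply: (fcomp_inj uP).
have an a b := fcomp_anti (P x) a b aX.
have dg a : fcomp (P x) X a a = 0 by have := an a a; lra.
have E (k : 'I_3) a b : fcomp (P x) (\sum_k fcomp (P x) X (hh k) vv *: wedge (e k) eta
    + \sum_k fcomp (P x) X (hh (s1 k)) (hh (s2 k)) *: wedge (e (s1 k)) (e (s2 k))) a b
  = \sum_j fcomp (P x) X (hh j) vv * ((hh j == a)%:R * (vv == b)%:R - (hh j == b)%:R * (vv == a)%:R)
  + \sum_j fcomp (P x) X (hh (s1 j)) (hh (s2 j)) *
    ((hh (s1 j) == a)%:R * (hh (s2 j) == b)%:R - (hh (s1 j) == b)%:R * (hh (s2 j) == a)%:R).
  by rewrite !(sum_cyc _ k) !fcompE !fcomp1_coframe// !addrA.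
apply: hv_ind => [k|]; apply: hv_ind => [l|].
- move: l; apply: (cyc_ind (i := k)); rewrite ?(E k) !(sum_cyc _ k) !cycE !(hh_eq, hv_eq, vh_eq, cyc_neq, eqxx) /= ?dg.
  + by ring.
  + by ring.
  + by rewrite (an (hh k) (hh (s2 k))) an; ring.
- by rewrite (E k) !(sum_cyc _ k) !cycE !(hh_eq, hv_eq, vh_eq, cyc_neq, eqxx) /=; ring.
- rewrite (E l) (an (hh l) vv) !(sum_cyc _ l) !cycE !(hh_eq, hv_eq, vh_eq, cyc_neq, eqxx) /=; ring.
- by rewrite (E 0) dg !(sum_cyc _ 0) !cycE !(hh_eq, hv_eq, vh_eq, cyc_neq, eqxx) /=; ring.
Qed.

End expansions.

Section legendrian_structure.
Variables (R : realType) (B : set 'rV[R]_3) (U : set 'rV[R]_4).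
Variables (Q : 'rV[R]_3 -> 'M[R]_3) (A : 'I_3 -> 'rV[R]_3 -> 'rV[R]_3).
Variables (pi : 'rV[R]_4 -> 'rV[R]_3) (eta : 'rV[R]_4 -> 'rV[R]_4).
Hypotheses (oB : open B) (sQ : smooth_mx_on B Q) (sA : forall k, smooth_mx_on B (A k)).
Hypothesis tors : structure_eq B Q (fun=> 0) A.
Hypotheses (oU : open U) (spi : smooth_mx_on U pi) (UB : forall x, U x -> B (pi x)).
Hypothesis seta : smooth_mx_on U eta.
Let P := fibre_frame Q pi eta.
Hypothesis uP : forall x, U x -> P x \in unitmx.
Variables (rho rc : 'rV[R]_4 -> R) (g : 'rV[R]_4 -> 'M[R]_4) (xi th0 : 'rV[R]_4 -> 'rV[R]_4).
Hypotheses (srho : smooth_on U rho) (src : smooth_on U rc).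
Hypothesis rho0 : forall x, U x -> rho x != 0.
Hypothesis gE : forall x, U x -> g x = rho x ^+ 2 *: gram P x.
Hypothesis rcP : forall x, U x -> rc x ^+ 4 * \det (P x) = 1.
Hypothesis xiE : forall x, U x -> xi x = (rc x)^-1 *: row vv (invmx (P x)).
Hypothesis ein : forall x, U x -> einstein_at g x /\ selfdual_at g x.
Hypothesis minth : minimal_weyl U (conformal_class g) xi th0.
Hypothesis leg : legendrian U g xi th0.
Notation e k := (coframe P (hh k)).
Notation AM k := (pull pi (A k)).
Notation hs k x := (wedge (e (s1 k) x) (e (s2 k) x)).

(** The Levi-Civita derivative of [g], as a 1-form in the scale of the adapted
    coframe. *)
Definition log_form x : 'rV[R]_4 := (rho x)^-1 *: differential rho x.
Let p k x := fcomp1 (P x) (log_form x) (hh k).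
(** The vertical component of [log_form]; it turns out to be [mu^-1]. *)
Definition fibre_log x := fcomp1 (P x) (log_form x) vv.
Let phi k x := fcomp (P x) (faraday eta x) (hh k) vv.
Definition fibre_twist k x := fcomp (P x) (faraday eta x) (hh (s1 k)) (hh (s2 k)).
(** The components of a horizontal 1-form which turns out to be the pull-back of
    the Weyl derivative of the base. *)
Definition weyl_comp k x := p k x - 2^-1 * fibre_twist k x.
Notation nu := fibre_log.
Notation w := fibre_twist.
Notation t := weyl_comp.

Let sP : smooth_mx_on U P := smooth_fibre_frame oU spi UB sQ seta.
Let sI : smooth_mx_on U (fun x => invmx (P x)) := smooth_invmx oU sP uP.
Let se a : smooth_mx_on U (coframe P a) := smooth_coframe a oU sP.

Let sfc1 (u : 'rV[R]_4 -> 'rV[R]_4) a : smooth_mx_on U u ->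
  smooth_on U (fun x => fcomp1 (P x) (u x) a).
Proof. by move=> su; exact: (smooth_mx_mul oU su (smooth_mx_tr oU sI) 0 a). Qed.

Let slog : smooth_mx_on U log_form.
Proof. by apply: smooth_mxZ => //; [exact: smooth_onV|exact: smooth_differential]. Qed.

Lemma smooth_fibre_log : smooth_on U nu. Proof. exact: sfc1 vv slog. Qed.

Lemma smooth_fibre_twist k : smooth_on U (w k).
Proof.
have sf : smooth_mx_on U (faraday eta) by exact: smooth_faraday.
exact: (smooth_mx_mul oU (smooth_mx_mul oU sI sf) (smooth_mx_tr oU sI)).
Qed.

Lemma smooth_weyl_comp k : smooth_on U (t k).
Proof.
apply: smooth_onB => //; first exact: sfc1 (hh k) slog.
by apply: smooth_onM => //; [exact: smooth_on_cst|exact: smooth_fibre_twist].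
Qed.

Let S1 x : U x -> forall k, faraday (e k) x
  = wedge (AM (s2 k) x) (e (s1 k) x) - wedge (AM (s1 k) x) (e (s2 k) x) - wedge 0 (e k x).
Proof.
move=> Ux k; rewrite !fibre_frame_h (pull_structure oB sQ tors oU spi UB k Ux).
by rewrite /pull mul0mx.
Qed.

Let S2 x : U x -> faraday (coframe P vv) x
  = \sum_k phi k x *: wedge (e k x) (coframe P vv x) + \sum_k w k x *: hs k x.
Proof.
by move=> Ux; rewrite {1}(fibre_frame_v Q pi eta) {1}(frame_expand2 (uP Ux) (faraday_tr eta x)).
Qed.

Let frameE (u : 'rV[R]_4 -> 'rV[R]_4) x : U x ->
  frame_form P (fun=> 0) (fun k x => fcomp1 (P x) (u x) (hh k)) (fun x => fcomp1 (P x) (u x) vv) x = u x.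
Proof. by move=> Ux; rewrite /frame_form add0r -frame_expand1// uP. Qed.

Let torsG (q : 'I_3 -> 'rV[R]_4 -> R) (n : 'rV[R]_4 -> R) :
  structure_eq4 U P (frame_form P (fun=> 0) q n) (rot_form P (fun k => AM k) w q)
    (fibre_form P w (fun k x => q k x + phi k x) n).
Proof.
apply: (submersion_structure (phi := phi)) => [x Ux k|x Ux|x Ux]; [exact: S1|exact: S2|].
by rewrite add0r -big_split; apply: eq_bigr => k _; rewrite scalerDl.
Qed.

Let rc0 x : U x -> rc x != 0.
Proof.
move=> Ux; apply: contraTneq (oner_neq0 R) => rc0.
by rewrite -(rcP Ux) rc0 expr0n /= mul0r eqxx.
Qed.

Let cE x : U x -> conformal_class g x = rc x ^+ 2 *: gram P x.
Proof. by move=> Ux; exact: conformal_class_frame (rho0 Ux) (rcP Ux) (gE Ux). Qed.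

Let tau x := th0 x + (rc x)^-1 *: differential rc x.

Let tau_h k x : U x -> fcomp1 (P x) (tau x) (hh k) = - phi k x.
Proof.
move=> Ux; have := (minth.2 x Ux).
move/(minimal_frame oU sP uP src rc0 xiE
  (torsG (fun k x => fcomp1 (P x) (tau x) (hh k)) (fun x => fcomp1 (P x) (tau x) vv)) cE Ux) => H.
have [|H1 _] := H; first by move=> y Uy; rewrite frameE// /tau addrK.
have := H1 k; rewrite /fibre_form !fcomp1E !fcomp1_coframe ?uP//.
rewrite !(hh_eq, hv_eq, vh_eq, cyc_neq, eqxx) /= => /eqP.
rewrite !mulr0 !oppr0 !addr0 mulr1 mulr0 subr0 addr_eq0 => /eqP.
by [].
Qed.

Let psi := frame_form P (fun=> 0) p nu.
Let psiE x : U x -> psi x = (rho x)^-1 *: differential rho x.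
Proof. by move=> Ux; rewrite /psi frameE. Qed.

(** The condition that the skew form of [legendrian_frame] be selfdual is one
    equation for each [k] between its horizontal component [w k] and its
    vertical one, which involves [phi k] and the form [psi]. *)
Let phiE k x : U x -> phi k x = - (t k x + w k x).
Proof.
move=> Ux.
have lc l i j : levi_civita g l i j x = weyl_conn (gram P) psi l i j x.
  exact: (levi_civita_conformal oU sP srho uP rho0 gE psiE l i j Ux).
have th0E : th0 x = tau x - (rc x)^-1 *: differential rc x by rewrite /tau addrK.
have := leg Ux; cbv zeta; rewrite (legendrian_frame oU sP uP src rc0 xiE (torsG p nu) cE (tau := tau) Ux th0E lc) cE//.
set X := (2^-1 * _) *: _; have aX : X^T = - X.
  by apply/matrixP => i j; rewrite mxE /X !entryE !wedgeE faraday_anti; ring.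
move/(selfdual_fcomp (rcP Ux) aX)/(_ k).
rewrite /X fibre_frame_v !fcompE -(fibre_frame_v Q pi eta) -/P !fcomp1_coframe ?uP//.
have F (u v : 'rV[R]_4) a : fcomp1 (P x) (u + u - v) a = fcomp1 (P x) u a + fcomp1 (P x) u a - fcomp1 (P x) v a.
  by rewrite !fcomp1E.
rewrite !(vh_eq, eqxx) /= !F (tau_h k)//.
have -> : fcomp1 (P x) (frame_form P (fun=> 0) p nu x) (hh k) = p k x by rewrite frameE.
rewrite (fcomp_anti (P x) (hh k) vv (faraday_tr _ x)) fibre_frame_v -/(w k x) -/(phi k x).
rewrite !(mulr0, mulr1) !subr0 !add0r addr0 /t => /(mulfI (mulf_neq0 _ (rc0 Ux))) H.
have := H _; rewrite invr_eq0 pnatr_eq0 => /(_ isT) {}H.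
by move: H; move: (phi k x) (p k x) (w k x) => a b d H; lra.
Qed.

Lemma legendrian_log_form x : U x -> (rho x)^-1 *: differential rho x
  = \sum_k (t k x + 2^-1 * w k x) *: e k x + nu x *: eta x.
Proof.
move=> Ux; rewrite -psiE// /psi /frame_form add0r fibre_frame_v; congr (_ + _).
by apply: eq_bigr => k _; rewrite subrK.
Qed.

(** By [phiE] the connection on antiselfdual forms has no component along
    [eta]. *)
Lemma legendrian_curvature x k : U x ->
  let u j y := AM j y + t (s1 j) y *: e (s2 j) y - t (s2 j) y *: e (s1 j) y - nu y *: e j y in
  faraday (u k) x + wedge (u (s1 k) x) (u (s2 k) x)
  = (- 12^-1 * scal g x * rho x ^+ 2) *: (hs k x + wedge (e k x) (eta x)).
Proof.
move=> Ux u.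
set X := rot_form P (fun k => AM k) w p.
set Y := fibre_form P w (fun k x => p k x + phi k x) nu.
have sp j : smooth_on U (p j) := sfc1 (hh j) slog.
have sw j : smooth_on U (w j) := smooth_fibre_twist j.
have sphi j : smooth_on U (phi j).
  have sf : smooth_mx_on U (faraday eta) by exact: smooth_faraday.
  exact: (smooth_mx_mul oU (smooth_mx_mul oU sI sf) (smooth_mx_tr oU sI)).
have spsi : smooth_mx_on U psi by apply: (eq_smooth_mx oU (fun y Uy => esym (psiE Uy))).
have sX j : smooth_mx_on U (X j).
  apply: smooth_mxD => //; last first.
    by apply: (smooth_mxZ oU _ (se vv)); apply: smooth_onM => //; exact: smooth_on_cst.
  apply: smooth_mxB => //; last exact: (smooth_mxZ oU (sp _) (se _)).
  apply: smooth_mxD => //; last exact: (smooth_mxZ oU (sp _) (se _)).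
  exact: (smooth_pull oU spi UB (sA j)).
have sY j : smooth_mx_on U (Y j).
  apply: smooth_mxB => //.
    apply: smooth_mxB => //; last exact: (smooth_mxZ oU smooth_fibre_log (se _)).
    by apply: (smooth_mxZ oU _ (se vv)); apply: smooth_onD => //; exact: sp.
  apply: smooth_mxZ => //; first exact: smooth_on_cst.
  exact: (smooth_mxB oU (smooth_mxZ oU (sw _) (se _)) (smooth_mxZ oU (sw _) (se _))).
have tors4 : structure_eq4 U P psi X Y by exact: torsG.
have uE j y : U y -> asd_conn X Y j y = u j y.
  move=> Uy; rewrite /asd_conn /X /Y /rot_form /fibre_form phiE// /u /t.
  apply/rowP => i; rewrite !entryE.
  move: (AM j y) (e j y) (e (s1 j) y) (e (s2 j) y) (coframe P vv y) (p j y) (p (s1 j) y) (p (s2 j) y)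
    (w j y) (w (s1 j) y) (w (s2 j) y) (nu y) => *.
  by field.
have antiR a b c d : frame_curv P (weyl_conn (gram P) psi) x a b d c
    = - frame_curv P (weyl_conn (gram P) psi) x a b c d.
  have := frame_curv_trace oU sP spsi uP sX sY tors4 Ux a b c d.
  rewrite (eq_on_faraday oU psiE Ux) (faraday_dlog oU srho rho0 Ux) /fcomp mulmx0 mul0mx mx0E mulr0.
  by rewrite addrC => /eqP; rewrite addr_eq0 => /eqP.
have [E1 E2] := ein Ux.
have E := einstein_selfdual_asd oU sP srho uP rho0 gE psiE Ux antiR (cE Ux) (rcP Ux) E1 E2.
apply: (fcomp_inj (uP Ux)) => a b.
have := E k a b; rewrite (asd_curvE oU sP spsi uP sX sY tors4 Ux).
rewrite (eq_on_faraday oU (uE k) Ux) !uE// => ->.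
rewrite -(fibre_frame_v Q pi eta) -/P !fcompE !fcomp1_coframe ?uP//.
Qed.

End legendrian_structure.

(** * Functions constant along the fibres *)

Lemma ball_rowP (R : realType) n (x y : 'rV[R]_n) (r : R) : 0 < r ->
  ball x r y <-> forall k, `|x 0 k - y 0 k| < r.
Proof.
move=> r0; rewrite -ball_normE /=; split=> [H k|H].
  by apply: le_lt_trans H; have := coord_le_norm (x - y) k; rewrite mxDE mxNE.
case: n x y H => [|n] x y H.
  by apply: le_lt_trans r0; apply: norm_le_coord => // -[].
have [j _ jm] := @arg_maxP _ R 'I_n.+1 ord0 xpredT (fun k => `|x 0 k - y 0 k|) isT.
apply: le_lt_trans (H j); apply: norm_le_coord => // k.
by rewrite mxDE mxNE; exact: jm.
Qed.

Lemma derive_coord (R : realType) n (v x : 'rV[R]_n) j :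
  'D_v (fun y : 'rV[R]_n => y 0 j) x = v 0 j.
Proof.
have did : differentiable (fun y : 'rV[R]_n => y) x.
  by apply: differentiable_row => k; exact: differentiable_coord.
by have := derive_row v did; rewrite derive_id => /rowP/(_ j); rewrite [RHS]mxE => ->.
Qed.

Lemma ball_segment (R : realType) n (x y z : 'rV[R]_n) (r t : R) : 0 < r ->
  ball x r y -> ball x r z -> 0 <= t <= 1 -> ball x r (y + t *: (z - y)).
Proof.
move=> r0 /(ball_rowP _ _ r0) yH /(ball_rowP _ _ r0) zH /andP[t0 t1].
apply/(ball_rowP _ _ r0) => k; rewrite !entryE.
have -> : x 0 k - (y 0 k + t * (z 0 k - y 0 k)) = (1 - t) * (x 0 k - y 0 k) + t * (x 0 k - z 0 k) by ring.
apply: (le_lt_trans (ler_normD _ _)); rewrite !normrM (ger0_norm t0) ger0_norm ?subr_ge0//.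
move: (yH k) (zH k); move: (`|x 0 k - y 0 k|) (`|x 0 k - z 0 k|) => b a hb ha.
have [->|t0'] := eqVneq t 0; first by rewrite subr0 mul1r mul0r addr0.
have tp : 0 < t by rewrite lt_def t0'.
have : t * a < t * r by rewrite ltr_pM2l.
have : (1 - t) * b <= (1 - t) * r by rewrite ler_wpM2l ?subr_ge0// ltW.
by move=> h1 h2; lra.
Qed.

Lemma ball_constant (R : realType) n (q y z : 'rV[R]_n) (r : R) (f : 'rV[R]_n -> R) : 0 < r ->
  ball q r y -> ball q r z -> (forall x, ball q r x -> differentiable f x) ->
  (forall x, ball q r x -> 'D_(z - y) f x = 0) -> f z = f y.
Proof.
move=> r0 By Bz df Df.
have [t|t /andP[t0 t1]] := @line_MVT R n f y (z - y).
  by move=> t01; apply: df; exact: ball_segment.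
rewrite (addrC y) subrK Df => [/eqP|]; first by rewrite subr_eq0 => /eqP.
by apply: ball_segment => //; rewrite !ltW.
Qed.

Lemma complete_submersion (R : realType) (J : 'M[R]_(4, 3)) : \rank J = 3%N ->
  exists d : 'rV[R]_4, (row_mx J d^T : 'M[R]_(3 + 1)) \in unitmx.
Proof.
move=> rJ; have kr : \rank (kermx J) = 1%N by rewrite mxrank_ker rJ.
have /rowV0Pn[v vk v0] : kermx J != 0 by rewrite -mxrank_eq0 kr.
have vJ : v *m J = 0 by apply/sub_kermxP.
exists v; rewrite -row_free_unit -kermx_eq0; apply/rowV0P => u /sub_kermxP uK.
have /eq_row_mx[uJ uv] : row_mx (u *m J) (u *m v^T) = row_mx 0 0 by rewrite -mul_mx_row uK row_mx0.
have [a uE] := kernel_line rJ vJ v0 uJ.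
move: uv; rewrite uE -scalemxAl => /(congr1 (fun Z : 'M[R]_1 => Z 0 0)); rewrite mxZE mx0E => /eqP.
have := gram_posdef (unitmx1 R 4) v0; rewrite trmx1 mulmx1 mulmx1 => vp.
by rewrite mulf_eq0 (gt_eqF vp) orbF => /eqP ->; rewrite scale0r.
Qed.

(** Completed by a linear function, [pi] is a local diffeomorphism.  In the chart
    which it defines, a ball is a box and the fibres of [pi] are segments, so a
    function with vanishing vertical derivative equals its value on the slice
    [sec], and one with vanishing differential is constant. *)
Lemma submersion_chart (R : realType) (U0 : set 'rV[R]_4) (pi : 'rV[R]_4 -> 'rV[R]_3) p :
  open U0 -> smooth_mx_on U0 pi -> U0 p -> \rank ('J pi p) = 3%N ->
  exists (U : set 'rV[R]_4) (r : R) (sec : 'rV[R]_3 -> 'rV[R]_4),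
  [/\ [/\ open U, U p & U `<=` U0], 0 < r /\ pi @` U = ball (pi p) r,
      smooth_mx_on (ball (pi p) r) sec /\
        (forall y, ball (pi p) r y -> U (sec y) /\ pi (sec y) = y),
      (forall f, smooth_on U f -> (forall x v, U x -> v *m 'J pi x = 0 -> 'D_v f x = 0) ->
         forall x, U x -> f x = f (sec (pi x)))
    & (forall f, smooth_on U f -> (forall x, U x -> differential f x = 0) ->
         forall x, U x -> f x = f p)].
Proof.
move=> oU0 spi U0p rJ; have [d ud] := complete_submersion rJ.
pose F x : 'rV[R]_4 := (row_mx (pi x) (x *m d^T) : 'rV[R]_(3 + 1)).
have Fh x k : F x 0 (hh k) = pi x 0 k by rewrite /F (@row_mxEl _ 1 3 1).
have Fv x : F x 0 vv = (x *m d^T) 0 0 by rewrite /F (@row_mxEr _ 1 3 1).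
have sX : smooth_mx_on U0 (fun x : 'rV[R]_4 => x) by move=> i j; exact: smooth_on_coord.
have sF : smooth_mx_on U0 F.
  apply: (@smooth_row_mx R 4 U0 oU0 1 3 1) => //.
  by apply: (smooth_mx_mul oU0 sX) => i j; exact: smooth_on_cst.
have JF x : U0 x -> 'J F x = (row_mx ('J pi x) d^T : 'M[R]_(4, 3 + 1)).
  move=> Ux; apply/matrixP => i; apply: hv_ind => [k|].
    rewrite (@row_mxEl _ 4 3 1) !jacobianE; [|exact: smooth_row_diff spi _ Ux|exact: smooth_row_diff sF _ Ux].
    by congr (partial i _ x); apply/funext => y; rewrite Fh.
  rewrite (@row_mxEr _ 4 3 1) jacobianE; last exact: smooth_row_diff sF _ Ux.
  have -> : (fun y => F y 0 vv) = (fun y => \sum_k d 0 k * (y : 'rV[R]_4) 0 k).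
    apply/funext => y; rewrite Fv mxE; apply: eq_bigr => k _.
    by rewrite [d^T _ _]mxE mulrC.
  have dk (k : 'I_4) : differentiable (fun y : 'rV[R]_4 => d 0 k * y 0 k) x.
    exact: smooth_on_diff (smooth_onM oU0 (smooth_on_cst _) (@smooth_on_coord R 4 U0 0 k)) Ux.
  rewrite partial_sum// [RHS]mxE (bigD1 i)//= big1 ?addr0 => [|k ki].
    rewrite partialM//; last exact: differentiable_coord.
    by rewrite partial_cst /partial derive_coord mxE !eqxx mul0r add0r mulr1.
  rewrite partialM//; last exact: differentiable_coord.
  by rewrite partial_cst /partial derive_coord mxE eqxx (negPf ki) mul0r mulr0 addr0.
have uF : 'J F p \in unitmx by rewrite JF.
have [r [G [r0 sG oW Gp GH]]] := local_inverse oU0 sF U0p uF.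
pose W := ball (F p) r; pose U := G @` W.
have oB : open W by exact: ball_open.
have WF x : U x -> [/\ W (F x), G (F x) = x & U0 x].
  by move=> [y Wy <-]; have [U0y FG] := GH y Wy; rewrite FG.
have WU y : W y -> U (G y) by exists y.
have JG y : W y -> 'J G y *m 'J F (G y) = 1%:M.
  move=> Wy; apply/matrixP => i j.
  have [U0y _] := GH y Wy.
  have -> : (1%:M : 'M[R]_4) i j = partial i (fun z : 'rV[R]_4 => z 0 j) y.
    by rewrite /partial derive_coord !mxE eqxx eq_sym.
  have -> : partial i (fun z : 'rV[R]_4 => z 0 j) y = partial i (fun z => F (G z) 0 j) y.
    by apply: (eq_on_partial _ oB Wy) => z Wz; have [_ ->] := GH z Wz.
  rewrite (@partial_compr R 4 4 G (fun z => F z 0 j) i y (fun k => smooth_mx_diff _ k sG Wy) (smooth_mx_diff _ j sF U0y)).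
  rewrite [LHS]mxE; apply: eq_bigr => k _.
  have E1 := jacobianE i k (smooth_row_diff sG Wy); have E2 := jacobianE k j (smooth_row_diff sF U0y).
  by apply: f_equal2; [exact: E1|exact: E2].
have JGpi y v : W y -> (v *m 'J G y) *m 'J pi (G y) = (\row_k v 0 (hh k)).
  move=> Wy; have [U0y _] := GH y Wy; have := congr1 (mulmx v) (JG y Wy).
  rewrite mulmxA mulmx1 JF// => E; apply/rowP => k; rewrite [RHS]mxE.
  have := congr1 (fun Z : 'rV[R]_4 => Z 0 (hh k)) E; rewrite (@mul_mx_row _ 1 4 3 1) => <-.
  by rewrite (@row_mxEl _ 1 3 1).
have lift y : ball (pi p) r y -> W (row_mx y (p *m d^T) : 'rV[R]_(3 + 1)).
  move=> /(ball_rowP _ _ r0) By; apply/(ball_rowP _ _ r0); apply: hv_ind => [k|].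
    by rewrite Fh (@row_mxEl _ 1 3 1).
  by rewrite Fv (@row_mxEr _ 1 3 1) subrr normr0.
pose sec y := G (row_mx y (p *m d^T) : 'rV[R]_(3 + 1)).
have secH y : ball (pi p) r y -> U (sec y) /\ pi (sec y) = y.
  move=> By; split; first exact/WU/lift.
  have [_ E] := GH _ (lift y By); apply/rowP => k.
  by rewrite -Fh [F _]E (@row_mxEl _ 1 3 1).
have piW x : U x -> ball (pi p) r (pi x).
  move=> /WF[/(ball_rowP _ _ r0) H _ _]; apply/(ball_rowP _ _ r0) => k.
  by have := H (hh k); rewrite !Fh.
have oU : open U by [].
have sub : U `<=` U0 by move=> x /WF[].
have der f v y : smooth_on U f -> W y -> 'D_v (fun z => f (G z)) y = 'D_(v *m 'J G y) f (G y).
  move=> sf Wy; rewrite (derive_compr _ (fun k => smooth_mx_diff _ k sG Wy) (smooth_on_diff sf (WU y Wy))).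
  rewrite derive_partial; last exact: smooth_on_diff sf (WU y Wy).
  apply: eq_bigr => k _; congr (_ * _); rewrite mxE derive_partial; last exact: smooth_mx_diff sG Wy.
  by apply: eq_bigr => l _; rewrite (jacobianE l k (smooth_row_diff sG Wy)).
have dfG f y : smooth_on U f -> W y -> differentiable (fun z => f (G z)) y.
  move=> sf Wy; apply: differentiable_compr; first by move=> k; exact: smooth_mx_diff sG Wy.
  exact: smooth_on_diff sf (WU y Wy).
exists U, r, sec; split.
- by split=> //; exists (F p) => //; exact: ballxx.
- split=> //; apply/seteqP; split=> [_ [x Ux <-]|y By]; first exact: piW.
  by have [Us E] := secH y By; exists (sec y).
- split=> //.
  have oB3 : open (ball (pi p) r) by exact: ball_open.
  have sl : smooth_mx_on (ball (pi p) r) (fun y => row_mx y (p *m d^T) : 'rV[R]_(3 + 1)).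
    apply: (@smooth_row_mx R 3 _ oB3 1 3 1) => i j; first exact: smooth_on_coord.
    exact: smooth_on_cst.
  exact: (smooth_mx_comp oB3 sl lift sG).
- move=> f sf vf x Ux; have [Wx GF _] := WF x Ux; rewrite -{1}GF /sec.
  apply: (ball_constant (q := F p) (r := r) (f := fun z => f (G z))) => //.
  - exact/lift/piW.
  - by move=> z Wz; exact: dfG.
  move=> z Wz; rewrite (der f _ z sf Wz); apply: vf; first exact: WU.
  rewrite JGpi//; apply/rowP => k; rewrite mxE mx0E mxDE mxNE Fh (@row_mxEl _ 1 3 1).
  by rewrite subrr.
move=> f sf vf x Ux; have [Wx GF _] := WF x Ux; rewrite -GF -[in RHS]Gp.
apply: (ball_constant (q := F p) (r := r) (f := fun z => f (G z))) => //; first exact: ballxx.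
  by move=> z Wz; exact: dfG.
move=> z Wz; rewrite (der f _ z sf Wz) (derive_differential _ sf (WU z Wz)) vf; last exact: WU.
by rewrite trmx0 mulmx0 mx0E.
Qed.

(** * Descent to an Einstein-Weyl structure *)

Section descent.
Variables (R : realType) (B : set 'rV[R]_3) (U : set 'rV[R]_4).
Variables (Q : 'rV[R]_3 -> 'M[R]_3) (A : 'I_3 -> 'rV[R]_3 -> 'rV[R]_3).
Variables (pi : 'rV[R]_4 -> 'rV[R]_3) (eta : 'rV[R]_4 -> 'rV[R]_4).
Hypotheses (oB : open B) (sQ : smooth_mx_on B Q) (sA : forall k, smooth_mx_on B (A k)).
Hypothesis uQ : forall y, B y -> Q y \in unitmx.
Hypothesis tors : structure_eq B Q (fun=> 0) A.
Hypotheses (oU : open U) (spi : smooth_mx_on U pi) (UB : forall x, U x -> B (pi x)).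
Hypothesis seta : smooth_mx_on U eta.
Let P := fibre_frame Q pi eta.
Hypothesis uP : forall x, U x -> P x \in unitmx.
Variables (t : 'I_3 -> 'rV[R]_4 -> R) (nu m : 'rV[R]_4 -> R).
Hypotheses (st : forall k, smooth_on U (t k)) (snu : smooth_on U nu).
Notation e k := (coframe P (hh k)).
Notation AM k := (pull pi (A k)).
Notation hs k x := (wedge (e (s1 k) x) (e (s2 k) x)).
Let u j y := AM j y + t (s1 j) y *: e (s2 j) y - t (s2 j) y *: e (s1 j) y - nu y *: e j y.
Hypothesis curv : forall x k, U x -> faraday (u k) x + wedge (u (s1 k) x) (u (s2 k) x)
  = m x *: (hs k x + wedge (e k x) (eta x)).

Let sP : smooth_mx_on U P := smooth_fibre_frame oU spi UB sQ seta.
Let se a : smooth_mx_on U (coframe P a) := smooth_coframe a oU sP.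

Let pull_v x Z a : U x -> fcomp (P x) ('J pi x *m Z *m ('J pi x)^T) a vv = 0.
Proof.
move=> Ux; rewrite /fcomp.
have -> : invmx (P x) *m ('J pi x *m Z *m ('J pi x)^T) *m (invmx (P x))^T
  = invmx (P x) *m ('J pi x *m Z) *m (invmx (P x) *m 'J pi x)^T by rewrite trmx_mul !mulmxA.
rewrite mxE big1// => j _; rewrite [_^T _ _]mxE.
have -> : (invmx (P x) *m 'J pi x) vv j = (row vv (invmx (P x)) *m 'J pi x) 0 j.
  by rewrite -row_mul [RHS]mxE.
by rewrite (fibre_dual_h (uP Ux) (uQ (UB Ux))) mx0E mulr0.
Qed.

Let pull1_v x (b : 'rV[R]_3) : U x -> fcomp1 (P x) (b *m ('J pi x)^T) vv = 0.
Proof.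
move=> Ux; rewrite /fcomp1 -mulmxA -trmx_mul mxE big1// => j _; rewrite [_^T _ _]mxE.
have -> : (invmx (P x) *m 'J pi x) vv j = (row vv (invmx (P x)) *m 'J pi x) 0 j.
  by rewrite -row_mul [RHS]mxE.
by rewrite (fibre_dual_h (uP Ux) (uQ (UB Ux))) mx0E mulr0.
Qed.

Let u_v x k : U x -> fcomp1 (P x) (u k x) vv = 0.
Proof.
move=> Ux; rewrite /u !fcomp1D !fcomp1N !fcomp1Z /pull pull1_v// !fcomp1_coframe ?uP//.
by rewrite !hv_eq /= !mulr0 !oppr0 !addr0.
Qed.

(** The forms [u k] are horizontal and built from pulled back forms, so only the
    derivatives of their coefficients contribute to the components of the
    curvature along [eta]. *)
Lemma vertical_derivatives x k : U x ->
  fcomp1 (P x) (differential (t k) x) vv = 0 /\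
  fcomp1 (P x) (differential nu x) vv = m x.
Proof.
move=> Ux.
have sAM j := smooth_pull oU spi UB (sA j).
have s1' j := smooth_mxZ oU (st (s1 j)) (se (hh (s2 j))).
have s2' j := smooth_mxZ oU (st (s2 j)) (se (hh (s1 j))).
have s3 j := smooth_mxZ oU snu (se (hh j)).
have dv (j : 'I_3) a : fcomp (P x) (faraday (e j) x) a vv = 0.
  by rewrite fibre_frame_h (faraday_pull oU spi UB (smooth_coframe j oB sQ) Ux) pull_v.
have E j (a : 'I_3) : - fcomp1 (P x) (differential (t (s1 j)) x) vv * (s2 j == a)%:R
    + fcomp1 (P x) (differential (t (s2 j)) x) vv * (s1 j == a)%:R
    + fcomp1 (P x) (differential nu x) vv * (j == a)%:R = m x * (j == a)%:R.
  have := congr1 (fun Z => fcomp (P x) Z (hh a) vv) (curv j Ux).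
  rewrite /= fcompD fcomp_wedge !u_v// mulr0 mul0r subrr addr0.
  rewrite (faradayB oU (smooth_mxB oU (smooth_mxD oU (sAM j) (s1' j)) (s2' j)) (s3 j) Ux).
  rewrite (faradayB oU (smooth_mxD oU (sAM j) (s1' j)) (s2' j) Ux).
  rewrite (faradayD (sAM j) (s1' j) Ux) !(faradayZ (st _) (se _) Ux) (faradayZ snu (se _) Ux).
  rewrite (faraday_pull oU spi UB (sA j) Ux) -(fibre_frame_v Q pi eta) -/P.
  have fc a' b' := @fcomp1_coframe _ _ P a' x b' (uP Ux).
  have L N (W : 'M[R]_N) Z Z1 Z2 Z3 (d1 d2 d3 e1 e2 e3 : 'rV[R]_N) r1 r2 r3 a' b' :
      fcomp W (Z + (wedge d1 e1 + r1 *: Z1) - (wedge d2 e2 + r2 *: Z2) - (wedge d3 e3 + r3 *: Z3)) a' b'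
      = fcomp W Z a' b' + (fcomp1 W d1 a' * fcomp1 W e1 b' - fcomp1 W d1 b' * fcomp1 W e1 a'
        + r1 * fcomp W Z1 a' b')
        - (fcomp1 W d2 a' * fcomp1 W e2 b' - fcomp1 W d2 b' * fcomp1 W e2 a' + r2 * fcomp W Z2 a' b')
        - (fcomp1 W d3 a' * fcomp1 W e3 b' - fcomp1 W d3 b' * fcomp1 W e3 a' + r3 * fcomp W Z3 a' b').
    by rewrite !(fcompD, fcompN, fcompZ, fcomp_wedge).
  rewrite L !dv (pull_v _ _ Ux) fcompZ fcompD !fcomp_wedge !fc.
  rewrite !(hh_eq, hv_eq, vh_eq, eqxx) /= => H; apply/eqP; rewrite -subr_eq0; apply/eqP.
  by apply: (@linear_consequence _ 1 _ _ _ H); ring.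
split.
  have := E (s2 k) (s1 k); rewrite !cycE !cyc_neq eqxx /=.
  by move: (fcomp1 _ _ _) => a; lra.
by have := E k k; rewrite !cyc_neq eqxx /=; lra.
Qed.

Lemma vertical_constant k x v : U x -> v *m 'J pi x = 0 -> 'D_v (t k) x = 0.
Proof.
move=> Ux vJ; have rJ := fibre_frame_rank (uP Ux).
have E0 : row vv (invmx (P x)) != 0.
  apply: contra_eqN (fibre_dual_v (uP Ux)) => /eqP ->; rewrite mul0mx.
  by apply/eqP => /matrixP/(_ 0 0); rewrite !mxE eqxx => /eqP; rewrite eq_sym oner_eq0.
have [a ->] := kernel_line rJ (fibre_dual_h (uP Ux) (uQ (UB Ux))) E0 vJ.
rewrite (derive_differential _ (st k) Ux) -scalemxAl mxZE.
have [+ _] := vertical_derivatives k Ux; rewrite /fcomp1 => H.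
have -> : (row vv (invmx (P x)) *m (differential (t k) x)^T) 0 0
    = (differential (t k) x *m (invmx (P x))^T) 0 vv.
  by rewrite [LHS]mxE [RHS]mxE; apply: eq_bigr => j _; rewrite !mxE mulrC.
by rewrite H mulr0.
Qed.

Variables (B' : set 'rV[R]_3) (tB : 'I_3 -> 'rV[R]_3 -> R).
Hypotheses (oB' : open B') (B'B : B' `<=` B) (piU : pi @` U = B').
Hypotheses (stB : forall k, smooth_on B' (tB k)).
Hypothesis tBE : forall k x, U x -> t k x = tB k (pi x).

Definition base_form y : 'rV[R]_3 := \sum_k tB k y *: coframe Q k y.
(** The rotational part of the connection changes in this way when the 1-form of
    the Weyl derivative changes from [0] to [base_form]. *)
Definition base_rotation k y : 'rV[R]_3 :=
  A k y + tB (s1 k) y *: coframe Q (s2 k) y - tB (s2 k) y *: coframe Q (s1 k) y.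
Notation th := base_form.
Notation A' := base_rotation.

Let sQ' : smooth_mx_on B' Q.
Proof. by move=> i j; exact: smooth_on_sub (sQ i j). Qed.

Lemma smooth_base_form : smooth_mx_on B' th.
Proof. by apply: smooth_mx_sum => // k; exact: (smooth_mxZ oB' (stB k) (smooth_coframe k oB' sQ')). Qed.

Lemma smooth_base_rotation k : smooth_mx_on B' (A' k).
Proof.
have sc j := smooth_coframe j oB' sQ'.
apply: smooth_mxB => //; last exact: (smooth_mxZ oB' (stB _) (sc _)).
apply: smooth_mxD => //; last exact: (smooth_mxZ oB' (stB _) (sc _)).
by move=> i j; exact: smooth_on_sub (sA k i j).
Qed.

Lemma base_structure : structure_eq B' Q th A'.
Proof.
move=> y B'y k; rewrite (tors (B'B B'y) k) /th /A' (sum_cyc _ k) !cycE.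
apply/matrixP => i j; rewrite !entryE !wedgeE !entryE.
move: (coframe Q k y) (coframe Q (s1 k) y) (coframe Q (s2 k) y) (tB k y) (tB (s1 k) y) (tB (s2 k) y)
  (A (s1 k) y) (A (s2 k) y) => *.
by ring.
Qed.

Let UB' x : U x -> B' (pi x). Proof. by move=> Ux; rewrite -piU; exists x. Qed.

Lemma pull_base_form x : U x -> pull pi th x = \sum_k t k x *: e k x.
Proof.
move=> Ux; rewrite /pull mulmx_suml; apply: eq_bigr => k _.
by rewrite -scalemxAl fibre_frame_h tBE.
Qed.

Let uE k x : U x -> u k x = pull pi (A' k) x - nu x *: pull pi (coframe Q k) x.
Proof.
move=> Ux; rewrite /u !fibre_frame_h !tBE// /A' /pull mulmxBl mulmxDl -!scalemxAl.
by [].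
Qed.

(** Since [d nu - nu th - m eta] has no vertical component, it is the pull-back of
    a covector of the base at the given point. *)
Let base_curvature x : U x -> exists X : 'rV[R]_3,
  X *m ('J pi x)^T = differential nu x - nu x *: pull pi th x - m x *: eta x /\
  forall k, rotation_curv A' k (pi x)
    = (m x - nu x ^+ 2) *: wedge (coframe Q (s1 k) (pi x)) (coframe Q (s2 k) (pi x))
      + wedge X (coframe Q k (pi x)).
Proof.
move=> Ux; set Y := differential nu x - _ - _.
have Yv : fcomp1 (P x) Y vv = 0.
  rewrite /Y -(fibre_frame_v Q pi eta) -/P !fcomp1E !fcomp1_coframe ?uP// pull1_v//.
  by have [_ ->] := vertical_derivatives 0 Ux; rewrite eqxx /= mulr1 mulr0 subr0 subrr.
exists (\sum_j fcomp1 (P x) Y (hh j) *: coframe Q j (pi x)).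
have XE : (\sum_j fcomp1 (P x) Y (hh j) *: coframe Q j (pi x)) *m ('J pi x)^T = Y.
  rewrite [RHS](frame_expand1 (uP Ux)) Yv scale0r addr0 mulmx_suml; apply: eq_bigr => j _.
  by rewrite -scalemxAl fibre_frame_h.
split=> // k; set X := (\sum_j _) in XE *.
have [K KJ] := full_rank_linv (fibre_frame_rank (uP Ux)).
suff E : 'J pi x *m rotation_curv A' k (pi x) *m ('J pi x)^T
  = 'J pi x *m ((m x - nu x ^+ 2) *: wedge (coframe Q (s1 k) (pi x)) (coframe Q (s2 k) (pi x))
      + wedge X (coframe Q k (pi x))) *m ('J pi x)^T.
  have := congr1 (fun Z => K *m Z *m K^T) E; rewrite /= !mulmxA KJ !mul1mx -!mulmxA -!trmx_mul KJ.
  by rewrite trmx1 !mulmx1.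
have sAM := smooth_pull oU spi UB' (smooth_base_rotation k).
have sek := smooth_pull oU spi UB' (smooth_coframe k oB' sQ').
rewrite [in RHS]mulmxDr [in RHS]mulmxDl -[in RHS]scalemxAr -[in RHS]scalemxAl !wedge_conj XE.
rewrite -[coframe Q k (pi x) *m _]/(pull pi (coframe Q k) x)
  -[coframe Q (s1 k) (pi x) *m _]/(pull pi (coframe Q (s1 k)) x)
  -[coframe Q (s2 k) (pi x) *m _]/(pull pi (coframe Q (s2 k)) x).
rewrite (pull_rotation smooth_base_rotation oU spi UB' k Ux).
have := curv k Ux; rewrite (eq_on_faraday oU (uE k) Ux) !uE//.
rewrite (faradayB oU sAM (smooth_mxZ oU snu sek) Ux) (faradayZ snu sek Ux).
rewrite (pull_structure oB' sQ' base_structure oU spi UB' k Ux) !fibre_frame_h /Y.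
move=> H; apply/matrixP => i j; move/matrixP/(_ i j): H.
rewrite !entryE !wedgeE !entryE.
move: (faraday _ x i j) (m x) (nu x) (pull pi (coframe Q k) x) (pull pi (coframe Q (s1 k)) x)
  (pull pi (coframe Q (s2 k)) x) (eta x) (pull pi th x) (differential nu x)
  (pull pi (A' (s1 k)) x) (pull pi (A' (s2 k)) x) => p1 p2 p3 p4 p5 p6 p7 p8 p9 p10 p11 H.
apply/eqP; rewrite -subr_eq0; apply/eqP.
by apply: (@linear_consequence _ 1 _ _ _ H); ring.
Qed.

Let sc := scalar_curvature (gram Q) th.

Lemma base_einstein_weyl y : B' y -> ew_at Q th y.
Proof.
rewrite -{1}piU => -[x Ux <-]; have [X [_ H]] := base_curvature Ux.
have uQ' z : B' z -> Q z \in unitmx by move=> /B'B; exact: uQ.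
by have [] := rotation_ew oB' sQ' smooth_base_form uQ' smooth_base_rotation base_structure (UB' Ux) H.
Qed.

(** Compare the expression for the curvature of the base in [base_curvature] with
    the general form of the curvature of an Einstein-Weyl space. *)
Lemma base_monopole x : U x -> m x = nu x ^+ 2 - 6^-1 * sc (pi x) /\
  differential nu x = nu x *: pull pi th x - 2^-1 *: pull pi (dual_faraday Q th) x + m x *: eta x.
Proof.
move=> Ux; have [X [XE H]] := base_curvature Ux.
have uQ' z : B' z -> Q z \in unitmx by move=> /B'B; exact: uQ.
have [_ sE fE] := rotation_ew oB' sQ' smooth_base_form uQ' smooth_base_rotation base_structure (UB' Ux) H.
split; first by rewrite /sc sE; field.
rewrite {2}/pull fE -scalemxAl XE; apply/rowP => i; rewrite !entryE.
by move: (differential nu x) (pull pi th x) (eta x) (nu x) (m x) => *; field.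
Qed.

End descent.

(** * The inverse construction *)

Lemma minimal_weyl_sub (R : realType) (M U : set 'rV[R]_4) c xi th : U `<=` M ->
  minimal_weyl M c xi th -> minimal_weyl U c xi th.
Proof.
move=> UM [sth H]; split=> [i j|x /UM]; last exact: H.
exact: smooth_on_sub (sth i j).
Qed.

Lemma smooth_mx_sub (R : realType) n (U V : set 'rV[R]_n) p q (A : 'rV[R]_n -> 'M[R]_(p, q)) :
  V `<=` U -> smooth_mx_on U A -> smooth_mx_on V A.
Proof. by move=> VU sA i j; exact: smooth_on_sub (sA i j). Qed.

Lemma conformal_structure_sub (R : realType) n (B B' : set 'rV[R]_n) c : B' `<=` B ->
  conformal_structure B c -> conformal_structure B' c.
Proof.
move=> B'B [[sc csp] dc]; split; last by move=> y /B'B; exact: dc.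
by split=> [|y /B'B]; [exact: smooth_mx_sub sc|exact: csp].
Qed.

Lemma open_neq0 (R : realType) n (U : set 'rV[R]_n) f : open U -> smooth_on U f ->
  open (U `&` [set x | f x != 0]).
Proof.
move=> oU sf; rewrite openE => x [Ux fx].
have /differentiable_continuous cf := smooth_on_diff (smooth_onM oU sf sf) Ux.
have N : nbhs x [set y | U y /\ 0 < f y * f y].
  apply: filterI; first exact: open_nbhs_nbhs.
  apply: (cf [set y | 0 < y]); apply: open_nbhs_nbhs; split; first exact: open_gt.
  by rewrite /= -expr2 exprn_even_gt0.
apply: filterS N => y [Uy fy]; split=> //.
by apply: contraTneq fy => /= ->; rewrite mul0r ltxx.
Qed.

Section converse.
Variables (R : realType) (M : set 'rV[R]_4) (g : 'rV[R]_4 -> 'M[R]_4).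
Variables (B : set 'rV[R]_3) (c : 'rV[R]_3 -> 'M[R]_3).
Variables (pi : 'rV[R]_4 -> 'rV[R]_3) (xi : 'rV[R]_4 -> 'rV[R]_4).
Hypotheses (rg : riemannian M g) (ein : einstein M g) (sc0 : forall x, M x -> scal g x != 0).
Hypotheses (sd : selfdual M g) (sub : legendrian_selfdual_submersion M g B c pi xi).

(** The functions [q] and [rho ^+ 2] have the same logarithmic derivative, so their
    quotient [- 1/12 scal] is constant; this fixes the multiple [k]. *)
Lemma legendrian_is_ansatz p : M p ->
   exists (U : set 'rV[R]_4) (th : 'rV[R]_3 -> 'rV[R]_3)
          (nu : 'rV[R]_4 -> R) (o eps k : R),
     let V := U `&` [set x | nu x != 0] in
     let mu := fun x => (nu x)^-1 in
     [/\ [/\ open U, U p & U `<=` M],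
         einstein_weyl (pi @` U) c th,
         smooth_on U nu /\ (forall x, U x -> 'D_(xi x) nu x < 0),
         [/\ o = 1 \/ o = -1, eps = 1 \/ eps = -1 & 0 < k] &
         ansatz_data o c th pi mu eps (pi @` V) V /\
         forall x, V x ->
           0 < 'D_(xi x) mu x /\
           g x = k *: (eps *: ansatz_metric o c th pi mu x)].
Proof.
move=> Mp; have [cs [th0 [minth _ leg]]] := sub.
have oB : open B by case: cs => -[].
have csB : conformal_structure B c by case: cs => -[].
have spiM : smooth_mx_on M pi by case: cs => _ [].
have piM : pi @` M = B by case: cs => _ [].
(* The sign of [q], which is [- 1/12 scal] up to a positive factor. *)
pose eps := - Num.sg (scal g p); have sp0 := sc0 Mp.
have eps1 : eps = 1 \/ eps = -1.
  by rewrite /eps; case: sgrP sp0 => // _ _; [right|left; rewrite opprK].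
have ee : eps * eps = 1 by case: eps1 => ->; rewrite ?mulr1 ?mulrNN ?mulr1.
have e0 : eps != 0 by apply: contra_eqN ee => /eqP ->; rewrite mul0r eq_sym oner_eq0.
have esc : eps * - scal g p = `|scal g p|.
  by rewrite /eps mulrNN; case: sgrP sp0 => // _ _; rewrite ?mul1r ?mulN1r.
have sgn1 : - eps = 1 \/ - eps = -1 by case: eps1 => ->; [right|left; rewrite opprK].
have [U1 [ o [Q [eta [rho [rc []]]]]]] := exists_adapted_frame rg cs sgn1 Mp.
set P := fibre_frame Q pi eta.
move=> [ oU1 U1p U1M o1] [sQ QE] [seta1 srho1 src1] H1.
have oo : o * o = 1 by case: o1 => ->; rewrite ?mulr1 ?mulrNN ?mulr1.
have uQ y : B y -> Q y \in unitmx by case/QE.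
have cE y : B y -> c y = gram Q y by case/QE.
have MB x : M x -> B (pi x) by move=> Mx; rewrite -piM; exists x.
have s0 : smooth_mx_on B (fun=> (0 : 'rV[R]_3)).
  by move=> i j; apply: (eq_smooth_on oB _ (smooth_on_cst 0)) => y _; rewrite mx0E.
have [A [sA tors]] := exists_rotation_forms oB sQ uQ s0.
have rJp : \rank ('J pi p) = 3%N by case: cs => _ [_ _ ->].
have [U [r [sec [[ oU Up UU1] [r0 piU] [ssec secH] basic cst0]]]] :=
  submersion_chart oU1 (smooth_mx_sub U1M spiM) U1p rJp.
have UM : U `<=` M by move=> x /UU1/U1M.
have spi : smooth_mx_on U pi := smooth_mx_sub UM spiM.
have UB x : U x -> B (pi x) by move=> /UM/MB.
have seta : smooth_mx_on U eta := smooth_mx_sub UU1 seta1.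
have srho : smooth_on U rho := smooth_on_sub UU1 srho1.
have src : smooth_on U rc := smooth_on_sub UU1 src1.
have uP x : U x -> P x \in unitmx by move=> /UU1/H1[].
have rho0 x : U x -> rho x != 0 by move=> /UU1/H1[_ []].
have gE x : U x -> g x = rho x ^+ 2 *: gram P x by move=> /UU1/H1[_ []].
have rcP x : U x -> rc x ^+ 4 * \det (P x) = 1 by move=> /UU1/H1[].
have xiE x : U x -> xi x = (rc x)^-1 *: row vv (invmx (P x)) by move=> /UU1/H1[].
have rcs x : U x -> 0 < - eps * rc x by move=> /UU1/H1[].
have einU x : U x -> einstein_at g x /\ selfdual_at g x.
  by move=> /UM Mx; split; [exact: ein|exact: sd].
have minU := minimal_weyl_sub UM minth.
have legU : legendrian U g xi th0 by move=> x /UM; exact: leg.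
pose t := weyl_comp Q pi eta rho; pose nu := fibre_log Q pi eta rho.
pose w := fibre_twist Q pi eta; pose m x := - 12^-1 * scal g x * rho x ^+ 2.
have st k : smooth_on U (t k) := smooth_weyl_comp sQ oU spi UB seta uP srho rho0 k.
have snu : smooth_on U nu := smooth_fibre_log sQ oU spi UB seta uP srho rho0.
have curv := fun x k (Ux : U x) => legendrian_curvature oB sQ sA tors oU spi UB seta uP srho src rho0 gE rcP xiE einU minU legU k Ux.
have logE x : U x -> (rho x)^-1 *: differential rho x
    = \sum_k (t k x + 2^-1 * w k x) *: coframe P (hh k) x + nu x *: eta x.
  exact: legendrian_log_form.
have vc k x v (Ux : U x) : v *m 'J pi x = 0 -> 'D_v (t k) x = 0.
  exact: (vertical_constant oB sQ sA uQ oU spi UB seta uP st snu (m := m) curv k Ux).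
pose B' := ball (pi p) r; pose tB k y := t k (sec y).
have oB' : open B' by exact: ball_open.
have B'B : B' `<=` B by rewrite /B' -piU => _ [x Ux <-]; exact: UB.
have stB k : smooth_on B' (tB k) by apply: smooth_on_comp oB' _ ssec (st k) => y /secH[].
have tBE k x : U x -> t k x = tB k (pi x) by apply: basic => //; exact: vc.
pose th := base_form Q tB; pose A' := base_rotation Q A tB.
have sQ' : smooth_mx_on B' Q := smooth_mx_sub B'B sQ.
have sth : smooth_mx_on B' th := smooth_base_form sQ oB' B'B stB.
have sA' k : smooth_mx_on B' (A' k) := smooth_base_rotation sQ sA oB' B'B stB k.
have tors' : structure_eq B' Q th A' := base_structure tors tB B'B.
have uQ' y : B' y -> Q y \in unitmx by move=> /B'B; exact: uQ.
have ew : forall y, B' y -> ew_at Q th y.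
  exact: (base_einstein_weyl oB sQ sA uQ tors oU spi UB seta uP st snu (m := m) curv oB' B'B piU stB tBE).
have UB' x : U x -> B' (pi x) by move=> Ux; rewrite /B' -piU; exists x.
pose sc := scalar_curvature (gram Q) th; pose q x := nu x ^+ 2 - 6^-1 * sc (pi x).
have mono x (Ux : U x) := base_monopole oB sQ sA uQ tors oU spi UB seta uP st snu (m := m) curv oB' B'B piU stB tBE Ux.
have qm x : U x -> q x = m x by move=> Ux; have [-> _] := mono x Ux.
have q0 x : U x -> q x != 0.
  move=> Ux; rewrite qm// /m !mulf_neq0 ?oppr_eq0 ?invr_eq0 ?pnatr_eq0 ?expf_neq0 ?rho0//.
  by apply: sc0; exact: UM.
have etaE x : U x -> differential nu x
    = nu x *: pull pi th x - 2^-1 *: pull pi (dual_faraday Q th) x + q x *: eta x.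
  by move=> Ux; rewrite qm//; have [_] := mono x Ux.
have qE x : U x -> q x = nu x ^+ 2 - 6^-1 * sc (pi x) by [].
have sq : smooth_on U q := smooth_q oB' sQ' sth uQ' sA' tors' oU spi UB' snu qE.
have twE k x : U x -> twist Q th pi nu q k x = w k x.
  move=> Ux; have := faraday_eta oB' sQ' sth uQ' sA' tors' oU spi UB' ew snu seta qE q0 etaE Ux.
  move=> /(congr1 (fun Z => fcomp (P x) Z (hh (s1 k)) (hh (s2 k)))).
  rewrite /= -/(fibre_twist Q pi eta k x) -/(w k x) => ->.
  rewrite !(sum_cyc _ k) !cycE -!(fibre_frame_h Q pi eta) -/P -(fibre_frame_v Q pi eta) -/P.
  rewrite !fcompE !fcomp1_coframe ?uP// !(hh_eq, hv_eq, vh_eq, cyc_neq, eqxx) /=.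
  by ring.
have dq x : U x -> differential q x = (2 * q x / rho x) *: differential rho x.
  move=> Ux; rewrite (differential_q oB' sQ' sth uQ' sA' tors' oU spi UB' snu qE q0 etaE Ux).
  rewrite -[RHS]scalerA logE// (@pull_base_form R U Q pi eta t tB tBE x Ux).
  rewrite !(sum_cyc _ 0) !twE// -!(fibre_frame_h Q pi eta) -/P.
  apply/rowP => i; rewrite !entryE.
  move: (coframe P (hh 0) x) (coframe P (hh (s1 0)) x) (coframe P (hh (s2 0)) x) (eta x) => v1 v2 v3 v4.
  move: (t 0 x) (t (s1 0) x) (t (s2 0) x) (w 0 x) (w (s1 0) x) (w (s2 0) x) (nu x) (q x) => *.
  by field.
have srr : smooth_on U (fun x => rho x * rho x) by exact: smooth_onM.
have rr0 x : U x -> rho x * rho x != 0 by move=> Ux; rewrite mulf_neq0 ?rho0.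
have sV : smooth_on U (fun x => (rho x * rho x)^-1) by exact: smooth_onV.
have ratio x : U x -> q x * (rho x * rho x)^-1 = q p * (rho p * rho p)^-1.
  apply: (cst0 (fun x => q x * (rho x * rho x)^-1)) => [|z Uz]; first exact: smooth_onM.
  rewrite (differentialM sq sV Uz) (differentialV srr (rr0 z Uz) Uz) (differentialM srho srho Uz).
  rewrite dq//; apply/rowP => i; rewrite !entryE.
  by have := rho0 z Uz; move: (rho z) (q z) => a b a0; field.
have qrho x : U x -> q x = - 12^-1 * scal g p * rho x ^+ 2.
  move=> Ux; have := ratio x Ux; rewrite (qm p Up) /m expr2 mulfK ?rr0// => E.
  by rewrite -E -mulrA mulVf ?mulr1// rr0.
have eq x : U x -> eps * q x = `|scal g p| / 12 * rho x ^+ 2.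
  by move=> Ux; rewrite qrho// -esc; field.
have eq0 x : U x -> 0 < eps * q x.
  move=> Ux; rewrite eq// mulr_gt0 ?divr_gt0 ?normr_gt0 ?ltr0n//.
  by rewrite exprn_even_gt0//= rho0.
have dnu x : U x -> 'D_(xi x) nu x = q x / rc x.
  move=> Ux; rewrite (derive_differential _ snu Ux) xiE// -scalemxAl mxZE.
  have [_ D] := vertical_derivatives oB sQ sA uQ oU spi UB seta uP st snu (m := m) curv 0 Ux.
  rewrite qm// -D mulrC; congr (_ * _); rewrite /fcomp1 [LHS]mxE [RHS]mxE.
  by apply: eq_bigr => j _; rewrite !mxE mulrC.
have rc0 x : U x -> rc x != 0.
  by move=> Ux; apply: contraTneq (rcs x Ux) => ->; rewrite mulr0 ltxx.
have dnu0 x : U x -> 'D_(xi x) nu x < 0.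
  move=> Ux; rewrite dnu// -oppr_gt0.
  have -> : - (q x / rc x) = (eps * q x) / (- eps * rc x).
    by have := rc0 x Ux; move: (q x) (rc x) => a b b0; field; rewrite b0 e0.
  by rewrite divr_gt0 ?eq0 ?rcs.
(* The last constant is such that [k * eps * q = rho ^+ 2]. *)
exists U, th, nu, o, eps, (12 / `|scal g p|) => V mu.
have oV : open V by exact: open_neq0.
have VU : V `<=` U by move=> x [].
have nu0 x : V x -> nu x != 0 by case.
have snuV : smooth_on V nu := smooth_on_sub VU snu.
have smu : smooth_on V mu by exact: smooth_onV.
have cE' y : B' y -> c y = gram Q y by move=> /B'B; exact: cE.
have fE x : V x -> ansatz_factor c th pi mu x = mu x ^+ 2 * q x.
  move=> Vx; rewrite /ansatz_factor (eq_on_scalar_curvature th oB' cE' (UB' x (VU x Vx))) -/sc /q /mu.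
  by have := nu0 x Vx; move: (nu x) (sc _) => a b a0; field.
have dmu x : V x -> differential mu x = - (nu x) ^- 2 *: differential nu x.
  by move=> Vx; exact: differentialV snuV (nu0 x Vx) Vx.
have etaD x : V x -> eta x = (- (mu x ^+ 2 * q x)^-1) *: differential mu x
    + ((q x)^-1 *: (2^-1 *: star3 o (c (pi x)) (faraday th (pi x)) - (mu x)^-1 *: th (pi x)))
      *m ('J pi x)^T.
  move=> Vx; have Ux := VU x Vx; have [E dQ _] := QE _ (UB x Ux).
  rewrite E (star3_faraday th uQ' (UB' x Ux) oo dQ) dmu// etaE// -scalemxAl mulmxBl -!scalemxAl.
  rewrite -[th (pi x) *m _]/(pull pi th x) -[dual_faraday Q th (pi x) *m _]/(pull pi (dual_faraday Q th) x).
  rewrite /mu invrK; apply/rowP => i; rewrite !entryE.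
  move: (pull pi th x) (pull pi (dual_faraday Q th) x) (eta x) => a b d.
  by have := nu0 x Vx; have := q0 x Ux; move: (q x) (nu x) => e f e1 f1; field; rewrite ?e1 ?f1.
split=> //.
- rewrite piU; split=> //.
  + exact: conformal_structure_sub csB.
  + by apply/(ew_at_frame th oB' cE').
- by split=> //; rewrite divr_gt0 ?ltr0n ?normr_gt0.
split.
  split=> //; first exact: smooth_mx_sub spi.
  move=> x Vx; have Ux := VU x Vx.
  have mu2 : 0 < mu x ^+ 2 by rewrite exprn_even_gt0//= invr_neq0 ?nu0.
  rewrite fE// mulrCA mulr_gt0 ?eq0//; split=> //.
  have := det_fibre_frame Q (etaD x Vx); rewrite -/P; have [_ -> _] := QE _ (UB x Ux).
  have dP : 0 < \det (P x).
    have := rcP x Ux; have r4 : 0 < rc x ^+ 4 by rewrite exprn_even_gt0//= rc0.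
    by move=> E; rewrite -(pmulr_rgt0 _ r4) E ltr01.
  move: (\det (row_mx _ _)) => D E.
  have -> : eps * o * D = \det (P x) * mu x ^+ 2 * (eps * q x).
    rewrite E; have := q0 x Ux; have : mu x != 0 by rewrite invr_neq0 ?nu0.
    by move: (mu x) (q x) => a b a0 b0; field; rewrite ?a0 ?b0.
  by rewrite mulr_gt0 ?eq0// mulr_gt0.
move=> x Vx; have Ux := VU x Vx; split.
  rewrite (derive_differential _ smu Vx) dmu//.
  have -> : (- (nu x) ^- 2 *: differential nu x)^T = - (nu x) ^- 2 *: (differential nu x)^T by exact: linearZ.
  rewrite -scalemxAr mxZE -(derive_differential _ snu Ux) mulNr -mulrN mulr_gt0 ?oppr_gt0 ?dnu0//.
  by rewrite invr_gt0 exprn_even_gt0//= nu0.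
rewrite (ansatz_metric_frame (Q := Q) (eta := eta) (q := q x)) //; last 5 first.
- by rewrite invr_neq0 ?nu0.
- exact: q0.
- exact/cE/UB.
- exact: fE.
- exact: etaD.
rewrite gE// !scalerA; congr (_ *: _); rewrite -mulrA eq//.
have : `|scal g p| != 0 by rewrite normr_eq0.
by move: (`|_|) => a a0; field.
Qed.

End converse.

Theorem theoremX (R : realType) :
  (forall (B : set 'rV[R]_3) (c : 'rV[R]_3 -> 'M[R]_3)
          (th : 'rV[R]_3 -> 'rV[R]_3),
   einstein_weyl B c th ->
   forall (o eps : R), (o = 1 \/ o = -1) -> (eps = 1 \/ eps = -1) ->
   forall (M : set 'rV[R]_4) (pi : 'rV[R]_4 -> 'rV[R]_3) (mu : 'rV[R]_4 -> R),
   ansatz_data o c th pi mu eps B M ->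
   ((forall x, M x -> mu x != 0) ->
    let g := fun x => eps *: ansatz_metric o c th pi mu x in
    [/\ riemannian M g,
        einstein M g,
        (forall x, M x -> scal g x != 0),
        selfdual M g &
        exists xi : 'rV[R]_4 -> 'rV[R]_4,
          (forall x, M x -> 0 < 'D_(xi x) mu x) /\
          legendrian_selfdual_submersion M g B c pi xi])
   /\
   (eps = 1 ->
    exists G : 'rV[R]_4 -> 'M[R]_4,
      [/\ riemannian M G,
          (forall x, M x -> mu x != 0 ->
             G x = mu x ^+ 2 *: ansatz_metric o c th pi mu x) &
          forall x, M x -> mu x = 0 ->
            differential mu x != 0 /\
            forall X Y : 'rV[R]_4, 'D_X mu x = 0 -> 'D_Y mu x = 0 ->
              X *m G x *m Y^T
              = X *m 'J pi x *m c (pi x) *m (Y *m 'J pi x)^T]))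
  /\
  (forall (M : set 'rV[R]_4) (g : 'rV[R]_4 -> 'M[R]_4)
          (B : set 'rV[R]_3) (c : 'rV[R]_3 -> 'M[R]_3)
          (pi : 'rV[R]_4 -> 'rV[R]_3) (xi : 'rV[R]_4 -> 'rV[R]_4),
   open M -> riemannian M g -> einstein M g ->
   (forall x, M x -> scal g x != 0) -> selfdual M g ->
   legendrian_selfdual_submersion M g B c pi xi ->
   forall p, M p ->
   exists (U : set 'rV[R]_4) (th : 'rV[R]_3 -> 'rV[R]_3)
          (nu : 'rV[R]_4 -> R) (o eps k : R),
     let V := U `&` [set x | nu x != 0] in
     let mu := fun x => (nu x)^-1 in
     [/\ [/\ open U, U p & U `<=` M],
         einstein_weyl (pi @` U) c th,
         smooth_on U nu /\ (forall x, U x -> 'D_(xi x) nu x < 0),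
         [/\ o = 1 \/ o = -1, eps = 1 \/ eps = -1 & 0 < k] &
         ansatz_data o c th pi mu eps (pi @` V) V /\
         forall x, V x ->
           0 < 'D_(xi x) mu x /\
           g x = k *: (eps *: ansatz_metric o c th pi mu x)]).
Proof.
split=> [B c th ewB o eps o1 eps1 M pi mu data|M g B c pi xi _ rg ein sc0 sd sub p Mp]; last first.
  exact: legendrian_is_ansatz rg ein sc0 sd sub p Mp.
have [ oB csB sth _] := ewB.
have [Q [sQ QE]] := exists_coframe oB csB o1.
have uQ y : B y -> Q y \in unitmx by case/QE.
have [A [sA tors]] := exists_rotation_forms oB sQ uQ sth.
split=> [mu0 g|e1].
  exact: (ansatz_selfdual_einstein ewB o1 eps1 data sQ QE sA tors mu0).
exact: (ansatz_conformal_infinity ewB o1 data sQ QE sA tors e1).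
Qed.
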